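(* Let $S\subseteq\mathbf{P}^3$ be a smooth (sufficiently general) surface over $\mathbf{C}$, let $p\in S$, and let $S^\vee\subseteq\check{\mathbf{P}}^3$ be the dual surface. Then: (a) the orthogonal line to a tangent line of $S$ at $p$ is a tangent line of $S^\vee$ at $(\mathbf{T}_pS)^\perp$; (b) if $p$ is non-parabolic, the orthogonal line to one of the two asymptotic tangents of $S$ at $p$ is one of the two asymptotic tangents of $S^\vee$ at $(\mathbf{T}_pS)^\perp$; (c) if $p$ is a general parabolic point, the orthogonal line to the asymptotic tangent of $S$ at $p$ is the tangent line at $(\mathbf{T}_pS)^\perp$ of the cuspidal double curve of $S^\vee$; (d) if $p$ is a parabolic point of type $\beta$, the orthogonal line to the asymptotic tangent of $S$ at $p$ is the common reduced tangent cone at $(\mathbf{T}_pS)^\perp$ of both the ordinary and the cuspidal double curves of $S^\vee$.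
   Context: For a linear subspace $L\subseteq\mathbf{P}^3$, $L^\perp\subseteq\check{\mathbf{P}}^3$ is the linear subspace of planes containing $L$; so the orthogonal of a plane is a point and the orthogonal of a line is a line. $\mathbf{T}_pS$ is the projective tangent plane. The dual $S^\vee$ is the closure of the set of planes tangent to $S$. A line is tangent (resp. asymptotic tangent) to a surface at a point if it meets the surface with intersection multiplicity at least $2$ (resp. at least $3$) at that point. A point $p\in S$ is parabolic if the Hessian determinant of the equation of $S$ vanishes at $p$; at a smooth non-parabolic point there are exactly two asymptotic tangents. At a parabolic point where the second fundamental form is non-zero there is exactly one (double) asymptotic tangent, the support of the tangent cone at $p$ of the tangent section $\mathbf{T}_pS\cap S$. At a general parabolic point the tangent section has an ordinary cusp at $p$; a parabolic point is of type $\beta$ if $\mathbf{T}_pS\cap S$ has a tacnode ($A_3$ singularity) at $p$. The ordinary double curve of $S^\vee$ is the closure of the locus of planes tangent to $S$ at two distinct points; the cuspidal double curve is the image of the parabolic curve by the Gauss map $q\mapsto(\mathbf{T}_qS)^\perp$. If $\mathbf{T}_pS$ is tangent to $S$ at points other than $p$, the assertions refer to the local branch of $S^\vee$ at $(\mathbf{T}_pS)^\perp$ which is the image by the Gauss map of a neighbourhood of $p$. Standing assumption: $S$ is general enough that at the points corresponding to tacnodal tangent sections the surface $S^\vee$ is locally isomorphic to the swallowtail (the discriminant of $x^4+ax^2+bx+c$ in $\mathbf{A}^3_{a,b,c}$). *)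

(* Defs.v *)
From HB Require Import structures.
From mathcomp Require Import all_boot all_order all_algebra.
From mathcomp Require Import complex.
From mathcomp Require Import all_classical all_reals all_analysis.
From mathcomp Require mpoly.
(* The notations of mpoly clash with those of mathcomp-analysis. *)
Import -(notations) mpoly.

Set Implicit Arguments.
Unset Strict Implicit.
Unset Printing Implicit Defensive.

Import Order.TTheory GRing.Theory Num.Theory.
Import numFieldNormedType.Exports.
Local Open Scope classical_set_scope.
Local Open Scope ring_scope.

(* R[i], seen as a numClosedFieldType so that it carries the topology and the
   normed module structure attached to a numFieldType. *)
Definition Cplx (R : realType) : numClosedFieldType := R[i].

(* Points of P^3 and of the dual P^3 are given by nonzero row vectors, up to
   scaling; xi represents the plane {x | x *m xi^T = 0}.  Linear subspaces of
   either space are row spaces of matrices ([%MS]), and two nonzero vectors x, y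
   define the same point iff (x == y)%MS. *)
Notation hvec R := 'rV[Cplx R]_4.
Notation lsub R := 'M[Cplx R]_4.
Notation form4 R := (mpoly 4 (Cplx R)).

Definition is_line {R : realType} (L : lsub R) : Prop := \rank L = 2%N.

Definition orth {R : realType} (L : lsub R) : lsub R := kermx L^T.

Definition on_surface {R : realType} (F : form4 R) (x : hvec R) : Prop :=
  x != 0 /\ meval (x 0) F = 0.

(* The plane T_xS, as a point of the dual space. *)
Definition gauss {R : realType} (F : form4 R) (x : hvec R) : hvec R :=
  \row_i meval (x 0) (mderiv i F).

Definition smooth {R : realType} (F : form4 R) : Prop :=
  forall x, on_surface F x -> gauss F x != 0.

Definition hessian {R : realType} (F : form4 R) : form4 R :=
  \det (\matrix_(i < 4, j < 4) mderiv i (mderiv j F)).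

Definition parabolic {R : realType} (F : form4 R) (x : hvec R) : Prop :=
  meval (x 0) (hessian F) = 0.

(* Holomorphic functions near q.  Being complex differentiable in a
   neighbourhood of q (the clause k = 1) already implies being so to all orders,
   by the theorems of Goursat and Cauchy; all orders are required explicitly
   since these theorems are not in the library. *)
Fixpoint cdiff_order {R : realType} (k : nat) (g : hvec R -> Cplx R)
    (q : hvec R) : Prop :=
  if k is k'.+1 then
    (\forall w \near q, differentiable g w) /\
    (forall v, cdiff_order k' (fun w => 'd g w v) q)
  else True.

Definition holomorphic_at {R : realType} (q : hvec R) (g : hvec R -> Cplx R) :
  Prop := forall k, cdiff_order k g q.

(* Functions on P^3 that are holomorphic near the point q: they are invariant
   under scaling as functions of the homogeneous coordinates. *)
Definition proj_holomorphic_at {R : realType} (q : hvec R)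
    (g : hvec R -> Cplx R) : Prop :=
  (forall (c : Cplx R) w, c != 0 -> g (c *: w) = g w) /\ holomorphic_at q g.

(* In the next three definitions, U = setT gives the global object: the
   dual surface (S being smooth and projective, the set of its tangent planes is
   closed), the cuspidal double curve and the ordinary double curve.  When U
   shrinks to a point p one gets the corresponding germs for the local branch of
   the dual surface which is the image of a neighbourhood of p. *)
Definition dual_surface {R : realType} (F : form4 R) (U : set (hvec R)) :
    set (hvec R) :=
  [set xi | exists x, [/\ U x, on_surface F x & (xi == gauss F x)%MS]].

Definition cuspidal_curve {R : realType} (F : form4 R) (U : set (hvec R)) :
    set (hvec R) :=
  [set xi | exists x,
    [/\ U x, on_surface F x, parabolic F x & (xi == gauss F x)%MS]].

Definition ordinary_curve {R : realType} (F : form4 R) (U : set (hvec R)) :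
    set (hvec R) :=
  [set xi | xi != 0] `&`
  closure [set xi | exists x y,
    [/\ U x /\ U y, on_surface F x /\ on_surface F y, ~~ (x == y)%MS,
        (xi == gauss F x)%MS & (xi == gauss F y)%MS]].

(* The ideal, in the local ring of the dual space at (T_pS)^\perp, of the germ of
   Z U for U a small neighbourhood of p. *)
Definition germ_ideal {R : realType} (F : form4 R)
    (Z : form4 R -> set (hvec R) -> set (hvec R)) (p : hvec R) :
    set (hvec R -> Cplx R) :=
  [set g | proj_holomorphic_at (gauss F p) g /\
    exists U W, [/\ nbhs p U, nbhs (gauss F p) W &
      forall xi, Z F U xi -> W xi -> g xi = 0]].

Definition equation {R : realType} (F : form4 R) : set (hvec R -> Cplx R) :=
  [set fun x : hvec R => meval (x 0) F].

(* The line L passes through q and meets there, with intersection multiplicity at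
   least k, the locus defined near q by the functions in I.  The multiplicity is
   the length of O_{L,q} / I O_{L,q}, that is, the least order of vanishing at q
   of the restrictions to L of the elements of I. *)
Definition contact {R : realType} (k : nat) (I : set (hvec R -> Cplx R))
    (q : hvec R) (L : lsub R) : Prop :=
  [/\ is_line L, (q <= L)%MS &
    forall g v, I g -> (v <= L)%MS ->
      (fun t : Cplx R => g (q + t *: v)) =O_ (0 : Cplx R) (fun t => t ^+ k)].

Definition tangent_line {R : realType} := @contact R 2.

Definition asymptotic_tangent {R : realType} := @contact R 3.

(* L is the projective Zariski tangent space at q of the locus defined by I; when
   this locus is a curve, this means that it is smooth at q with tangent L. *)
Definition curve_tangent_line {R : realType} (I : set (hvec R -> Cplx R))
    (q : hvec R) (L : lsub R) : Prop :=
  is_line L /\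
  forall v, (v <= L)%MS <-> (forall g, I g -> 'd g q v = 0).

(* Common zeros of the initial forms at q of the elements of I: if G is a form of
   degree m with g (q + w) = G w + o(|w|^m), then G is either 0 or the initial
   form of g.  As the elements of I are invariant under scaling, this is the cone
   over the projective tangent cone with vertex q. *)
Definition reduced_tangent_cone {R : realType} (I : set (hvec R -> Cplx R))
    (q : hvec R) : set (hvec R) :=
  [set v | forall g m (G : form4 R), I g -> G \is ishomog1 m mdeg ->
    (fun w : hvec R => g (q + w) - meval (w 0) G) =o_ (0 : hvec R)
      (fun w => `|w| ^+ m) ->
    meval (v 0) G = 0].

(* The plane section of S by T_pS has an A_k singularity at p: in suitable local
   holomorphic coordinates (u, v) of T_pS centered at p, its equation is
   u^2 = v^(k+1), up to a unit e.  Thus k = 2 is an ordinary cusp and k = 3 a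
   tacnode. *)
Definition tangent_section_A {R : realType} (k : nat) (F : form4 R)
    (p : hvec R) : Prop :=
  exists u v e : hvec R -> Cplx R,
    [/\ [/\ proj_holomorphic_at p u, proj_holomorphic_at p v &
            holomorphic_at p e],
        [/\ u p = 0, v p = 0 & e p != 0],
        forall x, x *m (gauss F p)^T = 0 -> 'd u p x = 0 -> 'd v p x = 0 ->
          (x <= p)%MS &
        \forall x \near p, x *m (gauss F p)^T = 0 ->
          meval (x 0) F = e x * (u x ^+ 2 - v x ^+ k.+1)].

Definition general_parabolic {R : realType} (F : form4 R) (p : hvec R) : Prop :=
  parabolic F p /\ tangent_section_A 2 F p.

Definition parabolic_beta {R : realType} (F : form4 R) (p : hvec R) : Prop :=
  parabolic F p /\ tangent_section_A 3 F p.

Definition swallowtail_disc {R : realType} (a b c : Cplx R) : Cplx R :=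
  let P : {poly Cplx R} := 'X^4 + a *: 'X^2 + b *: 'X + c%:P in
  resultant P (deriv P).

(* (a, b, c) are local holomorphic coordinates of the dual space centered at
   (T_pS)^\perp, in which the branch of the dual surface attached to p is the
   swallowtail. *)
Definition locally_swallowtail {R : realType} (F : form4 R) (p : hvec R) :
    Prop :=
  let q := gauss F p in
  exists a b c : hvec R -> Cplx R,
    [/\ [/\ proj_holomorphic_at q a, proj_holomorphic_at q b &
            proj_holomorphic_at q c],
        [/\ a q = 0, b q = 0 & c q = 0],
        forall xi, 'd a q xi = 0 -> 'd b q xi = 0 -> 'd c q xi = 0 ->
          (xi <= q)%MS &
        exists2 U0, nbhs p U0 & forall U, nbhs p U -> U `<=` U0 ->
          \forall xi \near q,
            dual_surface F U xi <-> swallowtail_disc (a xi) (b xi) (c xi) = 0].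

(* Main.v *)
Require Import Defs.
From HB Require Import structures.
From mathcomp Require Import all_boot all_order all_algebra.
From mathcomp Require Import complex.
From mathcomp Require Import all_classical all_reals all_analysis.
From mathcomp Require mpoly.
Import -(notations) mpoly.
From mathcomp Require Import ring lra.
Set Implicit Arguments.
Unset Strict Implicit.
Unset Printing Implicit Defensive.
Import Order.TTheory GRing.Theory Num.Theory.
Import numFieldNormedType.Exports.
Local Open Scope classical_set_scope.
Local Open Scope ring_scope.

(** Write [N] for the Gauss map [gauss F] and [H] for the Hessian matrix at a point [x] of the
    surface S. The derivative of [N] at [x] is [v |-> v *m H], the matrix [H] is symmetric, and
    Euler's relation gives [x *m H = (d - 1) N(x)]. Everything rests on these facts and on
    biduality: near [N(x)] the dual surface has a tangent plane orthogonal to [x].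

    Biduality. At a non-parabolic point every vector orthogonal to [x] is [z *m H] with [z] tangent
    to S, so a function vanishing on the dual surface has a differential vanishing on the orthogonal
    of [x]. Non-parabolic points are dense ([nonparabolic_dense]). Otherwise S would contain a line
    along which the tangent plane is constant; on it the gradient of [F] is a fixed vector times a
    binary form of degree [d - 1 > 0], which has a zero, against smoothness ([line_coefs_parallel],
    [ruling_singular]). By continuity the differentials vanish as required at all points
    ([dual_tangent]). This gives (a).

    Assertion (b). On the tangent plane, [u *m H *m v^T] is the second fundamental form. If [u] is
    isotropic, the orthogonal of the line through [p] and [u] is the line through [q = N(p)] and
    [u *m H]. The points of S osculating the first line are sent by [N] close to the second one, up
    to a second-order term that biduality kills, whence contact 3 ([dual_asymptotic]). Conversely
    the composition of [F] with the local inverse of [N] is an equation of the dual branch; its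
    second-order expansion, a Legendre transformation, shows that a direction of contact 3 comes
    from an isotropic [u] ([legendre_contact]).

    Assertion (c). At a cuspidal tangent section [H] has rank 3; let [k] span its kernel, so that
    the asymptotic tangent is the line through [p] and [k]. The derivative of the Hessian
    determinant along [k] is a nonzero multiple of the cubic coefficient of [F] along [k], which the
    cusp makes nonzero ([hessian_transversal]). So the parabolic curve is smooth and transversal to
    [k], and [H] maps its tangent isomorphically onto the orthogonal of the asymptotic tangent
    ([cuspidal_curve_tangent]).

    Assertion (d). In swallowtail coordinates [a, b, c], the dual branch is parametrized by quartics
    with [x^2]-coefficient [t] and a double root [s]. There the differential of the discriminant is
    proportional to [s^2 da + s db + dc], so by biduality this vector, called [Y], is a point of S
    having the given quartic as tangent plane ([param_surface]). The parabolic points are the triple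
    roots, [t = - 6 s^2]; double tangency means two double roots [s] and [- s], with [t = - 2 s^2].
    In both cases [b] and [c] are of order 3 and 4 in [s] (or [b = 0]), whereas [t] is of order 2:
    both curves have the tangent cone [db = dc = 0]. Finally [dc] is the point [p] up to a factor,
    and [db] lies on the asymptotic tangent, so that this cone is its orthogonal
    ([orth_swallowtail]). Explicit equations bound the cones from above ([ordinary_cone_sub],
    [cuspidal_cone_sub]), arcs bound them from below ([arc_direction]).

    The analysis is done with strict differentiability and explicit constants: points of S are
    produced near approximate ones, and orders of vanishing are compared directly, without
    parametrizing curves. *)

(** * Real-valued norms and Landau estimates over the complex numbers *)

Section RealNorm.
Context {R : realType}.
Local Notation C := (Cplx R).

(** Norms of modules over [C] are themselves elements of [C], real and nonnegative. Extracting the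
    real number puts all estimates in the ordered field [R], where [lra] and [nra] apply. *)
Definition nr {V : normedModType C} (x : V) : R := complex.Re (`|x| : R[i]).

Lemma nrE (V : normedModType C) (x : V) : `|x| = real_complex R (nr x) :> R[i].
Proof.
have : (0 : R[i]) <= `|x| by exact: normr_ge0.
by rewrite /nr; case: (`|x| : R[i]) => a b; rewrite lecE /= => /andP[/eqP -> _].
Qed.

Lemma nr_ge0 (V : normedModType C) (x : V) : 0 <= nr x.
Proof.
have : (0 : R[i]) <= `|x| by exact: normr_ge0.
by rewrite nrE ler0c.
Qed.

Lemma nrD (V : normedModType C) (x y : V) : nr (x + y) <= nr x + nr y.
Proof.
have := ler_normD x y.
have -> : (`|x + y| <= `|x| + `|y|) = ((`|x + y| : R[i]) <= `|x| + `|y|) by [].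
by rewrite !nrE -rmorphD lecR.
Qed.

Lemma nrN (V : normedModType C) (x : V) : nr (- x) = nr x.
Proof. by rewrite /nr normrN. Qed.

Lemma nrC (V : normedModType C) (x y : V) : nr (x - y) = nr (y - x).
Proof. by rewrite -nrN opprB. Qed.

Lemma nrB (V : normedModType C) (x y : V) : nr (x - y) <= nr x + nr y.
Proof. by rewrite -(nrN y); exact: nrD. Qed.

Lemma nr0 (V : normedModType C) : nr (0 : V) = 0.
Proof. by rewrite /nr normr0. Qed.

Lemma nrZ (V : normedModType C) (a : C) (x : V) : nr (a *: x) = nr a * nr x.
Proof.
apply: complexI; rewrite rmorphM /= -!nrE; exact: normrZ.
Qed.

Lemma nrM (a b : C) : nr (a * b) = nr a * nr b.
Proof. exact: (nrZ a (b : C^o)). Qed.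

Lemma nrX (a : C) n : nr (a ^+ n) = nr a ^+ n.
Proof.
elim: n => [|n IH]; last by rewrite !exprS nrM IH.
by rewrite !expr0 /nr normr1.
Qed.

Lemma nr_eq0 (V : normedModType C) (x : V) : nr x = 0 -> x = 0.
Proof.
move=> h; apply/eqP; rewrite -normr_eq0; apply/eqP.
by have := nrE x; rewrite h.
Qed.

Lemma nr_gt0 (V : normedModType C) (x : V) : x != 0 -> 0 < nr x.
Proof.
move=> x0; rewrite lt_neqAle nr_ge0 andbT eq_sym; apply/eqP => /nr_eq0 h.
by rewrite h eqxx in x0.
Qed.

Lemma nrV (a : C) : nr (a^-1) = (nr a)^-1.
Proof.
have [->|a0] := eqVneq a 0; first by rewrite invr0 nr0 invr0.
apply: (mulfI (lt0r_neq0 (nr_gt0 a0))).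
by rewrite -nrM divff // divff ?(lt0r_neq0 (nr_gt0 a0)) // /nr normr1.
Qed.

Lemma nr_real (r : R) : nr (real_complex R r : C) = `|r|.
Proof. by rewrite /nr normc_def /= expr0n /= addr0 sqrtr_sqr. Qed.

Lemma lt_nr (V : normedModType C) (x : V) (e : R) :
  (`|x| < (real_complex R e : C)) = (nr x < e).
Proof.
have -> : (`|x| < (real_complex R e : C)) = ((`|x| : R[i]) < real_complex R e) by [].
by rewrite nrE ltcR.
Qed.

Lemma le_nr (V W : normedModType C) (x : V) (y : W) (e : R) :
  (`|x| <= (real_complex R e : C) * `|y|) = (nr x <= e * nr y).
Proof.
have -> : (`|x| <= (real_complex R e : C) * `|y|) = ((`|x| : R[i]) <= real_complex R e * `|y|) by [].
by rewrite !nrE -rmorphM lecR.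
Qed.

Lemma nbhsP (V : normedModType C) (x : V) (U : set V) :
  nbhs x U <-> exists2 e : R, 0 < e & forall y, nr (y - x) < e -> U y.
Proof.
split=> [/nbhs_ballP[e /= e0 he]|[e e0 he]].
  exists (nr e).
    by apply: nr_gt0; rewrite gt_eqF.
  move=> y hy; apply: he; rewrite -ball_normE /= distrC.
  have -> : e = (real_complex R (nr e) : C) by rewrite -(nrE e) gtr0_norm.
  by rewrite lt_nr.
apply/nbhs_ballP; exists (real_complex R e : C).
  by rewrite /= ltcR.
by move=> y; rewrite -ball_normE /= distrC lt_nr => /he.
Qed.

End RealNorm.

Section Landau.
Context {R : realType}.
Local Notation C := (Cplx R).

Lemma bigO_nrP (V : normedModType C) (f : C -> V) k :
  (f =O_ (0 : C) (fun t : C => t ^+ k)) <->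
  exists K e : R, 0 < e /\ forall t : C, nr t < e -> nr (f t) <= K * nr t ^+ k.
Proof.
split=> [/eqO_exP[K K0 /nbhsP[e e0 he]]|[K [e [e0 he]]]].
  exists (nr K), e; split=> // t te.
  rewrite -nrX -le_nr -(nrE K) gtr0_norm //; apply: he.
  by rewrite subr0.
apply/eqO_exP; exists (real_complex R (`|K| + 1) : C).
  by change ((0 : R[i]) < real_complex R (`|K| + 1)); rewrite ltcR ltr_wpDl.
apply/nbhsP; exists e => // t; rewrite subr0 => te.
rewrite le_nr nrX (le_trans (he t te)) // ler_wpM2r ?exprn_ge0 ?nr_ge0 //.
by rewrite (le_trans (ler_norm K)) // lerDl.
Qed.

Lemma littleo_nrP (V W W' : normedModType C) (f : V -> W) (g : V -> W') :
  (f =o_ (0 : V) g) <->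
  forall eps : R, 0 < eps -> exists2 e : R, 0 < e &
    forall w : V, nr w < e -> nr (f w) <= eps * nr (g w).
Proof.
split=> [/eqoP fo eps eps0|fo].
  have e0 : (0 : C) < (real_complex R eps : C) by rewrite ltcR.
  have /nbhsP[e e1 he] := fo _ e0; exists e => // w we.
  by rewrite -le_nr; apply: he; rewrite subr0.
apply/eqoP => eps eps0.
have n0 : 0 < nr eps by apply: nr_gt0; rewrite gt_eqF.
have [e e0 he] := fo _ n0; apply/nbhsP; exists e => // w; rewrite subr0 => we.
by move: (he w we); rewrite -le_nr -(nrE eps) gtr0_norm.
Qed.

Lemma differentiable_nr (V W : normedModType C) (f : V -> W) (x : V) :
  differentiable f x -> forall eps : R, 0 < eps -> exists2 e : R, 0 < e &
    forall h : V, nr h < e -> nr (f (x + h) - f x - 'd f x h) <= eps * nr h.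
Proof.
move=> /diff_locallyP[_ /eqaddoP fo] eps eps0.
have /eqoP/littleo_nrP ho := fo.
have [e e0 he] := ho _ eps0; exists e => // w /he.
by change (nr (f (w + x) - (f x + 'd f x w)) <= eps * nr w -> nr (f (x + w) - f x - 'd f x w) <= eps * nr w); rewrite [w + x]addrC opprD addrA.
Qed.

(** The bound [K] provides the continuity of [df], and uniqueness of the differential then
    identifies ['d f x]. *)
Lemma differentiable_intro (V W : normedModType C) (f : V -> W) (x : V)
    (df : {linear V -> W}) (K : R) :
  (forall v, nr (df v) <= K * nr v) ->
  (forall eps : R, 0 < eps -> exists2 e : R, 0 < e &
    forall h : V, nr h < e -> nr (f (x + h) - f x - df h) <= eps * nr h) ->
  differentiable f x /\ 'd f x = df :> (V -> W).
Proof.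
move=> dfK fo.
have dfc : continuous df.
  apply/linear_bounded_continuous/linear_boundedP.
  exists (real_complex R (`|K| + 1) : C); split.
    by change ((real_complex R (`|K| + 1) : R[i]) \is Num.real); apply/complex_realP; eexists.
  move=> r hr v; apply: (@le_trans _ _ ((real_complex R (`|K| + 1) : C) * `|v|)).
    rewrite le_nr (le_trans (dfK v)) // ler_wpM2r ?nr_ge0 //.
    by rewrite (le_trans (ler_norm K)) // lerDl.
  by rewrite ler_wpM2r // ltW.
have fx : f \o shift x = cst (f x) + df +o_ 0 id.
  apply/eqaddoP; apply/eqoP; apply/littleo_nrP => eps /fo[e e0 he].
  exists e => // w /he.
  by change (nr (f (x + w) - f x - df w) <= eps * nr w -> nr (f (w + x) - (f x + df w)) <= eps * nr w); rewrite [w + x]addrC opprD addrA.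
have df_ : 'd f x = df :> (V -> W) by apply: diff_unique.
split=> //; apply/diff_locallyP; rewrite df_; split=> //.
Qed.

End Landau.

Section Coordinates.
Context {R : realType}.
Local Notation C := (Cplx R).

Lemma nr_coord m n (x : 'M[C]_(m, n)) i j : nr (x i j) <= nr x.
Proof.
rewrite -lecR -!nrE; change ((`|x i j| : C) <= mx_norm x).
rewrite mx_normE.
have := le_bigmax (0%:nng : {nonneg C}) (fun i : 'I_m * 'I_n => (`|x i.1 i.2|%:nng)) (i, j).
exact.
Qed.

Lemma nr_coord_le m n (x : 'M[C]_(m, n)) (e : R) : 0 <= e ->
  (forall i j, nr (x i j) <= e) -> nr x <= e.
Proof.
move=> e0 h; have [->|x0] := eqVneq x 0; first by rewrite nr0.
have /mx_norm_neq0[[i j] /= hij] : mx_norm x != 0.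
  by apply: contra x0 => /eqP /mx_norm_eq0 ->.
have -> : nr x = nr (x i j); last exact: h.
by rewrite /nr; congr complex.Re; exact: hij.
Qed.

Lemma nr_coord_lt m n (x : 'M[C]_(m, n)) (e : R) : 0 < e ->
  (forall i j, nr (x i j) < e) -> nr x < e.
Proof.
move=> e0 h; have [->|x0] := eqVneq x 0; first by rewrite nr0.
have /mx_norm_neq0[[i j] /= hij] : mx_norm x != 0.
  by apply: contra x0 => /eqP /mx_norm_eq0 ->.
have -> : nr x = nr (x i j); last exact: h.
by rewrite /nr; congr complex.Re; exact: hij.
Qed.

Lemma nr_sum (I : Type) (r : seq I) (P : pred I) (V : normedModType C) (F : I -> V) :
  nr (\sum_(i <- r | P i) F i) <= \sum_(i <- r | P i) nr (F i).
Proof.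
elim/big_ind2: _; [by rewrite nr0| |by []].
by move=> x1 x2 y1 y2 h1 h2; rewrite (le_trans (nrD _ _)) // lerD.
Qed.

Lemma nr_mulmx m n p (x : 'M[C]_(m, n)) (A : 'M[C]_(n, p)) :
  nr (x *m A) <= n%:R * nr A * nr x.
Proof.
apply: nr_coord_le => [|i j]; first by rewrite !mulr_ge0 ?nr_ge0.
rewrite mxE (le_trans (nr_sum _ _ _)) //.
apply: (@le_trans _ _ (\sum_(k < n) nr A * nr x)).
  apply: ler_sum => k _; rewrite nrM mulrC ler_pM ?nr_ge0 ?nr_coord //.
by rewrite sumr_const card_ord -[X in X <= _]mulr_natl mulrA lexx.
Qed.

End Coordinates.

(** * The mean value inequality for complex-valued functions *)

Section MeanValue.
Context {R : realType}.
Local Notation C := (Cplx R).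
Local Notation rc r := (real_complex R r : C).

Lemma is_derive_eps (f : R -> R) (x d : R) :
  (forall eps : R, 0 < eps -> exists2 e : R, 0 < e &
    forall h : R, `|h| < e -> `|f (x + h) - f x - d * h| <= eps * `|h|) ->
  is_derive x 1 f d.
Proof.
move=> H.
suff cv : (fun h => h^-1 *: ((f \o shift x) (h *: 1) - f x)) @ 0^' --> d.
  by split; [apply/cvg_ex; exists d | apply: cvg_lim].
apply/cvgrPdist_le => eps /H[e e0 he].
rewrite near_withinE; apply/nbhs_ballP; exists e => //= h.
rewrite /ball /= sub0r normrN => hlt h0.
have hn : 0 < `|h| by rewrite normr_gt0.
rewrite -(ler_pM2r hn); apply: le_trans (he h hlt).
rewrite -normrM distrC /shift /= /GRing.scale /= mulr1 [h + x]addrC.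
by rewrite mulrBl mulrAC mulVf // mul1r.
Qed.

Lemma Re_le (z : C) : `|complex.Re z| <= nr z.
Proof.
have /complexI e : real_complex R (complex.Re z ^+ 2 + complex.Im z ^+ 2) = real_complex R (nr z ^+ 2).
  by rewrite add_Re2_Im2 (nrE z : `|z : R[i]| = _) rmorphXn.
rewrite -(ler_pXn2r (n := 2)) ?nnegrE ?nr_ge0 // -e real_normK ?num_real //.
by rewrite lerDl sqr_ge0.
Qed.

Lemma Im_le (z : C) : `|complex.Im z| <= nr z.
Proof.
have /complexI e : real_complex R (complex.Re z ^+ 2 + complex.Im z ^+ 2) = real_complex R (nr z ^+ 2).
  by rewrite add_Re2_Im2 (nrE z : `|z : R[i]| = _) rmorphXn.
rewrite -(ler_pXn2r (n := 2)) ?nnegrE ?nr_ge0 // -e real_normK ?num_real //.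
by rewrite lerDr sqr_ge0.
Qed.

Lemma nr_ReIm (z : C) : nr z <= `|complex.Re z| + `|complex.Im z|.
Proof.
rewrite [in X in X <= _](complexE z) (le_trans (nrD _ _)) // nr_real lerD //.
rewrite nrM nr_real.
suff -> : nr ('i%C : C) = 1 by rewrite mul1r.
by rewrite /nr normc_def /= expr0n /= add0r expr1n sqrtr1.
Qed.

(** [P] stands for the real or the imaginary part: a real functional of norm at most 1, to which the
    mean value theorem for real functions on a segment applies. *)
Lemma mean_value_aux (P : C -> R) (V : normedModType C) (g : V -> C) (x v : V) (M : R) :
  {morph P : a b / a - b} -> (forall (t : R) z, P (rc t * z) = P z * t) ->
  (forall z, `|P z| <= nr z) ->
  (forall t : R, 0 <= t <= 1 -> differentiable g (x + rc t *: v)) ->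
  (forall t : R, 0 <= t <= 1 -> nr ('d g (x + rc t *: v) v) <= M) ->
  `|P (g (x + v)) - P (g x)| <= M.
Proof.
move=> PB PZ Ple gd gM.
pose phi (t : R) := P (g (x + rc t *: v)).
pose dphi (t : R) := P ('d g (x + rc t *: v) v).
have der (t : R) : 0 <= t <= 1 -> is_derive t 1 phi (dphi t).
  move=> t01; apply: is_derive_eps => eps eps0.
  have ev0 : 0 < eps / (nr v + 1) by rewrite divr_gt0 // ltr_wpDl // nr_ge0.
  have [e e0 he] := differentiable_nr (gd t t01) ev0.
  exists (e / (nr v + 1)); first by rewrite divr_gt0 // ltr_wpDl // nr_ge0.
  move=> h hh.
  have v1 : 0 < nr v + 1 by rewrite ltr_wpDl // nr_ge0.
  have hv : nr (rc h *: v) < e.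
    rewrite nrZ nr_real; apply: (@le_lt_trans _ _ (`|h| * (nr v + 1))).
      by rewrite ler_wpM2l // lerDl.
    by rewrite -ltr_pdivlMr.
  have E : x + rc t *: v + rc h *: v = x + rc (t + h) *: v.
    by rewrite -addrA -scalerDl -rmorphD.
  have := he _ hv; rewrite E linearZ /= => hle.
  rewrite /phi /dphi -PZ -!PB (le_trans (Ple _)) // (le_trans hle) //.
  rewrite nrZ nr_real mulrCA [leRHS]mulrC ler_wpM2l //.
  by rewrite mulrAC ler_pdivrMr // ler_wpM2l ?(ltW eps0) // lerDl.
have [c c01] : exists2 c, c \in `[0, 1]%R & phi 1 - phi 0 = dphi c * (1 - 0).
  apply: (MVT_segment (df := dphi)) => //.
    by move=> t; rewrite in_itv /= => /andP[t0 t1]; apply: der; rewrite !ltW.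
  apply: derivable_within_continuous => t; rewrite in_itv /= => t01.
  by case: (der t t01).
rewrite /phi /dphi scale1r scale0r addr0 subr0 mulr1 => ->.
by rewrite (le_trans (Ple _)) // gM.
Qed.

(** The factor 2 comes from adding the bounds for the real and the imaginary parts. *)
Lemma mean_value (V : normedModType C) (g : V -> C) (x v : V) (M : R) :
  (forall t : R, 0 <= t <= 1 -> differentiable g (x + rc t *: v)) ->
  (forall t : R, 0 <= t <= 1 -> nr ('d g (x + rc t *: v) v) <= M) ->
  nr (g (x + v) - g x) <= 2 * M.
Proof.
move=> gd gM; rewrite (le_trans (nr_ReIm _)) //.
have -> : 2 * M = M + M by rewrite mulr2n mulrDl mul1r.
apply: lerD.
  have h : {morph (@complex.Re R : C -> R) : a b / a - b} by move=> [a b] [a' b'].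
  rewrite h; apply: mean_value_aux => //; last exact: Re_le.
  by move=> t [a b] /=; rewrite mul0r subr0 mulrC.
have h : {morph (@complex.Im R : C -> R) : a b / a - b} by move=> [a b] [a' b'].
rewrite h; apply: mean_value_aux => //; last exact: Im_le.
by move=> t [a b] /=; rewrite mul0r addr0 mulrC.
Qed.

End MeanValue.

(** * Calculus of holomorphic functions and two-point second-order estimates *)

Section StrictDifferentiability.
Context {R : realType}.
Local Notation C := (Cplx R).
Local Notation rc r := (real_complex R r : C).

Lemma diff_bound (V W : normedModType C) (f : V -> W) (x : V) :
  differentiable f x -> exists2 K : R, 0 < K & forall v, nr ('d f x v) <= K * nr v.
Proof.
move=> df; have [k k0 hk] := linear_lipschitz (diff_continuous df).
exists (nr k); first by rewrite nr_gt0 // gt_eqF.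
by move=> v; rewrite -le_nr -(nrE k) gtr0_norm.
Qed.

Lemma near_eq_diff (V W : normedModType C) (f g : V -> W) (x : V) :
  (\forall w \near x, f w = g w) -> differentiable f x ->
  differentiable g x /\ 'd g x = 'd f x :> (V -> W).
Proof.
move=> /nbhsP[d d0 fg] df; have [K K0 hK] := diff_bound df.
apply: (differentiable_intro hK) => eps /(differentiable_nr df)[e e0 he].
exists (Num.min d e) => [|h]; first by rewrite lt_min d0.
rewrite lt_min => /andP[hd hhe].
have <- : f (x + h) = g (x + h) by apply: fg; rewrite addrC addKr.
have <- : f x = g x by apply: fg; rewrite subrr nr0.
exact: he.
Qed.

Lemma near_near (V : normedModType C) (P : V -> Prop) (x : V) :
  (\forall w \near x, P w) -> \forall w \near x, \forall w' \near w, P w'.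
Proof. move=> /nbhsP[d d0 h]; apply/nbhsP; exists d => // y yd.
apply/nbhsP; exists (d - nr (y - x)); first by rewrite subr_gt0.
move=> z zd; apply: h; have := nrD (z - y) (y - x); rewrite addrA subrK.
by move=> /le_lt_trans; apply; rewrite -ltrBrDr.
Qed.

(** The rules of calculus identify derivatives only at points near [q], so each inductive step on
    the order needs the freedom to replace a function by one that agrees with it near [q]. *)
Lemma cdiff_near_eq k (g g' : hvec R -> C) q :
  (\forall w \near q, g w = g' w) -> cdiff_order k g q -> cdiff_order k g' q.
Proof.
elim: k g g' => [//|k IH] g g' gg' [gd gk].
have gg2 := near_near gg'.
split.
  near=> w; suff : differentiable g' w /\ ('d g' w = 'd g w :> (hvec R -> C)) by case.
  apply: near_eq_diff; first by near: w; exact: gg2.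
  by near: w; exact: gd.
move=> v; apply: IH (gk v); near=> w.
have h1 : \forall w' \near w, g w' = g' w' by near: w; exact: gg2.
have h2 : differentiable g w by near: w; exact: gd.
have [_ e] := near_eq_diff h1 h2.
exact: (esym (congr1 (@^~ v) e)).
Unshelve. all: by end_near. Qed.

Lemma cdiffW k (g : hvec R -> C) q : cdiff_order k.+1 g q -> cdiff_order k g q.
Proof.
elim: k g => [//|k IH] g [gd gk]; split=> // v; exact: IH (gk v).
Qed.

Lemma cdiff_cst k (c : C) q : cdiff_order k (fun=> c) q.
Proof.
elim: k c => [//|k IH] c; split; first by near=> w; exact: differentiable_cst.
move=> v; apply: cdiff_near_eq (IH 0).
by near=> w; rewrite (diff_cst c w).
Unshelve. all: by end_near. Qed.

Lemma cdiffD k (f g : hvec R -> C) q : cdiff_order k f q -> cdiff_order k g q ->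
  cdiff_order k (fun w => f w + g w) q.
Proof.
elim: k f g => [//|k IH] f g [fd fk] [gd gk]; split.
  near=> w; apply: differentiableD; [by near: w; exact: fd | by near: w; exact: gd].
move=> v; apply: cdiff_near_eq (IH _ _ (fk v) (gk v)).
near=> w; have df : differentiable f w by near: w; exact: fd.
have dg : differentiable g w by near: w; exact: gd.
exact: esym (congr1 (@^~ v) (diffD df dg)).
Unshelve. all: by end_near. Qed.

Lemma cdiffM k (f g : hvec R -> C) q : cdiff_order k f q -> cdiff_order k g q ->
  cdiff_order k (fun w => f w * g w) q.
Proof.
elim: k f g => [//|k IH] f g fk1 gk1.
have [fd fk] := fk1; have [gd gk] := gk1; split.
  near=> w; apply: differentiableM; [by near: w; exact: fd | by near: w; exact: gd].
move=> v; have h1 := IH _ _ (cdiffW fk1) (gk v).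
have h2 := IH _ _ (cdiffW gk1) (fk v).
apply: cdiff_near_eq (cdiffD h1 h2).
near=> w; have df : differentiable f w by near: w; exact: fd.
have dg : differentiable g w by near: w; exact: gd.
exact: esym (congr1 (@^~ v) (diffM df dg)).
Unshelve. all: by end_near. Qed.

Lemma linear_diff n (f : {linear 'rV[C]_n -> C}) (w : 'rV[C]_n) :
  differentiable f w /\ 'd f w = f :> ('rV[C]_n -> C).
Proof.
apply: (@differentiable_intro _ _ _ f w f (\sum_(i < n) nr (f (delta_mx 0 i)))).
  move=> v; rewrite [in X in X <= _](row_sum_delta v) linear_sum (le_trans (nr_sum _ _ _)) //.
  rewrite mulr_suml; apply: ler_sum => i _; rewrite linearZ nrM mulrC.
  by rewrite ler_wpM2l ?nr_ge0 // nr_coord.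
move=> eps eps0; exists 1 => // h _.
have -> : f (w + h) - f w - f h = 0 by rewrite [f (w + h)]linearD [f w + _]addrC addrK subrr.
by rewrite nr0 mulr_ge0 ?nr_ge0 // ltW.
Qed.

Lemma cdiff_linear k (f : {linear hvec R -> C}) q : cdiff_order k f q.
Proof.
case: k => [//|k]; split.
  by near=> w; have [] := linear_diff f w.
move=> v; apply: cdiff_near_eq (cdiff_cst k (f v) q).
near=> w; have [_ e] := linear_diff f w; exact: esym (congr1 (@^~ v) e).
Unshelve. all: by end_near. Qed.

Lemma holo_D (f g : hvec R -> C) q : holomorphic_at q f -> holomorphic_at q g ->
  holomorphic_at q (fun w => f w + g w).
Proof. by move=> hf hg k; exact: cdiffD. Qed.

Lemma holo_M (f g : hvec R -> C) q : holomorphic_at q f -> holomorphic_at q g ->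
  holomorphic_at q (fun w => f w * g w).
Proof. by move=> hf hg k; exact: cdiffM. Qed.

Lemma holo_cst (c : C) q : holomorphic_at q (fun=> c).
Proof. by move=> k; exact: cdiff_cst. Qed.

Lemma holo_d (f : hvec R -> C) q v : holomorphic_at q f ->
  holomorphic_at q (fun w => 'd f w v).
Proof. by move=> hf k; have [_] := hf k.+1; apply. Qed.

Lemma holo_near_eq (g g' : hvec R -> C) q :
  (\forall w \near q, g w = g' w) -> holomorphic_at q g -> holomorphic_at q g'.
Proof. by move=> e h k; exact: cdiff_near_eq e (h k). Qed.

Lemma rv_lin n (f : {linear 'rV[C]_n -> C}) (v : 'rV[C]_n) :
  f v = \sum_i v 0 i * f (delta_mx 0 i).
Proof.
rewrite [in LHS](row_sum_delta v) linear_sum; apply: eq_bigr => i _.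
by rewrite linearZ.
Qed.

Lemma ball_convex (V : normedModType C) (x y z : V) (d : R) (t : R) : 0 <= t <= 1 ->
  nr (y - x) < d -> nr (z - x) < d -> nr (z + rc t *: (y - z) - x) < d.
Proof.
move=> /andP[t0 t1] hy hz.
have -> : z + rc t *: (y - z) - x = rc t *: (y - x) + rc (1 - t) *: (z - x).
  rewrite rmorphB rmorph1 scalerBl scale1r !scalerBr.
  set a := rc t *: y; set b := rc t *: z; set c := rc t *: x.
  by rewrite addrAC opprB [RHS]addrC -[RHS]addrA [c - b + _]addrC [a - c + _]addrA subrK.
rewrite (le_lt_trans (nrD _ _)) // !nrZ !nr_real (ger0_norm t0) ger0_norm ?subr_ge0 //.
have : t * nr (y - x) <= t * d by rewrite ler_wpM2l // ltW.
have : (1 - t) * nr (z - x) <= (1 - t) * d by rewrite ler_wpM2l ?subr_ge0 // ltW.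
have [t05|t05] := ltP t 1.
  have : (1 - t) * nr (z - x) < (1 - t) * d by rewrite ltr_pM2l ?subr_gt0.
  by move=> *; nra.
have -> : t = 1 by apply/eqP; rewrite eq_le t1.
by rewrite subrr !mul0r mul1r addr0.
Qed.

End StrictDifferentiability.

Section HolomorphicEstimates.
Context {R : realType}.
Local Notation C := (Cplx R).
Local Notation rc r := (real_complex R r : C).

Lemma finite_min (I : finType) (d : I -> R) : (forall i, 0 < d i) ->
  exists2 e : R, 0 < e & forall i, e <= d i.
Proof.
move=> d0; exists (\big[Order.min/1]_i d i).
  by apply/bigmin_gtP; split.
by move=> i; apply: bigmin_le_cond.
Qed.

Lemma holo_ball (g : hvec R -> C) q : holomorphic_at q g ->
  exists2 e : R, 0 < e & forall w, nr (w - q) < e ->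
    differentiable g w /\ forall v, differentiable (fun w => 'd g w v) w.
Proof.
move=> hg; have [/nbhsP[d d0 gd] _] := hg 1%N.
have /choice[e he] : forall i : 'I_4, exists e : R, 0 < e /\ forall w, nr (w - q) < e ->
    differentiable (fun w => 'd g w (delta_mx 0 i)) w.
  by move=> i; have [/nbhsP[e e0 h] _] := holo_d (delta_mx 0 i) hg 1%N; exists e.
have [m m0 hm] := finite_min (fun i => (he i).1).
exists (Num.min d m) => [|w]; first by rewrite lt_min d0.
rewrite lt_min => /andP[wd wm]; split; first exact: gd.
move=> v.
have -> : (fun w => 'd g w v) = \sum_(i < 4) (v 0 i *: (fun w => 'd g w (delta_mx 0 i) : C)).
  apply/funext => y; apply: etrans (rv_lin ('d g y) v) _.
  by rewrite fct_sumE.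
apply: differentiable_sum => i; apply: differentiableZ.
by apply: (he i).2; exact: lt_le_trans (hm i).
Qed.

Lemma diff_lip (V W : normedModType C) (f : V -> W) (x : V) : differentiable f x ->
  exists K e : R, [/\ 0 < K, 0 < e & forall y, nr (y - x) < e -> nr (f y - f x) <= K * nr (y - x)].
Proof.
move=> df; have [K K0 hK] := diff_bound df.
have [e e0 he] := differentiable_nr df ltr01.
exists (K + 1), e; split=> [||y /he]; rewrite ?addr_gt0 //.
rewrite (_ : x + (y - x) = y) ?mul1r; last by rewrite addrC subrK.
move=> h.
have := nrD (f y - f x - 'd f x (y - x)) ('d f x (y - x)); rewrite subrK.
move=> /le_trans; apply; rewrite mulrDl mul1r addrC; exact: lerD.
Qed.

Lemma d_lip (g : hvec R -> C) (x : hvec R) :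
  (forall v, differentiable (fun w => 'd g w v) x) ->
  exists K e : R, [/\ 0 < K, 0 < e & forall y v, nr (y - x) < e ->
    nr ('d g y v - 'd g x v) <= K * nr (y - x) * nr v].
Proof.
move=> dg.
have /choice[Ke hKe] : forall i : 'I_4, exists Ke : R * R, [/\ 0 < Ke.1, 0 < Ke.2 & forall y, nr (y - x) < Ke.2 ->
    nr ('d g y (delta_mx 0 i) - 'd g x (delta_mx 0 i)) <= Ke.1 * nr (y - x)].
  by move=> i; have [K [e h]] := diff_lip (dg (delta_mx 0 i)); exists (K, e).
have [m m0 hm] : exists2 e : R, 0 < e & forall i, e <= (Ke i).2.
  by apply: finite_min => i; have [] := hKe i.
exists (\sum_i (Ke i).1), m; split=> // [|y v yx].
  apply: (@lt_le_trans _ _ (Ke 0).1); first by have [] := hKe 0.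
  rewrite (bigD1 0) //= lerDl; apply: sumr_ge0 => i _.
  by have [/ltW] := hKe i.
have -> : 'd g y v - 'd g x v =
    \sum_i v 0 i * ('d g y (delta_mx 0 i) - 'd g x (delta_mx 0 i)).
  apply: etrans (congr2 (fun a b => a - b) (rv_lin ('d g y) v) (rv_lin ('d g x) v)) _.
  by rewrite -sumrB; apply: eq_bigr => i _; rewrite mulrBr.
rewrite (le_trans (nr_sum _ _ _)) // !mulr_suml.
apply: ler_sum => i _; rewrite nrM mulrC.
have [K0 _ h] := hKe i; apply: ler_pM; rewrite ?nr_ge0 ?nr_coord //.
by apply: h; exact: lt_le_trans (hm i).
Qed.

(** The mean value inequality is applied to [g] minus its differential at [x], on the segment from
    [z] to [y]; the derivative of this difference is small by [d_lip]. The form with two free points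
    [y] and [z] is what later comparisons of third-order terms use. *)
Lemma holo_lip2 (g : hvec R -> C) (x : hvec R) (d : R) : 0 < d ->
  (forall y, nr (y - x) < d -> differentiable g y) ->
  (forall v, differentiable (fun w => 'd g w v) x) ->
  exists K e : R, [/\ 0 < K, 0 < e & forall y z, nr (y - x) < e -> nr (z - x) < e ->
    nr (g y - g z - 'd g x (y - z)) <= K * (nr (y - x) + nr (z - x)) * nr (y - z)].
Proof.
move=> d0 gd dg; have [K [e [K0 e0 hK]]] := d_lip dg.
have m0 : 0 < Num.min d e by rewrite lt_min d0.
exists (2 * K), (Num.min d e); split=> // [|y z hy hz]; first by rewrite mulr_gt0.
pose f w := g w - 'd g x w.
pose M := K * (nr (y - x) + nr (z - x)) * nr (y - z).
have seg t : 0 <= t <= 1 -> nr (z + rc t *: (y - z) - x) < Num.min d e.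
  by move=> t01; apply: ball_convex.
have fd (t : R) : 0 <= t <= 1 -> differentiable f (z + rc t *: (y - z)) /\
    'd f (z + rc t *: (y - z)) (y - z) = 'd g (z + rc t *: (y - z)) (y - z) - 'd g x (y - z).
  move=> t01; have /gd dgw : nr (z + rc t *: (y - z) - x) < d.
    by apply: lt_le_trans (seg _ t01) _; rewrite ge_min lexx.
  set w := z + _ in dgw *.
  have [dl1 dl2] := linear_diff ('d g x) w.
  split; first exact: differentiableB.
  apply: etrans (congr1 (@^~ (y - z)) (diffB dgw dl1)) _.
  exact: (congr1 (fun h : hvec R -> C => 'd g w (y - z) - h (y - z)) dl2).
have /(_ _ _) := @mean_value _ _ f z (y - z) M.
rewrite subrKC => h.
have -> : g y - g z - 'd g x (y - z) = f y - f z.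
  by rewrite /f linearB /=; ring.
rewrite -!mulrA [K * _]mulrA; apply: h => t t01; first by have [] := fd t t01.
have [_ ->] := fd t t01.
apply: le_trans (hK _ _ _) _; first by apply: lt_le_trans (seg _ t01) _; rewrite ge_min lexx orbT.
rewrite /M ler_wpM2r ?nr_ge0 // ler_wpM2l ?(ltW K0) //.
rewrite -[in leRHS](nrN (z - x)).
have /andP[t0 t1] := t01.
have -> : z + rc t *: (y - z) - x = rc t *: (y - x) + rc (1 - t) *: (z - x).
  rewrite rmorphB rmorph1 scalerBl scale1r !scalerBr.
  set a := rc t *: y; set b := rc t *: z; set c := rc t *: x.
  by rewrite addrAC opprB [RHS]addrC -[RHS]addrA [c - b + _]addrC [a - c + _]addrA subrK.
rewrite nrN (le_trans (nrD _ _)) // !nrZ !nr_real (ger0_norm t0) ger0_norm ?subr_ge0 //.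
by rewrite lerD // ler_piMl ?nr_ge0 // lerBlDr lerDl.
Qed.

Lemma holo_lip2_at (g : hvec R -> C) (q : hvec R) : holomorphic_at q g ->
  exists2 d : R, 0 < d & forall x, nr (x - q) < d ->
  exists K e : R, [/\ 0 < K, 0 < e & forall y z, nr (y - x) < e -> nr (z - x) < e ->
    nr (g y - g z - 'd g x (y - z)) <= K * (nr (y - x) + nr (z - x)) * nr (y - z)].
Proof.
move=> /holo_ball[d d0 hd]; exists d => // x xd.
apply: (@holo_lip2 _ _ (d - nr (x - q))); first by rewrite subr_gt0.
  move=> y yx; apply: (hd y _).1; have := nrD (y - x) (x - q); rewrite addrA subrK.
  by move=> /le_lt_trans; apply; rewrite -ltrBrDr.
by case: (hd x xd).
Qed.

End HolomorphicEstimates.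

(** * Strict differentiability *)

Section StrictDiff.
Context {R : realType}.
Local Notation C := (Cplx R).
Local Notation rc r := (real_complex R r : C).

(** Additivity and boundedness are all that the estimates use. Compatibility with scalars is
    supplied separately, through [scalable_map] or [linear], where an argument calls for it. *)
Definition blin (V W : normedModType C) (A : V -> W) :=
  {morph A : u v / u - v} /\ exists2 K : R, 0 < K & forall v, nr (A v) <= K * nr v.

(** The two points vary independently. This is the hypothesis under which [A] controls [f] as a
    perturbation of a linear map on a whole ball, hence under which the inverse function theorem
    follows from information at [x] alone. *)
Definition sdiff (V W : normedModType C) (f : V -> W) (x : V) (A : V -> W) :=
  blin A /\ forall eps : R, 0 < eps -> exists2 e : R, 0 < e &
    forall y z, nr (y - x) < e -> nr (z - x) < e ->
      nr (f y - f z - A (y - z)) <= eps * nr (y - z).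

Lemma blin0 (V W : normedModType C) (A : V -> W) : blin A -> A 0 = 0.
Proof. by move=> [AB _]; rewrite -(subrr 0) AB subrr. Qed.

Lemma blin_linear (V W : normedModType C) (A : {linear V -> W}) (K : R) :
  (forall v, nr (A v) <= K * nr v) -> blin A.
Proof.
move=> h; split; first exact: linearB.
exists (`|K| + 1); first by rewrite ltr_wpDl.
move=> v; rewrite (le_trans (h v)) // ler_wpM2r ?nr_ge0 //.
by rewrite (le_trans (ler_norm K)) // lerDl.
Qed.

Lemma sdiff_lipschitz (V W : normedModType C) (f : V -> W) (x : V) (A : V -> W) :
  sdiff f x A -> exists K e : R, [/\ 0 < K, 0 < e & forall y z,
    nr (y - x) < e -> nr (z - x) < e -> nr (f y - f z) <= K * nr (y - z)].
Proof.
move=> [[_ [K K0 hK]] /(_ _ ltr01)[e e0 he]].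
exists (K + 1), e; split=> [||y z hy hz]; rewrite ?addr_gt0 //.
have := nrD (f y - f z - A (y - z)) (A (y - z)); rewrite subrK.
move=> /le_trans; apply; rewrite mulrDl mul1r addrC lerD //.
by have := he y z hy hz; rewrite mul1r.
Qed.

Lemma sdiff_near (V W : normedModType C) (f : V -> W) (x : V) (A : V -> W) (eps : R) :
  sdiff f x A -> 0 < eps ->
  exists2 e : R, 0 < e & forall y, nr (y - x) < e -> nr (f y - f x) < eps.
Proof.
move=> /sdiff_lipschitz[K [e [K0 e0 h]]] eps0.
exists (Num.min e (eps / K)); first by rewrite lt_min e0 divr_gt0.
move=> y; rewrite lt_min => /andP[ye yk].
rewrite (le_lt_trans (h y x ye _)) ?subrr ?nr0 //.
by rewrite mulrC -ltr_pdivlMr.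
Qed.

Lemma sdiff_comp (U V W : normedModType C) (f : U -> V) (g : V -> W) (x : U)
    (A : U -> V) (B : V -> W) :
  sdiff f x A -> sdiff g (f x) B -> sdiff (g \o f) x (B \o A).
Proof.
move=> sf sg; have [[AB [KA KA0 hA]] hf] := sf; have [[BB [KB KB0 hB]] hg] := sg.
split.
  split; first by move=> u v /=; rewrite AB BB.
  exists (KB * KA); first by rewrite mulr_gt0.
  by move=> v /=; rewrite (le_trans (hB _)) // -mulrA ler_wpM2l // ltW.
move=> eps eps0.
have [K [e1 [K0 e10 h1]]] := sdiff_lipschitz sf.
have eps2 : 0 < eps / 2 by rewrite divr_gt0.
have [e2 e20 h2] := hg _ (divr_gt0 eps2 K0).
have [e3 e30 h3] := hf _ (divr_gt0 eps2 KB0).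
have [e4 e40 h4] := sdiff_near sf e20.
exists (Num.min (Num.min e1 e3) e4); first by rewrite !lt_min e10 e30.
move=> y z; rewrite !lt_min => /andP[/andP[y1 y3] y4] /andP[/andP[z1 z3] z4] /=.
have -> : g (f y) - g (f z) - B (A (y - z)) =
  (g (f y) - g (f z) - B (f y - f z)) + B (f y - f z - A (y - z)).
  by rewrite (BB (f y - f z) (A (y - z))) addrA subrK.
rewrite (le_trans (nrD _ _)) // [eps]splitr mulrDl; apply: lerD.
  rewrite (le_trans (h2 _ _ (h4 _ y4) (h4 _ z4))) //.
  apply: le_trans (ler_wpM2l (ltW (divr_gt0 eps2 K0)) (h1 _ _ y1 z1)) _.
  by rewrite mulrA divfK // gt_eqF.
rewrite (le_trans (hB _)) //.
apply: le_trans (ler_wpM2l (ltW KB0) (h3 _ _ y3 z3)) _.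
by rewrite mulrA [KB * _]mulrC divfK // gt_eqF.
Qed.

Lemma sdiff_row (V : normedModType C) n (f : 'I_n -> V -> C) (x : V) (A : 'I_n -> V -> C) :
  (forall i, sdiff (f i) x (A i)) ->
  sdiff (fun y => \row_i f i y) x (fun v => \row_i A i v).
Proof.
move=> h; split; first split.
- by move=> u v; apply/rowP => i; rewrite !mxE; case: (h i) => [[->]].
- have /choice[K hK] : forall i, exists K : R, 0 < K /\ forall v, nr (A i v) <= K * nr v.
    by move=> i; have [[_ [K K0 hK]] _] := h i; exists K.
  have S0 : 0 <= \sum_i K i by apply: sumr_ge0 => i _; rewrite ltW // (hK i).1.
  exists (\sum_i K i + 1); first by rewrite ltr_wpDl.
  move=> v; apply: nr_coord_le => [|? i]; first by rewrite mulr_ge0 ?nr_ge0 ?addr_ge0.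
  rewrite mxE (le_trans ((hK i).2 v)) // ler_wpM2r ?nr_ge0 // ler_wpDr //.
  by rewrite (bigD1 i) //= lerDl; apply: sumr_ge0 => j _; rewrite ltW // (hK j).1.
move=> eps eps0.
have /choice[e he] : forall i, exists e : R, 0 < e /\ forall y z, nr (y - x) < e -> nr (z - x) < e ->
      nr (f i y - f i z - A i (y - z)) <= eps * nr (y - z).
  by move=> i; have [_ /(_ _ eps0)[e e0 he]] := h i; exists e.
have [m m0 hm] := finite_min (fun i => (he i).1).
exists m => // y z ym zm; apply: nr_coord_le => [|? i]; first by rewrite mulr_ge0 ?nr_ge0 ?ltW.
by rewrite !mxE; apply: (he i).2; exact: lt_le_trans (hm i).
Qed.

Lemma sdiffD (V : normedModType C) (f g : V -> C) (x : V) (A B : V -> C) :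
  sdiff f x A -> sdiff g x B -> sdiff (fun y => f y + g y) x (fun v => A v + B v).
Proof.
move=> [[AB [KA KA0 hA]] hf] [[BB [KB KB0 hB]] hg].
split; first split.
- by move=> u v; rewrite AB BB opprD addrACA.
- exists (KA + KB); first by rewrite addr_gt0.
  by move=> v; rewrite (le_trans (nrD _ _)) // mulrDl lerD.
move=> eps eps0.
have eps2 : 0 < eps / 2 by rewrite divr_gt0.
have [e1 e10 h1] := hf _ eps2.
have [e2 e20 h2] := hg _ eps2.
exists (Num.min e1 e2) => [|y z]; first by rewrite lt_min e10.
rewrite !lt_min => /andP[y1 y2] /andP[z1 z2].
have -> : f y + g y - (f z + g z) - (A (y - z) + B (y - z)) =
  (f y - f z - A (y - z)) + (g y - g z - B (y - z)) by ring.
by rewrite (le_trans (nrD _ _)) // [eps]splitr mulrDl lerD // ?h1 ?h2.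
Qed.

Lemma sdiff_cst (V W : normedModType C) (c : W) (x : V) : sdiff (fun=> c) x (fun=> 0).
Proof.
split; first split.
- by move=> u v; rewrite subrr.
- by exists 1 => // v; rewrite nr0 mul1r nr_ge0.
by move=> eps eps0; exists 1 => // y z _ _; rewrite !subrr nr0 mulr_ge0 ?nr_ge0 ?ltW.
Qed.

Lemma sdiff_blin (V W : normedModType C) (A : V -> W) (x : V) : blin A -> sdiff A x A.
Proof.
move=> bA; split=> // eps eps0; exists 1 => // y z _ _.
by rewrite bA.1 subrr nr0 mulr_ge0 ?nr_ge0 ?ltW.
Qed.

Lemma blin_coord n (i : 'I_n) : blin (fun v : 'rV[C]_n => v 0 i).
Proof.
split; first by move=> u v; rewrite !mxE.
by exists 1 => // v; rewrite mul1r nr_coord.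
Qed.

Lemma sdiffM (V : normedModType C) (f g : V -> C) (x : V) (A B : V -> C) :
  sdiff f x A -> sdiff g x B ->
  sdiff (fun y => f y * g y) x (fun v => f x * B v + A v * g x).
Proof.
move=> sf sg; have [[AB [KA KA0 hA]] hf] := sf; have [[BB [KB KB0 hB]] hg] := sg.
have nf : 0 < nr (f x) + 1 by rewrite ltr_wpDl ?nr_ge0.
have ng : 0 < nr (g x) + 1 by rewrite ltr_wpDl ?nr_ge0.
split; first split.
- by move=> u v; rewrite AB BB; ring.
- exists ((nr (f x) + 1) * KB + KA * (nr (g x) + 1)); first by rewrite addr_gt0 // mulr_gt0.
  move=> v; rewrite (le_trans (nrD _ _)) // !nrM mulrDl; apply: lerD.
    by rewrite -mulrA ler_pM ?nr_ge0 // lerDl.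
  by rewrite mulrAC ler_pM ?nr_ge0 // lerDl.
move=> eps eps0.
have q0 : 0 < eps / 4 by rewrite divr_gt0.
have [e1 e10 h1] := hf _ (divr_gt0 q0 ng).
have [e2 e20 h2] := hg _ (divr_gt0 q0 nf).
have [e3 e30 h3] := sdiff_near sf (divr_gt0 q0 KB0).
have [e4 e40 h4] := sdiff_near sg (divr_gt0 q0 KA0).
have [e5 e50 h5] := sdiff_near sf ltr01.
have [e6 e60 h6] := sdiff_near sg ltr01.
exists (Num.min (Num.min (Num.min e1 e2) (Num.min e3 e4)) (Num.min e5 e6)).
  by rewrite !lt_min e10 e20 e30 e40 e50.
move=> y z; rewrite !lt_min => /andP[/andP[/andP[y1 y2] /andP[y3 y4]] /andP[y5 y6]]
  /andP[/andP[/andP[z1 z2] /andP[z3 z4]] /andP[z5 z6]].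
(* Four terms, each a bounded factor times a small one; each of them receives a quarter of [eps]. *)
have -> : f y * g y - f z * g z - (f x * B (y - z) + A (y - z) * g x) =
  f y * (g y - g z - B (y - z)) + g z * (f y - f z - A (y - z)) +
  ((f y - f x) * B (y - z) + (g z - g x) * A (y - z)) by ring.
have hq : eps * nr (y - z) = (eps / 4 * nr (y - z) + eps / 4 * nr (y - z)) +
   (eps / 4 * nr (y - z) + eps / 4 * nr (y - z)) by field.
have fyn : nr (f y) <= nr (f x) + 1.
  have := nrD (f y - f x) (f x); rewrite subrK => /le_trans; apply.
  by rewrite addrC lerD2l ltW // h5.
have gzn : nr (g z) <= nr (g x) + 1.
  have := nrD (g z - g x) (g x); rewrite subrK => /le_trans; apply.
  by rewrite addrC lerD2l ltW // h6.
rewrite hq (le_trans (nrD _ _)) //; apply: lerD; rewrite (le_trans (nrD _ _)) //; apply: lerD; rewrite nrM.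
- apply: le_trans (ler_pM (nr_ge0 _) (nr_ge0 _) fyn (h2 _ _ y2 z2)) _.
  by rewrite mulrA [_ * (_ / _)]mulrC divfK // gt_eqF.
- apply: le_trans (ler_pM (nr_ge0 _) (nr_ge0 _) gzn (h1 _ _ y1 z1)) _.
  by rewrite mulrA [_ * (_ / _)]mulrC divfK // gt_eqF.
- apply: le_trans (ler_pM (nr_ge0 _) (nr_ge0 _) (ltW (h3 _ y3)) (hB _)) _.
  by rewrite mulrA divfK // gt_eqF.
- apply: le_trans (ler_pM (nr_ge0 _) (nr_ge0 _) (ltW (h4 _ z4)) (hA _)) _.
  by rewrite mulrA divfK // gt_eqF.
Qed.

Lemma sdiff_diff (V W : normedModType C) (f : V -> W) (x : V) (A : {linear V -> W}) :
  sdiff f x A -> differentiable f x /\ 'd f x = A :> (V -> W).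
Proof.
move=> [[_ [K K0 hK]] hf]; apply: (differentiable_intro hK) => eps /hf[e e0 he].
exists e => // h hh; have := he (x + h) x.
have -> : x + h - x = h by rewrite addrC addKr.
by rewrite subrr nr0; apply.
Qed.

Lemma lip2_sdiff (V W : normedModType C) (f : V -> W) (x : V) (A : V -> W) (K e : R) :
  blin A -> 0 < K -> 0 < e ->
  (forall y z, nr (y - x) < e -> nr (z - x) < e ->
    nr (f y - f z - A (y - z)) <= K * (nr (y - x) + nr (z - x)) * nr (y - z)) ->
  sdiff f x A.
Proof.
move=> bA K0 e0 h; split=> // eps eps0.
exists (Num.min e (eps / (2 * K))); first by rewrite lt_min e0 divr_gt0 // mulr_gt0.
move=> y z; rewrite !lt_min => /andP[y1 y2] /andP[z1 z2].
rewrite (le_trans (h y z y1 z1)) // ler_wpM2r ?nr_ge0 //.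
rewrite mulrC -ler_pdivlMr //.
have -> : eps / K = eps / (2 * K) + eps / (2 * K) by field; rewrite gt_eqF.
by rewrite lerD // ltW.
Qed.

Lemma sdiff_eq (V W : normedModType C) (f : V -> W) (x : V) (A B : V -> W) :
  A =1 B -> sdiff f x A -> sdiff f x B.
Proof. by move=> /funext ->. Qed.

Lemma blin_d (V W : normedModType C) (f : V -> W) (x : V) :
  differentiable f x -> blin ('d f x).
Proof. by move=> /diff_bound[K _ hK]; exact: blin_linear hK. Qed.

Lemma holo_sdiff (g : hvec R -> C) (q : hvec R) : holomorphic_at q g ->
  exists2 d : R, 0 < d & forall x, nr (x - q) < d -> sdiff g x ('d g x).
Proof.
move=> hg; have [d1 d10 h1] := holo_ball hg; have [d2 d20 h2] := holo_lip2_at hg.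
exists (Num.min d1 d2) => [|x]; first by rewrite lt_min d10.
rewrite lt_min => /andP[x1 x2]; have [K [e [K0 e0 h]]] := h2 _ x2.
by apply: lip2_sdiff K0 e0 h; apply: blin_d; have [] := h1 _ x1.
Qed.

End StrictDiff.

(** * The inverse function theorem *)

Section InverseFunction.
Context {R : realType}.
Local Notation C := (Cplx R).
Local Notation rc r := (real_complex R r : C).

(** With [e n = 2 c / 2 ^+ n], the intervals of centre [u n] and radius [e n] are nested, since
    [e n = e n.+1 + c / 2 ^+ n]. The supremum of their lower ends lies in all of them. *)
Lemma geometric_limit_real (u : nat -> R) (c : R) :
  (forall n, `|u n.+1 - u n| <= c / 2 ^+ n) ->
  exists l, forall n, `|l - u n| <= 2 * c / 2 ^+ n.
Proof.
move=> hu.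
pose e n := 2 * c / 2 ^+ n.
have eS n : e n = e n.+1 + c / 2 ^+ n.
  by rewrite /e exprS; field; rewrite expf_neq0.
have e0 n : 0 <= e n.
  have := le_trans (normr_ge0 _) (hu n); rewrite /e -mulrA => h.
  by rewrite mulr_ge0.
have vS n : u n - e n <= u n.+1 - e n.+1.
  by have := hu n; rewrite ler_norml (eS n) => /andP[]; lra.
have wS n : u n.+1 + e n.+1 <= u n + e n.
  by have := hu n; rewrite ler_norml (eS n) => /andP[]; lra.
have vm n m : (n <= m)%N -> u n - e n <= u m - e m.
  by elim: m => [|m IH]; [rewrite leqn0 => /eqP -> | rewrite leq_eqVlt => /orP[/eqP -> //|/IH /le_trans ->]].
have wm n m : (n <= m)%N -> u m + e m <= u n + e n.
  elim: m => [|m IH]; first by rewrite leqn0 => /eqP ->.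
  by rewrite leq_eqVlt => /orP[/eqP -> //|/IH]; exact: le_trans.
have vw n m : u n - e n <= u m + e m.
  apply: le_trans (vm n (maxn n m) (leq_maxl _ _)) _.
  apply: le_trans _ (wm m (maxn n m) (leq_maxr _ _)).
  by have := e0 (maxn n m); lra.
have hne : [set u n - e n | n in [set: nat]] !=set0 by exists (u 0%N - e 0%N), 0%N.
exists (sup [set u n - e n | n in [set: nat]]) => n.
rewrite ler_distl; apply/andP; split.
  apply: ub_le_sup; last by exists n.
  by exists (u 0%N + e 0%N) => _ [m _ <-]; exact: vw.
by apply: ge_sup => // _ [m _ <-]; exact: vw.
Qed.

Lemma geometric_limit (m n : nat) (u : nat -> 'M[C]_(m, n)) (c : R) :
  (forall k, nr (u k.+1 - u k) <= c / 2 ^+ k) ->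
  exists l, forall k, nr (l - u k) <= 4 * c / 2 ^+ k.
Proof.
move=> hu.
have hre i j k : `|complex.Re (u k.+1 i j) - complex.Re (u k i j)| <= c / 2 ^+ k.
  have := Re_le (u k.+1 i j - u k i j).
  have -> : complex.Re (u k.+1 i j - u k i j) = complex.Re (u k.+1 i j) - complex.Re (u k i j).
    by case: (u k.+1 i j) (u k i j) => [a b] [a' b'].
  move=> /le_trans; apply; apply: le_trans (hu k).
  by have := nr_coord (u k.+1 - u k) i j; rewrite !mxE.
have him i j k : `|complex.Im (u k.+1 i j) - complex.Im (u k i j)| <= c / 2 ^+ k.
  have := Im_le (u k.+1 i j - u k i j).
  have -> : complex.Im (u k.+1 i j - u k i j) = complex.Im (u k.+1 i j) - complex.Im (u k i j).
    by case: (u k.+1 i j) (u k i j) => [a b] [a' b'].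
  move=> /le_trans; apply; apply: le_trans (hu k).
  by have := nr_coord (u k.+1 - u k) i j; rewrite !mxE.
have c0 : 0 <= c by have := le_trans (nr_ge0 _) (hu 0%N); rewrite expr0 divr1.
have /choice[lre hlre] : forall ij : 'I_m * 'I_n, exists l, forall k, `|l - complex.Re (u k ij.1 ij.2)| <= 2 * c / 2 ^+ k.
  by move=> ij; apply: geometric_limit_real => k; exact: hre.
have /choice[lim hlim] : forall ij : 'I_m * 'I_n, exists l, forall k, `|l - complex.Im (u k ij.1 ij.2)| <= 2 * c / 2 ^+ k.
  by move=> ij; apply: geometric_limit_real => k; exact: him.
exists (\matrix_(i, j) (Complex (lre (i, j)) (lim (i, j)) : C)) => k.
apply: nr_coord_le => [|i j]; first by rewrite divr_ge0 ?mulr_ge0 ?exprn_ge0.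
rewrite !mxE (le_trans (nr_ReIm _)) //.
have := hlre (i, j) k; have := hlim (i, j) k; rewrite /=.
case: (u k i j) => [a b] /= h1 h2.
have -> : 4 * c / 2 ^+ k = 2 * c / 2 ^+ k + 2 * c / 2 ^+ k by field; rewrite expf_neq0.
exact: lerD.
Qed.

(** Only a left inverse of the derivative is used: [B] bounds [x - y] by [A (x - y)], which differs
    from [f x - f y] by an amount that contributes at most half of [nr (x - y)]. *)
Lemma sdiff_injective (V W : normedModType C) (f : V -> W) (x0 : V) (A : V -> W) (B : W -> V) :
  sdiff f x0 A -> blin B -> cancel A B ->
  exists K e : R, [/\ 0 < K, 0 < e & forall x y, nr (x - x0) < e -> nr (y - x0) < e ->
    nr (x - y) <= K * nr (f x - f y)].
Proof.
move=> [_ hf] [BB [KB KB0 hB]] AK.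
have [e e0 he] := hf (2 * KB)^-1 ltac:(by rewrite invr_gt0 mulr_gt0).
exists (2 * KB), e; split=> // [|x y hx hy]; first by rewrite mulr_gt0.
have h1 : nr (A (x - y)) <= nr (f x - f y) + (2 * KB)^-1 * nr (x - y).
  have := nrB (f x - f y) (f x - f y - A (x - y)); rewrite opprB addrC subrK.
  by move=> /le_trans; apply; rewrite lerD2l he.
have := hB (A (x - y)); rewrite AK => h2.
have := le_trans h2 (ler_wpM2l (ltW KB0) h1).
set a := nr (x - y); set b := nr (f x - f y).
have -> : KB * (b + (2 * KB)^-1 * a) = KB * b + a / 2 by field; rewrite gt_eqF.
lra.
Qed.

(** Simplified Newton iteration: [T x = x + B (y - f x)] is a contraction of ratio 1/2 near [x0],
    and its fixed points solve [f x = y]. *)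
Lemma local_surjectivity n (f : 'rV[C]_n -> 'rV[C]_n) (x0 : 'rV[C]_n) (A B : 'rV[C]_n -> 'rV[C]_n) :
  sdiff f x0 A -> blin B -> cancel A B -> cancel B A ->
  exists K e : R, [/\ 0 < K, 0 < e & forall y, nr (y - f x0) < e ->
    exists2 x, nr (x - x0) <= K * nr (y - f x0) & f x = y].
Proof.
move=> [bA hf] bB AK BK; have [BB [KB KB0 hB]] := bB.
have [d d0 hd] := hf (2 * KB)^-1 ltac:(by rewrite invr_gt0 mulr_gt0).
(* The first Newton step has length at most [r = KB * nr (y - f x0)], and [geometric_limit] then
   places the limit within [4 * r] of [x0]. *)
have K4 : 0 < 4 * KB by rewrite mulr_gt0.
exists (4 * KB), (d / (4 * KB)); split=> // [|y hy]; first exact: divr_gt0.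
pose T (x : 'rV[C]_n) : 'rV[C]_n := x + B (y - f x).
pose r := KB * nr (y - f x0).
have r0 : 0 <= r by rewrite mulr_ge0 ?nr_ge0 ?ltW.
have r4 : 4 * r < d by move: hy; rewrite ltr_pdivlMr ?mulr_gt0 // /r; lra.
have TL x x' : nr (x - x0) < d -> nr (x' - x0) < d -> nr (T x - T x') <= 2^-1 * nr (x - x').
  move=> hx hx'.
  have -> : T x - T x' = B (A (x - x') - (f x - f x')).
    rewrite (BB (A (x - x'))) AK /T !BB opprD addrACA; congr (_ + _).
    by rewrite !opprB addrC addrA subrK.
  apply: le_trans (hB _) _.
  rewrite nrC; apply: le_trans (ler_wpM2l (ltW KB0) (hd _ _ hx hx')) _.
  by rewrite mulrA invfM mulrCA mulfV ?gt_eqF // mulr1.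
pose u k : 'rV[C]_n := iter k T x0.
have ub k : nr (u k - x0) <= 2 * r * (1 - (2^-1) ^+ k) /\ nr (u k.+1 - u k) <= r / 2 ^+ k.
  elim: k => [|k [IH1 IH2]].
    rewrite /= subrr nr0 expr0 subrr mulr0; split=> //.
    by rewrite divr1 /u /= /T addrC addKr; exact: hB.
  have hp : 0 < (2^-1 : R) ^+ k by rewrite exprn_gt0 // invr_gt0.
  have h1 : nr (u k.+1 - x0) <= 2 * r * (1 - (2^-1) ^+ k.+1).
    have := nrD (u k.+1 - u k) (u k - x0); rewrite addrA subrK.
    move=> /le_trans; apply; apply: le_trans (lerD IH2 IH1) _.
    by rewrite exprS -exprVn; have := r0; nra.
  split=> //.
  have hk : nr (u k - x0) < d by apply: le_lt_trans IH1 _; nra.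
  have hk1 : nr (u k.+1 - x0) < d.
    apply: le_lt_trans h1 _.
    have : 0 < (2^-1 : R) ^+ k.+1 by rewrite exprn_gt0 // invr_gt0.
    by nra.
  have := TL _ _ hk1 hk => /le_trans; apply.
  rewrite exprS invfM mulrCA ler_wpM2l ?invr_ge0 //.
have [l hl] := geometric_limit (fun k => (ub k).2).
have hl0 : nr (l - x0) <= 4 * r by have := hl 0%N; rewrite expr0 divr1.
have hp k : 0 < (2^-1 : R) ^+ k by rewrite exprn_gt0 // invr_gt0.
(* [T l] is compared with [T (u k) = u k.+1], which tends to [l]: the gap is at most a constant
   times [2 ^- k]. *)
have Tl : nr (T l - l) = 0.
  apply/eqP; rewrite eq_le nr_ge0 andbT; apply/ler_addgt0Pl => eps eps0; rewrite addr0.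
  have [k hk] : exists k, 8 * r / 2 ^+ k <= eps.
    have [k hk] : exists k : nat, 8 * r / eps <= k%:R.
      by exists (Num.trunc (8 * r / eps)).+1; rewrite ltW // truncnS_gt.
    exists k; rewrite ler_pdivrMr ?exprn_gt0 // [eps * _]mulrC -ler_pdivrMr //.
    apply: le_trans hk _; by rewrite -natrX ler_nat ltnW // ltn_expl.
  have huk : nr (u k - x0) < d.
    by apply: le_lt_trans (ub k).1 _; have := hp k; nra.
  have hT := nrD (T l - T (u k)) (T (u k) - l); rewrite addrA subrK in hT; apply: (le_trans hT).
  have h1 := TL _ _ (le_lt_trans hl0 r4) huk.
  have h2 := hl k.
  have h3 : nr (T (u k) - l) <= 4 * r / 2 ^+ k.+1 by rewrite nrC; exact: hl k.+1.
  apply: le_trans (lerD h1 h3) (le_trans _ hk).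
  rewrite exprS invfM [4 * r * _]mulrCA -mulrDr -ler_pdivlMl ?invr_gt0 // invrK.
  have -> : 2 * (8 * r / 2 ^+ k) = 4 * r / 2 ^+ k + 12 * r / 2 ^+ k by field; rewrite expf_neq0.
  apply: lerD => //; rewrite ler_pM2r ?invr_gt0 ?exprn_gt0 //; lra.
exists l; first by move: hl0; rewrite /r mulrA.
move/nr_eq0/eqP: Tl; rewrite /T addrC addKr => /eqP h.
have := BK (y - f l); rewrite h (blin0 bA) => /eqP; rewrite eq_sym subr_eq0 => /eqP ->.
by [].
Qed.

End InverseFunction.

Section LocalInverse.
Context {R : realType}.
Local Notation C := (Cplx R).

(** [psi] is a total function, meaningful only on the ball of radius [rho]. The last clause makes
    [f] injective near [x0] and [psi] Lipschitz; keeping the constants explicit lets the same [psi]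
    be differentiated at every point of the ball. *)
Definition local_inverse n (f psi : 'rV[C]_n -> 'rV[C]_n) (x0 : 'rV[C]_n) (K r rho : R) :=
  [/\ 0 < K, 0 < r, 0 < rho,
    forall y, nr (y - f x0) < rho -> nr (psi y - x0) < r /\ f (psi y) = y &
    forall x y, nr (x - x0) < r -> nr (y - x0) < r -> nr (x - y) <= K * nr (f x - f y)].

Lemma inverse_function n (f : 'rV[C]_n -> 'rV[C]_n) (x0 : 'rV[C]_n) (A B : 'rV[C]_n -> 'rV[C]_n) :
  sdiff f x0 A -> blin B -> cancel A B -> cancel B A ->
  exists psi K r rho, local_inverse f psi x0 K r rho.
Proof.
move=> sf bB AK BK.
have [K [r [K0 r0 hK]]] := sdiff_injective sf bB AK.
have [K' [e [K'0 e0 he]]] := local_surjectivity sf bB AK BK.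
pose rho := Num.min e (r / K').
have /choice[psi hpsi] : forall y, exists x, nr (y - f x0) < rho ->
    nr (x - x0) < r /\ f x = y.
  move=> y; have [yr|] := ltP (nr (y - f x0)) rho; last by exists x0.
  move: yr; rewrite lt_min => /andP[ye yr].
  have [x hx fx] := he y ye; exists x => _; split=> //.
  by apply: le_lt_trans hx _; rewrite mulrC -ltr_pdivlMr.
exists psi, K, r, rho; split=> //.
by rewrite lt_min e0 divr_gt0.
Qed.

Section Properties.
Variables (n : nat) (f psi : 'rV[C]_n -> 'rV[C]_n) (x0 : 'rV[C]_n) (K r rho : R).
Hypothesis inv : local_inverse f psi x0 K r rho.

Lemma local_inverse_lip y z : nr (y - f x0) < rho -> nr (z - f x0) < rho ->
  nr (psi y - psi z) <= K * nr (y - z).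
Proof.
have [_ _ _ h1 h2] := inv; move=> /h1[yr fy] /h1[zr fz].
by have := h2 _ _ yr zr; rewrite fy fz.
Qed.

Lemma local_inverseK x : nr (x - x0) < r -> nr (f x - f x0) < rho -> psi (f x) = x.
Proof.
have [_ _ _ h1 h2] := inv => xr /h1[yr fy].
have := h2 _ _ yr xr; rewrite fy subrr nr0 mulr0 => h.
by apply/eqP; rewrite -subr_eq0; apply/eqP/nr_eq0/eqP; rewrite eq_le h nr_ge0.
Qed.

Lemma local_inverse_at : psi (f x0) = x0.
Proof. by have [_ r0 rho0 _ _] := inv; apply: local_inverseK; rewrite subrr nr0. Qed.

(** Valid at any point of the ball, with any left inverse of the derivative of [f] at the preimage.
    The Lipschitz bound on [psi] converts the remainder of [f] into a remainder for [psi]. *)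
Lemma local_inverse_sdiff y (A B : 'rV[C]_n -> 'rV[C]_n) :
  nr (y - f x0) < rho -> sdiff f (psi y) A -> blin B -> cancel A B ->
  sdiff psi y B.
Proof.
have [K0 r0 rho0 h1 h2] := inv => yr [bA hf] bB AK; split=> // eps eps0.
have [BB [KB KB0 hB]] := bB; have [pr fpy] := h1 _ yr.
have [e e0 he] := hf _ (divr_gt0 eps0 (mulr_gt0 KB0 K0)).
exists (Num.min (rho - nr (y - f x0)) (e / K)); first by rewrite lt_min subr_gt0 yr divr_gt0.
have near z : nr (z - y) < rho - nr (y - f x0) -> nr (z - f x0) < rho.
  rewrite ltrBrDr; apply: le_lt_trans; have := nrD (z - y) (y - f x0).
  by rewrite addrA subrK.
have near2 z : nr (z - f x0) < rho -> nr (z - y) < e / K -> nr (psi z - psi y) < e.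
  move=> hz; rewrite ltr_pdivlMr // mulrC; apply: le_lt_trans.
  exact: local_inverse_lip.
move=> z w; rewrite !lt_min => /andP[z1 z2] /andP[w1 w2].
have [zr wr] := (near _ z1, near _ w1).
have [[_ fz] [_ fw]] := (h1 _ zr, h1 _ wr).
have := he _ _ (near2 _ zr z2) (near2 _ wr w2).
rewrite fz fw => h.
have -> : psi z - psi w - B (z - w) = - B (z - w - A (psi z - psi w)).
  by rewrite (BB (z - w)) AK opprB.
rewrite nrN (le_trans (hB _)) //.
apply: le_trans (ler_wpM2l (ltW KB0) h) _.
apply: le_trans (ler_wpM2l (ltW KB0) (ler_wpM2l _ (local_inverse_lip zr wr))) _.
  by rewrite divr_ge0 ?mulr_ge0 ?ltW.
have -> : KB * (eps / (KB * K) * (K * nr (z - w))) = eps * nr (z - w); last by [].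
by field; rewrite !gt_eqF.
Qed.

End Properties.

Lemma blin_mulmx n m (A : 'M[C]_(n, m)) : blin (fun v : 'rV[C]_n => v *m A).
Proof.
split; first by move=> u v; rewrite mulmxBl.
exists (n%:R * nr A + 1); first by rewrite ltr_wpDl // mulr_ge0 ?nr_ge0.
by move=> v; rewrite (le_trans (nr_mulmx _ _)) // ler_wpM2r ?nr_ge0 // lerDl.
Qed.

End LocalInverse.

(** * Polynomial maps and holomorphy of their local inverses *)

Section Polynomials.
Context {R : realType}.
Local Notation C := (Cplx R).
Local Notation form := (form4 R).
Local Notation ev P := (fun x : hvec R => meval (x 0) P).

(** Induction along the ring operations, suited to evaluation, derivation and restriction to a line,
    which obey sum and product rules. *)
Lemma mpoly_alg_ind n (K : comNzRingType) (P : mpoly n K -> Prop) :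
  (forall c, P (mpolyC n c)) -> (forall i, P (mpolyX K (mnm1 i))) ->
  (forall p q, P p -> P q -> P (p + q)) -> (forall p q, P p -> P q -> P (p * q)) ->
  forall p, P p.
Proof.
move=> hC hX hD hM; elim/mpolyind => [|c m p _ _ hp]; first by rewrite -mpolyC0.
apply: (hD _ _) => //; rewrite -mul_mpolyC; apply: (hM _ _) => //.
rewrite mpolyXE_id; apply: (big_ind P) => [|p1 p2|i _]; [by rewrite -mpolyC1 | exact: hM|].
by elim: (m i) => [|k IH]; [rewrite expr0 -mpolyC1 | rewrite exprS; apply: (hM _ _)].
Qed.

Lemma holo_meval (P : form) q : holomorphic_at q (ev P).
Proof.
elim/mpoly_alg_ind: P => [c|i|p1 p2 h1 h2|p1 p2 h1 h2].
- have -> : ev (mpolyC 4 c) = fun=> c by apply/funext => x; rewrite mevalC.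
  exact: holo_cst.
- pose f : hvec R -> C := fun x => x 0 i.
  have lf : linear f by move=> a u v; rewrite /f !mxE.
  pose F := HB.pack_for {linear hvec R -> C} f (GRing.isLinear.Build _ _ _ _ f lf).
  have -> : ev (mpolyX C (mnm1 i)) = F by apply/funext => x; rewrite mevalXU.
  by move=> k; exact: cdiff_linear.
- have -> : ev (p1 + p2) = fun x => meval (x 0) p1 + meval (x 0) p2.
    by apply/funext => x; rewrite mevalD.
  exact: holo_D.
have -> : ev (p1 * p2) = fun x => meval (x 0) p1 * meval (x 0) p2.
  by apply/funext => x; rewrite mevalM.
exact: holo_M.
Qed.

Definition dmeval (P : form) (x v : hvec R) : C := \sum_i v 0 i * meval (x 0) (mderiv i P).

Lemma sdiff_meval (P : form) x : sdiff (ev P) x (dmeval P x).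
Proof.
elim/mpoly_alg_ind: P => [c|i|p1 p2 h1 h2|p1 p2 h1 h2].
- have -> : ev (mpolyC 4 c) = fun=> c by apply/funext => y; rewrite mevalC.
  apply: sdiff_eq (sdiff_cst c x) => v; rewrite /dmeval big1 // => j _.
  by rewrite mderivC meval0 mulr0.
- have -> : ev (mpolyX C (mnm1 i)) = fun y => y 0 i by apply/funext => y; rewrite mevalXU.
  apply: sdiff_eq (sdiff_blin x (blin_coord i)) => v.
  rewrite /dmeval (bigD1 i) //= big1 => [|j ji]; rewrite mderivX mnm1E.
    have -> : mnm_sub (mnm1 i) (mnm1 i) = mnm0 by apply/mnmP => k; rewrite mnmBE mnm0E subnn.
    by rewrite eqxx addr0 mpolyX0 scale1r meval1 mulr1.
  by rewrite eq_sym (negbTE ji) scale0r meval0 mulr0.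
- have -> : ev (p1 + p2) = fun x => meval (x 0) p1 + meval (x 0) p2.
    by apply/funext => y; rewrite mevalD.
  apply: sdiff_eq (sdiffD h1 h2) => v; rewrite /dmeval -big_split; apply: eq_bigr => j _.
  by rewrite mderivD mevalD mulrDr.
have -> : ev (p1 * p2) = fun x => meval (x 0) p1 * meval (x 0) p2.
  by apply/funext => y; rewrite mevalM.
apply: sdiff_eq (sdiffM h1 h2) => v; rewrite /dmeval mulr_sumr mulr_suml -big_split.
by apply: eq_bigr => j _; rewrite mderivM mevalD !mevalM /=; ring.
Qed.

Lemma dmeval_linear (P : form) x : linear (dmeval P x).
Proof.
move=> a u v; change (dmeval P x (a *: u + v) = a * dmeval P x u + dmeval P x v).
rewrite /dmeval mulr_sumr -big_split.
by apply: eq_bigr => j _; rewrite !mxE mulrDl mulrA.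
Qed.

Lemma diff_meval (P : form) x v :
  differentiable (ev P) x /\ 'd (ev P) x v = dmeval P x v.
Proof.
pose f := HB.pack_for {linear hvec R -> C} (dmeval P x)
  (GRing.isLinear.Build _ _ _ _ (dmeval P x) (@dmeval_linear P x)).
have [h1 h2] := @sdiff_diff _ _ _ _ _ f (sdiff_meval P x).
by split=> //; exact: (congr1 (@^~ v) h2).
Qed.

Lemma meval_near (P : form) (x : hvec R) (eps : R) : 0 < eps -> exists2 d : R, 0 < d &
  forall y : hvec R, nr (y - x) < d -> nr (meval (y 0) P - meval (x 0) P) < eps.
Proof. exact: sdiff_near (sdiff_meval P x). Qed.

Lemma meval_neq0_near (P : form) (x : hvec R) : meval (x 0) P != 0 -> exists2 d : R, 0 < d &
  forall y : hvec R, nr (y - x) < d -> meval (y 0) P != 0.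
Proof.
move=> /nr_gt0 /(meval_near P x)[d d0 hd]; exists d => // y /hd.
by apply: contraTneq => ->; rewrite sub0r nrN ltxx.
Qed.

End Polynomials.

Section HolomorphicInverse.
Context {R : realType}.
Local Notation C := (Cplx R).
Local Notation form := (form4 R).
Local Notation ev P := (fun x : hvec R => meval (x 0) P).

Lemma sdiff_diffE (V W : normedModType C) (f : V -> W) (x : V) (A : V -> W) :
  linear A -> sdiff f x A -> differentiable f x /\ forall v, 'd f x v = A v.
Proof.
move=> lA sf; pose A' := HB.pack_for {linear V -> W} A (GRing.isLinear.Build _ _ _ _ A lA).
have [h1 h2] := @sdiff_diff _ _ _ f x A' sf.
by split=> // v; exact: (congr1 (@^~ v) h2).
Qed.

Lemma cdiffV k (f : hvec R -> C) q : cdiff_order k f q -> f q != 0 ->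
  cdiff_order k (fun w => (f w)^-1) q.
Proof.
elim: k f => [//|k IH] f fk1 f0; have [fd fk] := fk1.
have nz : \forall w \near q, f w != 0.
  have fq : differentiable f q by exact: nbhs_singleton fd.
  have [K [e [K0 e0 he]]] := diff_lip fq.
  apply/nbhsP; exists (Num.min e (nr (f q) / K)); first by rewrite lt_min e0 divr_gt0 // nr_gt0.
  move=> w; rewrite lt_min => /andP[/he hw wK]; apply/eqP => fw0.
  move: hw; rewrite fw0 sub0r nrN leNgt => /negP; apply.
  by rewrite mulrC -ltr_pdivlMr.
split.
  near=> w; apply: differentiableV; first by near: w.
  by near: w; exact: nz.
move=> v; have iv := IH f (cdiffW fk1) f0.
have h := cdiffM (cdiff_cst k (-1) q) (cdiffM (cdiffM iv iv) (fk v)).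
apply: cdiff_near_eq h; near=> w.
have dfw : differentiable f w by near: w; exact: fd.
have fw : f w != 0 by near: w; exact: nz.
apply: esym; apply: etrans (congr1 (@^~ v) (diffV dfw fw)) _.
change (- (f w) ^- 2 * 'd f w v = -1 * ((f w)^-1 * (f w)^-1 * 'd f w v)).
by rewrite mulN1r mulNr expr2 invfM.
Unshelve. all: by end_near. Qed.

Lemma holo_V (f : hvec R -> C) q : holomorphic_at q f -> f q != 0 ->
  holomorphic_at q (fun w => (f w)^-1).
Proof. by move=> h f0 k; exact: cdiffV. Qed.

Lemma cdiff_sum k (I : finType) (f : I -> hvec R -> C) q :
  (forall i, cdiff_order k (f i) q) -> cdiff_order k (fun w => \sum_i f i w) q.
Proof.
move=> h; elim: (index_enum I) => [|i s IH].
  have -> : (fun w => \sum_(i <- [::]) f i w) = fun=> 0 by apply/funext => w; rewrite big_nil.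
  exact: cdiff_cst.
have -> : (fun w => \sum_(i <- i :: s) f i w) = fun w => f i w + \sum_(i <- s) f i w.
  by apply/funext => w; rewrite big_cons.
exact: cdiffD.
Qed.

Definition polymap (P : 'I_4 -> form) (x : hvec R) : hvec R := \row_j meval (x 0) (P j).

Definition jacobian_poly (P : 'I_4 -> form) : 'M[form]_4 := \matrix_(i, j) mderiv i (P j).

Definition jac (P : 'I_4 -> form) (x : hvec R) : 'M[C]_4 :=
  map_mx (meval (x 0)) (jacobian_poly P).

Lemma sdiff_polymap P x : sdiff (polymap P) x (fun v => v *m jac P x).
Proof.
apply: sdiff_eq (sdiff_row (fun j => sdiff_meval (P j) x)) => v.
by apply/rowP => j; rewrite !mxE; apply: eq_bigr => i _; rewrite !mxE.
Qed.

Lemma det_jac P x : \det (jac P x) = meval (x 0) (\det (jacobian_poly P)).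
Proof. by rewrite /jac det_map_mx. Qed.

Lemma inverse_polymap P p : jac P p \in unitmx ->
  exists psi K r rho, local_inverse (polymap P) psi p K r rho.
Proof.
move=> u; apply: inverse_function (sdiff_polymap P p) (blin_mulmx (invmx (jac P p))) _ _.
  by move=> v; rewrite mulmxK.
by move=> v; rewrite mulmxKV.
Qed.

(** The representative of the projective point [xi] in the affine chart [l = 1]. Composing with it
    turns functions on the vector space into functions on projective space. *)
Definition normalize (l : 'cV[C]_4) (xi : hvec R) : hvec R := ((xi *m l) 0 0)^-1 *: xi.

Lemma linear_form_holo (l : 'cV[C]_4) q : holomorphic_at q (fun xi : hvec R => (xi *m l) 0 0).
Proof.
pose f : hvec R -> C := fun xi => (xi *m l) 0 0.
have lf : linear f by move=> a u v; rewrite /f mulmxDl -scalemxAl !mxE.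
pose F := HB.pack_for {linear hvec R -> C} f (GRing.isLinear.Build _ _ _ _ f lf).
by move=> k; exact: (@cdiff_linear _ k F q).
Qed.

Section Composition.
Variables (P : 'I_4 -> form) (p : hvec R) (l : 'cV[C]_4) (psi : hvec R -> hvec R) (K r rho : R).
Hypotheses (uJ : jac P p \in unitmx) (inv : local_inverse (polymap P) psi p K r rho)
  (lq : (polymap P p *m l) 0 0 = 1).
Let q := polymap P p.
Let L (xi : hvec R) : C := ((xi *m l) 0 0)^-1.
Let D := \det (jacobian_poly P).
Let adjP := \adj (jacobian_poly P).
Let Psi xi := psi (normalize l xi).

Let Lholo : holomorphic_at q L.
Proof. by apply: holo_V; [exact: linear_form_holo | rewrite /q lq oner_eq0]. Qed.

Let normq : normalize l q = q.
Proof. by rewrite /normalize /q lq invr1 scale1r. Qed.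

Let normalize_sdiff : exists2 d : R, 0 < d & forall xi, nr (xi - q) < d ->
  sdiff (normalize l) xi (fun v => \row_j (L xi * v 0 j + 'd L xi v * xi 0 j)).
Proof.
have [d d0 hd] := holo_sdiff Lholo; exists d => // xi /hd sL.
have -> : normalize l = fun xi => \row_j (L xi * xi 0 j).
  by apply/funext => y; apply/rowP => j; rewrite [LHS]mxE [RHS]mxE.
by apply: sdiff_row => j; apply: sdiffM => //; apply: sdiff_blin; exact: blin_coord.
Qed.

Let Psi_sdiff : exists2 d : R, 0 < d & forall xi, nr (xi - q) < d ->
  [/\ nr (normalize l xi - q) < rho, meval (Psi xi 0) D != 0 &
  sdiff Psi xi (fun v => (\row_j (L xi * v 0 j + 'd L xi v * xi 0 j)) *m invmx (jac P (Psi xi)))].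
Proof.
have [d1 d10 h1] := normalize_sdiff.
have Dp : meval (p 0) D != 0 by rewrite -det_jac -unitfE -unitmxE.
have [d2 d20 h2] := meval_neq0_near Dp.
have [K0 r0 rho0 _ _] := inv.
have [d3 d30 h3] : exists2 d : R, 0 < d & forall xi, nr (xi - q) < d ->
    nr (normalize l xi - q) < Num.min rho (d2 / K).
  have := @sdiff_near _ _ _ (normalize l) q _ (Num.min rho (d2 / K)) (h1 q _).
  rewrite normq; apply; first by rewrite subrr nr0.
  by rewrite lt_min rho0 divr_gt0.
exists (Num.min d1 d3) => [|xi]; first by rewrite lt_min d10.
rewrite lt_min => /andP[x1 /h3]; rewrite lt_min => /andP[xr xK].
have DPsi : meval (Psi xi 0) D != 0.
  apply: h2; have := local_inverse_lip inv xr (_ : nr (q - q) < rho).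
  rewrite subrr nr0 (local_inverse_at inv) => /(_ rho0) /le_lt_trans; apply.
  by rewrite mulrC -ltr_pdivlMr.
split=> //.
have uPsi : jac P (Psi xi) \in unitmx by rewrite unitmxE unitfE det_jac.
have s2 := local_inverse_sdiff inv xr (sdiff_polymap P (Psi xi))
  (blin_mulmx (invmx (jac P (Psi xi)))) (fun v => mulmxK uPsi v).
exact: sdiff_comp (h1 _ x1) s2.
Qed.

Let dPsi (G : form) (xi v : hvec R) := dmeval G (Psi xi)
  ((\row_j (L xi * v 0 j + 'd L xi v * xi 0 j)) *m invmx (jac P (Psi xi))).

Let Psi_diff : exists2 d : R, 0 < d & forall xi, nr (xi - q) < d ->
  meval (Psi xi 0) D != 0 /\ forall G,
  differentiable (fun xi => meval (Psi xi 0) G) xi /\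
    forall v, 'd (fun xi => meval (Psi xi 0) G) xi v = dPsi G xi v.
Proof.
have [d d0 hd] := Psi_sdiff; exists d => // xi /hd[_ DPsi s]; split=> // G.
apply: sdiff_diffE; last exact: sdiff_comp s (sdiff_meval G _).
move=> a u v; rewrite /dPsi -dmeval_linear scalemxAl -mulmxDl; congr (dmeval _ _ (_ *m _)).
apply/rowP => j; rewrite !mxE linearP /=.
by change (a *: 'd L xi u) with (a * 'd L xi u); ring.
Qed.

(** Induction on the order of differentiability, for all polynomials [G] at once: the derivative of
    [G] composed with [Psi] is expressed by further polynomials composed with [Psi]. *)
Lemma holo_comp_inverse_aux (G : form) :
  holomorphic_at q (fun xi => meval (psi (normalize l xi) 0) G).
Proof.
move=> k; elim: k G => [//|k IH] G.
have [d d0 hd] := Psi_diff.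
have der xi : nr (xi - q) < d -> differentiable (fun xi => meval (Psi xi 0) G) xi /\
    forall v, 'd (fun xi => meval (Psi xi 0) G) xi v = dPsi G xi v.
  by move=> /hd[_ /(_ G)].
split; first by apply/nbhsP; exists d => // xi /der[].
move=> v.
have Dp : meval (Psi q 0) D != 0 by have [|-> //] := hd q _; rewrite subrr nr0.
(* The chain rule, with the inverse of the Jacobian matrix written as adjugate over determinant, so
   that each factor depending on [Psi] falls under the induction hypothesis. *)
have hk : cdiff_order k (fun xi => \sum_i \sum_j
    (L xi * v 0 j + 'd L xi v * xi 0 j) * (meval (Psi xi 0) D)^-1 * meval (Psi xi 0) (adjP j i)
    * meval (Psi xi 0) (mderiv i G)) q.
  apply: cdiff_sum => i; apply: cdiff_sum => j.
  apply: cdiffM; last exact: IH.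
  apply: cdiffM; last exact: IH.
  apply: cdiffM; last by apply: cdiffV => //; exact: IH.
  apply: cdiffD; apply: cdiffM.
  - exact: Lholo.
  - exact: cdiff_cst.
  - exact: (holo_d v Lholo).
  have -> : (fun w : hvec R => w 0 j) = ev (mpolyX C (mnm1 j)).
    by apply/funext => w; rewrite mevalXU.
  exact: holo_meval.
apply: cdiff_near_eq hk; apply/nbhsP; exists d => // xi xid.
have [_ e] := der xi xid; have [DPsi _] := hd xi xid.
apply: esym; apply: etrans (e v) _; apply: esym.
rewrite /dPsi /dmeval; apply: eq_bigr => i _; rewrite -mulr_suml; congr (_ * _).
have uPsi : jac P (Psi xi) \in unitmx by rewrite unitmxE unitfE det_jac.
rewrite mxE; apply: eq_bigr => j _; rewrite !mxE -mulrA; congr (_ * _).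
rewrite /invmx uPsi mxE det_jac; congr (_ * _).
by rewrite /jac -map_mx_adj [RHS]mxE [in RHS]mxE.
Qed.

(* Outside the domain of the local inverse the value is 0, so that the function is invariant under scaling. *)
Definition pulled_back (G : form) (xi : hvec R) : C :=
  if nr (normalize l xi - q) < rho then meval (psi (normalize l xi) 0) G else 0.

Lemma pulled_back_holo (G : form) : proj_holomorphic_at q (pulled_back G).
Proof.
split=> [c w c0|].
  suff e : normalize l (c *: w) = normalize l w by rewrite /pulled_back e.
  rewrite /normalize -scalemxAl mxE invfM scalerA mulrAC mulVf // mul1r.
  by [].
apply: holo_near_eq (holo_comp_inverse_aux G).
have [d d0 hd] := Psi_sdiff; apply/nbhsP; exists d => // xi /hd[h _ _].
by rewrite /pulled_back h.
Qed.

Let Ldiff v : 'd L q v = - (v *m l) 0 0.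
Proof.
pose f : hvec R -> C := fun xi => (xi *m l) 0 0.
have lf : linear f by move=> a u w; rewrite /f mulmxDl -scalemxAl !mxE.
have bf : blin f.
  split; first by move=> u w; rewrite /f mulmxBl !mxE.
  have [_ [k k0 hk]] := blin_mulmx l; exists k => // w.
  exact: le_trans (nr_coord _ _ _) (hk w).
have [df ef] := sdiff_diffE lf (sdiff_blin q bf).
have fq : f q = 1 by [].
apply: etrans (congr1 (@^~ v) (diffV df _)) _; first by rewrite fq oner_eq0.
change (- (f q) ^- 2 * 'd f q v = - f v).
by rewrite ef fq expr1n invr1 mulN1r.
Qed.

(** Since [l] takes the value 1 at [q], the derivative of [normalize l] at [q] is the projection
    along [q] onto the kernel of [l]; the rest is the chain rule. *)
Lemma pulled_back_diff (G : form) v :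
  'd (pulled_back G) q v = dmeval G p ((v - (v *m l) 0 0 *: q) *m invmx (jac P p)).
Proof.
have [d d0 hd] := Psi_diff; have [d' d'0 hd'] := Psi_sdiff.
have [_ /(_ G)[df e]] : _ := hd q ltac:(by rewrite subrr nr0).
have near : \forall xi \near q, meval (Psi xi 0) G = pulled_back G xi.
  by apply/nbhsP; exists d' => // xi /hd'[h _ _]; rewrite /pulled_back h.
have [_ e2] := near_eq_diff near df.
apply: etrans (congr1 (@^~ v) e2) _; apply: etrans (e v) _.
have Psiq : Psi q = p by rewrite /Psi normq; exact: local_inverse_at inv.
rewrite /dPsi Psiq; congr (dmeval _ _ (_ *m _)); apply/rowP => j.
rewrite [LHS]mxE; apply: etrans (congr1 (fun z => L q * v 0 j + z * q 0 j) (Ldiff v)) _.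
have -> : L q = 1 by rewrite /L lq invr1.
by rewrite mul1r mulNr [RHS]mxE; congr (_ + _); rewrite !mxE.
Qed.

End Composition.

End HolomorphicInverse.

(** * Restriction of forms to lines, and orders of vanishing *)

Section Lines.
Context {R : realType}.
Local Notation C := (Cplx R).
Local Notation form := (form4 R).

(** As a polynomial in the parameter of the line, so that orders of contact can be read on
    coefficients. *)
Definition line_poly (x v : hvec R) (P : form) : {poly C} :=
  mmap (polyC : C -> {poly C}) (fun i => (x 0 i)%:P + v 0 i *: 'X) P.

Lemma line_polyC x v c : line_poly x v (mpolyC 4 c) = c%:P.
Proof. by rewrite /line_poly mmapC. Qed.

Lemma line_polyX x v i : line_poly x v (mpolyX C (mnm1 i)) = (x 0 i)%:P + v 0 i *: 'X.
Proof. by rewrite /line_poly mmapX mmap1U. Qed.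

Lemma line_polyD x v P Q : line_poly x v (P + Q) = line_poly x v P + line_poly x v Q.
Proof. exact: mmapD. Qed.

Lemma line_polyM x v P Q : line_poly x v (P * Q) = line_poly x v P * line_poly x v Q.
Proof. exact: rmorphM. Qed.

Lemma horner_line x v P t : (line_poly x v P).[t] = meval ((x + t *: v) 0) P.
Proof.
elim/mpoly_alg_ind: P => [c|i|p q hp hq|p q hp hq].
- by rewrite line_polyC hornerC mevalC.
- by rewrite line_polyX !hornerE mevalXU !mxE mulrC.
- by rewrite line_polyD hornerD mevalD hp hq.
by rewrite line_polyM hornerM mevalM hp hq.
Qed.

Lemma deriv_line x v P : (line_poly x v P)^`() = \sum_i v 0 i *: line_poly x v (mderiv i P).
Proof.
elim/mpoly_alg_ind: P => [c|i|p q hp hq|p q hp hq].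
- rewrite line_polyC derivC big1 // => i _.
  by rewrite mderivC -mpolyC0 line_polyC scaler0.
- rewrite line_polyX derivD derivC add0r derivZ derivX (bigD1 i) //= big1 => [|j ji]; rewrite mderivX mnm1E.
    have -> : mnm_sub (mnm1 i) (mnm1 i) = mnm0 by apply/mnmP => k; rewrite mnmBE mnm0E subnn.
    by rewrite eqxx addr0 mpolyX0 scale1r -mpolyC1 line_polyC.
  by rewrite eq_sym (negbTE ji) scale0r -mpolyC0 line_polyC scaler0.
- rewrite line_polyD derivD hp hq -big_split; apply: eq_bigr => i _.
  by rewrite mderivD line_polyD scalerDr.
rewrite line_polyM derivM hp hq mulr_suml mulr_sumr -big_split; apply: eq_bigr => i _.
by rewrite mderivM line_polyD !line_polyM scalerDr -scalerAl -scalerAr.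
Qed.

Lemma line_coef0 x v P : (line_poly x v P)`_0 = meval (x 0) P.
Proof. by rewrite -horner_coef0 horner_line scale0r addr0. Qed.

Lemma line_coef1 x v P : (line_poly x v P)`_1 = dmeval P x v.
Proof.
have := coef_deriv (line_poly x v P) 0; rewrite mulr1n => <-.
rewrite deriv_line coef_sum; apply: eq_bigr => i _.
by rewrite coefZ line_coef0.
Qed.

Lemma line_coefS x v P k :
  (line_poly x v P)`_k.+1 *+ k.+1 = \sum_i v 0 i * (line_poly x v (mderiv i P))`_k.
Proof. by rewrite -coef_deriv deriv_line coef_sum; apply: eq_bigr => i _; rewrite coefZ. Qed.

Lemma size_line P : exists N, forall x v, (size (line_poly x v P) <= N)%N.
Proof.
elim/mpoly_alg_ind: P => [c|i|p q [N hp] [M hq]|p q [N hp] [M hq]].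
- by exists 1%N => x v; rewrite line_polyC size_polyC leq_b1.
- exists 2%N => x v; rewrite line_polyX (leq_trans (size_polyD _ _)) // geq_max.
  rewrite (leq_trans (size_polyC_leq1 _)) // (leq_trans (size_scale_leq _ _)) //.
  by rewrite size_polyX.
- exists (maxn N M) => x v; rewrite line_polyD (leq_trans (size_polyD _ _)) //.
  by rewrite geq_max !leq_max hp hq orbT.
exists (N + M)%N => x v; rewrite line_polyM (leq_trans (size_polyMleq _ _)) //.
by rewrite (leq_trans (leq_pred _)) // leq_add.
Qed.

Lemma le0_small (c K e : R) : 0 < e ->
  (forall t : C, t != 0 -> nr t < e -> c <= K * nr t) -> c <= 0.
Proof.
move=> e0 h; apply/ler_addgt0Pl => eps eps0; rewrite addr0.
pose r := Num.min (e / 2) (eps / (`|K| + 1)).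
have K0 : 0 < `|K| + 1 by rewrite ltr_wpDl.
have r0 : 0 < r by rewrite lt_min !divr_gt0.
have re : r < e.
  by apply: (@le_lt_trans _ _ (e / 2)); rewrite ?ge_min ?lexx // ltr_pdivrMr // mulr_natr mulr2n ltrDl.
have rr : nr (real_complex R r : C) = r by rewrite nr_real gtr0_norm.
have := h (real_complex R r); rewrite rr => /(_ _ re).
have t0 : (real_complex R r : C) != 0.
  by apply/eqP => t0; move: rr r0; rewrite t0 nr0 => <-; rewrite ltxx.
move=> /(_ t0) /le_trans; apply; apply: (@le_trans _ _ ((`|K| + 1) * r)).
  by rewrite ler_wpM2r ?(ltW r0) // (le_trans (ler_norm K)) // lerDl.
by rewrite mulrC -ler_pdivlMr // ge_min lexx orbT.
Qed.

Lemma poly_vanishing_bound (Q : {poly C}) k : (forall j, (j < k)%N -> Q`_j = 0) ->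
  exists2 K : R, 0 < K & forall t : C, nr t < 1 -> nr Q.[t] <= K * nr t ^+ k.
Proof.
move=> h; pose Q' := \poly_(i < size Q) Q`_(i + k).
have QE : Q = Q' * 'X^k.
  apply/polyP => i; rewrite coefMXn; case: ltnP => ik; first exact: h.
  rewrite coef_poly subnK //; case: ltnP => // hi.
  by rewrite nth_default // (leq_trans hi) // leq_subr.
exists (\sum_(i < size Q') nr Q'`_i + 1).
  by rewrite ltr_wpDl // sumr_ge0 // => i _; rewrite nr_ge0.
move=> t t1; rewrite QE hornerM hornerXn nrM nrX ler_wpM2r ?exprn_ge0 ?nr_ge0 //.
rewrite horner_coef (le_trans (nr_sum _ _ _)) // ler_wpDr //; apply: ler_sum => i _.
by rewrite nrM nrX ler_piMr ?nr_ge0 // exprn_ile1 ?nr_ge0 // ltW.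
Qed.

Lemma poly_bound_vanishing (Q : {poly C}) k (K e : R) : 0 < e ->
  (forall t : C, t != 0 -> nr t < e -> nr Q.[t] <= K * nr t ^+ k) ->
  forall j, (j < k)%N -> Q`_j = 0.
Proof.
move=> e0; elim: k Q => [//|k IH] Q hQ.
have Q0 : Q`_0 = 0.
  have [K1 K10 h1] := @poly_vanishing_bound (Q - (Q`_0)%:P) 1 ltac:(by case=> // _; rewrite coefB coefC subrr).
  apply: nr_eq0; apply/eqP; rewrite eq_le nr_ge0 andbT.
  apply: (@le0_small _ (`|K| + K1) (Num.min e 1)); first by rewrite lt_min e0 ltr01.
  move=> t t0; rewrite lt_min => /andP[te t1].
  have := nrB Q.[t] (Q - (Q`_0)%:P).[t]; rewrite !hornerE opprB addrC subrK.
  move=> /le_trans; apply; rewrite mulrDl lerD //.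
    rewrite (le_trans (hQ t t0 te)) // exprS mulrCA mulrC ler_wpM2r ?nr_ge0 //.
    apply: (@le_trans _ _ (`|K| * nr t ^+ k)); first by rewrite ler_wpM2r ?exprn_ge0 ?nr_ge0 ?ler_norm.
    by rewrite ler_piMr // exprn_ile1 ?nr_ge0 // ltW.
  by have := h1 t t1; rewrite expr1 !hornerE.
pose Q' := Poly (behead Q).
have QE : Q = Q' * 'X.
  by apply/polyP => i; rewrite coefMX; case: i => [//|i] /=; rewrite coef_Poly nth_behead.
case=> [//|j]; rewrite ltnS => jk; rewrite QE coefMX /=; apply: (IH Q') => // t t0 te.
have := hQ t t0 te; rewrite QE hornerMX nrM exprSr mulrA.
by rewrite ler_pM2r // nr_gt0.
Qed.

Lemma line_bigO x v P k :
  (forall j, (j < k)%N -> (line_poly x v P)`_j = 0) ->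
  exists2 K : R, 0 < K & forall t : C, nr t < 1 -> nr (meval ((x + t *: v) 0) P) <= K * nr t ^+ k.
Proof.
by move=> /poly_vanishing_bound[K K0 h]; exists K => // t /h; rewrite horner_line.
Qed.

End Lines.

(** * Producing points of the surface near approximate ones *)

Section SmallRoots.
Context {R : realType}.
Local Notation C := (Cplx R).

Lemma deriv_prod0 (s : seq C) : all (fun z => z != 0) s ->
  (\prod_(z <- s) ('X - z%:P))^`().[0] = - (\prod_(z <- s) ('X - z%:P)).[0] * \sum_(z <- s) z^-1.
Proof.
elim: s => [|z s IH] /=; first by rewrite !big_nil derivC hornerC mulr0.
move=> /andP[z0 /IH h]; rewrite !big_cons derivM derivB derivX derivC subr0 mul1r.
rewrite hornerD !hornerM h hornerXsubC; field.
by [].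
Qed.

(** If no root vanishes, [- Q'(0) / Q(0)] is the sum of the inverses of the roots; so the roots
    cannot all be larger than [deg Q * |Q(0)| / |Q'(0)|]. This replaces an implicit function theorem
    for the equation of the surface. *)
Lemma small_root (Q : {poly C}) : Q^`().[0] != 0 -> exists2 a, root Q a &
  nr a <= (size Q)%:R * nr Q.[0] / nr Q^`().[0].
Proof.
have [s QE] := closed_field_poly_normal Q => dQ0.
have lc0 : lead_coef Q != 0.
  by apply: contraNneq dQ0 => h; rewrite QE h scale0r derivC horner0.
have szQ : size Q = (size s).+1 by rewrite QE size_scale // size_prod_XsubC.
have [s0|/allPn[z zs /negPn/eqP z0]] := boolP (all (fun z => z != 0) s); last first.
  exists 0; last by rewrite nr0 divr_ge0 ?mulr_ge0 ?nr_ge0.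
  by rewrite QE rootZ // root_prod_XsubC -z0.
have dE : Q^`().[0] = - Q.[0] * \sum_(z <- s) z^-1.
  by rewrite QE derivZ !hornerZ deriv_prod0 // mulrA mulrN mulNr.
pose B := (size Q)%:R * nr Q.[0] / nr Q^`().[0].
have [/hasP[z zs zB]|/hasPn hB] := boolP (has (fun z => nr z <= B) s).
  by exists z => //; rewrite QE rootZ // root_prod_XsubC.
exfalso.
have d0 := nr_gt0 dQ0.
have Q00 : 0 < nr Q.[0] by apply: nr_gt0; apply: contraNneq dQ0 => h; rewrite dE h oppr0 mul0r.
have B0 : 0 < B by rewrite divr_gt0 // mulr_gt0 // szQ ltr0Sn.
(* All roots being larger than [B], the sum of inverses is at most [size s / B]. As [B] was built
   with [size Q = (size s).+1], the resulting inequality is strict and absurd. *)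
have : nr Q^`().[0] <= nr Q.[0] * ((size s)%:R / B).
  rewrite dE nrM nrN ler_wpM2l ?nr_ge0 // (le_trans (nr_sum _ _ _)) //.
  have -> : (size s)%:R / B = \sum_(z <- s) B^-1.
    by rewrite big_const_seq count_predT iter_addr_0 mulr_natl.
  rewrite big_seq [leRHS]big_seq; apply: ler_sum => z zs.
  rewrite nrV lef_pV2 ?posrE //; last by rewrite nr_gt0 // (allP s0).
  by rewrite ltW // ltNge hB.
rewrite /B szQ invfM invfM invrK.
have : (size s)%:R < (size s).+1%:R :> R by rewrite ltr_nat.
have : 0 < (size s).+1%:R :> R by rewrite ltr0Sn.
move: ((size s).+1%:R : R) ((size s)%:R : R) => n1 n0 n1_gt0 n01.
have -> : nr Q.[0] * (n0 * (n1^-1 / nr Q.[0] * nr Q^`().[0])) =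
  n0 / n1 * nr Q^`().[0].
  by field; rewrite !gt_eqF.
rewrite leNgt => /negP; apply; rewrite -[ltRHS]mul1r ltr_pM2r //.
by rewrite ltr_pdivrMr // mul1r.
Qed.

End SmallRoots.

Section Surface.
Context {R : realType}.
Local Notation C := (Cplx R).
Local Notation form := (form4 R).
Local Notation ev P := (fun x : hvec R => meval (x 0) P).

Lemma nr_tri (V : normedModType C) (z x w : V) : nr (z - x) <= nr (z - (x + w)) + nr w.
Proof. by have := nrD (z - (x + w)) w; rewrite opprD addrA subrK. Qed.

Definition scalable_map (V W : normedModType C) (A : V -> W) := forall (a : C) u, A (a *: u) = a *: A u.

Lemma curve_deriv (V W : normedModType C) (G : V -> W) (x : V) (A : V -> W) (u : V) :
  sdiff G x A -> scalable_map A ->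
  (exists K e : R, 0 < e /\ forall t : C, t != 0 -> nr t < e ->
     exists2 z, nr (z - (x + t *: u)) <= K * nr t ^+ 2 & nr (G z - G x) <= K * nr t ^+ 2) ->
  A u = 0.
Proof.
move=> [[AB [KA KA0 hA]] hG] sA [K' [e [e0 hz]]].
pose K := `|K'| + 1; have K0 : 0 < K by rewrite ltr_wpDl.
have {}hz (t : C) : t != 0 -> nr t < e ->
   exists2 z, nr (z - (x + t *: u)) <= K * nr t ^+ 2 & nr (G z - G x) <= K * nr t ^+ 2.
  move=> t0 te; have KK : K' <= K by rewrite (le_trans (ler_norm _)) // lerDl.
  have [z h1 h2] := hz t t0 te; exists z; rewrite ?(le_trans h1) ?(le_trans h2) //;
  by rewrite ler_wpM2r ?exprn_ge0 ?nr_ge0.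
apply: nr_eq0; apply/eqP; rewrite eq_le nr_ge0 andbT.
suff h eps : 0 < eps -> nr (A u) <= eps * (nr u + K).
  apply/ler_addgt0Pl => eps eps0; rewrite addr0.
  have uK : 0 < nr u + K by rewrite ltr_wpDl ?nr_ge0.
  by have := h _ (divr_gt0 eps0 uK); rewrite divfK // gt_eqF.
move=> eps0; rewrite -subr_le0.
have [d d0 hd] := hG _ eps0.
have uK : 0 < nr u + K + 1 by rewrite ltr_wpDl // addr_ge0 ?nr_ge0 // ltW.
apply: (@le0_small _ _ (K + KA * K) (Num.min (Num.min e 1) (d / (nr u + K + 1)))).
  by rewrite !lt_min e0 ltr01 divr_gt0.
move=> t t0; rewrite !lt_min => /andP[/andP[te t1] td].
have [z h1 h2] := hz t t0 te.
have tp := nr_gt0 t0.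
have ht2 : K * nr t ^+ 2 <= K * nr t.
  by rewrite ler_wpM2l ?(ltW K0) // expr2 ler_piMl ?nr_ge0 // ltW.
have zx : nr (z - x) <= (nr u + K) * nr t.
  apply: le_trans (nr_tri z x (t *: u)) _; rewrite nrZ; move: h1 ht2; lra.
have zd : nr (z - x) < d.
  apply: le_lt_trans zx _; move: td; rewrite ltr_pdivlMr // mulrC; apply: le_lt_trans.
  by rewrite ler_wpM2r ?nr_ge0 // lerDl.
have h3 : nr (A (z - x)) <= K * nr t ^+ 2 + eps * nr (z - x).
  have := nrB (G z - G x) (G z - G x - A (z - x)); rewrite opprB addrC subrK.
  move=> /le_trans; apply; apply: lerD => //; apply: hd => //; by rewrite subrr nr0.
have h4 : nr t * nr (A u) <= K * nr t ^+ 2 + eps * ((nr u + K) * nr t) + KA * (K * nr t ^+ 2).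
  rewrite -nrZ -sA.
  have -> : A (t *: u) = A (z - x) - A (z - (x + t *: u)).
    by rewrite -AB; congr (A _); rewrite opprB addrC addrA subrK addrC addKr.
  rewrite (le_trans (nrB _ _)) //; apply: lerD.
    by rewrite (le_trans h3) // lerD2l ler_wpM2l // ltW.
  by rewrite (le_trans (hA _)) // ler_wpM2l // ltW.
by rewrite -(ler_pM2l tp); move: h4; lra.
Qed.

Lemma dmevalE (P : form) (x v : hvec R) : meval (x 0) (\sum_i v 0 i *: mderiv i P) = dmeval P x v.
Proof. by rewrite raddf_sum; apply: eq_bigr => i _; exact: mevalZ. Qed.

Lemma dmeval_gauss (F : form) (x v : hvec R) : dmeval F x v = (v *m (gauss F x)^T) 0 0.
Proof. by rewrite mxE; apply: eq_bigr => i _; rewrite !mxE. Qed.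

(** [small_root] is applied to [F] on the line through [y] in the direction [n], where the
    derivative of [F] is bounded below uniformly for [y] near [x]. *)
Lemma near_root (F : form) (x n : hvec R) : dmeval F x n != 0 ->
  exists K e : R, [/\ 0 < K, 0 < e & forall y, nr (y - x) < e ->
    exists2 s, meval ((y + s *: n) 0) F = 0 & nr s <= K * nr (meval (y 0) F)].
Proof.
move=> dn; have [N hN] := size_line F.
have c0 := nr_gt0 dn; set c := nr _ in c0.
have c20 : 0 < c / 2 by rewrite divr_gt0.
have [e e0 he] := meval_near (\sum_i n 0 i *: mderiv i F) x c20.
exists (N.+1%:R * 2 / c), e; split=> // [|y ye]; first by rewrite !mulr_gt0 ?invr_gt0 // ltr0Sn.
have := he y ye; rewrite !dmevalE => hy.
have cy : c / 2 < nr (dmeval F y n).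
  have := nrB (dmeval F y n) (dmeval F y n - dmeval F x n).
  rewrite opprB addrC subrK -/c => h; move: hy h; lra.
have dy : dmeval F y n != 0.
  by apply/eqP => h; move: cy; rewrite h nr0; move: c0; lra.
have dQ : (line_poly y n F)^`().[0] = dmeval F y n.
  by rewrite horner_coef0 coef_deriv mulr1n line_coef1.
have := @small_root _ (line_poly y n F); rewrite dQ => /(_ dy)[s /rootP rs hs].
exists s; first by rewrite -horner_line.
apply: le_trans hs _; rewrite horner_coef0 line_coef0.
rewrite mulrAC ler_wpM2r ?nr_ge0 // -mulrA ler_pM //.
- by rewrite invr_ge0 nr_ge0.
- by rewrite ler_nat (leq_trans (hN _ _)).
have -> : 2 / c = (c / 2)^-1 by rewrite invfM invrK mulrC.
by rewrite lef_pV2 ?posrE ?(ltW cy) //; move: c0 cy; lra.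
Qed.

Lemma surface_near (F : form) (x : hvec R) : on_surface F x -> gauss F x != 0 ->
  exists K e : R, [/\ 0 < K, 0 < e & forall y, nr (y - x) < e ->
    exists2 z, on_surface F z & nr (z - y) <= K * nr (meval (y 0) F)].
Proof.
move=> [x0 Fx] gx.
have [i gi] : exists i, gauss F x 0 i != 0.
  apply/existsP; apply: contraNT gx; rewrite negb_exists => /forallP h.
  by apply/eqP/rowP => i; have /negPn/eqP -> := h i; rewrite mxE.
have dn : dmeval F x (delta_mx 0 i) != 0.
  rewrite dmeval_gauss; apply: contra gi => /eqP h.
  apply/eqP; rewrite -[RHS]h [RHS]mxE (bigD1 i) //= big1 => [|j ji].
    by rewrite [delta_mx _ _ _ _]mxE !eqxx mul1r addr0 [in RHS]mxE.
  by rewrite mxE (negbTE ji) mul0r.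
have [K [e [K0 e0 h]]] := near_root dn.
have nx := nr_gt0 x0.
have x20 : 0 < nr x / 2 / K by rewrite !divr_gt0.
have [e' e'0 he'] := meval_near F x x20.
exists K, (Num.min (Num.min e e') (nr x / 2)); split=> //.
  by rewrite !lt_min e0 e'0 divr_gt0.
move=> y; rewrite !lt_min => /andP[/andP[ye ye'] yx].
have [s Fs hs] := h y ye; exists (y + s *: delta_mx 0 i); last first.
  rewrite addrC addKr nrZ; apply: le_trans hs; rewrite ler_piMr ?nr_ge0 //.
  apply: nr_coord_le => // a b; rewrite mxE; case: (_ && _); last by rewrite nr0.
  by rewrite /nr normr1.
(* A point of projective space needs a nonzero vector: the displacement and the distance from [y] to
   [x] are both less than [nr x / 2], so the corrected vector cannot be 0. *)
split=> //; apply/eqP => z0.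
have : nr s < nr x / 2.
  apply: le_lt_trans hs _; have := he' y ye'; rewrite Fx subr0 ltr_pdivlMr // mulrC.
  exact.
have hn : nr (s *: delta_mx 0 i : hvec R) <= nr s.
  rewrite nrZ ler_piMr ?nr_ge0 //.
  apply: nr_coord_le => // a b; rewrite mxE; case: (_ && _); last by rewrite nr0.
  by rewrite /nr normr1.
have := nrB (y - x) (y + s *: delta_mx 0 i - s *: delta_mx 0 i).
rewrite z0 sub0r opprK.
have -> : y - x + s *: delta_mx 0 i = - x by rewrite addrAC z0 sub0r.
rewrite !nrN; move: hn yx; lra.
Qed.

Lemma surface_curve (F : form) (x u : hvec R) k : on_surface F x -> gauss F x != 0 ->
  (forall j, (j < k)%N -> (line_poly x u F)`_j = 0) ->
  exists K e : R, [/\ 0 < K, 0 < e & forall t : C, nr t < e ->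
    exists2 z, on_surface F z & nr (z - (x + t *: u)) <= K * nr t ^+ k].
Proof.
move=> Sx gx /line_bigO[K K0 hK]; have [K' [e [K'0 e0 he]]] := surface_near Sx gx.
have u1 : 0 < nr u + 1 by rewrite ltr_wpDl ?nr_ge0.
exists (K' * K), (Num.min 1 (e / (nr u + 1))); split; first by rewrite mulr_gt0.
  by rewrite lt_min ltr01 divr_gt0.
move=> t; rewrite lt_min => /andP[t1]; rewrite ltr_pdivlMr // => te.
have [|z Sz hz] := he (x + t *: u).
  rewrite addrC addKr nrZ; apply: le_lt_trans te; rewrite ler_wpM2l ?nr_ge0 //.
  by rewrite lerDl.
exists z => //; apply: le_trans hz _; rewrite -mulrA ler_wpM2l ?(ltW K'0) //.
exact: hK.
Qed.

Lemma surface_tangent_curve (F : form) (x u : hvec R) : on_surface F x -> gauss F x != 0 ->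
  dmeval F x u = 0 ->
  exists K e : R, [/\ 0 < K, 0 < e & forall t : C, nr t < e ->
    exists2 z, on_surface F z & nr (z - (x + t *: u)) <= K * nr t ^+ 2].
Proof.
move=> Sx gx du; apply: surface_curve => // -[|[|//]] _.
  by rewrite line_coef0; case: Sx.
by rewrite line_coef1.
Qed.

(** The only form in which the manifold structure of S enters: functions vanishing on S near [x]
    have derivative zero along tangent vectors at [x]. *)
Lemma surface_tangent_deriv (W : normedModType C) (F : form) (x u : hvec R) (G : hvec R -> W) (A : hvec R -> W) (d : R) :
  on_surface F x -> gauss F x != 0 -> dmeval F x u = 0 ->
  sdiff G x A -> scalable_map A -> 0 < d ->
  (forall y, nr (y - x) < d -> on_surface F y -> G y = 0) -> A u = 0.
Proof.
move=> Sx gx du sG sA d0 hG; apply: curve_deriv sG sA _.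
have [K [e [K0 e0 h]]] := surface_tangent_curve Sx gx du.
have u1 : 0 < nr u + K by rewrite ltr_wpDl ?nr_ge0.
exists K, (Num.min (Num.min e 1) (d / (nr u + K))); split; first by rewrite !lt_min e0 ltr01 divr_gt0.
move=> t t0; rewrite !lt_min => /andP[/andP[te t1]]; rewrite ltr_pdivlMr // => td.
have [z Sz hz] := h t te; exists z => //.
have zx : nr (z - x) < d.
  apply: le_lt_trans (nr_tri z x (t *: u)) _; apply: le_lt_trans td; rewrite nrZ.
  have : K * nr t ^+ 2 <= K * nr t.
    by rewrite ler_wpM2l ?(ltW K0) // expr2 ler_piMl ?nr_ge0 // ltW.
  by move: hz; lra.
rewrite (hG z zx Sz) (hG x _ Sx) ?subrr ?nr0 //.
by rewrite mulr_ge0 ?exprn_ge0 ?nr_ge0 ?ltW.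
Qed.

End Surface.

(** * Euler relations, Gauss map and Hessian *)

Section Euler.
Context {R : realType}.
Local Notation C := (Cplx R).
Local Notation form := (form4 R).
Local Notation "''X_' i" := (mpolyX C (mnm1 i)).

(** Homogeneity is used through this identity, which passes directly to partial derivatives with [k]
    lowered by 1. *)
Definition euler (k : nat) (P : form) : Prop :=
  \sum_i 'X_i * mderiv i P = k%:R *: P.

Lemma euler_homog k P : P \is ishomog1 k mdeg -> euler k P.
Proof.
move=> /dhomogP hP; rewrite /euler {1 2}(mpolyE P).
under eq_bigr do rewrite raddf_sum mulr_sumr.
rewrite exchange_big scaler_sumr /= big_seq [RHS]big_seq; apply: eq_bigr => m /hP hm.
have -> : k%:R = \sum_(i < 4) ((m i)%:R : C) by rewrite -(hm : mdeg m = k) mdegE natr_sum.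
rewrite scaler_suml; apply: eq_bigr => i _.
rewrite mderivZ mderivX -!scalerAr scalerA [RHS]scalerA mulrC.
have [->|mi] := eqVneq (m i) 0%N; first by rewrite mul0r !scale0r.
rewrite -mpolyXD; congr (_ *: mpolyX _ _); apply/mnmP => j.
rewrite mnmDE mnmBE mnm1E; case: eqVneq => [<-|_] /=; last by rewrite add0n subn0.
by rewrite addnC subnK // lt0n.
Qed.

Lemma euler_deriv k P j : euler k.+1 P -> euler k (mderiv j P).
Proof.
rewrite /euler => /(congr1 (mderiv j)); rewrite raddf_sum mderivZ /=.
under eq_bigr do rewrite mderivM mderiv_comm.
rewrite big_split /= (bigD1 j) //= big1 => [|i ij]; last first.
  by rewrite mderivX mnm1E (negbTE ij) scale0r mul0r.
have -> : mderiv j 'X_j = 1.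
  have e : mnm_sub (mnm1 j) (mnm1 j) = mnm0 by apply/mnmP => k'; rewrite mnmBE mnm0E subnn.
  by rewrite mderivX mnm1E eqxx e scale1r mpolyX0.
by rewrite mul1r addr0 -[k.+1]add1n natrD scalerDl scale1r => /addrI.
Qed.

Lemma euler_dmeval k P (x : hvec R) : euler k P -> dmeval P x x = k%:R * meval (x 0) P.
Proof.
move=> /(congr1 (meval (x 0))); rewrite mevalZ raddf_sum => <-.
by apply: eq_bigr => i _; rewrite /= mevalM mevalXU.
Qed.

Lemma euler_scale k P (c : C) (x : hvec R) : euler k P -> meval ((c *: x) 0) P = c ^+ k * meval (x 0) P.
Proof.
move=> eP; pose Q := line_poly 0 x P.
have hQ t : Q.[t] = meval ((t *: x) 0) P by rewrite horner_line add0r.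
have dQ : 'X * Q^`() = k%:R *: Q.
  have dmh t : t * Q^`().[t] = k%:R * Q.[t].
    rewrite hQ -(euler_dmeval _ eP) deriv_line horner_sum mulr_sumr.
    by apply: eq_bigr => i _; rewrite hornerZ horner_line add0r mxE mulrA.
  apply/eqP; rewrite -subr_eq0; apply/eqP.
  have inj : injective (fun n : nat => n%:R : C).
    by move=> m n /eqP; rewrite eqr_nat => /eqP.
  (* The identity holds at all values of [t]; the natural numbers provide more distinct roots than
     the degree allows. *)
  apply: (@roots_geq_poly_eq0 _ _ (map (fun n : nat => n%:R) (iota 0 (size ('X * Q^`() - k%:R *: Q))))).
  - by apply/allP => t _; rewrite /root !hornerE dmh subrr.
  - by rewrite map_inj_uniq // iota_uniq.
  by rewrite size_map size_iota.
have Qj j : j != k -> Q`_j = 0.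
  move=> jk; have := congr1 (fun p : {poly C} => p`_j) dQ; rewrite mulrC coefMX coefZ.
  case: j jk => [|j] jk /=.
    by move=> /esym/eqP; rewrite mulf_eq0 pnatr_eq0 eq_sym (negbTE jk) => /eqP.
  rewrite coef_deriv => h.
  have /eqP : (j.+1%:R - k%:R) * Q`_j.+1 = 0 by rewrite mulrBl -h [X in X - _]mulr_natl subrr.
  by rewrite mulf_eq0 subr_eq0 eqr_nat (negbTE jk) => /eqP.
have QE : Q = Q`_k *: 'X^k.
  apply/polyP => j; rewrite coefZ coefXn; case: eqVneq => [->|jk]; first by rewrite mulr1.
  by rewrite mulr0 Qj.
rewrite -hQ -[x in RHS]scale1r -hQ QE !hornerZ !hornerXn expr1n mulr1 mulrC.
by [].
Qed.

End Euler.

Section Hessian.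
Context {R : realType}.
Local Notation C := (Cplx R).
Local Notation form := (form4 R).

Definition hess (F : form) (x : hvec R) : 'M[C]_4 := jac (fun j => mderiv j F) x.

Lemma hessE (F : form) (x : hvec R) i j : hess F x i j = meval (x 0) (mderiv i (mderiv j F)).
Proof. by rewrite !mxE. Qed.

Lemma hess_sym (F : form) (x : hvec R) : (hess F x)^T = hess F x.
Proof. by apply/matrixP => i j; rewrite mxE !hessE mderiv_comm. Qed.

Lemma gauss_polymap (F : form) : gauss F = polymap (fun j => mderiv j F).
Proof. by []. Qed.

Lemma parabolicE (F : form) (x : hvec R) : parabolic F x <-> \det (hess F x) = 0.
Proof. by rewrite /hess det_jac. Qed.

Lemma dmeval_hess (F : form) (x v : hvec R) j : dmeval (mderiv j F) x v = (v *m hess F x) 0 j.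
Proof. by rewrite mxE; apply: eq_bigr => i _; rewrite hessE. Qed.

Lemma sdiff_gauss (F : form) (x : hvec R) : sdiff (gauss F) x (fun v => v *m hess F x).
Proof. exact: sdiff_polymap. Qed.

Lemma hess_symm (F : form) x (u v : hvec R) : (u *m hess F x *m v^T) 0 0 = (v *m hess F x *m u^T) 0 0.
Proof. by rewrite -[in LHS]hess_sym -[in LHS](trmxK u) -!trmx_mul mulmxA [LHS]mxE. Qed.

Variables (F : form) (d : nat).
Hypotheses (d_gt1 : (1 < d)%N) (homF : F \is ishomog1 d mdeg).

Let eF : euler d F. Proof. exact: euler_homog. Qed.

Let eF1 j : euler d.-1 (mderiv j F).
Proof. by apply: euler_deriv; rewrite prednK // ltnW. Qed.

Let eF2 i j : euler d.-2 (mderiv i (mderiv j F)).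
Proof. by apply: euler_deriv; rewrite -[d.-2.+1]/(d.-2.+1) prednK //; case: d d_gt1 => [|[]]. Qed.

Lemma gauss_pairing (x : hvec R) : (x *m (gauss F x)^T) 0 0 = d%:R * meval (x 0) F.
Proof. by rewrite -dmeval_gauss (euler_dmeval _ eF). Qed.

Lemma hess_euler (x : hvec R) : x *m hess F x = d.-1%:R *: gauss F x.
Proof. by apply/rowP => j; rewrite -dmeval_hess (euler_dmeval _ (eF1 j)) !mxE. Qed.

Lemma meval_scale (c : C) (x : hvec R) : meval ((c *: x) 0) F = c ^+ d * meval (x 0) F.
Proof. exact: euler_scale. Qed.

Lemma gauss_scale (c : C) (x : hvec R) : gauss F (c *: x) = c ^+ d.-1 *: gauss F x.
Proof. by apply/rowP => j; rewrite !mxE (euler_scale _ _ (eF1 j)). Qed.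

Lemma hess_scale (c : C) (x : hvec R) : hess F (c *: x) = c ^+ d.-2 *: hess F x.
Proof. by apply/matrixP => i j; rewrite hessE mxE hessE (euler_scale _ _ (eF2 i j)). Qed.

Lemma on_surface_scale (c : C) (x : hvec R) : c != 0 -> on_surface F (c *: x) <-> on_surface F x.
Proof.
move=> c0; rewrite /on_surface scaler_eq0 negb_or c0 /= meval_scale.
split=> [[-> /eqP]|[-> ->]]; last by rewrite mulr0.
by rewrite mulf_eq0 expf_eq0 (negbTE c0) andbF => /eqP ->.
Qed.

Lemma parabolic_scale (c : C) (x : hvec R) : c != 0 -> parabolic F (c *: x) <-> parabolic F x.
Proof.
move=> c0; rewrite !parabolicE hess_scale detZ; split=> [/eqP|->]; last by rewrite mulr0.
by rewrite mulf_eq0 !expf_eq0 (negbTE c0) !andbF => /eqP.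
Qed.

Lemma natC_neq0 n : (0 < n)%N -> (n%:R : C) != 0.
Proof. by rewrite pnatr_eq0 lt0n. Qed.

Lemma pred_d_neq0 : (d.-1%:R : C) != 0.
Proof. by apply: natC_neq0; rewrite -ltnS prednK // ltnW. Qed.

Lemma gauss_zero_on_surface (x : hvec R) : x != 0 -> gauss F x = 0 -> on_surface F x.
Proof.
move=> x0 gx; split=> //; have := gauss_pairing x; rewrite gx trmx0 mulmx0 mxE => /esym/eqP.
by rewrite mulf_eq0 (negbTE (natC_neq0 (ltnW d_gt1))) => /eqP.
Qed.

End Hessian.

(** * Density of the non-parabolic points, with the linear algebra it requires *)

Section RankThree.
Context {K : fieldType}.

Lemma mxrank_row' m n (A : 'M[K]_(m.+1, n)) i : (row i A <= row' i A)%MS ->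
  \rank (row' i A) = \rank A.
Proof.
move=> h; apply/eqP; rewrite eqn_leq; apply/andP; split; apply: mxrankS.
  by rewrite row'Esub rowsub_sub.
apply/row_subP => k; case: (unliftP i k) => [k' ->|-> //].
by rewrite rowEsub; apply: submx_trans (row_sub k' _); rewrite row'Esub rowEsub -mxsub_comp.
Qed.

(** A nonzero cofactor is a nonzero minor of size [n.+1]. Conversely, when the matrix is not
    invertible, a dependent row and then a dependent column can be deleted without lowering the
    rank. *)
Lemma adj_neq0_rank n (A : 'M[K]_n.+2) : \adj A != 0 <-> (n.+1 <= \rank A)%N.
Proof.
split=> [adjA|rA].
  have [i [j cij]] : exists i j, cofactor A i j != 0.
    have : ~~ [forall i, forall j, cofactor A i j == 0].
      apply: contra adjA => /forallP h; apply/eqP/matrixP => i j; rewrite !mxE.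
      by apply/eqP; move/forallP: (h j) => /(_ i).
    by case/forallPn => i /forallPn[j hj]; exists i, j.
  have dij : \det (row' i (col' j A)) != 0.
    by apply: contra cij => /eqP h; rewrite /cofactor h mulr0.
  apply: (@leq_trans (\rank (row' i (col' j A)))).
    have : row_free (row' i (col' j A)) by rewrite row_free_unit unitmxE unitfE.
    by rewrite /row_free => /eqP e; apply: eq_leq; exact: esym e.
  apply: leq_trans (mxrankS (_ : row' i (col' j A) <= col' j A)%MS) _.
    by rewrite row'Esub rowsub_sub.
  rewrite -mxrank_tr tr_col' -[leqRHS]mxrank_tr; apply: mxrankS.
  by rewrite row'Esub rowsub_sub.
have [fA|nfA] := boolP (row_free A).
  apply/eqP => adj0; have := mul_mx_adj A; rewrite adj0 mulmx0 => /matrixP/(_ 0 0).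
  rewrite !mxE eqxx mulr1n => /esym/eqP; apply/negP.
  by rewrite -unitfE -unitmxE -row_free_unit.
have /row_freePn[i hi] := nfA.
have ri : \rank (row' i A) = n.+1.
  rewrite mxrank_row' //; apply/eqP; rewrite eqn_leq rA andbT -ltnS ltn_neqAle rank_leq_row andbT.
  exact: nfA.
have nf2 : ~~ row_free (row' i A)^T by rewrite /row_free mxrank_tr ri neq_ltn ltnSn.
have /row_freePn[j hj] := nf2.
have rj : \rank (row' j (row' i A)^T) = n.+1 by rewrite mxrank_row' // mxrank_tr.
apply/eqP => /matrixP /(_ j i); rewrite !mxE /cofactor => /eqP.
rewrite mulf_eq0 signr_eq0 /= => /eqP d0.
have : row_free (row' j (row' i A)^T) by rewrite /row_free rj.
have -> : row' j (row' i A)^T = (row' i (col' j A))^T.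
  by apply/matrixP => a b; rewrite !mxE.
by rewrite row_free_unit unitmxE unitfE det_tr d0 eqxx.
Qed.

End RankThree.

Section PolynomialFamilies.
Context {R : realType}.
Local Notation C := (Cplx R).
Local Notation form := (form4 R).

Definition psdiff (Q : hvec R -> {poly C}) (x : hvec R) (A : hvec R -> {poly C}) :=
  forall n, sdiff (fun y => (Q y)`_n) x (fun v => (A v)`_n).

Lemma psdiff_eq Q x A B : A =1 B -> psdiff Q x A -> psdiff Q x B.
Proof. by move=> /funext ->. Qed.

Lemma psdiffD Q1 Q2 x A B : psdiff Q1 x A -> psdiff Q2 x B ->
  psdiff (fun y => Q1 y + Q2 y) x (fun v => A v + B v).
Proof.
move=> h1 h2 n; have := sdiffD (h1 n) (h2 n).
have -> : (fun y => (Q1 y + Q2 y)`_n) = (fun y => (Q1 y)`_n + (Q2 y)`_n).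
  by apply/funext => y; rewrite coefD.
by apply: sdiff_eq => v; rewrite coefD.
Qed.

Lemma sdiff_sum (V : normedModType C) (I : Type) (r : seq I) (f A : I -> V -> C) x :
  (forall i, sdiff (f i) x (A i)) ->
  sdiff (fun y => \sum_(i <- r) f i y) x (fun v => \sum_(i <- r) A i v).
Proof.
move=> h; elim: r => [|i r IH].
  have -> : (fun y => \sum_(i <- [::]) f i y) = fun=> 0 by apply/funext => y; rewrite big_nil.
  by apply: sdiff_eq (sdiff_cst 0 x) => v; rewrite big_nil.
have -> : (fun y => \sum_(j <- i :: r) f j y) = fun y => f i y + \sum_(j <- r) f j y.
  by apply/funext => y; rewrite big_cons.
by apply: sdiff_eq (sdiffD (h i) IH) => v; rewrite big_cons.
Qed.

Lemma psdiffM Q1 Q2 x A B : psdiff Q1 x A -> psdiff Q2 x B ->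
  psdiff (fun y => Q1 y * Q2 y) x (fun v => Q1 x * B v + A v * Q2 x).
Proof.
move=> h1 h2 n.
have -> : (fun y => (Q1 y * Q2 y)`_n) = (fun y => \sum_(i < n.+1) (Q1 y)`_i * (Q2 y)`_(n - i)).
  by apply/funext => y; rewrite coefM.
apply: sdiff_eq (sdiff_sum _ (fun i : 'I_n.+1 => sdiffM (h1 i) (h2 (n - i)%N))) => v.
by rewrite coefD !coefM -big_split.
Qed.

Definition polymap_deriv (k : 'I_4 -> form) (x v : hvec R) : hvec R :=
  \row_j dmeval (k j) x v.

(** The line through [y] in the direction [polymap k y] moves with [y]; the derivative of the
    restriction of [P] has one contribution from the base point and one, with a factor ['X], from
    the direction. *)
Lemma psdiff_line (k : 'I_4 -> form) (P : form) x :
  psdiff (fun y => line_poly y (polymap k y) P) x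
    (fun v => \sum_j ((v 0 j)%:P + (polymap_deriv k x v) 0 j *: 'X) *
       line_poly x (polymap k x) (mderiv j P)).
Proof.
elim/mpoly_alg_ind: P => [c|i|p q hp hq|p q hp hq].
- move=> n; have -> : (fun y => (line_poly y (polymap k y) (mpolyC 4 c))`_n) = fun=> (c%:P)`_n.
    by apply/funext => y; rewrite line_polyC.
  apply: sdiff_eq (sdiff_cst _ x) => v; rewrite coef_sum big1 // => j _.
  by rewrite mderivC -mpolyC0 line_polyC mulr0 coef0.
- move=> n.
  have -> : (fun y => (line_poly y (polymap k y) (mpolyX C (mnm1 i)))`_n) =
      fun y => y 0 i * (n == 0%N)%:R + meval (y 0) (k i) * (n == 1%N)%:R.
    apply/funext => y; rewrite line_polyX coefD coefC coefZ coefX !mxE.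
    by case: (n == 0%N); rewrite ?mulr1 ?mulr0.
  have h1 := sdiffM (sdiff_blin x (blin_coord i)) (sdiff_cst ((n == 0%N)%:R : C) x).
  have h2 := sdiffM (sdiff_meval (k i) x) (sdiff_cst ((n == 1%N)%:R : C) x).
  apply: sdiff_eq (sdiffD h1 h2) => v.
  rewrite (bigD1 i) //= big1 => [|j ji]; rewrite mderivX mnm1E.
    have -> : mnm_sub (mnm1 i) (mnm1 i) = mnm0 by apply/mnmP => k'; rewrite mnmBE mnm0E subnn.
    rewrite eqxx mpolyX0 scale1r -mpolyC1 line_polyC mulr1 addr0 coefD coefC coefZ coefX !mxE.
    by case: (n == 0%N); rewrite ?mulr1 ?mulr0 !add0r.
  by rewrite eq_sym (negbTE ji) scale0r -mpolyC0 line_polyC mulr0.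
- have -> : (fun y => line_poly y (polymap k y) (p + q)) =
      fun y => line_poly y (polymap k y) p + line_poly y (polymap k y) q.
    by apply/funext => y; rewrite line_polyD.
  apply: psdiff_eq (psdiffD hp hq) => v; rewrite -big_split; apply: eq_bigr => j _.
  by rewrite mderivD line_polyD mulrDr.
have -> : (fun y => line_poly y (polymap k y) (p * q)) =
    fun y => line_poly y (polymap k y) p * line_poly y (polymap k y) q.
  by apply/funext => y; rewrite line_polyM.
apply: psdiff_eq (psdiffM hp hq) => v; rewrite mulr_sumr mulr_suml -big_split.
by apply: eq_bigr => j _; rewrite mderivM line_polyD !line_polyM /=; ring.
Qed.

End PolynomialFamilies.

Section RulingLines.
Context {R : realType}.
Local Notation C := (Cplx R).
Local Notation form := (form4 R).
Variables (F : form) (d : nat).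
Hypotheses (d_gt1 : (1 < d)%N) (homF : F \is ishomog1 d mdeg) (smoothF : smooth F).

Let wedge_cancel (l1 l2 D1 D2 N1 N2 b m : C) :
  l1 * (b * N2) + D1 * N2 + (-1 * (l2 * (b * N1) + D2 * N1) + 0 * m) = 0 ->
  l1 * N2 = l2 * N1 -> D1 * N2 = D2 * N1.
Proof.
move=> h w; apply/eqP; rewrite -subr_eq0; apply/eqP.
have -> : D1 * N2 - D2 * N1 = (l1 * (b * N2) + D1 * N2 + (-1 * (l2 * (b * N1) + D2 * N1) + 0 * m))
   - b * (l1 * N2 - l2 * N1) by ring.
by rewrite h w subrr mulr0 subr0.
Qed.

Let wedge_scale (a e1 e2 l1 l2 N1 N2 : C) : l1 * N2 = l2 * N1 ->
  a * (e1 * l1 - e2 * l1) * N2 = a * (e1 * l2 - e2 * l2) * N1.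
Proof.
move=> w; have -> : a * (e1 * l1 - e2 * l1) * N2 = a * (e1 - e2) * (l1 * N2) by ring.
by rewrite w; ring.
Qed.

Let wedge_solve (m1 m0 c l1 l2 N1 N2 T1 T2 k1 k2 : C) : m1 != 0 ->
  T1 * N2 = T2 * N1 -> l1 * N2 = l2 * N1 ->
  (m1 * k1 + c * (m0 * l1) + T1) * N2 = (m1 * k2 + c * (m0 * l2) + T2) * N1 ->
  k1 * N2 = k2 * N1.
Proof.
move=> m10 hT w h; apply: (mulfI m10); apply/eqP; rewrite -subr_eq0; apply/eqP.
have -> : m1 * (k1 * N2) - m1 * (k2 * N1) =
  ((m1 * k1 + c * (m0 * l1) + T1) * N2 - (m1 * k2 + c * (m0 * l2) + T2) * N1)
  - c * m0 * (l1 * N2 - l2 * N1) - (T1 * N2 - T2 * N1) by ring.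
by rewrite h w hT !subrr mulr0 !subr0.
Qed.

Lemma line_euler m P (x v : hvec R) : euler m P ->
  \sum_l ((x 0 l)%:P + v 0 l *: 'X) * line_poly x v (mderiv l P) = m%:R *: line_poly x v P.
Proof.
move=> /(congr1 (line_poly x v)); rewrite /line_poly mmapZ mul_polyC => <-.
rewrite raddf_sum; apply: eq_bigr => l _ /=.
by rewrite -!/(line_poly x v _) line_polyM line_polyX.
Qed.

Lemma coefXderiv (p : {poly C}) n : ('X * p^`())`_n = p`_n *+ n.
Proof. by rewrite coefXM; case: n => [|n] //=; rewrite coef_deriv. Qed.

Definition parallel (a b : hvec R) := forall i j, a 0 i * b 0 j = a 0 j * b 0 i.

Definition line_coefs (x v : hvec R) (n : nat) : hvec R :=
  \row_i (line_poly x v (mderiv i F))`_n.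

Lemma line_coefsE x v n i : line_coefs x v n 0 i = (line_poly x v (mderiv i F))`_n.
Proof. by rewrite mxE. Qed.

Lemma gaussE (x : hvec R) i : gauss F x 0 i = meval (x 0) (mderiv i F).
Proof. by rewrite mxE. Qed.

(* The tangent plane is constant along the lines spanned by a vector field k as below:
   the hypothesis on [k] says that its integral curves are lines up to reparametrization,
   and the Taylor coefficients of the Gauss map along these lines are compared with the
   Gauss map by differentiating along k. *)
Lemma line_coefs_parallel (k : 'I_4 -> form) (x0 : hvec R) (e : R) : 0 < e ->
  (forall x, nr (x - x0) < e -> on_surface F x ->
     [/\ dmeval F x (polymap k x) = 0,
         exists b, polymap k x *m hess F x = b *: gauss F x &
         exists a b, polymap_deriv k x (polymap k x) = a *: x + b *: polymap k x]) ->
  forall n x, nr (x - x0) < e -> on_surface F x ->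
    parallel (line_coefs x (polymap k x) n) (gauss F x).
Proof.
move=> e0 hk; elim/ltn_ind => n IH x xe Sx i j.
case: n IH => [|n] IH.
  have e0' l : line_coefs x (polymap k x) 0 0 l = gauss F x 0 l.
    by rewrite line_coefsE line_coef0 gaussE.
  rewrite (e0' i) (e0' j).
  exact: mulrC.
have [kT [b kH] [a [c kk]]] := hk x xe Sx.
set K := polymap k x in kT kH kk *.
(* A minor expressing parallelism at order [n]. By induction it vanishes on S near [x], so its
   derivative along the tangent vector [K] is zero; this derivative contains the coefficients of
   order [n.+1]. *)
pose G (y : hvec R) : C := (line_coefs y (polymap k y) n) 0 i * (gauss F y) 0 j -
  (line_coefs y (polymap k y) n) 0 j * (gauss F y) 0 i.
pose L (P : form) := line_poly x K P.
pose D (v : hvec R) (i : 'I_4) : C := (\sum_l ((v 0 l)%:P + (polymap_deriv k x v) 0 l *: 'X) * L (mderiv l (mderiv i F)))`_n.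
pose N := gauss F x.
pose A (v : hvec R) : C := (line_coefs x K n 0 i * (v *m hess F x) 0 j + D v i * N 0 j) +
   (-1 * (line_coefs x K n 0 j * (v *m hess F x) 0 i + D v j * N 0 i) + 0 *
    (line_coefs x K n 0 j * N 0 i)).
have sl i' : sdiff (fun y => line_coefs y (polymap k y) n 0 i') x (fun v => D v i').
  have -> : (fun y => line_coefs y (polymap k y) n 0 i') =
     fun y => (line_poly y (polymap k y) (mderiv i' F))`_n by apply/funext => y; rewrite line_coefsE.
  exact: psdiff_line.
have sg i' : sdiff (fun y => gauss F y 0 i') x (fun v => (v *m hess F x) 0 i').
  have -> : (fun y => gauss F y 0 i') = fun y => meval (y 0) (mderiv i' F).
    by apply/funext => y; rewrite gaussE.
  by apply: sdiff_eq (sdiff_meval _ x) => v; rewrite dmeval_hess.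
have sG : sdiff G x A.
  have -> : G = fun y => (line_coefs y (polymap k y) n) 0 i * (gauss F y) 0 j +
      -1 * ((line_coefs y (polymap k y) n) 0 j * (gauss F y) 0 i).
    by apply/funext => y; rewrite /G mulN1r.
  have s1 := sdiffM (sl i) (sg j).
  have s2 := sdiffM (sdiff_cst (-1 : C) x) (sdiffM (sl j) (sg i)).
  exact: sdiff_eq (sdiffD s1 s2).
have DZ (t : C) v i' : D (t *: v) i' = t * D v i'.
  rewrite /D !coef_sum mulr_sumr; apply: eq_bigr => l _.
  rewrite -coefZ scalerAl; apply: (congr1 (fun p : {poly C} => p`_n)); apply: (congr2 *%R) => //.
  rewrite scalerDr scalerA -[t *: (v 0 l)%:P]mul_polyC -polyCM; congr (_%:P + _ *: _).
    by rewrite mxE.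
  rewrite !mxE /dmeval mulr_sumr; apply: eq_bigr => m _.
  by rewrite mxE mulrA.
have sA : scalable_map A.
  move=> t v; change (A (t *: v) = t * A v).
  have hZ i' : ((t *: v) *m hess F x) 0 i' = t * (v *m hess F x) 0 i' by rewrite -scalemxAl mxE.
  rewrite /A !DZ !hZ.
  by move: (line_coefs x K n 0 i) (line_coefs x K n 0 j) (N 0 j) (N 0 i) (D v i) (D v j)
     ((v *m hess F x) 0 i) ((v *m hess F x) 0 j) => *; ring.
have AK : A K = 0.
  apply: (surface_tangent_deriv Sx (smoothF Sx) kT sG sA (_ : 0 < e - nr (x - x0))).
    by rewrite subr_gt0.
  move=> y yx Sy; have ye : nr (y - x0) < e.
    rewrite ltrBrDr in yx; apply: le_lt_trans yx.
    by have := nrD (y - x) (x - x0); rewrite addrA subrK.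
  by rewrite /G (IH n (ltnSn n) y ye Sy i j) subrr.
have wedge m : (m <= n)%N -> (L (mderiv i F))`_m * N 0 j = (L (mderiv j F))`_m * N 0 i.
  by move=> mn; have := IH m _ x xe Sx i j; rewrite ltnS !line_coefsE; apply.
(* Along [K] the direction field varies by [a *: x + c *: K]. The term in [K] reparametrizes the
   line, and the term in [x] is evaluated by Euler's relation restricted to the line; only
   coefficients of order at most [n] accompany the one of order [n.+1]. *)
have DE i' : D K i' = n.+1%:R * (L (mderiv i' F))`_n.+1 + c * (n%:R * (L (mderiv i' F))`_n) +
    (if n is n'.+1 then a * (d.-1%:R * (L (mderiv i' F))`_n' - n'%:R * (L (mderiv i' F))`_n') else 0).
  pose Q := L (mderiv i' F).
  have Q' : \sum_l K 0 l *: L (mderiv l (mderiv i' F)) = Q^`() by rewrite /Q /L deriv_line.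
  have QE : \sum_l x 0 l *: L (mderiv l (mderiv i' F)) = d.-1%:R *: Q - 'X * Q^`().
    have eF1 : euler d.-1 (mderiv i' F).
      by apply: euler_deriv; rewrite prednK ?(ltnW d_gt1) //; exact: euler_homog.
    rewrite -(line_euler x K eF1) -Q' mulr_sumr -sumrB; apply: eq_bigr => l _.
    by rewrite mulrDl mul_polyC -scalerAl -scalerAr addrK.
  have -> : D K i' = (Q^`() + c *: ('X * Q^`()) + a *: ('X * (d.-1%:R *: Q - 'X * Q^`())))`_n.
    rewrite /D -QE -Q'; apply: (congr1 (fun p : {poly C} => p`_n)); rewrite !mulr_sumr !scaler_sumr -!big_split.
    apply: eq_bigr => l _; rewrite kk -/(L _) /= mulrDl mul_polyC -addrA; congr (_ + _).
    by rewrite !mxE scalerDl mulrDl addrC -!scalerAl -!scalerAr !scalerA.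
  rewrite !coefD !coefZ coefXderiv coef_deriv coefXM.
  case: (n) => [|n'] /=; first by rewrite mul1r mul0r mulr1n mulr0n !mulr0.
  by rewrite coefB coefZ coefXderiv !mulr_natl.
have Hk i' : (K *m hess F x) 0 i' = b * N 0 i' by rewrite kH mxE.
have hD : D K i * N 0 j = D K j * N 0 i.
  have := AK; rewrite /A !Hk => h; apply: wedge_cancel h _.
  by rewrite !line_coefsE; exact: wedge (leqnn n).
rewrite !line_coefsE -/(L _) -/(L _).
pose T i' := if n is n'.+1 then a * (d.-1%:R * (L (mderiv i' F))`_n' - n'%:R * (L (mderiv i' F))`_n') else 0.
have hT : T i * N 0 j = T j * N 0 i.
  rewrite /T; move: wedge; case: (n) => [|n'] wedge; first by rewrite !mul0r.
  by apply: wedge_scale; exact: wedge (leqnSn n').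
have m1 : (n.+1%:R : C) != 0 by rewrite pnatr_eq0.
apply: (wedge_solve m1 hT (wedge n (leqnn n))).
exact: etrans (congr1 (fun z => z * N 0 j) (esym (DE i)))
  (etrans hD (congr1 (fun z => z * N 0 i) (DE j))).
Qed.

End RulingLines.

Section LinearAlgebra.
Context {K : fieldType}.

Lemma kernel_line n (A : 'M[K]_n.+1) (k y : 'rV_n.+1) : (n <= \rank A)%N ->
  k != 0 -> k *m A = 0 -> y *m A = 0 -> exists b, y = b *: k.
Proof.
move=> rA k0 kA yA.
have kK : (k <= kermx A)%MS by apply/sub_kermxP.
have yK : (y <= kermx A)%MS by apply/sub_kermxP.
have e : \rank k = \rank (kermx A).
  apply/eqP; rewrite eqn_leq mxrankS //= rank_rV k0 mxrank_ker.
  by rewrite leq_subLR addn1 ltnS.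
have := mxrank_leqif_eq kK; rewrite e => -[_]; rewrite eqxx => /esym/andP[_ Kk].
by have /sub_rVP := submx_trans yK Kk.
Qed.

Lemma rank_col_mx2 n (u v : 'rV[K]_n) : u != 0 -> ~~ (v <= u)%MS -> \rank (col_mx u v) = 2%N.
Proof.
move=> u0 vu; apply/eqP; rewrite eqn_leq rank_leq_row /=.
have : (u < col_mx u v)%MS.
  rewrite ltmxE -addsmxE addsmxSl /=; by apply: contra vu; rewrite col_mx_sub => /andP[].
by move/rank_ltmx; rewrite rank_rV u0.
Qed.

Lemma perp_span n (N w : 'rV[K]_n) : N != 0 ->
  (forall v : 'rV_n, (v *m N^T) 0 0 = 0 -> (v *m w^T) 0 0 = 0) -> exists c, w = c *: N.
Proof.
move=> N0 h; have [i Ni] : exists i, N 0 i != 0.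
  have : ~~ [forall i, N 0 i == 0].
    apply: contra N0 => /forallP h'; apply/eqP/rowP => i; rewrite mxE; exact/eqP.
  by case/forallPn => i hi; exists i.
exists (w 0 i / N 0 i); apply/rowP => j; rewrite mxE.
have E (a : 'rV[K]_n) : ((N 0 i *: delta_mx 0 j - N 0 j *: delta_mx 0 i : 'rV[K]_n) *m a^T) 0 0 =
    N 0 i * a 0 j - N 0 j * a 0 i.
  have D l : ((delta_mx 0 l : 'rV[K]_n) *m a^T) 0 0 = a 0 l.
    rewrite mxE (bigD1 l) //= big1 => [|m ml]; first by rewrite mxE !eqxx mul1r addr0 mxE.
    by rewrite mxE (negbTE ml) mul0r.
  have S c l : ((c *: (delta_mx 0 l : 'rV[K]_n)) *m a^T) 0 0 = c * a 0 l.
    by rewrite -scalemxAl [LHS]mxE D.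
  rewrite mulmxBl [LHS]mxE; congr (_ + _); first exact: S.
  by rewrite [LHS]mxE; congr (- _); exact: S.
have := h (N 0 i *: delta_mx 0 j - N 0 j *: delta_mx 0 i); rewrite !E mulrC subrr => /(_ erefl).
move=> /eqP; rewrite subr_eq0 => /eqP hw; apply: (mulfI Ni).
by rewrite hw mulrAC mulrCA divff // mulr1 mulrC.
Qed.

Lemma dot_sym n (u v : 'rV[K]_n) : (u *m v^T) 0 0 = (v *m u^T) 0 0.
Proof. by rewrite -{1}[u]trmxK -trmx_mul mxE. Qed.

End LinearAlgebra.

Section Density.
Context {R : realType}.
Local Notation C := (Cplx R).
Local Notation form := (form4 R).
Variables (F : form) (d : nat).
Hypotheses (d_gt1 : (1 < d)%N) (homF : F \is ishomog1 d mdeg) (smoothF : smooth F).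

(** Along the line the gradient is a fixed vector [N] times a polynomial [phi] of the parameter. A
    zero of [phi], or the point at infinity of the line when [phi] is a nonzero constant, is a
    singular point of S. *)
Lemma ruling_singular (x k : hvec R) : on_surface F x -> ~~ (k <= x)%MS ->
  (forall n, parallel (line_coefs F x k n) (gauss F x)) -> False.
Proof.
move=> Sx kx hp; set N := gauss F x.
have N0 : N != 0 by exact: smoothF.
have [i Ni] : exists i, N 0 i != 0.
  have : ~~ [forall i, N 0 i == 0].
    apply: contra N0 => /forallP h'; apply/eqP/rowP => i; rewrite [RHS]mxE; exact/eqP.
  by case/forallPn => i hi; exists i.
pose phi := line_poly x k (mderiv i F).
have gE (t : C) : gauss F (x + t *: k) = (phi.[t] / N 0 i) *: N.
  apply/rowP => j; rewrite gaussE -horner_line mxE.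
  have -> : line_poly x k (mderiv j F) = (N 0 j / N 0 i) *: phi.
    apply/polyP => n; rewrite coefZ; have := hp n j i; rewrite !line_coefsE -/N -/phi => h.
    by apply: (mulIf Ni); rewrite h [RHS]mulrAC divfK // mulrC.
  by rewrite hornerZ mulrC mulrA mulrAC.
have k0 : k != 0 by apply: contraNneq kx => ->; rewrite sub0mx.
have [/size_poly1P[c c0 phic]|phin] := boolP (size phi == 1%N); last first.
  have /closed_rootP[t /rootP ht] := phin.
  have y0 : x + t *: k != 0.
    apply: contra kx => /eqP h; have t0 : t != 0.
      by apply/eqP => t0; move: h Sx.1; rewrite t0 scale0r addr0 => ->; rewrite eqxx.
    rewrite -[k]scale1r -(mulVf t0) -scalerA; apply: scalemx_sub.
    have -> : t *: k = - x by apply/eqP; rewrite -addr_eq0 addrC h.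
    by rewrite eqmx_opp.
  have g0 : gauss F (x + t *: k) = 0 by rewrite gE ht mul0r scale0r.
  by have := smoothF (gauss_zero_on_surface d_gt1 homF y0 g0); rewrite g0 eqxx.
(* Homogeneity of degree [d - 1 > 0] gives the value at [k + t *: x] as [t ^+ d.-1] times a constant
   vector, which tends to 0 with [t]. *)
have gk : gauss F k = 0.
  apply/rowP => j; rewrite [RHS]mxE gaussE -(line_coef0 k x).
  apply: (@poly_bound_vanishing _ (line_poly k x (mderiv j F)) 1 (nr (c / N 0 i * N 0 j)) 1) => // t t0 t1.
  rewrite expr1 horner_line.
  have -> : k + t *: x = t *: (x + t^-1 *: k) by rewrite scalerDr scalerA divff // scale1r addrC.
  rewrite -gaussE (gauss_scale d_gt1 homF) gE phic hornerC mxE nrM nrX mulrC mxE.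
  rewrite ler_wpM2l ?nr_ge0 //.
  have -> : d.-1 = d.-2.+1 by case: d d_gt1 => [|[]].
  by rewrite exprS ler_piMr ?nr_ge0 // exprn_ile1 ?nr_ge0 // ltW.
by have := smoothF (gauss_zero_on_surface d_gt1 homF k0 gk); rewrite gk eqxx.
Qed.

(** From the symmetry of the Hessian matrix and [x *m hess F x = d.-1%:R *: gauss F x]. In
    particular [v] is tangent at [x] exactly when its image by the Hessian is orthogonal to [x]. *)
Lemma dot_gauss (x v : hvec R) : (v *m (gauss F x)^T) 0 0 = (d.-1%:R)^-1 * (v *m hess F x *m x^T) 0 0.
Proof.
have e : (v *m hess F x *m x^T) 0 0 = d.-1%:R * (v *m (gauss F x)^T) 0 0.
  by rewrite hess_symm (hess_euler d_gt1 homF) -scalemxAl [LHS]mxE dot_sym.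
by rewrite e mulKf // (pred_d_neq0 d_gt1).
Qed.

(* If the adjugate of the Hessian matrix vanishes, then this matrix has rank at most 2,
   and the second fundamental form is zero. *)
Lemma adj0_hess_tangent (x u : hvec R) : on_surface F x -> \adj (hess F x) = 0 ->
  dmeval F x u = 0 -> exists b, u *m hess F x = b *: gauss F x.
Proof.
move=> Sx adj0 uT; apply/sub_rVP; apply/negP => /negP hu.
pose H := hess F x; pose B := col_mx (gauss F x) (u *m H).
have N0 := smoothF Sx.
have NH : (gauss F x <= H)%MS.
  have -> : gauss F x = (d.-1%:R)^-1 *: (x *m H).
    by rewrite (hess_euler d_gt1 homF) scalerA mulVf ?scale1r ?(pred_d_neq0 d_gt1).
  by apply: scalemx_sub; exact: submxMl.
have BH : (B <= H)%MS by rewrite col_mx_sub NH submxMl.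
have rH : (\rank H <= 2)%N.
  rewrite leqNgt; apply/negP => /adj_neq0_rank; rewrite adj0 eqxx //.
have rB : \rank B = 2 by exact: rank_col_mx2.
have HB : (H <= B)%MS by rewrite -(geq_leqif (mxrank_leqif_sup BH)) rB.
have Bx : B *m x^T = 0.
  have gx : gauss F x *m x^T = 0.
    apply/rowP => i; rewrite ord1 [RHS]mxE dot_sym (gauss_pairing homF) Sx.2 mulr0 //.
  rewrite mul_col_mx gx; have -> : u *m H *m x^T = 0; last by rewrite col_mx0.
  have := dot_gauss x u; rewrite -dmeval_gauss uT => /esym/eqP.
  rewrite mulf_eq0 invr_eq0 (negbTE (pred_d_neq0 d_gt1)) /= => /eqP h.
  by apply/rowP => i; rewrite ord1 [RHS]mxE.
have : x *m H = 0.
  have /submxP[D HD] := HB.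
  have -> : x *m H = (H *m x^T)^T by rewrite trmx_mul trmxK hess_sym.
  by rewrite HD -mulmxA Bx mulmx0 trmx0.
rewrite (hess_euler d_gt1 homF) => /eqP; rewrite scaler_eq0 (negbTE (pred_d_neq0 d_gt1)) /=.
by rewrite (negbTE N0).
Qed.

End Density.

Section Density2.
Context {R : realType}.
Local Notation C := (Cplx R).
Local Notation form := (form4 R).
Variables (F : form) (d : nat).
Hypotheses (d_gt1 : (1 < d)%N) (homF : F \is ishomog1 d mdeg) (smoothF : smooth F).

Lemma parallelP (a b : hvec R) : b != 0 -> parallel a b -> exists c, a = c *: b.
Proof.
move=> b0 h; have [i bi] : exists i, b 0 i != 0.
  have : ~~ [forall i, b 0 i == 0].
    apply: contra b0 => /forallP h'; apply/eqP/rowP => i; rewrite [RHS]mxE; exact/eqP.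
  by case/forallPn => i hi; exists i.
exists (a 0 i / b 0 i); apply/rowP => j; rewrite mxE; apply: (mulIf bi).
by rewrite [RHS]mulrAC divfK // h.
Qed.

Lemma tangent_deriv_meval (P : form) (x u : hvec R) (e : R) : on_surface F x ->
  dmeval F x u = 0 -> 0 < e ->
  (forall y, nr (y - x) < e -> on_surface F y -> meval (y 0) P = 0) -> dmeval P x u = 0.
Proof.
move=> Sx uT e0 h; apply: (surface_tangent_deriv Sx (smoothF Sx) uT (sdiff_meval P x) _ e0) => //.
move=> t v; change (dmeval P x (t *: v) = t * dmeval P x v); rewrite /dmeval mulr_sumr.
by apply: eq_bigr => i _; rewrite mxE mulrA.
Qed.

Definition third (x u v w : hvec R) : C :=
  \sum_i \sum_j \sum_l u 0 i * v 0 j * w 0 l * meval (x 0) (mderiv i (mderiv j (mderiv l F))).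

Lemma third_C12 x u v w : third x u v w = third x v u w.
Proof.
rewrite /third exchange_big; apply: eq_bigr => i _; apply: eq_bigr => j _.
by apply: eq_bigr => l _; rewrite mderiv_comm [v 0 i * _]mulrC.
Qed.

Lemma third_C23 x u v w : third x u v w = third x u w v.
Proof.
rewrite /third; apply: eq_bigr => i _; rewrite exchange_big; apply: eq_bigr => j _.
by apply: eq_bigr => l _; rewrite [mderiv l (mderiv j F)]mderiv_comm [u 0 i * _ * _]mulrAC.
Qed.

(* A polynomial vector field which generates the kernel of the Hessian matrix at the
   points of the surface. *)
Lemma kernel_field_lines (k : 'I_4 -> form) (x0 : hvec R) (e : R) : 0 < e ->
  (forall x, nr (x - x0) < e -> on_surface F x ->
    [/\ polymap k x *m hess F x = 0, (3 <= \rank (hess F x))%N & polymap k x != 0]) ->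
  forall x, nr (x - x0) < e -> on_surface F x ->
     [/\ dmeval F x (polymap k x) = 0,
         exists b, polymap k x *m hess F x = b *: gauss F x &
         exists a b, polymap_deriv k x (polymap k x) = a *: x + b *: polymap k x].
Proof.
move=> e0 hk x xe Sx; have [kH rH k0] := hk x xe Sx.
set K := polymap k x in kH k0 *; pose H := hess F x.
have KT : dmeval F x K = 0.
  by rewrite dmeval_gauss (dot_gauss d_gt1 homF) kH mul0mx mxE mulr0.
split=> //; first by exists 0; rewrite kH scale0r.
have er : 0 < e - nr (x - x0) by rewrite subr_gt0.
(* Differentiation of the identity [k *m H = 0], valid on S, along a tangent vector [u]. *)
have DkH (u w : hvec R) : dmeval F x u = 0 ->
    (polymap_deriv k x u *m H *m w^T) 0 0 = - third x u K w.
  move=> uT; pose P l := \sum_j k j * mderiv j (mderiv l F).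
  have dP l : dmeval (P l) x u = 0.
    apply: (tangent_deriv_meval Sx uT er) => y yx Sy.
    have ye : nr (y - x0) < e.
      rewrite ltrBrDr in yx; apply: le_lt_trans yx.
      by have := nrD (y - x) (x - x0); rewrite addrA subrK.
    have [h _ _] := hk y ye Sy; have := congr1 (fun v : hvec R => v 0 l) h.
    rewrite [X in _ = X -> _]mxE => <-; rewrite mxE /P raddf_sum; apply: eq_bigr => j _ /=.
    by rewrite mevalM hessE mxE.
  have dP2 l : (polymap_deriv k x u *m H) 0 l = - \sum_i \sum_j u 0 i * K 0 j *
      meval (x 0) (mderiv i (mderiv j (mderiv l F))).
    apply/eqP; rewrite -addr_eq0; apply/eqP; rewrite -[RHS](dP l).
    transitivity (\sum_i (\sum_j (u 0 i * meval (x 0) (mderiv i (k j)) * H j l) +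
       \sum_j u 0 i * K 0 j * meval (x 0) (mderiv i (mderiv j (mderiv l F))))).
      rewrite [RHS]big_split /=; congr (_ + _); rewrite [RHS]exchange_big mxE.
      by apply: eq_bigr => j _ /=; rewrite mxE /dmeval mulr_suml.
    apply: eq_bigr => i _.
    have -> : mderiv i (P l) = \sum_j mderiv i (k j * mderiv j (mderiv l F)) by rewrite /P raddf_sum.
    have -> : meval (x 0) (\sum_j mderiv i (k j * mderiv j (mderiv l F))) =
      \sum_j meval (x 0) (mderiv i (k j * mderiv j (mderiv l F))) by rewrite raddf_sum.
    rewrite -big_split mulr_sumr.
    apply: eq_bigr => j _ /=; rewrite mderivM mevalD !mevalM mulrDr hessE.
    by rewrite [K 0 j]mxE !mulrA.
  rewrite mxE /third.
  under eq_bigr => l _ do rewrite dP2 mulNr.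
  rewrite sumrN; congr (- _).
  under eq_bigr => l _ do rewrite mulr_suml.
  rewrite exchange_big; apply: eq_bigr => i _.
  under eq_bigr => l _ do rewrite mulr_suml.
  rewrite exchange_big; apply: eq_bigr => j _; apply: eq_bigr => l _.
  by rewrite [w^T _ _]mxE mulrAC.
have KHK (y : hvec R) : (y *m H *m K^T) 0 0 = 0 by rewrite hess_symm kH mul0mx mxE.
(* On a tangent vector [v] the pairing is [- third x K K v]; by the symmetry of third derivatives
   this is the variation of [k] along [v] paired with [K], which is zero because [K] lies in the
   kernel of [H]. Since [gauss F x] is a multiple of [x *m H], the variation of [k] along [K] is
   then a multiple of [x] modulo the kernel of [H]. *)
have [c hc] : exists c, polymap_deriv k x K *m H = c *: gauss F x.
  apply: perp_span (smoothF Sx) _ => v; rewrite -dmeval_gauss => vT.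
  rewrite dot_sym DkH // third_C23 third_C12.
  by have := DkH v K vT; rewrite KHK => /esym.
have hN : gauss F x = (d.-1%:R)^-1 *: (x *m H).
  by rewrite (hess_euler d_gt1 homF) scalerA mulVf ?scale1r ?(pred_d_neq0 d_gt1).
have [b hb] := kernel_line (y := polymap_deriv k x K - (c / d.-1%:R) *: x) rH k0 kH
   ltac:(by rewrite mulmxBl hc hN scalerA -scalemxAl subrr).
by exists (c / d.-1%:R), b; rewrite -hb addrC subrK.
Qed.

Let meval_deriv_nat (x : hvec R) i (n m : nat) (P Q : form) :
  meval (x 0) (mderiv i (n%:R * P - m%:R * Q)) =
  n%:R * meval (x 0) (mderiv i P) - m%:R * meval (x 0) (mderiv i Q).
Proof. by rewrite !mulr_natl mderivB !mderivMn mevalB !mevalMn. Qed.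

(** If all nearby points of S were parabolic, there would be a polynomial tangent field whose
    directions are those of lines with constant tangent plane: a row of the adjugate of [H] if the
    rank is 3 somewhere, any tangent field of a suitable form if the adjugate vanishes throughout.
    [ruling_singular] excludes such lines. *)
Lemma nonparabolic_dense (p : hvec R) (e : R) : on_surface F p -> 0 < e ->
  exists x, [/\ nr (x - p) < e, on_surface F x & ~ parabolic F x].
Proof.
move=> Sp e0; apply: contrapT => hno.
have par x : nr (x - p) < e -> on_surface F x -> \det (hess F x) = 0.
  by move=> xe Sx; apply/parabolicE; apply: contrapT => hx; apply: hno; exists x.
pose ap := \adj (jacobian_poly (fun j => mderiv j F)).
have apE (x : hvec R) i j : meval (x 0) (ap i j) = \adj (hess F x) i j.
  by rewrite /hess /jac -map_mx_adj [RHS]mxE.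
have concl (k : 'I_4 -> form) (x0 : hvec R) (r : R) : 0 < r -> on_surface F x0 ->
  ~~ (polymap k x0 <= x0)%MS ->
  (forall x, nr (x - x0) < r -> on_surface F x ->
     [/\ dmeval F x (polymap k x) = 0,
         exists b, polymap k x *m hess F x = b *: gauss F x &
         exists a b, polymap_deriv k x (polymap k x) = a *: x + b *: polymap k x]) -> False.
  move=> r0 Sx0 kx0 hk; apply: (ruling_singular d_gt1 homF smoothF Sx0 kx0) => n.
  apply: (line_coefs_parallel d_gt1 homF smoothF r0 hk n _ Sx0).
  by rewrite subrr nr0.
have [[x0 [x0e Sx0 adj0]]|hadj] := pselect (exists x0, [/\ nr (x0 - p) < e, on_surface F x0 &
   \adj (hess F x0) != 0]).
  have [i [j aij]] : exists i j, \adj (hess F x0) i j != 0.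
    have : ~~ [forall i, forall j, \adj (hess F x0) i j == 0].
      apply: contra adj0 => /forallP h; apply/eqP/matrixP => i j; rewrite [RHS]mxE.
      by apply/eqP; move/forallP: (h i) => /(_ j).
    by case/forallPn => i /forallPn[j hj]; exists i, j.
  have [r1 r10 h1] := @meval_neq0_near _ (ap i j) x0 ltac:(by rewrite apE).
  have r0 : 0 < Num.min r1 (e - nr (x0 - p)) by rewrite lt_min r10 subr_gt0.
  (* A row of the adjugate is polynomial in [x], is killed by [H] where the determinant vanishes,
     and is nonzero near [x0] by the choice of [i]. *)
  pose k l := ap i l.
  have kE x : polymap k x = row i (\adj (hess F x)).
    by apply/rowP => l; rewrite [LHS]mxE /k apE [RHS]mxE.
  have hk x : nr (x - x0) < Num.min r1 (e - nr (x0 - p)) -> on_surface F x ->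
    [/\ polymap k x *m hess F x = 0, (3 <= \rank (hess F x))%N & polymap k x != 0].
    rewrite lt_min => /andP[x1 x2] Sx.
    have xe : nr (x - p) < e.
      rewrite ltrBrDr in x2; apply: le_lt_trans x2.
      by have := nrD (x - x0) (x0 - p); rewrite addrA subrK.
    have aij' : \adj (hess F x) i j != 0 by rewrite -apE h1.
    split.
    - rewrite kE -row_mul mul_adj_mx par // raddf0.
      by apply/rowP => l; rewrite !mxE.
    - by apply/adj_neq0_rank; apply: contra aij' => /eqP ->; rewrite mxE.
    - by apply: contra aij' => /eqP h; have := congr1 (fun v : hvec R => v 0 j) h; rewrite kE mxE [RHS]mxE => ->.
  have [kH0 _ k0] := hk x0 ltac:(by rewrite subrr nr0) Sx0.
  apply: (concl k x0 _ r0 Sx0) (kernel_field_lines r0 hk).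
  apply/negP => /sub_rVP[a ha]; move: kH0; rewrite ha -scalemxAl (hess_euler d_gt1 homF) => /eqP.
  rewrite !scaler_eq0 (negbTE (smoothF Sx0)) (negbTE (pred_d_neq0 d_gt1)) !orbF => /eqP a0.
  by move: k0; rewrite ha a0 scale0r eqxx.
have adj0 x : nr (x - p) < e -> on_surface F x -> \adj (hess F x) = 0.
  by move=> xe Sx; apply/eqP; apply: contrapT => /negP h; apply: hadj; exists x.
pose N := gauss F p.
have N0 : N != 0 by exact: smoothF.
have [a Na] : exists i, N 0 i != 0.
  have : ~~ [forall i, N 0 i == 0].
    apply: contra N0 => /forallP h'; apply/eqP/rowP => i; rewrite [RHS]mxE; exact/eqP.
  by case/forallPn => i hi; exists i.
(* The field [N_a e_b - N_b e_a] is tangent. The second fundamental form being zero, [N] varies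
   proportionally to itself along it, and the field, which is linear in [N], does the same. *)
pose k b (j : 'I_4) : form := (j == b)%:R * mderiv a F - (j == a)%:R * mderiv b F.
have kE b x j : polymap (k b) x 0 j = (j == b)%:R * gauss F x 0 a - (j == a)%:R * gauss F x 0 b.
  by rewrite !gaussE mxE /k mevalB !mevalM !rmorph_nat.
have hk b : b != a -> forall x, nr (x - p) < e -> on_surface F x ->
     [/\ dmeval F x (polymap (k b) x) = 0,
         exists c, polymap (k b) x *m hess F x = c *: gauss F x &
         exists c c', polymap_deriv (k b) x (polymap (k b) x) = c *: x + c' *: polymap (k b) x].
  move=> ba x xe Sx.
  have kT : dmeval F x (polymap (k b) x) = 0.
    rewrite /dmeval (bigD1 a) //= (bigD1 b) //= big1 => [|j /andP[ja jb]]; last first.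
      by rewrite kE (negbTE ja) (negbTE jb) !mul0r subrr mul0r.
    rewrite !kE !eqxx [a == b]eq_sym (negbTE ba) -!gaussE.
    by rewrite !mul0r !mul1r sub0r subr0 addr0 mulNr mulrC addrC subrr.
  have [c hc] := adj0_hess_tangent d_gt1 homF smoothF Sx (adj0 x xe Sx) kT.
  split=> //; first by exists c.
  exists 0, c; rewrite scale0r add0r; apply/rowP => j; rewrite [RHS]mxE kE mxE.
  have dk (v : hvec R) : dmeval (k b j) x v =
     (j == b)%:R * (v *m hess F x) 0 a - (j == a)%:R * (v *m hess F x) 0 b.
    rewrite -!dmeval_hess /dmeval !mulr_sumr -sumrB; apply: eq_bigr => i _.
    apply: etrans (congr1 (fun z => v 0 i * z) (meval_deriv_nat _ _ _ _ _ _)) _.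
    by rewrite mulrBr; congr (_ - _); exact: mulrCA.
  have cE i : (c *: gauss F x) 0 i = c * gauss F x 0 i by rewrite mxE.
  by rewrite dk hc cE cE mulrBr; congr (_ - _); exact: mulrCA.
(* Two indices are taken because one of the fields may be a multiple of [p] at [p]. If both were,
   comparison of coordinates would give [N 0 a = 0]. *)
have [b1 [b2 [b1a b2a b12]]] : exists b1 b2 : 'I_4, [/\ b1 != a, b2 != a & b1 != b2].
  exists (lift a (0 : 'I_3)), (lift a (1 : 'I_3)); split; rewrite 1?eq_sym ?neq_lift //.
  by apply/eqP => /lift_inj.
have [h|kp] := boolP (polymap (k b1) p <= p)%MS; last first.
  exact: concl e0 Sp kp (hk b1 b1a).
have [h'|kp] := boolP (polymap (k b2) p <= p)%MS; last first.
  exact: concl e0 Sp kp (hk b2 b2a).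
have /sub_rVP[c1 hc1] := h; have /sub_rVP[c2 hc2] := h'.
have cE c i : (c *: p) 0 i = c * p 0 i by rewrite mxE.
have e11 : N 0 a = c1 * p 0 b1.
  by rewrite -cE -hc1 kE eqxx (negbTE b1a) mul1r mul0r subr0.
have e12 : c1 * p 0 b2 = 0.
  by rewrite -cE -hc1 kE [b2 == b1]eq_sym (negbTE b12) (negbTE b2a) !mul0r subr0.
have e22 : N 0 a = c2 * p 0 b2.
  by rewrite -cE -hc2 kE eqxx (negbTE b2a) mul1r mul0r subr0.
move/eqP: e12; rewrite mulf_eq0 => /orP[/eqP c10|/eqP p0].
  by move: Na; rewrite e11 c10 mul0r eqxx.
by move: Na; rewrite e22 p0 mulr0 eqxx.
Qed.

End Density2.

(** * Biduality and assertion (a) *)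

Section DualTangent.
Context {R : realType}.
Local Notation C := (Cplx R).
Local Notation form := (form4 R).
Variables (F : form) (d : nat).
Hypotheses (d_gt1 : (1 < d)%N) (homF : F \is ishomog1 d mdeg) (smoothF : smooth F).

Lemma holo_ball_all (g : hvec R -> C) q : holomorphic_at q g -> exists2 r : R, 0 < r &
  forall y, nr (y - q) < r -> sdiff g y ('d g y) /\ forall v, exists A, sdiff (fun w => 'd g w v) y A.
Proof.
move=> hg; have [r1 r10 h1] := holo_sdiff hg.
have /choice[r2 h2] : forall i : 'I_4, exists r : R, 0 < r /\ forall y, nr (y - q) < r ->
    sdiff (fun w => 'd g w (delta_mx 0 i)) y ('d (fun w => 'd g w (delta_mx 0 i)) y).
  by move=> i; have [r r0 h] := holo_sdiff (holo_d (delta_mx 0 i) hg); exists r.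
have [m m0 hm] := finite_min (fun i => (h2 i).1).
exists (Num.min r1 m) => [|y]; first by rewrite lt_min r10.
rewrite lt_min => /andP[y1 ym]; split; first exact: h1.
move=> v; exists (fun w => \sum_i (v 0 i * 'd (fun w => 'd g w (delta_mx 0 i)) y w + 0 * 'd g y (delta_mx 0 i))).
have -> : (fun w => 'd g w v) = fun w => \sum_i (v 0 i * 'd g w (delta_mx 0 i)).
  by apply/funext => w; exact: rv_lin ('d g w) v.
apply: sdiff_sum => i; apply: sdiffM; first exact: sdiff_cst.
by apply: (h2 i).2; exact: lt_le_trans (hm i).
Qed.

(** At a non-parabolic [x], a vector orthogonal to [x] is [z *m hess F x] with [z] tangent, and its
    pairing with the differential of [g] is the derivative along [z] of [g] composed with the Gauss
    map, a function vanishing on S. Density and continuity extend this to all [x] near [p]; the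
    uniformity in [x] is used in the second-order arguments. *)
Lemma dual_tangent (g : hvec R -> C) (p : hvec R) (U W : set (hvec R)) :
  on_surface F p -> holomorphic_at (gauss F p) g -> nbhs p U -> nbhs (gauss F p) W ->
  (forall xi, dual_surface F U xi -> W xi -> g xi = 0) ->
  exists2 e : R, 0 < e & forall x, on_surface F x -> nr (x - p) < e ->
    g (gauss F x) = 0 /\ forall v, (v *m x^T) 0 0 = 0 -> 'd g (gauss F x) v = 0.
Proof.
move=> Sp hg /nbhsP[u u0 hU] /nbhsP[w w0 hW] hgU.
have [r r0 hr] := holo_ball_all hg.
have rw0 : 0 < Num.min r w by rewrite lt_min r0.
have [e1 e10 he1] := sdiff_near (sdiff_gauss F p) rw0.
exists (Num.min u e1) => [|x Sx]; first by rewrite lt_min u0.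
have gz y : on_surface F y -> nr (y - p) < Num.min u e1 -> g (gauss F y) = 0.
  move=> Sy; rewrite lt_min => /andP[yu /he1]; rewrite lt_min => /andP[_ yw].
  by apply: hgU; [exists y; split=> //; [exact: hU | exact/eqmxP] | exact: hW].
move=> xe; split; first exact: gz.
have near y : nr (y - x) < Num.min u e1 - nr (x - p) -> nr (y - p) < Num.min u e1.
  rewrite ltrBrDr; apply: le_lt_trans.
  by have := nrD (y - x) (x - p); rewrite addrA subrK.
have e0 : 0 < Num.min u e1 - nr (x - p) by rewrite subr_gt0.
have nonpar y : nr (y - x) < Num.min u e1 - nr (x - p) -> on_surface F y -> ~ parabolic F y ->
    forall v, (v *m y^T) 0 0 = 0 -> 'd g (gauss F y) v = 0.
  move=> yx Sy npy v vy; have ye := near y yx.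
  have uH : hess F y \in unitmx.
    by rewrite unitmxE unitfE; apply/eqP => /parabolicE.
  pose z := v *m invmx (hess F y).
  have zH : z *m hess F y = v by rewrite /z mulmxKV.
  rewrite -zH; move: (ye); rewrite lt_min => /andP[_ /he1]; rewrite lt_min => /andP[/hr[sg _] _].
  have sG := sdiff_comp (sdiff_gauss F y) sg.
  apply: (@surface_tangent_deriv _ _ F y z (g \o gauss F)
    ('d g (gauss F y) \o (fun v => v *m hess F y)) (Num.min u e1 - nr (y - p))) => //.
  - exact: smoothF.
  - by rewrite dmeval_gauss (dot_gauss d_gt1 homF) zH vy mulr0.
  - by move=> t a /=; rewrite -scalemxAl linearZ.
  - by rewrite subr_gt0.
  - move=> y' hy' Sy' /=; apply: gz => //; move: hy'; rewrite ltrBrDr; apply: le_lt_trans.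
    by have := nrD (y' - y) (y - p); rewrite addrA subrK.
move=> v vx; have [i xi] : exists i, x 0 i != 0.
  have : ~~ [forall i, x 0 i == 0].
    apply: contra Sx.1 => /forallP h'; apply/eqP/rowP => i; rewrite [RHS]mxE; exact/eqP.
  by case/forallPn => i hi; exists i.
(* The orthogonality condition depends on the point, so [v] is extended to the vector field
   [y_i v - (y . v) e_i], orthogonal to [y] at every [y] and equal to [x_i v] at [x]. *)
pose Phi (y : hvec R) : C := y 0 i * 'd g (gauss F y) v +
  (-1 * (y *m v^T) 0 0) * 'd g (gauss F y) (delta_mx 0 i).
have PhiE y : Phi y = 'd g (gauss F y) (y 0 i *: v - (y *m v^T) 0 0 *: delta_mx 0 i).
  have h (c1 c2 : C) (a b : hvec R) : 'd g (gauss F y) (c1 *: a - c2 *: b) =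
    c1 * 'd g (gauss F y) a - c2 * 'd g (gauss F y) b by rewrite linearB !linearZ.
  by apply: etrans (esym (h _ _ _ _)); rewrite /Phi mulN1r mulNr.
have Phi0 y : nr (y - x) < Num.min u e1 - nr (x - p) -> on_surface F y -> ~ parabolic F y -> Phi y = 0.
  move=> yx Sy npy; rewrite PhiE; apply: nonpar => //.
  rewrite mulmxBl -!scalemxAl [LHS]mxE [X in X + _]mxE [X in _ + X]mxE [X in - X]mxE.
  have -> : ((delta_mx 0 i : hvec R) *m y^T) 0 0 = y 0 i.
    rewrite mxE (bigD1 i) //= big1 => [|m mi]; first by rewrite mxE !eqxx mul1r addr0 mxE.
    by rewrite mxE (negbTE mi) mul0r.
  by rewrite dot_sym mulrC subrr.
have [A sPhi] : exists A, sdiff Phi x A.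
  move: (xe); rewrite lt_min => /andP[_ /he1]; rewrite lt_min => /andP[/hr[_ hv] _].
  have [A1 s1] := hv v; have [A2 s2] := hv (delta_mx 0 i).
  eexists; apply: sdiffD; apply: sdiffM.
  - exact: sdiff_blin (blin_coord i).
  - exact: sdiff_comp (sdiff_gauss F x) s1.
  - apply: sdiffM; first exact: sdiff_cst.
    apply: (sdiff_blin (A := fun y : hvec R => (y *m v^T) 0 0)).
    split; first by move=> a b; rewrite mulmxBl !mxE.
    have [_ [k k0 hk]] := blin_mulmx v^T; exists k => // y.
    exact: le_trans (nr_coord _ _ _) (hk y).
  - exact: sdiff_comp (sdiff_gauss F x) s2.
(* [Phi] is continuous at [x] and vanishes at non-parabolic points arbitrarily close to it. *)
have Phix : Phi x = 0.
  apply: nr_eq0; apply/eqP; rewrite eq_le nr_ge0 andbT; apply/ler_addgt0Pl => eps eps0.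
  rewrite addr0; have [e2 e20 h2] := sdiff_near sPhi eps0.
  have m0 : 0 < Num.min e2 (Num.min u e1 - nr (x - p)) by rewrite lt_min e20.
  have [y [yx Sy npy]] := nonparabolic_dense d_gt1 homF smoothF Sx m0.
  move: yx; rewrite lt_min => /andP[/h2 hy yx]; move: hy.
  by rewrite (Phi0 y yx Sy npy) sub0r nrN => /ltW.
have := Phix; rewrite PhiE dot_sym vx scale0r subr0 linearZ => /eqP.
change (x 0 i * 'd g (gauss F x) v == 0 -> 'd g (gauss F x) v = 0).
by rewrite mulf_eq0 (negbTE xi) => /eqP.
Qed.

End DualTangent.

Section LinearSubspaces.
Context {R : realType}.
Local Notation C := (Cplx R).
Implicit Types (L : lsub R) (x y v w : hvec R).

Lemma orthP L w : (w <= orth L)%MS <-> forall x, (x <= L)%MS -> (w *m x^T) 0 0 = 0.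
Proof.
rewrite /orth; split=> [/sub_kermxP h x /submxP[D ->]|h].
  by rewrite trmx_mul mulmxA h mul0mx mxE.
apply/sub_kermxP/rowP => i; rewrite [RHS]mxE.
by rewrite -[RHS](h (row i L) (row_sub i L)) !mxE; apply: eq_bigr => j _; rewrite !mxE.
Qed.

Lemma is_line_orth L : is_line L -> is_line (orth L).
Proof. by rewrite /is_line /orth mxrank_ker mxrank_tr => ->. Qed.

Definition span2 x y : lsub R := <<col_mx x y>>%MS.

Lemma span2_line x y : x != 0 -> ~~ (y <= x)%MS -> is_line (span2 x y).
Proof. by move=> x0 yx; rewrite /is_line /span2 genmxE rank_col_mx2. Qed.

Lemma span2_l x y : (x <= span2 x y)%MS.
Proof. by rewrite genmxE -addsmxE addsmxSl. Qed.

Lemma span2_r x y : (y <= span2 x y)%MS.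
Proof. by rewrite genmxE -addsmxE addsmxSr. Qed.

Lemma span2_sub x y (m : nat) (M : 'M[C]_(m, 4)) : (x <= M)%MS -> (y <= M)%MS -> (span2 x y <= M)%MS.
Proof. by move=> xM yM; rewrite genmxE col_mx_sub xM yM. Qed.

Lemma span2P x y v : (v <= span2 x y)%MS <-> exists a b, v = a *: x + b *: y.
Proof.
rewrite genmxE -addsmxE; split=> [/sub_addsmxP[[D E] /= ->]|[a [b ->]]].
  by exists (D 0 0), (E 0 0); rewrite [D]mx11_scalar [E]mx11_scalar !mul_scalar_mx !mxE eqxx !mulr1n.
by apply: addmx_sub_adds; exact: scalemx_sub.
Qed.

Lemma line_eq L M : is_line L -> is_line M -> (L <= M)%MS -> (L == M)%MS.
Proof.
move=> hL hM LM; rewrite -(mxrank_leqif_eq LM).2.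
by rewrite (hL : \rank L = _) (hM : \rank M = _).
Qed.

Lemma line_span2 L x y : is_line L -> (x <= L)%MS -> (y <= L)%MS -> x != 0 ->
  ~~ (y <= x)%MS -> (L == span2 x y)%MS.
Proof.
move=> hL xL yL x0 yx; rewrite andbC; apply: line_eq => //; first exact: span2_line.
exact: span2_sub.
Qed.

Lemma line_second_point L x : is_line L -> (x <= L)%MS -> x != 0 ->
  exists2 y : hvec R, (y <= L)%MS & ~~ (y <= x)%MS.
Proof.
move=> hL xL x0; apply: contrapT => h.
have : (L <= x)%MS.
  apply/row_subP => i; apply: contrapT => /negP hi; apply: h.
  by exists (row i L) => //; exact: row_sub.
by move/mxrankS; rewrite (hL : \rank L = _) rank_rV; case: (x != 0).
Qed.

Lemma eqmx_orth L M : (L == M)%MS -> (orth L == orth M)%MS.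
Proof.
move=> /eqmxP LM; apply/andP; split; apply/row_subP => i; apply/orthP => x.
  by rewrite -LM => xL; have /orthP := row_sub i (orth L); apply.
by rewrite LM => xM; have /orthP := row_sub i (orth M); apply.
Qed.

End LinearSubspaces.

Section Contact.
Context {R : realType}.
Local Notation C := (Cplx R).
Local Notation form := (form4 R).

Lemma line_coef2 (F : form) (x v : hvec R) :
  (line_poly x v F)`_2 *+ 2 = (v *m hess F x *m v^T) 0 0.
Proof.
rewrite line_coefS mxE; apply: eq_bigr => i _.
by rewrite line_coef1 dmeval_hess mulrC [v^T _ _]mxE.
Qed.

Lemma line_coef2_eq0 (F : form) (x v : hvec R) :
  (line_poly x v F)`_2 = 0 <-> (v *m hess F x *m v^T) 0 0 = 0.
Proof.
rewrite -line_coef2; split=> [->|/eqP]; first by rewrite mul0rn.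
by rewrite mulrn_eq0 => /eqP.
Qed.

Lemma contact_equation (F : form) (x : hvec R) (L : lsub R) k :
  contact k (equation F) x L <-> [/\ is_line L, (x <= L)%MS &
    forall v, (v <= L)%MS -> forall j, (j < k)%N -> (line_poly x v F)`_j = 0].
Proof.
split=> -[hL xL h]; split=> //.
  move=> v vL; have /bigO_nrP[K [e [e0 he]]] := h _ v erefl vL.
  apply: (poly_bound_vanishing (K := K) e0) => t t0 te.
  by rewrite horner_line; exact: he.
move=> g v -> /h /line_bigO[K K0 hK]; apply/bigO_nrP; exists K, 1; split=> //.
Qed.

Lemma tangent_line_equation (F : form) (x : hvec R) (L : lsub R) : on_surface F x ->
  tangent_line (equation F) x L <-> [/\ is_line L, (x <= L)%MS &
    forall v, (v <= L)%MS -> dmeval F x v = 0].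
Proof.
move=> Sx; rewrite /tangent_line contact_equation.
split=> -[hL xL h]; split=> //.
  by move=> v /h /(_ 1%N erefl); rewrite line_coef1.
by move=> v /h vT [|[|//]] _; [rewrite line_coef0; case: Sx | rewrite line_coef1].
Qed.

Lemma asymptotic_tangent_equation (F : form) (x : hvec R) (L : lsub R) : on_surface F x ->
  asymptotic_tangent (equation F) x L <-> [/\ is_line L, (x <= L)%MS &
    forall v, (v <= L)%MS -> dmeval F x v = 0 /\ (v *m hess F x *m v^T) 0 0 = 0].
Proof.
move=> Sx; rewrite /asymptotic_tangent contact_equation.
split=> -[hL xL h]; split=> //.
  move=> v /h hv; split; first by have := hv 1%N erefl; rewrite line_coef1.
  by apply/line_coef2_eq0; exact: hv 2%N erefl.
move=> v /h[vT vv] [|[|[|//]]] _; first by rewrite line_coef0; case: Sx.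
  by rewrite line_coef1.
exact/line_coef2_eq0.
Qed.

End Contact.

Section PartA.
Context {R : realType}.
Local Notation C := (Cplx R).
Local Notation form := (form4 R).
Variables (F : form) (d : nat).
Hypotheses (d_gt1 : (1 < d)%N) (homF : F \is ishomog1 d mdeg) (smoothF : smooth F).

Lemma dual_germ_tangent (p : hvec R) g : on_surface F p -> germ_ideal F dual_surface p g ->
  g (gauss F p) = 0 /\ forall v, (v *m p^T) 0 0 = 0 -> 'd g (gauss F p) v = 0.
Proof.
move=> Sp [[_ hg] [U [W [pU qW h]]]].
have [e e0 he] := dual_tangent d_gt1 homF smoothF Sp hg pU qW h.
by apply: he => //; rewrite subrr nr0.
Qed.

(** A vector of [orth L] is orthogonal to [p], hence killed by the differential of every germ in the
    ideal; the second-order estimate on holomorphic functions then gives contact 2. *)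
Lemma orth_tangent_line (p : hvec R) (L : lsub R) : on_surface F p ->
  tangent_line (equation F) p L -> tangent_line (germ_ideal F dual_surface p) (gauss F p) (orth L).
Proof.
move=> Sp /(tangent_line_equation _ Sp)[hL pL hT]; split.
- exact: is_line_orth.
- by apply/orthP => x xL; rewrite dot_sym -dmeval_gauss hT.
move=> g v Ig /orthP vL; have [gq dg] := dual_germ_tangent Sp Ig.
have dv : 'd g (gauss F p) v = 0 by apply: dg; exact: vL.
have [[_ hg] _] := Ig; have [r r0 hr] := holo_lip2_at hg.
have [|K [e [K0 e0 h]]] := hr (gauss F p); first by rewrite subrr nr0.
apply/bigO_nrP; exists (K * nr v ^+ 2), (e / (nr v + 1)).
have v1 : 0 < nr v + 1 by rewrite ltr_wpDl ?nr_ge0.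
split=> [|t]; first by rewrite divr_gt0.
rewrite ltr_pdivlMr // => te.
have := h (gauss F p + t *: v) (gauss F p).
have dtv : 'd g (gauss F p) (t *: v) = 0 by rewrite linearZ dv; exact: mulr0.
have tvE : gauss F p + t *: v - gauss F p = t *: v by rewrite addrC addKr.
rewrite tvE subrr nr0 gq subr0 dtv subr0 addr0 nrZ.
have te' : nr t * nr v < e by apply: le_lt_trans te; rewrite ler_wpM2l ?nr_ge0 // lerDl.
by move=> /(_ te' e0); congr (_ <= _); ring.
Qed.

End PartA.

(** * Asymptotic tangents at a non-parabolic point and assertion (b) *)

Section TangentPlane.
Context {R : realType}.
Local Notation C := (Cplx R).
Local Notation form := (form4 R).
Variables (F : form) (d : nat).
Hypotheses (d_gt1 : (1 < d)%N) (homF : F \is ishomog1 d mdeg) (smoothF : smooth F).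
Variable (p : hvec R).
Hypothesis (Sp : on_surface F p).
Local Notation H := (hess F p).
Local Notation q := (gauss F p).

Definition second_form (u v : hvec R) : C := (u *m H *m v^T) 0 0.

Lemma second_formC u v : second_form u v = second_form v u.
Proof. exact: hess_symm. Qed.

Lemma second_formDl a b u v w : second_form (a *: u + b *: v) w = a * second_form u w + b * second_form v w.
Proof. by rewrite /second_form !mulmxDl -!scalemxAl !mxE. Qed.

Lemma second_formDr a b u v w : second_form w (a *: u + b *: v) = a * second_form w u + b * second_form w v.
Proof. by rewrite second_formC second_formDl !(second_formC _ w). Qed.

Lemma second_form_l v : second_form p v = d.-1%:R * dmeval F p v.
Proof. by rewrite /second_form (hess_euler d_gt1 homF) -scalemxAl mxE dot_sym dmeval_gauss. Qed.

Lemma dmeval_lin a b u v : dmeval F p (a *: u + b *: v) = a * dmeval F p u + b * dmeval F p v.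
Proof. by rewrite !dmeval_gauss mulmxDl -!scalemxAl !mxE. Qed.

Lemma dmeval_self : dmeval F p p = 0.
Proof. by rewrite dmeval_gauss (gauss_pairing homF) Sp.2 mulr0. Qed.

Lemma gauss_p : (q *m p^T) 0 0 = 0.
Proof. by rewrite dot_sym -dmeval_gauss dmeval_self. Qed.

Lemma tangentE v : (v <= kermx q^T)%MS <-> dmeval F p v = 0.
Proof.
rewrite dmeval_gauss; split=> [/sub_kermxP ->|h]; first by rewrite mxE.
by apply/sub_kermxP/rowP => i; rewrite ord1 h mxE.
Qed.

Lemma rank_tangent : \rank (kermx q^T) = 3.
Proof. by rewrite mxrank_ker mxrank_tr rank_rV (smoothF Sp). Qed.

Lemma tangent_notin m (A : 'M[C]_(m, 4)) : (\rank A < 3)%N ->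
  exists2 a, dmeval F p a = 0 & ~~ (a <= A)%MS.
Proof.
move=> rA; have : ~~ (kermx q^T <= A)%MS.
  by apply/negP => /mxrankS; rewrite rank_tangent leqNgt rA.
by move/row_subPn => [i hi]; exists (row i (kermx q^T)) => //; apply/tangentE; exact: row_sub.
Qed.

Lemma kernel_second_form u : dmeval F p u = 0 ->
  (forall w, dmeval F p w = 0 -> second_form u w = 0) -> exists c, u *m H = c *: (p *m H).
Proof.
move=> uT h; have [c hc] : exists c, u *m H = c *: q.
  apply: perp_span (smoothF Sp) _ => w; rewrite -dmeval_gauss => /h.
  by rewrite dot_sym.
exists (c / d.-1%:R); rewrite hc (hess_euler d_gt1 homF) scalerA divfK //.
exact: pred_d_neq0.
Qed.

Lemma hess_gauss_scalar u c : u *m H = c *: q -> (u - (c / d.-1%:R) *: p) *m H = 0.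
Proof.
move=> h; rewrite mulmxBl h -scalemxAl (hess_euler d_gt1 homF) scalerA divfK ?subrr //.
exact: pred_d_neq0.
Qed.

Hypothesis (npar : ~ parabolic F p).

Let uH : H \in unitmx.
Proof. by rewrite unitmxE unitfE; apply/eqP => /parabolicE. Qed.

(** The second fundamental form lives on the tangent plane modulo [p], of dimension 2, and is
    nondegenerate there because [H] is invertible: over an algebraically closed field it is a
    hyperbolic plane. *)
Lemma isotropic_basis : exists u1 u2 : hvec R,
  [/\ dmeval F p u1 = 0 /\ dmeval F p u2 = 0, ~~ (u1 <= p)%MS, ~~ (u2 <= span2 p u1)%MS,
      [/\ second_form u1 u1 = 0, second_form u2 u2 = 0 & second_form u1 u2 != 0] &
      forall v, dmeval F p v = 0 -> exists a b c, v = a *: p + b *: u1 + c *: u2].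
Proof.
have p0 := Sp.1.
have [a aT ap] : exists2 a, dmeval F p a = 0 & ~~ (a <= p)%MS.
  by apply: tangent_notin; rewrite rank_rV p0.
have [u1 [u1T u1p u11]] : exists u1 : hvec R, [/\ dmeval F p u1 = 0, ~~ (u1 <= p)%MS & second_form u1 u1 = 0].
  have [aa|aa] := eqVneq (second_form a a) 0; first by exists a.
  have [b bT bpa] : exists2 b, dmeval F p b = 0 & ~~ (b <= span2 p a)%MS.
    by apply: tangent_notin; rewrite (span2_line p0 ap : \rank _ = _).
  (* [Q] is the value of the form at [t *: a + b]; its leading coefficient is nonzero in this case,
     so it has a root. *)
  pose Q : {poly C} := (second_form b b)%:P + (2 * second_form a b) *: 'X + second_form a a *: 'X^2.
  have szQ : size Q != 1%N.
    apply/eqP => sz; have : Q`_2 = 0 by rewrite nth_default // sz.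
    by rewrite !coefD coefC !coefZ coefX coefXn /= mulr0 mulr1 !add0r => /eqP; apply/negP.
  have [t /rootP ht] := closed_rootP _ szQ.
  exists (t *: a + 1 *: b); split; first by rewrite dmeval_lin aT bT !mulr0 addr0.
    apply: contra bpa => /sub_rVP[c hc]; apply/span2P; exists c, (- t).
    by rewrite -hc scale1r scaleNr addrC addKr.
  rewrite second_formDl !second_formDr (second_formC b a) -[RHS]ht.
  by rewrite /Q !(hornerD, hornerC, hornerZ, hornerX, hornerXn); ring.
have [w wT u1w] : exists2 w, dmeval F p w = 0 & second_form u1 w != 0.
  apply: contrapT => h; have [c hc] : exists c, u1 *m H = c *: (p *m H).
    apply: kernel_second_form => // w wT; apply/eqP; apply: contrapT => /negP hw.
    by apply: h; exists w.
  case/negP: u1p; apply/sub_rVP; exists c.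
  by rewrite -(mulmxK uH u1) hc -scalemxAl mulmxK.
(* A multiple of the isotropic vector [u1] is subtracted so that [u2] becomes isotropic while its
   pairing with [u1] is unchanged. *)
pose u2 := 1 *: w + (- (second_form w w / (2 * second_form u1 w))) *: u1.
have u2T : dmeval F p u2 = 0 by rewrite dmeval_lin wT u1T !mulr0 addr0.
have u12 : second_form u1 u2 = second_form u1 w by rewrite second_formDr u11 mulr0 addr0 mul1r.
have u22 : second_form u2 u2 = 0.
  rewrite {1}/u2 second_formDl u12 second_formDr (second_formC w u1); field.
  by rewrite u1w.
have u2p : ~~ (u2 <= span2 p u1)%MS.
  apply: contra u1w => /span2P[x [y hxy]]; apply/eqP; rewrite -u12 hxy second_formDr u11.
  by rewrite second_formC second_form_l u1T !mulr0 addr0.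
exists u1, u2; split=> //; first by rewrite u11 u22 u12.
move=> v /tangentE vT.
have rB : (2 < \rank (col_mx (col_mx p u1) u2))%N.
  have : (col_mx p u1 < col_mx (col_mx p u1) u2)%MS.
    rewrite ltmxE; apply/andP; split; first by have := addsmxSl (col_mx p u1) u2; rewrite addsmxE.
    by apply: contra u2p; rewrite col_mx_sub => /andP[_]; rewrite genmxE.
  by move/rank_ltmx; rewrite rank_col_mx2.
have BT : (col_mx (col_mx p u1) u2 <= kermx q^T)%MS.
  by rewrite !col_mx_sub; apply/andP; split; [apply/andP; split|]; apply/tangentE => //; exact: dmeval_self.
have TB : (kermx q^T <= col_mx (col_mx p u1) u2)%MS.
  by rewrite -(geq_leqif (mxrank_leqif_sup BT)) rank_tangent.
have := submx_trans vT TB; rewrite -(addsmxE (col_mx p u1) u2) => /sub_addsmxP[[D E] /= hv].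
have /span2P[x [y hxy]] : (D *m col_mx p u1 <= span2 p u1)%MS by rewrite genmxE submxMl.
exists x, y, (E 0 0); rewrite hv hxy; congr (_ + _).
by rewrite [E]mx11_scalar mul_scalar_mx mxE eqxx mulr1n.
Qed.

Section IsotropicLines.
Variables (u1 u2 : hvec R).
Hypotheses (u1T : dmeval F p u1 = 0) (u2T : dmeval F p u2 = 0)
  (u1p : ~~ (u1 <= p)%MS) (u2p : ~~ (u2 <= span2 p u1)%MS)
  (u11 : second_form u1 u1 = 0) (u22 : second_form u2 u2 = 0) (u12 : second_form u1 u2 != 0)
  (basis : forall v, dmeval F p v = 0 -> exists a b c, v = a *: p + b *: u1 + c *: u2).

Let u2p' : ~~ (u2 <= p)%MS.
Proof. by apply: contra u2p => h; exact: submx_trans h (span2_l _ _). Qed.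

(** In the basis [p, u1, u2] the form is a nonzero multiple of the product of the last two
    coordinates. *)
Lemma isotropic_cases v : dmeval F p v = 0 -> second_form v v = 0 ->
  (v <= span2 p u1)%MS \/ (v <= span2 p u2)%MS.
Proof.
move=> vT; have [a [b [c vE]]] := basis vT.
have : second_form v v = 2 * b * c * second_form u1 u2.
  rewrite vE -[_ + c *: u2]/(_ + c *: u2) -[a *: p + b *: u1]scale1r second_formDl !second_formDr !second_formDl.
  rewrite (second_formC u1 p) (second_formC u2 p) !second_form_l dmeval_self u1T u2T u11 u22 (second_formC u2 u1).
  by ring.
move=> -> /eqP; rewrite !mulf_eq0 (negbTE u12) pnatr_eq0 /= orbF => /orP[/eqP b0|/eqP c0].
  by right; apply/span2P; exists a, c; rewrite vE b0 scale0r addr0.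
by left; apply/span2P; exists a, b; rewrite vE c0 scale0r addr0.
Qed.

Lemma isotropic_in u v : dmeval F p u = 0 -> second_form u u = 0 -> (v <= span2 p u)%MS ->
  dmeval F p v = 0 /\ second_form v v = 0.
Proof.
move=> uT uu /span2P[a [b ->]]; split; first by rewrite dmeval_lin dmeval_self uT !mulr0 addr0.
rewrite second_formDl !second_formDr (second_formC u p) !second_form_l dmeval_self uT uu.
by rewrite !(mulr0, addr0).
Qed.

Lemma asymptotic_tangents_equation M : asymptotic_tangent (equation F) p M <->
  (M == span2 p u1)%MS \/ (M == span2 p u2)%MS.
Proof.
rewrite (asymptotic_tangent_equation _ Sp); split.
  move=> [hM pM hv]; have [y yM yp] := line_second_point hM pM Sp.1.
  have [yT yy] := hv y yM.
  have hMy := line_span2 hM pM yM Sp.1 yp.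
  have [yL|yL] := isotropic_cases yT yy; [left | right].
    apply: line_eq => //; first exact: (span2_line Sp.1 u1p).
    by have /andP[My _] := hMy; apply: submx_trans My _; apply: span2_sub => //; exact: span2_l.
  apply: line_eq => //; first exact: (span2_line Sp.1 u2p').
  by have /andP[My _] := hMy; apply: submx_trans My _; apply: span2_sub => //; exact: span2_l.
have gen u : dmeval F p u = 0 -> second_form u u = 0 -> ~~ (u <= p)%MS -> (M == span2 p u)%MS ->
   [/\ is_line M, (p <= M)%MS & forall v : hvec R, (v <= M)%MS ->
     dmeval F p v = 0 /\ (v *m H *m v^T) 0 0 = 0].
  move=> uT uu up /eqmxP eM; split.
  - by rewrite /is_line eM; exact: (span2_line Sp.1 up).
  - by rewrite eM span2_l.
  - by move=> v; rewrite eM => vM; exact: isotropic_in uT uu vM.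
by case; exact: gen.
Qed.

(** [gauss F p] is orthogonal to the tangent vectors [p] and [u]. So is [u *m H]: its pairing with
    [u] is the second fundamental form at [u], its pairing with [p] a multiple of the differential
    of [F] at [u]. *)
Lemma orth_isotropic u : dmeval F p u = 0 -> second_form u u = 0 -> ~~ (u <= p)%MS ->
  (orth (span2 p u) == span2 q (u *m H))%MS.
Proof.
move=> uT uu up; have lu := span2_line Sp.1 up.
have uHq : ~~ (u *m H <= q)%MS.
  apply: contra up => /sub_rVP[c /hess_gauss_scalar h]; apply/sub_rVP; exists (c / d.-1%:R).
  have : u - c / d.-1%:R *: p = 0 by rewrite -(mulmxK uH (u - _)) h mul0mx.
  by move/eqP; rewrite subr_eq0 => /eqP.
apply: line_span2 uHq; [exact: is_line_orth| | |exact: smoothF].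
  apply/orthP => x /(isotropic_in uT uu)[xT _].
  by rewrite dot_sym -dmeval_gauss.
apply/orthP => x /span2P[a [b ->]].
rewrite -[(_ *m _) 0 0]/(second_form u _) second_formDr uu second_formC second_form_l uT.
by rewrite !mulr0 addr0.
Qed.

End IsotropicLines.

End TangentPlane.

Section DualAsymptotic.
Context {R : realType}.
Local Notation C := (Cplx R).
Local Notation form := (form4 R).
Variables (F : form) (d : nat).
Hypotheses (d_gt1 : (1 < d)%N) (homF : F \is ishomog1 d mdeg) (smoothF : smooth F).
Variable (p : hvec R).
Hypothesis (Sp : on_surface F p).
Local Notation H := (hess F p).
Local Notation q := (gauss F p).

(* Second-order expansion of the Gauss map; along an asymptotic direction its quadratic
   term is orthogonal to p, hence is killed by the differential of an equation of the dual
   surface. *)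
Lemma gauss_line_expansion (u : hvec R) :
  exists2 w : hvec R, (w *m p^T) 0 0 = (d%:R - 2) * (line_poly p u F)`_2 &
  exists2 K : R, 0 < K & forall t : C, nr t < 1 ->
    nr (gauss F (p + t *: u) - (q + t *: (u *m H) + t ^+ 2 *: w)) <= K * nr t ^+ 3.
Proof.
pose w := line_coefs F p u 2; exists w.
  have := congr1 (fun P : {poly C} => P`_2) (line_euler p u (euler_homog homF)).
  rewrite coefZ coef_sum.
  have -> : \sum_(i < 4) (((p 0 i)%:P + u 0 i *: 'X) * line_poly p u (mderiv i F))`_2 =
    \sum_i (p 0 i * w 0 i) + \sum_i u 0 i * (line_poly p u (mderiv i F))`_1.
    rewrite -big_split; apply: eq_bigr => i _.
    by rewrite mulrDl coefD coefCM -scalerAl coefZ coefXM /= line_coefsE.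
  rewrite -line_coefS => h; rewrite dot_sym mxE mulrBl -h mulr_natl addrK.
  by apply: eq_bigr => i _; rewrite [w^T _ _]mxE.
have /choice[K hK] : forall j, exists K : R, 0 < K /\ forall t : C, nr t < 1 ->
    nr ((gauss F (p + t *: u)) 0 j - (q 0 j + t * (u *m H) 0 j + t ^+ 2 * w 0 j)) <= K * nr t ^+ 3.
  move=> j; pose Q := line_poly p u (mderiv j F).
  have [|K K0 h] := @poly_vanishing_bound _ (Q - (Q`_0)%:P - Q`_1 *: 'X - Q`_2 *: 'X^2) 3.
    by case=> [|[|[|//]]] _; rewrite !coefB coefC !coefZ coefX coefXn /= ?mulr0 ?mulr1 ?subr0 subrr ?subr0.
  exists K; split=> // t /h.
  rewrite !hornerD !hornerN hornerC !hornerZ hornerX hornerXn horner_line.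
  rewrite line_coef0 line_coef1 dmeval_hess gaussE [q 0 j]gaussE line_coefsE -/Q.
  rewrite [t * _]mulrC [t ^+ 2 * _]mulrC; congr (nr _ <= _).
  by rewrite !opprD !addrA.
exists (\sum_j K j).
  rewrite (bigD1 0) //= ltr_pwDl ?(hK 0).1 // sumr_ge0 // => i _.
  by rewrite ltW // (hK i).1.
move=> t t1; apply: nr_coord_le => [|a j].
  by rewrite mulr_ge0 ?exprn_ge0 ?nr_ge0 // sumr_ge0 // => i _; rewrite ltW // (hK i).1.
have E (y1 y2 y3 y4 : hvec R) : (y1 - (y2 + y3 + y4)) 0 j = y1 0 j - (y2 0 j + y3 0 j + y4 0 j).
  by rewrite !mxE.
have Z (c : C) (y : hvec R) : (c *: y) 0 j = c * y 0 j by rewrite mxE.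
rewrite ord1 E !Z.
apply: le_trans ((hK j).2 t t1) _; rewrite ler_wpM2r ?exprn_ge0 ?nr_ge0 //.
by rewrite (bigD1 j) //= lerDl sumr_ge0 // => i _; rewrite ltW // (hK i).1.
Qed.

(** For [z] on S within [O(t^3)] of [p + t *: u], one has [gauss F z = q + t *: (u *m H) + t ^+ 2 *:
    w] up to [O(t^3)], and the term in [w] is killed by the differential of [g]. As [g] vanishes at
    [gauss F z], its value at [q + t *: (u *m H)] is [O(t^3)]. *)
Lemma dual_asymptotic (g : hvec R -> C) (u : hvec R) : germ_ideal F dual_surface p g ->
  dmeval F p u = 0 -> second_form F p u u = 0 ->
  exists K e : R, [/\ 0 < K, 0 < e & forall t : C, nr t < e ->
    nr (g (q + t *: (u *m H))) <= K * nr t ^+ 3].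
Proof.
move=> Ig uT uu; have [[_ hg] [U [W [pU qW hU]]]] := Ig.
have [gq dg] := dual_germ_tangent d_gt1 homF smoothF Sp Ig.
have [e1 e10 h1] := dual_tangent d_gt1 homF smoothF Sp hg pU qW hU.
have [w wp [K2 K20 h2]] := gauss_line_expansion u.
have dw : 'd g q w = 0.
  by apply: dg; rewrite wp ((line_coef2_eq0 F p u).2 uu) mulr0.
have [K3 [e3 [K30 e30 h3]]] : exists K e : R, [/\ 0 < K, 0 < e & forall t : C, nr t < e ->
    exists2 z, on_surface F z & nr (z - (p + t *: u)) <= K * nr t ^+ 3].
  apply: surface_curve => //; first exact: smoothF.
  move=> [|[|[|//]]] _; first by rewrite line_coef0 Sp.2.
    by rewrite line_coef1.
  exact/line_coef2_eq0.
have [K4 [e4 [K40 e40 h4]]] := sdiff_lipschitz (sdiff_gauss F p).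
have [r r0 hr] := holo_lip2_at hg.
have [|K5 [e5 [K50 e50 h5]]] := hr q; first by rewrite subrr nr0.
have [rb rb0 hb] := holo_ball hg.
have [|dgq _] := hb q; first by rewrite subrr nr0.
have [K6 K60 h6] := diff_bound dgq.
pose M := nr u + K3.
pose v := u *m H.
have M0 : 0 < M by rewrite ltr_wpDl ?nr_ge0.
pose M2 := nr v + nr w + K2 + K4 * K3.
have M20 : 0 < M2 by rewrite /M2 ltr_wpDl ?mulr_gt0 // !addr_ge0 ?nr_ge0 // ltW.
exists (K5 * (M2 + M2) * M2 + K6 * (K2 + K4 * K3)).
exists (Num.min (Num.min (Num.min e1 e4 / M) (e5 / M2)) (Num.min 1 e3)).
split.
- have K24 : 0 < K2 + K4 * K3 by rewrite addr_gt0 // mulr_gt0.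
  by apply: addr_gt0; rewrite !mulr_gt0 // addr_gt0.
- have e14 : 0 < Num.min e1 e4 by rewrite lt_min e10.
  by rewrite !lt_min ltr01 e30 !divr_gt0.
move=> t; rewrite !lt_min => /andP[/andP[tM tM2] /andP[t1 t3]].
move: tM; rewrite ltr_pdivlMr // lt_min => /andP[tM1 tM4].
move: tM2; rewrite ltr_pdivlMr // => tM2.
have [z Sz hz] := h3 t t3.
have tn := nr_ge0 t.
have t2 : nr t ^+ 2 <= nr t by rewrite expr2 ler_piMl // ltW.
have t32 : nr t ^+ 3 <= nr t ^+ 2 by rewrite exprS ler_piMl ?exprn_ge0 // ltW.
have zp : nr (z - p) <= nr t * M.
  apply: le_trans (nr_tri z p (t *: u)) _; rewrite nrZ /M.
  have : K3 * nr t ^+ 3 <= K3 * nr t by rewrite ler_wpM2l ?(ltW K30) // (le_trans t32).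
  by move: hz; lra.
have gz : g (gauss F z) = 0 by have [] := h1 z Sz (le_lt_trans zp tM1).
pose y1 := q + t *: v.
have hN : nr (gauss F z - (y1 + t ^+ 2 *: w)) <= (K2 + K4 * K3) * nr t ^+ 3.
  have := nrD (gauss F z - gauss F (p + t *: u)) (gauss F (p + t *: u) - (y1 + t ^+ 2 *: w)).
  rewrite addrA subrK => /le_trans; apply; rewrite mulrDl addrC; apply: lerD; first exact: h2.
  rewrite -mulrA; apply: le_trans (ler_wpM2l (ltW K40) hz); apply: h4.
    exact: le_lt_trans zp tM4.
  rewrite addrC addKr nrZ; apply: le_lt_trans tM4; rewrite ler_wpM2l //.
  by rewrite /M lerDl ltW.
have hNy : nr (gauss F z - y1) <= M2 * nr t ^+ 2.
  apply: le_trans (nr_tri _ _ (t ^+ 2 *: w)) _; rewrite nrZ nrX /M2.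
  have : (K2 + K4 * K3) * nr t ^+ 3 <= (K2 + K4 * K3) * nr t ^+ 2.
    by rewrite ler_wpM2l // addr_ge0 ?mulr_ge0 // ltW.
  have : 0 <= nr v * nr t ^+ 2 by rewrite mulr_ge0 ?exprn_ge0 ?nr_ge0.
  by move: hN; lra.
have y1q : nr (y1 - q) <= M2 * nr t.
  rewrite addrC addKr nrZ mulrC ler_wpM2r // /M2.
  have : 0 <= nr w := nr_ge0 w.
  have : 0 <= K4 * K3 by rewrite mulr_ge0 // ltW.
  by move: K20; lra.
have zq : nr (gauss F z - q) <= M2 * nr t.
  apply: le_trans (nr_tri _ _ (t *: v + t ^+ 2 *: w)) _.
  rewrite addrA; apply: le_trans (lerD hN (nrD _ _)) _; rewrite (nrZ t v) (nrZ (t ^+ 2) w) nrX /M2.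
  have : (K2 + K4 * K3) * nr t ^+ 3 <= (K2 + K4 * K3) * nr t.
    by rewrite ler_wpM2l ?(le_trans t32) // addr_ge0 ?mulr_ge0 // ltW.
  have : nr w * nr t ^+ 2 <= nr w * nr t by rewrite ler_wpM2l ?nr_ge0.
  by lra.
have M2t : M2 * nr t < e5 by rewrite mulrC.
(* The two points are at distance [O(t)] from [q] and [O(t^2)] from each other, so the error of the
   linear approximation is [O(t^3)]. *)
have := h5 y1 (gauss F z) (le_lt_trans y1q M2t) (le_lt_trans zq M2t).
rewrite gz subr0 => hmain.
have hd : nr ('d g q (y1 - gauss F z)) <= K6 * (K2 + K4 * K3) * nr t ^+ 3.
  have -> : 'd g q (y1 - gauss F z) = - 'd g q (gauss F z - (y1 + t ^+ 2 *: w)).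
    have e : y1 - gauss F z = - (gauss F z - (y1 + t ^+ 2 *: w)) - t ^+ 2 *: w.
      by rewrite opprB [in RHS]addrAC addrK.
    have z0 : 'd g q (t ^+ 2 *: w) = 0 by rewrite linearZ dw; exact: mulr0.
    by rewrite {1}e linearB z0 subr0 linearN.
  by rewrite nrN (le_trans (h6 _)) // -mulrA ler_wpM2l ?(ltW K60).
have := nrD (g y1 - 'd g q (y1 - gauss F z)) ('d g q (y1 - gauss F z)); rewrite subrK.
move=> /le_trans; apply; rewrite mulrDl; apply: lerD => //.
apply: le_trans hmain _; rewrite nrC in hNy.
apply: (@le_trans _ _ (K5 * (M2 * nr t + M2 * nr t) * (M2 * nr t ^+ 2))).
  apply: ler_pM; rewrite ?nr_ge0 ?mulr_ge0 ?addr_ge0 ?nr_ge0 ?(ltW K50) //.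
  by rewrite ler_wpM2l ?(ltW K50) // lerD.
by rewrite le_eqVlt; apply/orP; left; apply/eqP; ring.
Qed.

End DualAsymptotic.

Section NormalizedPreimage.
Context {R : realType}.
Local Notation C := (Cplx R).
Local Notation form := (form4 R).

(** [small_root] for [('X + 1) ^+ n - c], whose derivative at 0 is [n]; the factor 2 bounds
    [n.+1 / n]. *)
Lemma root_near1 n (c : C) : (0 < n)%N -> exists2 l : C, l ^+ n = c & nr (l - 1) <= 2 * nr (c - 1).
Proof.
move=> n0; pose Q : {poly C} := ('X + 1%:P) ^+ n - c%:P.
have Qh (t : C) : Q.[t] = (t + 1) ^+ n - c by rewrite !hornerE.
have dQ : Q^`().[0] = n%:R.
  rewrite derivB derivC subr0 deriv_exp derivD derivX derivC addr0 mul1r.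
  by rewrite hornerMn horner_exp hornerD hornerX hornerC add0r expr1n.
have [|a /rootP ra ha] := @small_root _ Q; first by rewrite dQ pnatr_eq0 -lt0n.
exists (a + 1); first by apply/eqP; rewrite -subr_eq0 -Qh ra.
rewrite addrK (le_trans ha) // dQ Qh add0r expr1n nrC.
have szQ : (size Q <= n.+1)%N.
  rewrite (leq_trans (size_polyD _ _)) // geq_max size_polyN (leq_trans (size_polyC_leq1 _)) // andbT.
  have -> : 'X + 1%:P = 'X - (-1)%:P :> {poly C} by rewrite polyCN opprK.
  by rewrite size_exp_XsubC.
have nn : nr (n%:R : C) = n%:R.
  have -> : (n%:R : C) = real_complex R n%:R by rewrite rmorph_nat.
  by rewrite nr_real ger0_norm.
rewrite nn mulrAC ler_wpM2r ?nr_ge0 // ler_pdivrMr ?ltr0n //.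
by rewrite -natrM ler_nat (leq_trans szQ) // mul2n -addnn -addn1 leq_add2l.
Qed.

Variables (F : form) (d : nat).
Hypotheses (d_gt1 : (1 < d)%N) (homF : F \is ishomog1 d mdeg).

Lemma normalizeZ (l : 'cV[C]_4) c (xi : hvec R) : c != 0 -> normalize l (c *: xi) = normalize l xi.
Proof.
move=> c0; rewrite /normalize -scalemxAl mxE invfM scalerA mulrAC mulVf // mul1r.
by [].
Qed.

(** The Gauss map is homogeneous of degree [d - 1], so [x] is multiplied by a [(d - 1)]-th root of
    the inverse of the [l]-coordinate of [gauss F x]; [root_near1] keeps the factor close to 1. *)
Lemma normalized_preimage (p : hvec R) (l : 'cV[C]_4) (r : R) : 0 < r ->
  (gauss F p *m l) 0 0 = 1 ->
  exists2 e : R, 0 < e & forall x, nr (x - p) < e -> exists2 c : C, c != 0 &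
    nr (c *: x - p) < r /\ gauss F (c *: x) = normalize l (gauss F x).
Proof.
move=> r0 lq.
pose L (x : hvec R) : C := (gauss F x *m l) 0 0.
have bl : blin (fun y : hvec R => (y *m l) 0 0).
  split; first by move=> a b; rewrite mulmxBl !mxE.
  have [_ [k k0 hk]] := blin_mulmx l; exists k => // y.
  exact: le_trans (nr_coord _ _ _) (hk y).
have sL : sdiff L p (fun v => (v *m hess F p *m l) 0 0).
  exact: sdiff_comp (sdiff_gauss F p) (sdiff_blin _ bl).
have P0 : 0 < nr p + 1 by rewrite ltr_wpDl ?nr_ge0.
pose eps := Num.min (1 / 4) (r / (16 * (nr p + 1))) : R.
have eps0 : 0 < eps by rewrite lt_min !divr_gt0 // mulr_gt0.
have [e e0 he] := sdiff_near sL eps0.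
exists (Num.min e (Num.min 1 (r / 2))) => [|x]; first by rewrite !lt_min e0 ltr01 divr_gt0.
rewrite !lt_min => /andP[/he hx /andP[x1 xr]].
have Lp : L p = 1 by [].
rewrite Lp in hx.
have [hx1 hx2] : nr (L x - 1) < 1 / 4 /\ nr (L x - 1) < r / (16 * (nr p + 1)).
  by move: hx; rewrite lt_min => /andP[].
have Lx : 1 / 2 < nr (L x).
  have := nrB (L x) (L x - 1); rewrite opprB addrC subrK.
  have -> : nr (1 : C) = 1 by rewrite /nr normr1.
  by move: hx1; lra.
have L0 : L x != 0 by apply/eqP => h; move: Lx; rewrite h nr0; lra.
have hinv : nr ((L x)^-1 - 1) <= 2 * nr (L x - 1).
  have -> : (L x)^-1 - 1 = - ((L x)^-1 * (L x - 1)) by field.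
  rewrite nrN nrM nrV ler_wpM2r ?nr_ge0 // -[leRHS]invrK lef_pV2 ?posrE ?invr_gt0 //.
    by move: Lx; rewrite div1r => /ltW.
  by apply: lt_trans Lx; lra.
have dn : (0 < d.-1)%N by rewrite -ltnS prednK // ltnW.
have [c cE hc] := root_near1 ((L x)^-1) dn.
have hc1 : nr (c - 1) <= 4 * nr (L x - 1) by move: hc hinv; lra.
have c0 : c != 0.
  apply/eqP => h; have : c ^+ d.-1 = 0 by rewrite h expr0n; case: (d.-1) dn.
  by rewrite cE => /eqP; rewrite invr_eq0 (negbTE L0).
exists c => //; split; last by rewrite (gauss_scale d_gt1 homF) cE.
have -> : c *: x - p = (c - 1) *: x + (x - p) by rewrite scalerBl scale1r addrA subrK.
apply: le_lt_trans (nrD _ _) _; rewrite nrZ.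
have xn : nr x <= nr p + 1.
  by have := nrD (x - p) p; rewrite subrK; move: x1; lra.
have : nr (c - 1) * nr x <= r / 4.
  apply: (@le_trans _ _ (4 * (r / (16 * (nr p + 1))) * (nr p + 1))).
    by apply: ler_pM; rewrite ?nr_ge0 //; move: hc1 hx2; lra.
  by rewrite le_eqVlt; apply/orP; left; apply/eqP; field; rewrite gt_eqF.
by move: xr; lra.
Qed.

End NormalizedPreimage.

Section DualContact.
Context {R : realType}.
Local Notation C := (Cplx R).
Local Notation form := (form4 R).
Variables (F : form) (d : nat).
Hypotheses (d_gt1 : (1 < d)%N) (homF : F \is ishomog1 d mdeg) (smoothF : smooth F).
Variable (p : hvec R).
Hypothesis (Sp : on_surface F p).
Local Notation H := (hess F p).
Local Notation q := (gauss F p).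

Lemma dual_coordinate : exists l : 'cV[C]_4, (q *m l) 0 0 = 1.
Proof.
have [i qi] : exists i, q 0 i != 0.
  have : ~~ [forall i, q 0 i == 0].
    apply: contra (smoothF Sp) => /forallP h'; apply/eqP/rowP => i; rewrite [RHS]mxE; exact/eqP.
  by case/forallPn => i hi; exists i.
exists ((q 0 i)^-1 *: delta_mx i 0); rewrite -scalemxAr mxE.
have -> : (q *m (delta_mx i 0 : 'cV[C]_4)) 0 0 = q 0 i.
  rewrite [LHS]mxE (bigD1 i) //= big1 => [|m mi]; first by rewrite [delta_mx _ _ _ _]mxE !eqxx mulr1 addr0.
  by rewrite [delta_mx _ _ _ _]mxE (negbTE mi) mulr0.
by rewrite mulVf.
Qed.

Lemma gauss_lip2 : exists K e : R, [/\ 0 < K, 0 < e & forall y z, nr (y - p) < e -> nr (z - p) < e ->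
  nr (gauss F y - gauss F z - (y - z) *m H) <= K * (nr (y - p) + nr (z - p)) * nr (y - z)].
Proof.
have /choice[Ke hKe] : forall j : 'I_4, exists Ke : R * R, [/\ 0 < Ke.1, 0 < Ke.2 & forall y z,
    nr (y - p) < Ke.2 -> nr (z - p) < Ke.2 ->
    nr ((gauss F y - gauss F z - (y - z) *m H) 0 j) <= Ke.1 * (nr (y - p) + nr (z - p)) * nr (y - z)].
  move=> j; have [r r0 hr] := holo_lip2_at (holo_meval (mderiv j F) p).
  have [|K [e [K0 e0 h]]] := hr p; first by rewrite subrr nr0.
  exists (K, e); split=> // y z hy hz.
  have B3 (a b c : hvec R) : (a - b - c) 0 j = a 0 j - b 0 j - c 0 j by rewrite !mxE.
  have := h y z hy hz; rewrite B3 !gaussE -dmeval_hess.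
  by have [_ ->] := diff_meval (mderiv j F) p (y - z).
have [m m0 hm] : exists2 e : R, 0 < e & forall i, e <= (Ke i).2.
  by apply: finite_min => i; have [] := hKe i.
exists (\sum_i (Ke i).1), m; split=> // [|y z hy hz].
  apply: (@lt_le_trans _ _ (Ke 0).1); first by have [] := hKe 0.
  rewrite (bigD1 0) //= lerDl; apply: sumr_ge0 => i _; by have [/ltW] := hKe i.
have S0 : 0 <= \sum_i (Ke i).1 by apply: sumr_ge0 => i _; have [/ltW] := hKe i.
apply: nr_coord_le => [|a j]; first by rewrite !mulr_ge0 ?addr_ge0 ?nr_ge0.
rewrite ord1; have [K0 _ h] := hKe j.
apply: le_trans (h y z (lt_le_trans hy (hm j)) (lt_le_trans hz (hm j))) _.
rewrite ler_wpM2r ?nr_ge0 // ler_wpM2r ?addr_ge0 ?nr_ge0 // (bigD1 j) //= lerDl.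
by apply: sumr_ge0 => i _; have [/ltW] := hKe i.
Qed.

Hypothesis (uH : H \in unitmx).

(* Legendre transformation: along the line spanned by v in the dual space, F composed with
   the inverse of the Gauss map has a Taylor expansion whose first terms are those of F along
   the line spanned by [v *m invmx H], up to a nonzero factor. *)
Lemma legendre_contact (psi : hvec R -> hvec R) (K0 r rho : R) (v : hvec R) (K1 e1 : R) :
  local_inverse (gauss F) psi p K0 r rho -> 0 < e1 ->
  (forall t : C, nr t < e1 -> nr (meval (psi (q + t *: v) 0) F) <= K1 * nr t ^+ 3) ->
  dmeval F p (v *m invmx H) = 0 /\ second_form F p (v *m invmx H) (v *m invmx H) = 0.
Proof.
move=> inv e10 hF; pose u := v *m invmx H.
have vE : u *m H = v by rewrite /u mulmxKV.
have [K00 r0 rho0 _ _] := inv.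
have [w wp [K2 K20 h2]] := gauss_line_expansion homF p u.
have [K3 [e3 [K30 e30 h3]]] := gauss_lip2.
have [rF rF0 hrF] := holo_lip2_at (holo_meval F p).
have [|K4 [e4 [K40 e40 h4]]] := hrF p; first by rewrite subrr nr0.
have [_ [KB KB0 hB]] := blin_mulmx (invmx H).
pose M := K0 * nr v + nr u + 1.
have M0 : 0 < M by rewrite ltr_wpDl // addr_ge0 ?mulr_ge0 ?nr_ge0 // ltW.
pose M2 := KB * (K3 * M * M).
have M20 : 0 < M2 by rewrite !mulr_gt0.
have [K5 K50 h5] := @poly_vanishing_bound _ (line_poly p u F - ((line_poly p u F)`_1 *: 'X +
    (line_poly p u F)`_2 *: 'X^2)) 3
  ltac:(by case=> [|[|[|//]]] _; rewrite coefB coefD !coefZ coefX coefXn /= ?mulr0 ?mulr1 ?addr0 ?add0r ?line_coef0 ?Sp.2 subrr).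
set F1 := (line_poly p u F)`_1 in h5; set F2 := (line_poly p u F)`_2 in wp h5.
(* Let [x = psi (q + t *: v)] and [s = x - (p + t *: u)]. Comparing Gauss maps gives
   [s *m H = - t^2 w + O(t^3)], and pairing with [p] gives [(d - 1) dF(s) = - (d - 2) F2 t^2 +
   O(t^3)]. Hence [F(x) = F1 t + F2 t^2 + dF(s) + O(t^3) = F1 t + F2 / (d - 1) t^2 + O(t^3)]. *)
have key (t : C) : nr t < Num.min (Num.min 1 e1) (Num.min (rho / (nr v + 1)) (Num.min e3 e4 / M)) ->
  nr (F1 * t + F2 / d.-1%:R * t ^+ 2) <=
  (K1 + K5 + K4 * (M + M) * M2 + (K3 * (M + M) * M2 + K2) * (4 * nr p)) * nr t ^+ 3.
  rewrite !lt_min => /andP[/andP[t1 te1] /andP[]].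
  have v1 : 0 < nr v + 1 by rewrite ltr_wpDl ?nr_ge0.
  rewrite !ltr_pdivlMr // => tv; rewrite lt_min => /andP[tM3 tM4].
  have tn := nr_ge0 t.
  pose x := psi (q + t *: v).
  have tvr : nr (q + t *: v - q) < rho.
    rewrite addrC addKr nrZ; apply: le_lt_trans tv; rewrite ler_wpM2l // lerDl //.
  have [_ Nx] : nr (x - p) < r /\ gauss F x = q + t *: v by have [_ _ _ h _] := inv; exact: h.
  have xp : nr (x - p) <= M * nr t.
    have := local_inverse_lip inv tvr (_ : nr (q - q) < rho).
    rewrite subrr nr0 (local_inverse_at inv) -/x => /(_ rho0) /le_trans; apply.
    rewrite addrC addKr nrZ mulrCA mulrC ler_wpM2r // /M.
    by have := nr_ge0 u; lra.
  have up : nr (p + t *: u - p) <= M * nr t.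
    rewrite addrC addKr nrZ mulrC ler_wpM2r // /M.
    have : 0 <= K0 * nr v by rewrite mulr_ge0 ?nr_ge0 // ltW.
    by lra.
  have Mt3 : M * nr t < e3 by rewrite mulrC.
  have Mt4 : M * nr t < e4 by rewrite mulrC.
  pose s := x - (p + t *: u).
  have sH : nr (s *m H) <= K3 * M * M * nr t ^+ 2.
    have := h3 x p (le_lt_trans xp Mt3) ltac:(by rewrite subrr nr0).
    rewrite Nx subrr nr0 addr0.
    have -> : q + t *: v - q - (x - p) *m H = - (s *m H).
      have sE : s *m H = (x - p) *m H - t *: v.
        have -> : s = x - p - t *: u by rewrite /s opprD addrA.
        by rewrite mulmxBl; congr (_ - _); rewrite -scalemxAl vE.
      by rewrite sE opprB [q + _]addrC addrK.
    rewrite nrN => /le_trans; apply.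
    have -> : K3 * M * M * nr t ^+ 2 = K3 * (M * nr t) * (M * nr t) by ring.
    by apply: ler_pM; rewrite ?mulr_ge0 ?nr_ge0 ?(ltW K30) // ler_wpM2l // ltW.
  have sn : nr s <= M2 * nr t ^+ 2.
    rewrite -[s](mulmxK uH); apply: le_trans (hB _) _.
    by rewrite /M2 -mulrA ler_wpM2l // ltW.
  have hS : nr (s *m H + t ^+ 2 *: w) <= (K3 * (M + M) * M2 + K2) * nr t ^+ 3.
    have a1 := h3 x (p + t *: u) (le_lt_trans xp Mt3) (le_lt_trans up Mt3).
    have a2 := h2 t t1.
    have -> : s *m H + t ^+ 2 *: w = - (gauss F x - gauss F (p + t *: u) - s *m H) -
       (gauss F (p + t *: u) - (q + t *: (u *m H) + t ^+ 2 *: w)).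
      rewrite Nx vE; set a := gauss F (p + t *: u); set b := q + t *: v; set c := s *m H.
      by rewrite opprB [- (a - _)]opprB [b + _ - a]addrAC addrA subrK.
    apply: le_trans (nrB _ _) _; rewrite nrN mulrDl; apply: lerD => //.
    apply: le_trans a1 _.
    have -> : K3 * (M + M) * M2 * nr t ^+ 3 = K3 * (M * nr t + M * nr t) * (M2 * nr t ^+ 2) by ring.
    by apply: ler_pM; rewrite ?mulr_ge0 ?addr_ge0 ?nr_ge0 ?(ltW K30) // ler_wpM2l ?lerD // ltW.
  have hp : nr (d.-1%:R * dmeval F p s + t ^+ 2 * ((d%:R - 2) * F2)) <=
      (K3 * (M + M) * M2 + K2) * nr t ^+ 3 * (4 * nr p).
    have -> : d.-1%:R * dmeval F p s + t ^+ 2 * ((d%:R - 2) * F2) =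
        ((s *m H + t ^+ 2 *: w) *m p^T) 0 0.
      rewrite mulmxDl -scalemxAl [RHS]mxE [X in _ = _ + X]mxE wp; congr (_ + _).
      by rewrite -(second_form_l d_gt1 homF p s) second_formC.
    apply: le_trans (nr_coord _ _ _) _; apply: le_trans (nr_mulmx _ _) _.
    rewrite mulrC; apply: ler_pM; rewrite ?nr_ge0 ?mulr_ge0 ?nr_ge0 //.
    rewrite ler_wpM2l //; apply: nr_coord_le; rewrite ?nr_ge0 // => i j.
    by rewrite mxE nr_coord.
  have hx : nr (meval (x 0) F - meval ((p + t *: u) 0) F - dmeval F p s) <=
      K4 * (M + M) * M2 * nr t ^+ 3.
    have := h4 x (p + t *: u) (le_lt_trans xp Mt4) (le_lt_trans up Mt4).
    have [_ ->] := diff_meval F p (x - (p + t *: u)).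
    move=> /le_trans; apply.
    have -> : K4 * (M + M) * M2 * nr t ^+ 3 = K4 * (M * nr t + M * nr t) * (M2 * nr t ^+ 2) by ring.
    by apply: ler_pM; rewrite ?mulr_ge0 ?addr_ge0 ?nr_ge0 ?(ltW K40) // ler_wpM2l ?lerD // ltW.
  have hl : nr (meval ((p + t *: u) 0) F - (F1 * t + F2 * t ^+ 2)) <= K5 * nr t ^+ 3.
    have := h5 t t1; rewrite hornerD hornerN hornerD !hornerZ hornerX hornerXn horner_line.
    by [].
  have hFx := hF t te1; rewrite -/x in hFx.
  have d10 : (d.-1%:R : C) != 0 by exact: pred_d_neq0.
  have dE : (d%:R : C) = d.-1%:R + 1 by rewrite natr1 prednK // ltnW.
  set m := d.-1%:R in hp d10 dE *.
  have m1 : nr m^-1 <= 1.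
    have -> : m = real_complex R d.-1%:R by rewrite rmorph_nat.
    rewrite nrV nr_real ger0_norm // invf_le1 ?ltr0n ?ler1n //; by rewrite -ltnS prednK // ltnW.
  have -> : F1 * t + F2 / m * t ^+ 2 = meval (x 0) F -
     (meval ((p + t *: u) 0) F - (F1 * t + F2 * t ^+ 2)) -
     (meval (x 0) F - meval ((p + t *: u) 0) F - dmeval F p s) -
     m^-1 * (m * dmeval F p s + t ^+ 2 * ((d%:R - 2) * F2)).
    by rewrite dE; field.
  apply: le_trans (nrB _ _) _; apply: le_trans (lerD (nrB _ _) (lexx _)) _.
  apply: le_trans (lerD (lerD (nrB _ _) (lexx _)) (lexx _)) _.
  have : nr (m^-1 * (m * dmeval F p s + t ^+ 2 * ((d%:R - 2) * F2))) <=
      (K3 * (M + M) * M2 + K2) * nr t ^+ 3 * (4 * nr p).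
    by rewrite nrM (le_trans _ hp) // ler_piMl ?nr_ge0.
  by move: hFx hl hx; lra.
pose Q : {poly C} := F1 *: 'X + (F2 / d.-1%:R) *: 'X^2.
have Qj : forall j, (j < 3)%N -> Q`_j = 0.
  apply: poly_bound_vanishing; last first.
    by move=> t _ /key; rewrite /Q hornerD !hornerZ hornerX hornerXn; apply.
  by rewrite !lt_min ltr01 e10 !divr_gt0 ?lt_min ?e30 // ltr_wpDl ?nr_ge0.
have := Qj 1%N erefl; have := Qj 2%N erefl.
rewrite /Q !coefD !coefZ !coefX !coefXn /= !mulr0 !mulr1 add0r addr0 => /eqP.
rewrite mulf_eq0 invr_eq0 (negbTE (pred_d_neq0 d_gt1)) orbF => /eqP F20.
by rewrite /F1 line_coef1; split=> //; apply/line_coef2_eq0.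
Qed.

End DualContact.

Section DualEquations.
Context {R : realType}.
Local Notation C := (Cplx R).
Local Notation form := (form4 R).
Variables (F : form) (d : nat).
Hypotheses (d_gt1 : (1 < d)%N) (homF : F \is ishomog1 d mdeg) (smoothF : smooth F).
Variable (p : hvec R).
Hypothesis (Sp : on_surface F p).
Local Notation H := (hess F p).
Local Notation q := (gauss F p).

Lemma eqmx_scale (x y : hvec R) : y != 0 -> (x == y)%MS -> exists2 c : C, c != 0 & x = c *: y.
Proof.
move=> y0 /andP[/sub_rVP[c xE] yx]; exists c => //; apply: contraNneq y0 => c0.
by move: yx; rewrite xE c0 scale0r => /submx0null ->.
Qed.

(** A point of the dual locus is represented as [gauss F (c *: x)] in the chart [l = 1]; there the
    local inverse of [P], which agrees with the Gauss map on the locus, returns [c *: x], where [G]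
    is zero. [Q] is trivial for the dual surface and parabolicity for the cuspidal curve. *)
Lemma pulled_back_vanishes (Q : hvec R -> Prop) (P : 'I_4 -> form) (l : 'cV[C]_4) psi (K r rho : R) (G : form) :
  (forall (c : C) x, c != 0 -> Q x -> Q (c *: x)) ->
  (forall x, on_surface F x -> Q x -> polymap P x = gauss F x /\ meval (x 0) G = 0) ->
  polymap P p = q -> local_inverse (polymap P) psi p K r rho -> (q *m l) 0 0 = 1 ->
  exists U W, [/\ nbhs p U, nbhs q W & forall xi,
    (exists x, [/\ U x, on_surface F x, Q x & (xi == gauss F x)%MS]) -> W xi ->
    pulled_back P p l psi rho G xi = 0].
Proof.
move=> Qscale hQ Pp inv lq; have [_ r0 _ _ _] := inv.
have [e e0 he] := normalized_preimage d_gt1 homF r0 lq.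
exists [set x | nr (x - p) < e], setT; split.
- by apply/nbhsP; exists e.
- exact: filterT.
move=> xi [x [/he[c c0 [cx Ncx]] Sx Qx /(eqmx_scale (smoothF Sx))[c' c'0 ->]]] _.
have Scx : on_surface F (c *: x) by apply: (on_surface_scale homF x c0).2.
have [Phx Gx] := hQ _ Scx (Qscale c x c0 Qx).
rewrite /pulled_back normalizeZ // -Ncx -Phx; case: ifP => // nx.
by rewrite (local_inverseK inv cx nx).
Qed.

Lemma legendre_germ (l : 'cV[C]_4) psi (K r rho : R) : H \in unitmx ->
  local_inverse (gauss F) psi p K r rho -> (q *m l) 0 0 = 1 ->
  germ_ideal F dual_surface p (pulled_back (fun j => mderiv j F) p l psi rho F).
Proof.
move=> uH inv lq; split; first exact: (pulled_back_holo uH inv lq).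
have hQ x : on_surface F x -> True -> polymap (fun j => mderiv j F) x = gauss F x /\ meval (x 0) F = 0.
  by move=> [_ Fx] _; rewrite gauss_polymap.
have [U [W [pU qW h]]] := pulled_back_vanishes (Q := fun=> True) (fun _ _ _ _ => I) hQ (congr1 (fun f => f p) (esym (gauss_polymap F))) (eq_ind _ (fun f => local_inverse f psi p K r rho) inv _ (gauss_polymap F)) lq.
exists U, W; split=> // xi [x [Ux Sx xiE]]; apply: h; by exists x.
Qed.

(** The equation of the dual branch given by [legendre_germ] belongs to the ideal, so it vanishes to
    order 3 along the line, and [legendre_contact] reads off an isotropic tangent vector of S. *)
Lemma asymptotic_dual_isotropic (N : lsub R) : ~ parabolic F p ->
  asymptotic_tangent (germ_ideal F dual_surface p) q N ->
  exists u, [/\ dmeval F p u = 0, second_form F p u u = 0, ~~ (u <= p)%MS &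
    (N == span2 q (u *m H))%MS].
Proof.
move=> npar [hN qN hI].
have uH : H \in unitmx by rewrite unitmxE unitfE; apply/eqP => /parabolicE.
have q0 := smoothF Sp.
have [l lq] := dual_coordinate smoothF Sp.
have [psi [K [r [rho inv]]]] : exists psi K r rho, local_inverse (gauss F) psi p K r rho.
  exact: inverse_polymap uH.
have [_ r0 rho0 _ _] := inv.
have [y yN yq] := line_second_point hN qN q0.
(* With a direction killed by [l], all points [q + t *: v] satisfy [l = 1], and the normalization
   inside [pulled_back] is trivial along the line. *)
pose v := y - (y *m l) 0 0 *: q.
have lv : (v *m l) 0 0 = 0.
  rewrite /v mulmxBl -scalemxAl; set a := y *m l; set b := q *m l in lq *.
  by rewrite [LHS]mxE [X in _ + X]mxE [X in - X]mxE lq mulr1 subrr.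
have vN : (v <= N)%MS.
  by rewrite /v; apply: addmx_sub => //; rewrite eqmx_opp; exact: scalemx_sub.
have vq : ~~ (v <= q)%MS.
  apply: contra yq => h; rewrite -[y](subrK ((y *m l) 0 0 *: q)); apply: addmx_sub => //.
  exact: scalemx_sub.
have /bigO_nrP[K1 [e1 [e10 h1]]] := hI _ v (legendre_germ uH inv lq) vN.
have normE (t : C) : normalize l (q + t *: v) = q + t *: v.
  suff e : ((q + t *: v) *m l) 0 0 = 1 by rewrite /normalize e invr1 scale1r.
  rewrite mulmxDl -scalemxAl; set a := q *m l in lq *; set b := v *m l in lv *.
  by rewrite [LHS]mxE [X in _ + X]mxE lq lv mulr0 addr0.
have v1 : 0 < nr v + 1 by rewrite ltr_wpDl ?nr_ge0.
have e2 : 0 < Num.min e1 (rho / (nr v + 1)) by rewrite lt_min e10 divr_gt0.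
have [|uT uu] := legendre_contact d_gt1 homF Sp uH (v := v) (K1 := K1) inv e2.
  move=> t; rewrite lt_min => /andP[te]; rewrite ltr_pdivlMr // => tr.
  have := h1 t te; rewrite /pulled_back normE.
  have -> : nr (q + t *: v - polymap ((mderiv (R:=C))^~ F) p) < rho; last by [].
  rewrite -gauss_polymap addrC addKr nrZ; apply: le_lt_trans tr.
  by rewrite ler_wpM2l ?nr_ge0 // lerDl.
exists (v *m invmx H); split=> //.
  apply: contra vq => /sub_rVP[c hc]; rewrite -(mulmxKV uH v) hc -scalemxAl (hess_euler d_gt1 homF).
  by rewrite scalerA; exact: scalemx_sub.
by rewrite mulmxKV //; exact: line_span2.
Qed.

Theorem asymptotic_tangents_dual : ~ parabolic F p ->
  exists L1 L2 : lsub R,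
    [/\ ~~ (L1 == L2)%MS,
        forall M : lsub R, asymptotic_tangent (equation F) p M <-> (M == L1)%MS \/ (M == L2)%MS &
        forall N : lsub R, asymptotic_tangent (germ_ideal F dual_surface p) q N <->
          (N == orth L1)%MS \/ (N == orth L2)%MS].
Proof.
move=> npar.
have [u1 [u2 [[u1T u2T] u1p u2p [u11 u22 u12] basis]]] := isotropic_basis d_gt1 homF smoothF Sp npar.
have u2p' : ~~ (u2 <= p)%MS by apply: contra u2p => h; exact: submx_trans h (span2_l _ _).
exists (span2 p u1), (span2 p u2); split.
- by apply: contra u2p => /andP[_ h]; exact: submx_trans (span2_r _ _) h.
- by move=> M; exact: (asymptotic_tangents_equation d_gt1 homF Sp u1T u2T u1p u2p u11 u22 u12 basis).
move=> N; split.
  move=> /(asymptotic_dual_isotropic npar)[u [uT uu up hN]].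
  have hO := orth_isotropic d_gt1 homF smoothF Sp npar uT uu up.
  have NO : (N == orth (span2 p u))%MS.
    by apply/eqmxP; apply: eqmx_trans (eqmxP hN) (eqmx_sym (eqmxP hO)).
  have trans u' : (u <= span2 p u')%MS -> ~~ (u' <= p)%MS -> (N == orth (span2 p u'))%MS.
    move=> uu' u'p; have e : (span2 p u == span2 p u')%MS.
      apply: line_eq; [exact: span2_line Sp.1 up|exact: span2_line Sp.1 u'p|].
      by apply: span2_sub => //; exact: span2_l.
    by apply/eqmxP; apply: eqmx_trans (eqmxP NO) (eqmxP (eqmx_orth e)).
  by have [h|h] := isotropic_cases d_gt1 homF Sp u1T u2T u11 u22 u12 basis uT uu; [left|right]; exact: trans.
have gen u : dmeval F p u = 0 -> second_form F p u u = 0 -> ~~ (u <= p)%MS -> (N == orth (span2 p u))%MS ->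
   asymptotic_tangent (germ_ideal F dual_surface p) q N.
  move=> uT uu up /eqmxP NO; have hO := orth_isotropic d_gt1 homF smoothF Sp npar uT uu up.
  have NO' := eqmx_trans NO (eqmxP hO).
  split.
  - by rewrite /is_line NO; exact: (is_line_orth (span2_line Sp.1 up)).
  - by rewrite NO' span2_l.
  move=> g v Ig; rewrite NO' => /span2P[a [b ->]].
  pose u' := (a / d.-1%:R) *: p + b *: u.
  have -> : a *: q + b *: (u *m H) = u' *m H.
    rewrite /u' mulmxDl -!scalemxAl (hess_euler d_gt1 homF) scalerA divfK //.
    exact: pred_d_neq0.
  have u'L : (u' <= span2 p u)%MS by apply/span2P; exists (a / d.-1%:R), b.
  have [u'T u'u'] := isotropic_in d_gt1 homF Sp uT uu u'L.
  have [K [e [K0 e0 h]]] := dual_asymptotic d_gt1 homF smoothF Sp Ig u'T u'u'.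
  by apply/bigO_nrP; exists K, e.
by case; exact: gen.
Qed.

End DualEquations.

(** * Orders of vanishing and tangent sections with an A_n singularity *)

Section OrderOfVanishing.
Context {R : realType}.
Local Notation C := (Cplx R).

(** That is, [f = O(|t|^n)] at 0. Orders add under products, which reduces Taylor comparisons to
    algebraic decompositions. *)
Definition flat {V : normedModType C} (n : nat) (f : V -> C) :=
  exists K e : R, [/\ 0 < K, 0 < e & forall t : V, nr t < e -> nr (f t) <= K * nr t ^+ n].

Lemma flat_ext (V : normedModType C) n (f g : V -> C) (e : R) : 0 < e -> (forall t, nr t < e -> f t = g t) -> flat n g -> flat n f.
Proof.
move=> e0 fg [K [e' [K0 e'0 h]]]; exists K, (Num.min e e'); split=> //; first by rewrite lt_min e0.
by move=> t; rewrite lt_min => /andP[te te']; rewrite fg //; exact: h.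
Qed.

Lemma flatD (V : normedModType C) n (f g : V -> C) : flat n f -> flat n g -> flat n (fun t => f t + g t).
Proof.
move=> [K [e [K0 e0 h]]] [K' [e' [K'0 e'0 h']]].
exists (K + K'), (Num.min e e'); split; [exact: addr_gt0|by rewrite lt_min e0|].
move=> t; rewrite lt_min => /andP[/h ht /h' h't]; apply: le_trans (nrD _ _) _.
by rewrite mulrDl lerD.
Qed.

Lemma flatM (V : normedModType C) n m (f g : V -> C) : flat n f -> flat m g -> flat (n + m) (fun t => f t * g t).
Proof.
move=> [K [e [K0 e0 h]]] [K' [e' [K'0 e'0 h']]].
exists (K * K'), (Num.min e e'); split; [exact: mulr_gt0|by rewrite lt_min e0|].
move=> t; rewrite lt_min => /andP[/h ht /h' h't].
by rewrite nrM exprD mulrACA ler_pM ?nr_ge0.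
Qed.

Lemma flatW (V : normedModType C) n m (f : V -> C) : (m <= n)%N -> flat n f -> flat m f.
Proof.
move=> mn [K [e [K0 e0 h]]]; exists K, (Num.min e 1); split=> //; first by rewrite lt_min e0 ltr01.
move=> t; rewrite lt_min => /andP[/h ht t1]; apply: le_trans ht _.
rewrite (ler_wpM2l (ltW K0)) // -(subnK mn) exprD ler_piMl ?exprn_ge0 ?nr_ge0 //.
by rewrite exprn_ile1 ?nr_ge0 ?ltW.
Qed.

Lemma flat_monomial (c : C) n : flat n (fun t : C => c * t ^+ n).
Proof.
exists (nr c + 1), 1; split=> //; first by rewrite ltr_wpDl ?nr_ge0.
by move=> t _; rewrite nrM nrX ler_wpM2r ?exprn_ge0 ?nr_ge0 // lerDl.
Qed.

Lemma flat_cst (V : normedModType C) (c : C) : flat 0 (fun _ : V => c).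
Proof.
by exists (nr c + 1), 1; split=> [||t _]; rewrite ?expr0 ?mulr1 ?lerDl // ltr_wpDl ?nr_ge0.
Qed.

Lemma flatX (V : normedModType C) n k (f : V -> C) : flat n f -> flat (n * k) (fun t => f t ^+ k).
Proof.
move=> hf; elim: k => [|k IH]; first by rewrite muln0; exact: (flat_cst V 1).
by rewrite mulnS; apply: (flat_ext ltr01) (flatM hf IH) => t _; rewrite exprS.
Qed.

Lemma flat_coef (Q : {poly C}) n : flat n (fun t : C => Q.[t]) -> forall j, (j < n)%N -> Q`_j = 0.
Proof.
by move=> [K [e [K0 e0 h]]]; apply: (poly_bound_vanishing (K := K) e0) => t _; exact: h.
Qed.

Lemma holo_flat (g : hvec R -> C) q (x : hvec R) : holomorphic_at q g ->
  flat 2 (fun t : C => g (q + t *: x) - (g q + 'd g q x * t)).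
Proof.
move=> hg; have [dl dl0 h] := holo_lip2_at hg.
have [|K [e [K0 e0 hK]]] := h q; first by rewrite subrr nr0.
have x1 : 0 < nr x + 1 by rewrite ltr_wpDl ?nr_ge0.
exists (K * (nr x + 1) ^+ 2), (e / (nr x + 1)); split; [by rewrite mulr_gt0 ?exprn_gt0|exact: divr_gt0|].
move=> t; rewrite ltr_pdivlMr // => te.
have tx : nr t * nr x < e by apply: le_lt_trans te; rewrite ler_wpM2l ?nr_ge0 // lerDl.
have e1 : q + t *: x - q = t *: x by rewrite addrC addKr.
have := hK (q + t *: x) q; rewrite subrr nr0 addr0 e1 nrZ => /(_ tx e0).
have -> : 'd g q (t *: x) = 'd g q x * t by rewrite linearZ mulrC.
rewrite opprD addrA => hh; apply: le_trans hh _.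
rewrite -mulrA -expr2 -[leRHS]mulrA (ler_wpM2l (ltW K0)) // exprMn mulrC ler_wpM2r ?exprn_ge0 ?nr_ge0 //.
by rewrite lerXn2r ?nnegrE ?nr_ge0 ?ltW // ltrDl.
Qed.

Lemma holo_flat1 (g : hvec R -> C) q (x : hvec R) : holomorphic_at q g ->
  flat 1 (fun t : C => g (q + t *: x) - g q).
Proof.
move=> hg; apply: (flat_ext ltr01) (flatD (flatW (isT : 1 <= 2)%N (holo_flat x hg)) (flat_monomial ('d g q x) 1)).
by move=> t _; rewrite expr1; ring.
Qed.

Lemma holo_flat_at (g : hvec R -> C) q (x : hvec R) a : holomorphic_at q g -> g q = 0 -> a = 'd g q x ->
  flat 2 (fun t : C => g (q + t *: x) - a * t).
Proof. by move=> /(holo_flat x)[K [e [K0 e0 h]]] g0 ->; exists K, e; split=> // t /h; rewrite g0 add0r. Qed.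

(** [g] takes the same value at [(1 + t) *: q] and at [q]. *)
Lemma proj_diff_self (g : hvec R -> C) q : proj_holomorphic_at q g -> 'd g q q = 0.
Proof.
move=> [sg hg]; have [K [e [K0 e0 h]]] := holo_flat q hg.
apply/nr_eq0/le_anti; rewrite nr_ge0 andbT.
apply: (le0_small (K := K) (e := Num.min e 1)); first by rewrite lt_min e0 ltr01.
move=> t t0; rewrite lt_min => /andP[te t1].
have tn : 0 < nr t by exact: nr_gt0.
have := h t te; have -> : q + t *: q = (1 + t) *: q by rewrite scalerDl scale1r.
rewrite sg; last first.
  by apply: contraTneq t1 => /eqP; rewrite addrC addr_eq0 => /eqP ->; rewrite nrN -[1]/(real_complex R 1 : C) nr_real normr1 ltxx.
rewrite opprD addrA subrr add0r nrN nrM expr2 mulrA ler_pM2r //.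
Qed.
End OrderOfVanishing.

Section TangentSection.
Context {R : realType}.
Local Notation C := (Cplx R).
Local Notation form := (form4 R).
Variables (F : form) (d : nat).
Hypotheses (d_gt1 : (1 < d)%N) (homF : F \is ishomog1 d mdeg) (smoothF : smooth F).
Variable (p : hvec R).
Hypothesis (Sp : on_surface F p).
Local Notation H := (hess F p).
Local Notation q := (gauss F p).
Local Notation second_form := (second_form F p).

Section Coordinates.
Variables (n : nat) (u v e : hvec R -> C).
Hypotheses (n_gt1 : (1 < n)%N) (hu : proj_holomorphic_at p u) (hv : proj_holomorphic_at p v)
  (he : holomorphic_at p e) (u0 : u p = 0) (v0 : v p = 0)
  (FE : \forall x \near p, x *m q^T = 0 -> meval (x 0) F = e x * (u x ^+ 2 - v x ^+ n.+1)).

Lemma section_flat x m a : dmeval F p x = 0 ->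
  flat m (fun t : C => e (p + t *: x) * (u (p + t *: x) ^+ 2 - v (p + t *: x) ^+ n.+1) - (a : {poly C}).[t]) ->
  forall j, (j < m)%N -> (line_poly p x F)`_j = a`_j.
Proof.
move=> xT hf; have [r r0 hr] := (nbhsP _ _).1 FE.
have x1 : 0 < nr x + 1 by rewrite ltr_wpDl ?nr_ge0.
suff hQ : flat m (fun t => (line_poly p x F - a).[t]).
  by move=> j jm; apply/eqP; rewrite -subr_eq0 -coefB; apply/eqP; exact: flat_coef hQ j jm.
apply: flat_ext hf; first exact: (divr_gt0 r0 x1).
move=> t; rewrite ltr_pdivlMr // => tr; rewrite hornerD hornerN horner_line hr //.
  rewrite addrC addKr nrZ; apply: le_lt_trans tr.
  by rewrite ler_wpM2l ?nr_ge0 // lerDl.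
apply/rowP => i; rewrite ord1 -dmeval_gauss [RHS]mxE -{2}[p]scale1r dmeval_lin.
by rewrite (dmeval_self homF Sp) xT !mulr0 addr0.
Qed.

(** Along a tangent line [v ^+ n.+1] has order at least 3, so the quadratic part of
    [e * (u ^+ 2 - v ^+ n.+1)] is [e p] times the square of the differential of [u]. *)
Lemma section_second x : dmeval F p x = 0 -> second_form x x = 2 * e p * 'd u p x ^+ 2.
Proof.
move=> xT; have <- : (line_poly p x F)`_2 *+ 2 = second_form x x by exact: line_coef2.
rewrite (section_flat (m := 3) (a := (e p * 'd u p x ^+ 2) *: 'X^2)) //.
  by rewrite coefZ coefXn eqxx /= mulr1 mulr2n; ring.
have fu := holo_flat x hu.2; have fv := holo_flat1 x hv.2; have fe := holo_flat1 x he.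
have fu1 := holo_flat1 x hu.2.
have f1 := flatM fe (flatX 2 fu1).
have f2 := flatM (flat_cst C (e p)) (flatM fu (flatD fu1 (flat_monomial ('d u p x) 1))).
have f3 : flat 3 (fun t : C => e (p + t *: x) * (- v (p + t *: x) ^+ n.+1)).
  have fe0 := flatD (flatW (isT : (0 <= 1)%N) fe) (flat_cst C (e p)).
  have h3 : (3 <= 0 + 1 * n.+1)%N by rewrite add0n mul1n.
  apply: (flat_ext ltr01) (flatM fe0 (flatW h3 (flatM (flat_cst C (-1)) (flatX n.+1 fv)))) => t _.
  by rewrite v0 subr0 subrK mulN1r.
apply: (flat_ext ltr01) (flatD f1 (flatD f2 f3)) => t _.
by rewrite u0 hornerZ hornerXn expr1; ring.
Qed.

(** In the direction where the differential of [u] vanishes, [u ^+ 2] has order at least 4 and the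
    cubic part comes from [v ^+ 3] alone. *)
Lemma section_cubic x w : n = 2%N -> dmeval F p x = 0 -> 'd u p x = 0 -> w = 'd v p x ->
  (line_poly p x F)`_3 = - (e p * w ^+ 3).
Proof.
move=> n2 xT ux wE; rewrite (section_flat (m := 4) (a := (- (e p * w ^+ 3)) *: 'X^3)) //.
  by rewrite coefZ coefXn eqxx mulr1.
have fu := holo_flat_at hu.2 u0 (esym ux); have fv := holo_flat_at hv.2 v0 wE.
have fe := holo_flat1 x he; have fm := flat_monomial w 1.
have fv1 := flatD (flatW (isT : (1 <= 2)%N) fv) fm.
have fe0 := flatD (flatW (isT : (0 <= 1)%N) fe) (flat_cst C (e p)).
have f1 := flatM fe0 (flatX 2 fu).
have f2 := flatM fe (flatM (flat_cst C (-1)) (flatX 3 fv1)).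
have f3 := flatM (flat_cst C (- e p)) (flatM fv (flatD (flatX 2 fv1) (flatD (flatM fv1 fm) (flatX 2 fm)))).
apply: (flat_ext ltr01) (flatD f1 (flatD f2 f3)) => t _.
rewrite n2 hornerZ hornerXn expr1; move: (u _) (v _) (e _) (e p) => a b c c'; ring.
Qed.
End Coordinates.

Lemma second_formP x y : second_form (x + y) (x + y) = second_form x x + 2 * second_form x y + second_form y y.
Proof.
rewrite -[x]scale1r -[y]scale1r second_formDl !second_formDr !scale1r (second_formC F p y x); ring.
Qed.

Definition dlinear (g : hvec R -> C) := forall (a b : C) x y, g (a *: x + b *: y) = a * g x + b * g y.

Lemma tangent_section_forms n : (1 < n)%N -> tangent_section_A n F p ->
  exists (du dv : hvec R -> C) (e : C),
    [/\ dlinear du /\ dlinear dv, e != 0 /\ du p = 0 /\ dv p = 0,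
        forall x, dmeval F p x = 0 -> second_form x x = 2 * e * du x ^+ 2,
        forall x, dmeval F p x = 0 -> du x = 0 -> dv x = 0 -> (x <= p)%MS &
        n = 2%N -> forall x, dmeval F p x = 0 -> du x = 0 -> (line_poly p x F)`_3 = - (e * dv x ^+ 3)].
Proof.
move=> n1 [u [v [e [[hu hv he] [u0 v0 e0] ker FE]]]].
have dL (g : hvec R -> C) : dlinear ('d g p).
  by move=> a b x y; rewrite linearD !linearZ.
exists ('d u p), ('d v p), (e p); split.
- by split; exact: dL.
- exact: (conj e0 (conj (proj_diff_self hu) (proj_diff_self hv))).
- exact: (section_second n1 hu hv he u0 v0 FE).
- by move=> x xT; apply: ker; apply/rowP => i; rewrite ord1 -dmeval_gauss xT mxE.
- by move=> n2 x xT ux; exact: (section_cubic hu hv he u0 v0 FE n2 xT ux erefl).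
Qed.

(** The second fundamental form is a nonzero multiple of the square of the linear form [du], hence
    of rank 1 modulo [p]: its radical is the single asymptotic tangent. For a cusp the cubic
    coefficient along it is a nonzero multiple of the cube of [dv]. *)
Lemma tangent_section_line n : (1 < n)%N -> tangent_section_A n F p ->
  exists k : hvec R,
    [/\ dmeval F p k = 0, ~~ (k <= p)%MS, k *m H = 0,
        forall x, dmeval F p x = 0 -> (x *m H <= q)%MS -> (x <= span2 p k)%MS &
        (forall M : lsub R, asymptotic_tangent (equation F) p M <-> (M == span2 p k)%MS) /\
        (n = 2%N -> (line_poly p k F)`_3 != 0)].
Proof.
move=> n1 /(tangent_section_forms n1)[du [dv [e [[dLu dLv] [e0 [up vp]] uuE kerT cub]]]].
have p0 := Sp.1; have pT := dmeval_self homF Sp.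
have linT x y a b : dmeval F p x = 0 -> dmeval F p y = 0 -> dmeval F p (a *: x + b *: y) = 0.
  by move=> xT yT; rewrite dmeval_lin xT yT !mulr0 addr0.
have duD x y : du (x + y) = du x + du y by have := dLu 1 1 x y; rewrite !scale1r !mul1r.
(* Polarization of the formula on the diagonal. *)
have uvE x y : dmeval F p x = 0 -> dmeval F p y = 0 -> second_form x y = 2 * e * (du x * du y).
  move=> xT yT; have xyT : dmeval F p (x + y) = 0.
    by have := linT x y 1 1 xT yT; rewrite !scale1r.
  have := uuE _ xyT; rewrite second_formP (uuE x xT) (uuE y yT) duD => h.
  have h2 : 2 * second_form x y = 2 * (2 * e * (du x * du y)).
    by apply: (addIr (2 * e * du y ^+ 2)); apply: (addrI (2 * e * du x ^+ 2)); rewrite addrA h; ring.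
  by apply: mulfI h2; rewrite pnatr_eq0.
have [a aT ap] : exists2 a, dmeval F p a = 0 & ~~ (a <= p)%MS.
  by apply: tangent_notin; rewrite // rank_rV p0.
have [b bT bp] : exists2 b, dmeval F p b = 0 & ~~ (b <= span2 p a)%MS.
  by apply: tangent_notin; rewrite // (span2_line p0 ap).
have bp' : ~~ (b <= p)%MS by apply: contra bp => h; exact: submx_trans h (span2_l _ _).
have noT (g h : hvec R -> C) : dlinear g -> dlinear h -> (forall x, dmeval F p x = 0 -> g x = 0 -> h x = 0 -> (x <= p)%MS) ->
    exists2 w, dmeval F p w = 0 & g w != 0.
  move=> gL hL kk; have [ga|ga] := eqVneq (g a) 0; last by exists a.
  have [gb|gb] := eqVneq (g b) 0; last by exists b.
  exfalso; have [ha|ha] := eqVneq (h a) 0; first by move: ap; rewrite kk.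
  have : (b - (h b / h a) *: a <= p)%MS.
    have E : b - (h b / h a) *: a = 1 *: b + (- (h b / h a)) *: a by rewrite scale1r scaleNr.
    rewrite E; apply: kk; [exact: linT|by rewrite gL ga gb !mulr0 addr0|].
    by rewrite hL mul1r mulNr divfK // subrr.
  move=> h1; move/negP: bp; apply; rewrite -[b](subrK ((h b / h a) *: a)).
  apply: addmx_sub; first exact: submx_trans h1 (span2_l _ _).
  by apply: scalemx_sub; exact: span2_r.
have [w wT uw] := noT du dv dLu dLv kerT.
have [k1 [k1T k1p uk1]] : exists k1, [/\ dmeval F p k1 = 0, ~~ (k1 <= p)%MS & du k1 = 0].
  have [w' w'T w'0] := noT dv du dLv dLu (fun x xT vx ux => kerT x xT ux vx).
  have [ua|ua] := eqVneq (du a) 0; first by exists a.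
  exists (1 *: b + (- (du b / du a)) *: a); split; first exact: linT.
    apply: contra bp => h1; rewrite -[b](subrK ((du b / du a) *: a)).
    apply: addmx_sub; last by apply: scalemx_sub; exact: span2_r.
    by apply: submx_trans (span2_l p a); move: h1; rewrite scale1r scaleNr.
  by rewrite dLu mul1r mulNr divfK // subrr.
have [c hc] : exists c, k1 *m H = c *: (p *m H).
  apply: (kernel_second_form d_gt1 homF smoothF Sp k1T) => y yT.
  by rewrite uvE // uk1 mul0r mulr0.
(* [k1 *m H] is a multiple of [p *m H]; correcting by a multiple of [p] stays on the same line and
   yields a true kernel vector of [H]. *)
pose k := 1 *: k1 + (- c) *: p.
have kT : dmeval F p k = 0 by exact: linT.
have uk : du k = 0 by rewrite dLu uk1 up !mulr0 addr0.
have kp : ~~ (k <= p)%MS.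
  apply: contra k1p => h; have -> : k1 = k + c *: p by rewrite /k scale1r scaleNr subrK.
  by apply: addmx_sub h _; exact: scalemx_sub.
have vk : dv k != 0 by apply: contra kp => /eqP vk; exact: kerT.
have inL x : dmeval F p x = 0 -> du x = 0 -> (x <= span2 p k)%MS.
  move=> xT ux; rewrite -[x](subrK ((dv x / dv k) *: k)).
  apply: addmx_sub; last by apply: scalemx_sub; exact: span2_r.
  apply: submx_trans (span2_l p k).
  have -> : x - (dv x / dv k) *: k = 1 *: x + (- (dv x / dv k)) *: k by rewrite scale1r scaleNr.
  apply: kerT; [exact: linT|by rewrite dLu ux uk !mulr0 addr0|].
  by rewrite dLv mul1r mulNr divfK // subrr.
have e2 : 2 * e != 0 by rewrite mulf_neq0 // pnatr_eq0.
exists k; split=> //.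
- by rewrite /k mulmxDl -!scalemxAl hc scale1r scaleNr subrr.
- move=> x xT /sub_rVP[c' hx]; apply: inL => //.
  have : second_form x w = 0.
    have : (w *m q^T) 0 0 = 0 by rewrite -dmeval_gauss.
    by rewrite dot_sym => h; rewrite -[LHS]/((x *m H *m w^T) 0 0) hx -scalemxAl; move: h; set A := q *m _ => h; rewrite mxE h mulr0.
  by move/eqP; rewrite uvE // !mulf_eq0 (negbTE (_ : e != 0)) // (negbTE uw) pnatr_eq0 /= orbF => /eqP.
split=> [M|n2].
- rewrite (asymptotic_tangent_equation _ Sp); split.
    move=> [hM pM hv']; apply: line_eq => //; first exact: span2_line.
    apply/rV_subP => x /hv'[xT xx]; apply: inL => //.
    have : second_form x x = 0 by [].
    by move/eqP; rewrite uuE // mulf_eq0 (negbTE e2) expf_eq0 => /eqP.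
  move=> /eqmxP hM; split; [by rewrite /is_line hM; exact: span2_line|by rewrite hM span2_l|].
  move=> x; rewrite hM => /span2P[a' [b' ->]]; have xT := linT p k a' b' pT kT.
  by split=> //; have := uuE _ xT; rewrite dLu up uk !mulr0 addr0 expr0n mulr0.
- rewrite (cub n2 k kT uk) oppr_eq0.
  by rewrite mulf_neq0 // expf_neq0.
Qed.
End TangentSection.

(** * The derivative of the Hessian determinant and assertion (c) *)

Section Derivation.
Context {S : comNzRingType} (D : S -> S).
Hypotheses (DD : {morph D : a b / a + b}) (DM : forall a b, D (a * b) = D a * b + a * D b).

Let D0 : D 0 = 0.
Proof. by apply: (addrI (D 0)); rewrite -DD !addr0. Qed.

Let D1 : D 1 = 0.
Proof. by have := DM 1 1; rewrite !mulr1 mul1r -{1}[D 1]addr0 => /addrI. Qed.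

Let DN a : D (- a) = - D a.
Proof. by apply/eqP; rewrite -addr_eq0 -DD addNr D0. Qed.

Lemma derivation_sum (I : Type) (r : seq I) (f : I -> S) : D (\sum_(i <- r) f i) = \sum_(i <- r) D (f i).
Proof. exact: (big_morph D DD D0). Qed.

Lemma derivation_prod n (f : 'I_n -> S) :
  D (\prod_i f i) = \sum_i \prod_j (if j == i then D (f j) else f j).
Proof.
elim: n f => [|n IH] f; first by rewrite !big_ord0 D1.
rewrite !big_ord_recl DM IH eqxx; congr (_ * _ + _).
rewrite big_distrr; apply: eq_bigr => i _; rewrite big_ord_recl /=; congr (_ * _).
Qed.

(** Jacobi's formula: the determinant is differentiated one row at a time, and each resulting
    determinant is expanded along the differentiated row. *)
Lemma det_derivation n (A : 'M[S]_n) : D (\det A) = \sum_i \sum_j D (A i j) * \adj A j i.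
Proof.
pose B i := \matrix_(a, b) (if a == i then D (A a b) else A a b).
transitivity (\sum_i \det (B i)).
  rewrite /determinant exchange_big derivation_sum; apply: eq_bigr => s _ /=.
  rewrite -mulr_sumr !mulr_sign (fun_if D) DN derivation_prod.
  by case: ifP => _; [congr (- _)|]; apply: eq_bigr => i _; apply: eq_bigr => j _; rewrite mxE.
apply: eq_bigr => i _; rewrite (expand_det_row _ i); apply: eq_bigr => j _.
rewrite !mxE eqxx; congr (_ * (_ * \det _)); apply/matrixP => a b; rewrite !mxE.
by rewrite eq_sym (negbTE (neq_lift _ _)).
Qed.
End Derivation.

Section HessianDeterminant.
Context {R : realType}.
Local Notation C := (Cplx R).
Local Notation form := (form4 R).

Lemma dmeval_hessian (F : form) (x v : hvec R) :
  dmeval (hessian F) x v = \sum_i \sum_j (\sum_l v 0 l * meval (x 0) (mderiv l (mderiv i (mderiv j F)))) * \adj (hess F x) j i.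
Proof.
rewrite /dmeval.
transitivity (\sum_l \sum_i \sum_j v 0 l * meval (x 0) (mderiv l (mderiv i (mderiv j F))) * \adj (hess F x) j i).
  apply: eq_bigr => l _; rewrite /hessian (det_derivation (mderivD l) (mderivM l)) raddf_sum mulr_sumr.
  apply: eq_bigr => i _; rewrite raddf_sum mulr_sumr; apply: eq_bigr => j _.
  rewrite /= mevalM mxE mulrA; congr (_ * _).
  by rewrite /hess /jac -map_mx_adj [RHS]mxE.
rewrite exchange_big; apply: eq_bigr => i _; rewrite exchange_big; apply: eq_bigr => j _.
by rewrite mulr_suml.
Qed.

Lemma line_coef3 (F : form) (x v : hvec R) : (line_poly x v F)`_3 *+ 6 = third F x v v v.
Proof.
rewrite -[6%N]/(3 * 2)%N mulrnA line_coefS -sumrMnl /third; apply: eq_bigr => i _.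
rewrite -mulrnAr line_coefS mulr_sumr; apply: eq_bigr => j _; rewrite line_coef1 /dmeval !mulr_sumr.
apply: eq_bigr => l _; rewrite mulrA mulrA mulrA; congr (_ * meval _ _).
by rewrite (mderiv_comm i j) (mderiv_comm i l) (mderiv_comm j l).
Qed.

Lemma symmetric_rank1 (A : 'M[C]_4) (k : hvec R) : k != 0 -> A != 0 -> A^T = A ->
  (forall i, exists b, row i A = b *: k) ->
  exists2 c, c != 0 & forall i j, A i j = c * (k 0 i * k 0 j).
Proof.
move=> k0 A0 sA h.
have [m km] : exists m, k 0 m != 0.
  have : ~~ [forall i, k 0 i == 0].
    by apply: contra k0 => /forallP h'; apply/eqP/rowP => i; rewrite [RHS]mxE; exact/eqP.
  by case/forallPn => i hi; exists i.
pose b i := A i m / k 0 m.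
have AE i j : A i j = b i * k 0 j.
  have [b' /rowP hb] := h i; have hj j' : A i j' = b' * k 0 j' by have := hb j'; rewrite !mxE.
  by rewrite /b !hj mulfK.
have bE i : b i = b m / k 0 m * k 0 i.
  have := congr1 (fun M : 'M[C]_4 => M m i) sA; rewrite mxE !AE => h'.
  by rewrite mulrAC -h' mulfK.
exists (b m / k 0 m).
  by apply: contraNneq A0 => c0; apply/eqP/matrixP => i j; rewrite AE bE c0 !mul0r mxE.
by move=> i j; rewrite AE bE mulrA.
Qed.

(** [n] and [k] are dual to the differentials of [F] and [G] at [p], which are therefore
    independent; the statement gives points of the curve [F = G = 0] tangent to [u]. *)
Lemma intersection_curve (F G : form) (p n k u : hvec R) :
  meval (p 0) F = 0 -> meval (p 0) G = 0 ->
  dmeval F p n = 1 -> dmeval G p n = 0 -> dmeval F p k = 0 -> dmeval G p k = 1 ->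
  dmeval F p u = 0 -> dmeval G p u = 0 ->
  exists K e : R, [/\ 0 < K, 0 < e & forall t : C, nr t < e ->
    exists2 z, nr (z - (p + t *: u)) <= K * nr t ^+ 2 & meval (z 0) F = 0 /\ meval (z 0) G = 0].
Proof.
move=> Fp Gp Fn Gn Fk Gk Fu Gu.
have dl (P : form) a (x : hvec R) b y : dmeval P p (a *: x + b *: y) = a * dmeval P p x + b * dmeval P p y.
  by have := dmeval_lin P p a b x y.
have lip2 (P : form) : exists K e : R, [/\ 0 < K, 0 < e & forall y z, nr (y - p) < e -> nr (z - p) < e ->
    nr (meval (y 0) P - meval (z 0) P - dmeval P p (y - z)) <= K * (nr (y - p) + nr (z - p)) * nr (y - z)].
  have [dl' dl0 h] := holo_lip2_at (holo_meval P p).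
  have [|K [e [K0 e0 hK]]] := h p; first by rewrite subrr nr0.
  by exists K, e; split=> // y z hy hz; have := hK y z hy hz; rewrite (diff_meval P p (y - z)).2.
have [KF [eF [KF0 eF0 hF]]] := lip2 F; have [KG [eG [KG0 eG0 hG]]] := lip2 G.
(* [T] has the identity as strict derivative at [p]. If [T z = p + t *: u], then [z - p] is [t *: u]
   minus the two corrections; applying the differentials of [F] and [G] to it gives exactly
   [F(z) = G(z) = 0]. *)
pose T (x : hvec R) := x + (meval (x 0) F - dmeval F p (x - p)) *: n + (meval (x 0) G - dmeval G p (x - p)) *: k.
have dB (P : form) x y : dmeval P p (x - y) = dmeval P p x - dmeval P p y.
  by have := dl P 1 x (-1) y; rewrite scale1r scaleN1r mul1r mulN1r.
have d0 (P : form) : dmeval P p 0 = 0 by have := dB P 0 0; rewrite !subrr.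
have Tp : T p = p by rewrite /T Fp Gp !subrr !d0 !subrr !scale0r !addr0.
pose K := KF * nr n + KG * nr k + 1.
have K0 : 0 < K by rewrite ltr_wpDl // addr_ge0 // mulr_ge0 ?nr_ge0 ?ltW.
pose e := Num.min eF eG.
have e0 : 0 < e by rewrite lt_min eF0.
have Tlip y z : nr (y - p) < e -> nr (z - p) < e ->
    nr (T y - T z - (y - z)) <= K * (nr (y - p) + nr (z - p)) * nr (y - z).
  rewrite !lt_min => /andP[yF yG] /andP[zF zG].
  have -> : T y - T z - (y - z) = (meval (y 0) F - meval (z 0) F - dmeval F p (y - z)) *: n +
      (meval (y 0) G - meval (z 0) G - dmeval G p (y - z)) *: k.
    rewrite /T !dB; move: (meval (y 0) F) (meval (z 0) F) (meval (y 0) G) (meval (z 0) G) => a b a' b'.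
    move: (dmeval F p y) (dmeval F p z) (dmeval F p p) (dmeval G p y) (dmeval G p z) (dmeval G p p) => c1 c2 c3 c4 c5 c6.
    by apply/rowP => i; rewrite !mxE; ring.
  apply: le_trans (nrD _ _) _; rewrite !nrZ.
  have := ler_wpM2r (nr_ge0 n) (hF y z yF zF); have := ler_wpM2r (nr_ge0 k) (hG y z yG zG).
  have : 0 <= (nr (y - p) + nr (z - p)) * nr (y - z) by rewrite mulr_ge0 ?addr_ge0 ?nr_ge0.
  set s := nr (y - p) + nr (z - p); set w := nr (y - z) => sw h1 h2.
  have -> : K * s * w = KF * s * w * nr n + KG * s * w * nr k + s * w by rewrite /K; ring.
  by apply: le_trans (lerD h2 h1) _; rewrite lerDl.
have bid : blin (fun v : hvec R => v).
  by split=> //; exists 1 => // v; rewrite mul1r.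
have sT : sdiff T p (fun v => v) := lip2_sdiff bid K0 e0 Tlip.
have [K1 [e1 [K10 e10 hs]]] := local_surjectivity sT bid (fun _ => erefl) (fun _ => erefl).
have u1 : 0 < nr u + 1 by rewrite ltr_wpDl ?nr_ge0.
exists (K * (K1 * (nr u + 1)) ^+ 2), (Num.min e1 (e / K1) / (nr u + 1)); split.
- by rewrite mulr_gt0 // exprn_gt0 // mulr_gt0.
- by rewrite divr_gt0 // lt_min e10 divr_gt0.
move=> t; rewrite ltr_pdivlMr // lt_min ltr_pdivlMr // => /andP[te1 te].
have tu : nr (t *: u) <= nr t * (nr u + 1) by rewrite nrZ ler_wpM2l ?nr_ge0 // lerDl.
have [|z hz Tz] := hs (p + t *: u); first by rewrite Tp addrC addKr; exact: le_lt_trans te1.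
rewrite Tp in hz; have ptp : p + t *: u - p = t *: u by rewrite addrC addKr.
rewrite ptp in hz; have zp : nr (z - p) <= K1 * (nr u + 1) * nr t.
  by apply: le_trans hz _; rewrite -mulrA ler_wpM2l ?(ltW K10) // mulrC.
exists z.
  have := Tlip z p; rewrite Tp Tz subrr nr0 addr0 => h.
  have -> : z - (p + t *: u) = - (p + t *: u - p - (z - p)).
    by rewrite opprB ptp; apply/rowP => i; rewrite !mxE; ring.
  rewrite nrN; apply: le_trans (h _ e0) _.
    by apply: le_lt_trans zp _; rewrite -mulrA mulrC (mulrC _ (nr t)).
  rewrite -mulrA -[leRHS]mulrA (ler_wpM2l (ltW K0)) // -expr2 -exprMn lerXn2r ?nnegrE ?nr_ge0 //.
  by rewrite mulr_ge0 ?nr_ge0 // mulr_ge0 ?ltW.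
have [a' [b' [aE bE TzE]]] : exists a' b', [/\ a' = meval (z 0) F - dmeval F p (z - p),
    b' = meval (z 0) G - dmeval G p (z - p) & T z = z + a' *: n + b' *: k].
  by exists (meval (z 0) F - dmeval F p (z - p)), (meval (z 0) G - dmeval G p (z - p)).
have zpE : z - p = t *: u + (- a') *: n + (- b') *: k.
  rewrite TzE in Tz; apply: (addIr (a' *: n + b' *: k + p)).
  have -> : z - p + (a' *: n + b' *: k + p) = z + a' *: n + b' *: k by apply/rowP => i; rewrite !mxE; ring.
  by rewrite Tz; apply/rowP => i; rewrite !mxE; ring.
have E (P : form) : dmeval P p (z - p) = t * dmeval P p u - a' * dmeval P p n - b' * dmeval P p k.
  by rewrite zpE -[t *: u + _]scale1r !dl mul1r !mulNr.
have FE := E F; have GE := E G.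
rewrite Fn Fk Fu mulr0 mulr0 mulr1 sub0r subr0 in FE; rewrite Gn Gk Gu mulr0 mulr0 mulr1 !sub0r in GE.
split.
  by move: aE; rewrite FE opprK -{1}[a']add0r => /addIr.
by move: bE; rewrite GE oppr0 add0r opprK -{1}[b']add0r => /addIr.
Qed.
End HessianDeterminant.

Section CuspidalEdge.
Context {R : realType}.
Local Notation C := (Cplx R).
Local Notation form := (form4 R).
Variables (F : form) (d : nat).
Hypotheses (d_gt1 : (1 < d)%N) (homF : F \is ishomog1 d mdeg) (smoothF : smooth F).
Variable (p : hvec R).
Hypothesis (Sp : on_surface F p).
Local Notation H := (hess F p).
Local Notation q := (gauss F p).

Lemma cuspidal_germ (g : hvec R -> C) : germ_ideal F cuspidal_curve p g ->
  exists2 e : R, 0 < e & forall x, nr (x - p) < e -> meval (x 0) F = 0 -> parabolic F x -> g (gauss F x) = 0.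
Proof.
move=> [_ [U [W [/nbhsP[e1 e10 hU] /nbhsP[e2 e20 hW] h]]]].
have [e3 e30 h3] := sdiff_near (sdiff_gauss F p) e20.
have p1 : 0 < nr p by apply: nr_gt0; exact: Sp.1.
exists (Num.min (Num.min e1 e3) (nr p)); first by rewrite !lt_min e10 e30.
move=> x; rewrite !lt_min => /andP[/andP[x1 x3] xp] Fx px; apply: h; last by apply: hW; exact: h3.
exists x; split=> //; [exact: hU|split=> //|by rewrite !submx_refl].
by apply: contraTneq xp => ->; rewrite sub0r nrN ltxx.
Qed.

Section Kernel.
Variable (k : hvec R).
Hypotheses (par : parabolic F p) (kT : dmeval F p k = 0) (kp : ~~ (k <= p)%MS) (kH : k *m H = 0)
  (asy : forall x, dmeval F p x = 0 -> (x *m H <= q)%MS -> (x <= span2 p k)%MS)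
  (cub : (line_poly p k F)`_3 != 0).

Let k0 : k != 0.
Proof. by apply: contraNneq kp => ->; exact: sub0mx. Qed.

Lemma hess_kernel (x : hvec R) : x *m H = 0 -> exists b, x = b *: k.
Proof.
move=> xH; have xT : dmeval F p x = 0.
  by rewrite dmeval_gauss (dot_gauss d_gt1 homF) xH mul0mx mxE mulr0.
have /span2P[a [b xE]] : (x <= span2 p k)%MS by apply: asy => //; rewrite xH sub0mx.
exists b; move: xH; rewrite xE mulmxDl -!scalemxAl kH scaler0 addr0 (hess_euler d_gt1 homF) scalerA.
move/eqP; rewrite scaler_eq0 (negbTE (smoothF Sp)) orbF mulf_eq0 (negbTE (pred_d_neq0 d_gt1)) orbF.
by move=> /eqP ->; rewrite scale0r add0r.
Qed.

Lemma hess_rank3 : \rank H = 3%N.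
Proof.
have : (kermx H <= k)%MS.
  apply/row_subP => i; have : row i (kermx H) *m H = 0 by rewrite -row_mul mulmx_ker row0.
  by move=> /hess_kernel[b ->]; exact: scalemx_sub.
have : (k <= kermx H)%MS by apply/sub_kermxP.
move=> /mxrankS h1 /mxrankS; rewrite mxrank_ker rank_rV k0 in h1 *.
by move: h1; case: (\rank H) => [|[|[|[|[|n]]]]].
Qed.

(** By symmetry the image of [H] lies in the orthogonal of its kernel, and the ranks agree. *)
Lemma hess_image (v : hvec R) : (v *m k^T) 0 0 = 0 -> exists u, v = u *m H.
Proof.
move=> vk; suff /submxP[u ->] : (v <= H)%MS by exists u.
have kHk : (H <= kermx k^T)%MS.
  by apply/sub_kermxP; rewrite -(hess_sym F p) -trmx_mul kH trmx0.
have : (kermx k^T <= H)%MS.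
  by rewrite -(geq_leqif (mxrank_leqif_sup kHk)) hess_rank3 mxrank_ker mxrank_tr rank_rV k0.
by apply: submx_trans; apply/sub_kermxP/rowP => i; rewrite ord1 vk mxE.
Qed.

(** Since [H] is symmetric with kernel spanned by [k], its adjugate is [c] times the matrix with
    entries [k_i k_j], with [c != 0]. By Jacobi's formula the derivative of the determinant along
    [k] is [c * third F p k k k], six times [c] times the cubic coefficient. *)
Lemma hessian_transversal : dmeval (hessian F) p k != 0.
Proof.
have A0 : \adj H != 0 by apply/adj_neq0_rank; rewrite hess_rank3.
have [||c c0 cE] := symmetric_rank1 k0 A0.
- by rewrite trmx_adj hess_sym.
- move=> i; apply: hess_kernel; rewrite -row_mul mul_adj_mx.
  by move: par => /parabolicE ->; rewrite raddf0 row0.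
have -> : dmeval (hessian F) p k = c * third F p k k k.
  rewrite dmeval_hessian /third mulr_sumr; apply: eq_bigr => i _; rewrite mulr_sumr; apply: eq_bigr => j _.
  rewrite cE mulr_suml mulr_sumr; apply: eq_bigr => l _.
  rewrite (mderiv_comm i l) (mderiv_comm j l); move: (meval _ _) (k 0 i) (k 0 j) (k 0 l) => *; ring.
by rewrite mulf_neq0 // -line_coef3 mulrn_eq0.
Qed.

(** [u] is tangent to the parabolic curve, whose points near [p] are provided by
    [intersection_curve], and [g] composed with the Gauss map vanishes there. *)
Lemma cuspidal_velocity g (u : hvec R) : germ_ideal F cuspidal_curve p g ->
  dmeval F p u = 0 -> dmeval (hessian F) p u = 0 -> 'd g q (u *m H) = 0.
Proof.
move=> Ig uT uh; have [e1 e10 h1] := cuspidal_germ Ig.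
have [[_ hg] _] := Ig; have [dl dl0 hs] := holo_sdiff hg.
have sg : sdiff g q ('d g q) by apply: hs; rewrite subrr nr0.
apply: (curve_deriv (sdiff_comp (sdiff_gauss F p) sg)).
  by move=> a w /=; rewrite -scalemxAl linearZ.
have dk := hessian_transversal.
have dlin P (a : C) (x : hvec R) b y : dmeval P p (a *: x + b *: y) = a * dmeval P p x + b * dmeval P p y.
  exact: dmeval_lin.
have [l lq] := dual_coordinate smoothF Sp.
(* [n] and [k'] form the basis dual to the differentials of [F] and of the Hessian determinant;
   transversality along [k] makes it possible. *)
pose k' := (dmeval (hessian F) p k)^-1 *: k + 0 *: k.
pose n := 1 *: l^T + (- dmeval (hessian F) p l^T) *: k'.
have Fk' : dmeval F p k' = 0 by rewrite dlin kT !mulr0 addr0.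
have Gk' : dmeval (hessian F) p k' = 1 by rewrite dlin mul0r addr0 mulVf.
have Fn : dmeval F p n = 1.
  by rewrite dlin Fk' mulr0 addr0 mul1r dmeval_gauss -trmx_mul mxE.
have Gn : dmeval (hessian F) p n = 0 by rewrite dlin Gk' mul1r mulr1 subrr.
have [K [e [K0 e0 h]]] := intersection_curve Sp.2 par Fn Gn Fk' Gk' uT uh.
have u1 : 0 < nr u + K by rewrite ltr_wpDl ?nr_ge0.
exists K, (Num.min (Num.min e 1) (e1 / (nr u + K))); split; first by rewrite !lt_min e0 ltr01 divr_gt0.
move=> t t0; rewrite !lt_min => /andP[/andP[te t1]]; rewrite ltr_pdivlMr // => td.
have [z hz [Fz Gz]] := h t te; exists z => //.
have zx : nr (z - p) < e1.
  apply: le_lt_trans (nr_tri z p (t *: u)) _; apply: le_lt_trans td; rewrite nrZ.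
  have : K * nr t ^+ 2 <= K * nr t.
    by rewrite ler_wpM2l ?(ltW K0) // expr2 ler_piMl ?nr_ge0 // ltW.
  by move: hz; lra.
rewrite /= (h1 z zx Fz Gz) (h1 p _ Sp.2 par) ?subrr ?nr0 //.
by rewrite mulr_ge0 ?exprn_ge0 ?nr_ge0 ?ltW.
Qed.

(** The Gauss map is not a local isomorphism at [p]. Adding a multiple of the Hessian determinant
    leaves it unchanged on the parabolic curve and repairs its Jacobian along the kernel of [H]. *)
Definition cuspidal_chart (w : hvec R) (j : 'I_4) : form := mderiv j F + mpolyC 4 (w 0 j) * hessian F.

Lemma cuspidal_chart_polymap (w x : hvec R) : parabolic F x -> polymap (cuspidal_chart w) x = gauss F x.
Proof.
by move=> hx; apply/rowP => j; rewrite [LHS]mxE [RHS]mxE mevalD mevalM (hx : meval _ _ = 0) mulr0 addr0.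
Qed.

Lemma cuspidal_chart_jac (w v : hvec R) : v *m jac (cuspidal_chart w) p = v *m H + dmeval (hessian F) p v *: w.
Proof.
apply/rowP => j; rewrite [LHS]mxE [RHS]mxE -dmeval_hess [X in _ + X]mxE mulrC /dmeval mulr_sumr -big_split.
apply: eq_bigr => i _; rewrite !mxE mderivD mderivM mderivC mul0r add0r mevalD mevalM mevalC.
by rewrite mulrDr mulrCA.
Qed.

(** The velocities of the image of the parabolic curve fill [orth L]. Conversely, [F] and the
    Hessian determinant, transported by the inverse of [cuspidal_chart], lie in the ideal, and their
    differentials cut out no more than [orth L]. *)
Theorem cuspidal_curve_tangent : curve_tangent_line (germ_ideal F cuspidal_curve p) q (orth (span2 p k)).
Proof.
split; first exact/is_line_orth/(span2_line Sp.1 kp).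
have dk := hessian_transversal.
have dlin P (a : C) (x : hvec R) b y : dmeval P p (a *: x + b *: y) = a * dmeval P p x + b * dmeval P p y.
  exact: dmeval_lin.
move=> v; split.
  move=> /orthP hv g Ig; have vk := hv k (span2_r _ _); have vp := hv p (span2_l _ _).
  have [u uE] := hess_image vk.
  (* A multiple of [k] makes [u'] tangent to the parabolic curve without changing its image by
     [H]. *)
  pose u' := 1 *: u + (- (dmeval (hessian F) p u / dmeval (hessian F) p k)) *: k.
  have -> : v = u' *m H by rewrite mulmxDl -!scalemxAl kH scaler0 addr0 scale1r.
  have uT : dmeval F p u = 0.
    by rewrite dmeval_gauss (dot_gauss d_gt1 homF) -uE vp mulr0.
  apply: cuspidal_velocity => //; first by rewrite dlin uT kT !mulr0 addr0.
  by rewrite dlin mul1r mulNr divfK // subrr.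
move=> hv.
have [w wH] : exists w : hvec R, ~~ (w <= H)%MS.
  have : ~~ (1%:M <= H)%MS by apply/negP => /mxrankS; rewrite mxrank1 hess_rank3.
  by move=> /row_subPn[i hi]; exists (row i 1%:M).
(* As [w] is outside the image of [H], a vector killed by the Jacobian is killed by [H] and by the
   differential of the Hessian determinant; the first makes it a multiple of [k], the second makes
   it zero. *)
have uJ : jac (cuspidal_chart w) p \in unitmx.
  rewrite -row_free_unit -kermx_eq0; apply/eqP/row_matrixP => i; rewrite row0.
  have : row i (kermx (jac (cuspidal_chart w) p)) *m jac (cuspidal_chart w) p = 0 by rewrite -row_mul mulmx_ker row0.
  rewrite cuspidal_chart_jac; move: (row i _) => x xJ.
  have hx : dmeval (hessian F) p x = 0.
    apply/eqP; apply: contraNT wH => hx; rewrite -[w](scalerK hx); apply: scalemx_sub.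
    by move/eqP: xJ; rewrite addrC addr_eq0 => /eqP ->; rewrite eqmx_opp submxMl.
  have [b xb] : exists b, x = b *: k by apply: hess_kernel; move: xJ; rewrite hx scale0r addr0.
  move: hx; rewrite xb -[b *: k]addr0 -[0](scale0r k) dlin mul0r addr0 => /eqP.
  by rewrite mulf_eq0 (negbTE dk) orbF => /eqP ->; rewrite !scale0r addr0.
have [l lq] := dual_coordinate smoothF Sp.
have Pp : polymap (cuspidal_chart w) p = q by exact: cuspidal_chart_polymap.
have [psi [K [r [rho inv]]]] : exists psi K r rho, local_inverse (polymap (cuspidal_chart w)) psi p K r rho.
  exact: inverse_polymap uJ.
have lq' : (polymap (cuspidal_chart w) p *m l) 0 0 = 1 by rewrite Pp.
pose y := (v - (v *m l) 0 0 *: q) *m invmx (jac (cuspidal_chart w) p).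
have germ G : (forall x, on_surface F x -> parabolic F x -> meval (x 0) G = 0) -> dmeval G p y = 0.
  move=> hG; have Ig : germ_ideal F cuspidal_curve p (pulled_back (cuspidal_chart w) p l psi rho G).
    split; first by have := pulled_back_holo uJ inv lq' G; rewrite Pp.
    have [||U [W [pU qW h]]] := pulled_back_vanishes d_gt1 homF smoothF (Q := parabolic F) (G := G) _ _ Pp inv lq.
    - by move=> c x c0; exact: (parabolic_scale d_gt1 homF x c0).2.
    - by move=> x Sx px; split; [exact: cuspidal_chart_polymap|exact: hG].
    by exists U, W.
  by have := hv _ Ig; have := pulled_back_diff uJ inv lq' G v; rewrite Pp => ->.
have yT : dmeval F p y = 0 by apply: germ => x [].
have yh : dmeval (hessian F) p y = 0 by apply: germ.
have vE : v = y *m H + (v *m l) 0 0 *: q.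
  have := cuspidal_chart_jac w y; rewrite yh scale0r addr0 => <-.
  by rewrite /y mulmxKV // subrK.
apply/orthP => x /span2P[a [b ->]]; rewrite vE.
have qx : (q *m (a *: p + b *: k)^T) 0 0 = 0.
  by rewrite dot_sym -dmeval_gauss dlin kT (dmeval_self homF Sp) !mulr0 addr0.
have yx : (y *m H *m (a *: p + b *: k)^T) 0 0 = 0.
  rewrite hess_symm mulmxDl -!scalemxAl kH scaler0 addr0 (hess_euler d_gt1 homF) scalerA -scalemxAl.
  have := yT; rewrite dmeval_gauss dot_sym; set A := q *m _ => hA.
  by rewrite [LHS]mxE hA mulr0.
rewrite mulmxDl -scalemxAl; move: qx yx; set A := q *m _; set B := y *m H *m _ => qx yx.
by rewrite [LHS]mxE yx [X in _ + X]mxE qx mulr0 addr0.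
Qed.
End Kernel.
End CuspidalEdge.

(** * Quartics with multiple roots *)

Section SwallowtailAlgebra.
Context {R : realType}.
Local Notation C := (Cplx R).

(** A vanishing resultant with the derivative means a double root [s], and the equations
    [P(s) = P'(s) = 0] are solved for [b] and [c]. *)
Lemma swallowtail_disc_root (a b c : C) : swallowtail_disc a b c = 0 <->
  exists s, b = - 4 * s ^+ 3 - 2 * a * s /\ c = 3 * s ^+ 4 + a * s ^+ 2.
Proof.
rewrite /swallowtail_disc; set P : {poly C} := _ + c%:P.
have PE s : P.[s] = s ^+ 4 + a * s ^+ 2 + b * s + c.
  by rewrite /P !(hornerD, hornerC, hornerZ, hornerX, hornerXn).
have dPE s : P^`().[s] = 4 * s ^+ 3 + 2 * a * s + b.
  rewrite /P !(derivD, derivC, derivZ, derivX, derivXn) /= !(hornerD, hornerC, hornerZ, hornerX, hornerMn, hornerXn).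
  by ring.
have P0 : P != 0.
  apply/eqP => h; have := congr1 (fun p : {poly C} => p`_4) h.
  by rewrite /P !(coefD, coefZ, coefC, coefX, coefXn) /= !(mulr0, addr0) => /eqP; rewrite oner_eq0.
split.
  move=> /eqP; rewrite resultant_eq0 => sz.
  have /closed_rootP[s] : size (gcdp P P^`()) != 1%N by rewrite neq_ltn sz orbT.
  rewrite root_gcd => /andP[/rootP Ps /rootP dPs]; exists s.
  have bE : b = - 4 * s ^+ 3 - 2 * a * s.
    by apply/eqP; rewrite -subr_eq0 -dPs dPE; apply/eqP; ring.
  split=> //; apply/eqP; rewrite -subr_eq0 -Ps PE bE; apply/eqP; ring.
move=> [s [bE cE]]; apply/eqP; rewrite resultant_eq0 (root_size_gt1 (a := s)) //.
  by rewrite gcdp_eq0 negb_and P0.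
by rewrite root_gcd; apply/andP; split; apply/rootP; rewrite ?PE ?dPE bE ?cE; ring.
Qed.

(* The discriminant of x^4 + a x^2 + b x + c. *)
Definition disc_poly (a b c : C) : C :=
  16 * a ^+ 4 * c - 4 * a ^+ 3 * b ^+ 2 - 128 * a ^+ 2 * c ^+ 2 + 144 * a * b ^+ 2 * c
  - 27 * b ^+ 4 + 256 * c ^+ 3.

Lemma disc_poly_root (a s : C) : disc_poly a (- 4 * s ^+ 3 - 2 * a * s) (3 * s ^+ 4 + a * s ^+ 2) = 0.
Proof. rewrite /disc_poly; ring. Qed.

Definition disc_da (a b c : C) : C :=
  64 * a ^+ 3 * c - 12 * a ^+ 2 * b ^+ 2 - 256 * a * c ^+ 2 + 144 * b ^+ 2 * c.
Definition disc_db (a b c : C) : C := - 8 * a ^+ 3 * b + 288 * a * b * c - 108 * b ^+ 3.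
Definition disc_dc (a b c : C) : C := 16 * a ^+ 4 - 256 * a ^+ 2 * c + 144 * a * b ^+ 2 + 768 * c ^+ 2.

(** Zero exactly when the two other roots coincide ([a = - 2 s^2]) or [s] is a root of multiplicity
    at least 3 ([a = - 6 s^2]). *)
Definition disc_factor (s a : C) : C := 16 * (a + 2 * s ^+ 2) * (a + 6 * s ^+ 2) ^+ 3.

(* At a polynomial with the double root s, the differential of the discriminant is proportional to
   that of the evaluation at s. *)
Lemma disc_gradient (a s : C) : let b := - 4 * s ^+ 3 - 2 * a * s in let c := 3 * s ^+ 4 + a * s ^+ 2 in
  [/\ disc_da a b c = disc_factor s a * s ^+ 2, disc_db a b c = disc_factor s a * s &
      disc_dc a b c = disc_factor s a].
Proof. rewrite /disc_da /disc_db /disc_dc /disc_factor; split; ring. Qed.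

(** Two distinct double roots have sum zero, since the quartic has no cubic term; the value of [a]
    follows. *)
Lemma two_double_roots (a s s' : C) : s != s' ->
  - 4 * s ^+ 3 - 2 * a * s = - 4 * s' ^+ 3 - 2 * a * s' ->
  3 * s ^+ 4 + a * s ^+ 2 = 3 * s' ^+ 4 + a * s' ^+ 2 -> a = - 2 * s ^+ 2.
Proof.
move=> ss; have s0 : s - s' != 0 by rewrite subr_eq0.
move=> hb hc.
have h1 : a = - 2 * (s ^+ 2 + s * s' + s' ^+ 2).
  apply: (mulfI (mulf_neq0 (_ : 2 != 0) s0)); first by rewrite pnatr_eq0.
  have : - 4 * s ^+ 3 - 2 * a * s - (- 4 * s' ^+ 3 - 2 * a * s') = 0 by rewrite hb subrr.
  move=> h; rewrite -[LHS]addr0 -h; ring.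
have h2 : (s + s') * (s - s') ^+ 3 = 0.
  have : 3 * s ^+ 4 + a * s ^+ 2 - (3 * s' ^+ 4 + a * s' ^+ 2) = 0 by rewrite hc subrr.
  by rewrite h1 => h; rewrite -[RHS]h; ring.
move/eqP: h2; rewrite mulf_eq0 expf_eq0 /= (negbTE s0) orbF => /eqP/addr0_eq s'E.
by rewrite h1 -s'E; ring.
Qed.

Lemma avoid_two (x y : C) (eps : R) : 0 < eps -> exists t : C, [/\ nr t < eps, t != x & t != y].
Proof.
move=> eps0; apply: contrapT => h.
pose Q : {poly C} := ('X - x%:P) * ('X - y%:P).
have Q2 : Q`_2 = 1.
  have mQ : Q \is monic by rewrite rpredM ?monicXsubC.
  have sQ : size Q = 3 by rewrite size_Mmonic ?monicXsubC ?polyXsubC_eq0 // !size_XsubC.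
  by move/monicP: mQ; rewrite lead_coefE sQ.
have : Q`_2 = 0.
  apply: (poly_bound_vanishing (k := 3) (K := 0) eps0) => // t _ te.
  suff -> : Q.[t] = 0 by rewrite nr0 mul0r.
  apply/eqP; rewrite /Q hornerM !hornerXsubC mulf_eq0 !subr_eq0.
  have [//|tx] := eqVneq t x; have [//|ty] := eqVneq t y.
  by exfalso; apply: h; exists t.
by move/eqP; rewrite Q2 oner_eq0.
Qed.
End SwallowtailAlgebra.

(** * Charts of the dual space and parametrization of the swallowtail *)

Section LocalCharts.
Context {R : realType}.
Local Notation C := (Cplx R).
Local Notation rc r := (real_complex R r : C).

(** A vector in the kernel of the derivative would give displacements [o(t)] of [f] for
    displacements of order [t] of the argument. *)
Lemma lower_lipschitz_injective (V W : normedModType C) (f : V -> W) (x : V) (A : V -> W) (K r : R) :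
  sdiff f x A -> scalable_map A -> 0 < K -> 0 < r ->
  (forall y z, nr (y - x) < r -> nr (z - x) < r -> nr (y - z) <= K * nr (f y - f z)) ->
  forall v, A v = 0 -> v = 0.
Proof.
move=> [_ hf] sA K0 r0 hl v Av.
have eps0 : 0 < (2 * K)^-1 by rewrite invr_gt0 mulr_gt0.
have [e e0 he] := hf _ eps0.
have v1 : 0 < nr v + 1 by rewrite ltr_wpDl ?nr_ge0.
pose t := Num.min e r / 2 / (nr v + 1).
have m0 : 0 < Num.min e r by rewrite lt_min e0.
have t0 : 0 < t by rewrite /t !divr_gt0.
have tv : nr (rc t *: v) < Num.min e r.
  rewrite nrZ nr_real gtr0_norm //.
  have tE : t * (nr v + 1) = Num.min e r / 2 by rewrite divfK // lt0r_neq0.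
  have tv : t * nr v < t * (nr v + 1) by rewrite ltr_pM2l // ltrDl.
  by apply: (lt_trans tv); rewrite tE; lra.
have yx : x + rc t *: v - x = rc t *: v by rewrite addrC addKr.
move: tv; rewrite lt_min => /andP[te tr].
have := he (x + rc t *: v) x; rewrite yx subrr nr0 => /(_ te e0).
rewrite sA Av scaler0 subr0 => h1.
have := hl (x + rc t *: v) x; rewrite yx subrr nr0 => /(_ tr r0) h2.
have : nr (rc t *: v) <= 2^-1 * nr (rc t *: v).
  apply: le_trans h2 _; apply: le_trans (ler_wpM2l (ltW K0) h1) _.
  by rewrite mulrA invfM mulrCA divff ?mulr1 // lt0r_neq0.
have := nr_ge0 (rc t *: v) => h3 h4; have h5 : nr (rc t *: v) = 0 by lra.
move/nr_eq0: h5 => /eqP; rewrite scaler_eq0 => /orP[/eqP th|/eqP //].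
by have := congr1 (@nr R C) th; rewrite nr_real nr0 gtr0_norm // => h6; move: t0; rewrite h6 ltxx.
Qed.

Definition row4 (x0 x1 x2 x3 : C) : hvec R := \row_i [:: x0; x1; x2; x3]`_i.

Definition i0 : 'I_4 := Ordinal (isT : 0 < 4)%N.
Definition i1 : 'I_4 := Ordinal (isT : 1 < 4)%N.
Definition i2 : 'I_4 := Ordinal (isT : 2 < 4)%N.
Definition i3 : 'I_4 := Ordinal (isT : 3 < 4)%N.

Lemma ord4P (P : 'I_4 -> Prop) : P i0 -> P i1 -> P i2 -> P i3 -> forall i, P i.
Proof.
move=> h0 h1 h2 h3 [[|[|[|[|n]]]] hn] //; [move: h0|move: h1|move: h2|move: h3];
  by congr P; apply: val_inj.
Qed.

Lemma row4_inj x0 x1 x2 x3 y0 y1 y2 y3 : row4 x0 x1 x2 x3 = row4 y0 y1 y2 y3 ->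
  [/\ x0 = y0, x1 = y1, x2 = y2 & x3 = y3].
Proof.
by move=> h; split; [have := congr1 (fun M : hvec R => M 0 i0) h|have := congr1 (fun M : hvec R => M 0 i1) h
  |have := congr1 (fun M : hvec R => M 0 i2) h|have := congr1 (fun M : hvec R => M 0 i3) h]; rewrite !mxE.
Qed.

Lemma row4_0 : row4 0 0 0 0 = 0.
Proof. by apply/rowP; apply: ord4P; rewrite !mxE. Qed.

Lemma row4_linear x0 x1 x2 x3 y0 y1 y2 y3 a : a *: row4 x0 x1 x2 x3 + row4 y0 y1 y2 y3 =
  row4 (a * x0 + y0) (a * x1 + y1) (a * x2 + y2) (a * x3 + y3).
Proof. by apply/rowP; apply: ord4P; rewrite !mxE. Qed.

Lemma sdiff_row4 (V : normedModType C) (f0 f1 f2 f3 : V -> C) x A0 A1 A2 A3 :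
  sdiff f0 x A0 -> sdiff f1 x A1 -> sdiff f2 x A2 -> sdiff f3 x A3 ->
  sdiff (fun y => row4 (f0 y) (f1 y) (f2 y) (f3 y)) x (fun v => row4 (A0 v) (A1 v) (A2 v) (A3 v)).
Proof.
move=> h0 h1 h2 h3.
apply: (sdiff_row (f := fun i y => [:: f0 y; f1 y; f2 y; f3 y]`_i) (A := fun i v => [:: A0 v; A1 v; A2 v; A3 v]`_i)).
exact: ord4P.
Qed.

Lemma linear_scalable (A : hvec R -> hvec R) : linear A -> scalable_map A.
Proof.
move=> lA k u; have A0 : A 0 = 0.
  by have := lA 1 0 0; rewrite !scale1r addr0 => h; apply: (addrI (A 0)); rewrite -h addr0.
by have := lA k u 0; rewrite !addr0 A0 addr0.
Qed.

Lemma linear_mx (A : hvec R -> hvec R) : linear A -> exists M : 'M[C]_4, forall v, A v = v *m M.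
Proof.
move=> lA; pose L := GRing.isLinear.Build _ _ _ _ A lA.
pose LA : {linear hvec R -> hvec R} := HB.pack A L.
by exists (lin1_mx LA) => v; rewrite mul_rV_lin1.
Qed.

Lemma injective_unitmx (M : 'M[C]_4) : (forall v : hvec R, v *m M = 0 -> v = 0) -> M \in unitmx.
Proof.
move=> h; rewrite -row_free_unit -kermx_eq0; apply/eqP/row_matrixP => i; rewrite row0.
by apply: h; rewrite -row_mul mulmx_ker row0.
Qed.

Lemma sdiff_linform (l : 'cV[C]_4) (x : hvec R) : sdiff (fun v : hvec R => (v *m l) 0 0) x (fun v => (v *m l) 0 0).
Proof.
apply: (sdiff_comp (f := fun v : hvec R => v *m l) (g := fun w : 'rV[C]_1 => w 0 0)
  (A := fun v => v *m l) (B := fun w : 'rV[C]_1 => w 0 0)).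
  exact/sdiff_blin/blin_mulmx.
exact/sdiff_blin/blin_coord.
Qed.

Section Chart.
Variables (a b c : hvec R -> C) (l : 'cV[C]_4) (q : hvec R).
Hypotheses (ha : holomorphic_at q a) (hb : holomorphic_at q b) (hc : holomorphic_at q c)
  (a0 : a q = 0) (b0 : b q = 0) (c0 : c q = 0) (lq : (q *m l) 0 0 = 1)
  (ker : forall xi, 'd a q xi = 0 -> 'd b q xi = 0 -> 'd c q xi = 0 -> (xi <= q)%MS).

(** [a, b, c] are invariant under scaling, so the linear form [l] is added as a fourth coordinate to
    obtain a chart of the vector space near [q]. *)
Definition coords (xi : hvec R) := row4 (a xi) (b xi) (c xi) ((xi *m l) 0 0).
Definition dcoords (xi v : hvec R) := row4 ('d a xi v) ('d b xi v) ('d c xi v) ((v *m l) 0 0).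

Lemma dcoords_linear xi : linear (dcoords xi).
Proof.
move=> k u v; rewrite row4_linear /dcoords; congr row4; try by rewrite linearD linearZ.
by rewrite mulmxDl -scalemxAl [LHS]mxE [X in X + _]mxE.
Qed.

Lemma dcoords0 xi : dcoords xi 0 = 0.
Proof. by have := linear_scalable (dcoords_linear xi) 0 0; rewrite !scale0r. Qed.

Lemma dual_chart (e : R) : 0 < e -> exists psi r,
  [/\ 0 < r, psi (row4 0 0 0 1) = q & forall y, nr (y - row4 0 0 0 1) < r ->
    [/\ nr (psi y - q) < e, coords (psi y) = y & exists J,
      [/\ sdiff psi y (fun v => v *m J), forall v, dcoords (psi y) (v *m J) = v &
          forall w, dcoords (psi y) w = 0 -> w = 0]]].
Proof.
move=> e0; have [ra ra0 sa] := holo_sdiff ha; have [rb rb0 sb] := holo_sdiff hb; have [r3 r30 sc] := holo_sdiff hc.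
pose r0 := Num.min (Num.min ra rb) r3.
have r00 : 0 < r0 by rewrite !lt_min ra0 rb0.
have sco xi : nr (xi - q) < r0 -> sdiff coords xi (dcoords xi).
  rewrite !lt_min => /andP[/andP[xa xb] xc]; apply: sdiff_row4; [exact: sa|exact: sb|exact: sc|exact: sdiff_linform].
have qq : nr (q - q) < r0 by rewrite subrr nr0.
have y0 : coords q = row4 0 0 0 1 by rewrite /coords a0 b0 c0 lq.
have inj0 v : dcoords q v = 0 -> v = 0.
  rewrite -{1}row4_0 => /row4_inj[va vb vc vl]; have /sub_rVP[m vE] := ker va vb vc.
  move: vl; rewrite vE -scalemxAl; move: lq; set w := q *m l => wE; rewrite [X in X = 0 -> _]mxE wE mulr1 => ->; exact: scale0r.
have [J0 J0E] := linear_mx (dcoords_linear q).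
have uJ0 : J0 \in unitmx by apply: injective_unitmx => v; rewrite -J0E; exact: inj0.
have [psi [K [r [rho inv]]]] : exists psi K r rho, local_inverse coords psi q K r rho.
  apply: (inverse_function (A := fun v => v *m J0) (B := fun v => v *m invmx J0)).
  - exact: sdiff_eq J0E (sco q qq).
  - exact: blin_mulmx.
  - by move=> v; rewrite mulmxK.
  - by move=> v; rewrite mulmxKV.
have [K0 r1 rho0 hpsi hlow] := inv.
have psi0 : psi (row4 0 0 0 1) = q by rewrite -y0; exact: local_inverse_at inv.
pose r' := Num.min rho (Num.min e (Num.min r0 r) / K).
have m0 : 0 < Num.min e (Num.min r0 r) by rewrite lt_min e0 lt_min r00.
exists psi, r'; split=> //; first by rewrite lt_min rho0 divr_gt0.
move=> y; rewrite lt_min ltr_pdivlMr // => /andP[yr yK].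
have yr' : nr (y - coords q) < rho by rewrite y0.
have : nr (psi y - q) < Num.min e (Num.min r0 r).
  rewrite -{1}(local_inverse_at inv); apply: le_lt_trans (local_inverse_lip inv yr' _) _.
    by rewrite subrr nr0.
  by rewrite y0 mulrC.
rewrite lt_min => /andP[pe]; rewrite lt_min => /andP[p0 pr]; split=> //; first exact: (hpsi y yr').2.
(* The lower Lipschitz bound of the local inverse holds on a ball, so the differentials of the
   coordinates are independent at all nearby points and not only at [q]. *)
have inj w : dcoords (psi y) w = 0 -> w = 0.
  have sA := linear_scalable (dcoords_linear (psi y)).
  have r2 : 0 < r - nr (psi y - q) by rewrite subr_gt0.
  apply: (lower_lipschitz_injective (sco _ p0) sA K0 r2) => x z hx hz; apply: hlow.
    by rewrite -[x](subrK (psi y)) -addrA; apply: le_lt_trans (nrD _ _) _; rewrite -ltrBrDr.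
  by rewrite -[z](subrK (psi y)) -addrA; apply: le_lt_trans (nrD _ _) _; rewrite -ltrBrDr.
have [J JE] := linear_mx (dcoords_linear (psi y)).
have uJ : J \in unitmx by apply: injective_unitmx => v; rewrite -JE; exact: inj.
exists (invmx J); split=> //; last by move=> v; rewrite JE mulmxKV.
apply: (local_inverse_sdiff inv yr' (sco _ p0)); first exact: blin_mulmx.
by move=> v /=; rewrite JE mulmxK.
Qed.
End Chart.
End LocalCharts.

Section Gradient.
Context {R : realType}.
Local Notation C := (Cplx R).

Definition grad (g : hvec R -> C) (xi : hvec R) : hvec R := \row_j 'd g xi (delta_mx 0 j : hvec R).

Definition dgrad (g : hvec R -> C) (xi v : hvec R) : hvec R :=
  \row_j 'd (fun w => 'd g w (delta_mx 0 j : hvec R)) xi v.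

Lemma gradE (g : hvec R -> C) (xi v : hvec R) : (v *m (grad g xi)^T) 0 0 = 'd g xi v.
Proof. by rewrite [LHS]mxE [RHS](rv_lin ('d g xi) v); apply: eq_bigr => j _; rewrite !mxE. Qed.

Lemma dgrad_linear g xi : linear (dgrad g xi).
Proof.
move=> k u v; apply/rowP => j.
have E w : dgrad g xi w 0 j = 'd (fun w => 'd g w (delta_mx 0 j : hvec R)) xi w by rewrite mxE.
rewrite [RHS]mxE [X in _ = X + _]mxE (E (k *: u + v)) (E u) (E v); exact: linearP.
Qed.

Lemma dot_comb3 (v x y z : hvec R) (k1 k2 k3 : C) : (v *m (k1 *: x + k2 *: y + k3 *: z)^T) 0 0 =
  k1 * (v *m x^T) 0 0 + k2 * (v *m y^T) 0 0 + k3 * (v *m z^T) 0 0.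
Proof.
rewrite ![(v *m _) 0 0]mxE !mulr_sumr -!big_split; apply: eq_bigr => j _ /=.
by rewrite !mxE; ring.
Qed.

Lemma combination_linear (A B C' D : hvec R -> hvec R) (E : hvec R) (k1 k2 : C) :
  linear A -> linear B -> linear C' -> linear D ->
  linear (fun v => k1 *: A (D v) + k2 *: B (D v) + C' (D v) + v 0 i0 *: E).
Proof.
move=> lA lB lC lD k u v; rewrite lD lA lB lC; apply/rowP => j; rewrite !mxE; ring.
Qed.

Lemma dgrad0 g xi : dgrad g xi 0 = 0.
Proof. by apply/rowP => j; rewrite mxE linear0 mxE. Qed.

Lemma grad_near (g : hvec R -> C) q : holomorphic_at q g -> exists2 e : R, 0 < e &
  forall xi, nr (xi - q) < e -> sdiff g xi ('d g xi) /\ sdiff (grad g) xi (dgrad g xi).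
Proof.
move=> hg; have [e1 e10 h1] := holo_sdiff hg.
have /choice[e2 h2] : forall j : 'I_4, exists e : R, 0 < e /\ forall xi, nr (xi - q) < e ->
    sdiff (fun w => 'd g w (delta_mx 0 j : hvec R)) xi ('d (fun w => 'd g w (delta_mx 0 j : hvec R)) xi).
  by move=> j; have [e e0 h] := holo_sdiff (holo_d (delta_mx 0 j) hg); exists e.
have [m m0 hm] := finite_min (fun j => (h2 j).1).
exists (Num.min e1 m); first by rewrite lt_min e10.
move=> xi; rewrite lt_min => /andP[x1 xm]; split; first exact: h1.
by apply: sdiff_row => j; apply: (h2 j).2; exact: lt_le_trans (hm j).
Qed.
End Gradient.

Section Parametrization.
Context {R : realType}.
Local Notation C := (Cplx R).
Variables (a b c : hvec R -> C) (l : 'cV[C]_4) (q : hvec R) (psi : hvec R -> hvec R) (r : R).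
Hypotheses (r0 : 0 < r)
  (chart : forall y, nr (y - row4 0 0 0 1) < r ->
    [/\ [/\ sdiff (grad a) (psi y) (dgrad a (psi y)), sdiff (grad b) (psi y) (dgrad b (psi y)) &
            sdiff (grad c) (psi y) (dgrad c (psi y))],
        coords a b c l (psi y) = y & exists J,
      [/\ sdiff psi y (fun v => v *m J), forall v, dcoords a b c l (psi y) (v *m J) = v &
          forall w, dcoords a b c l (psi y) w = 0 -> w = 0]]).

(* Coordinates of the polynomial with double root s and x^2-coefficient t, where
   (s, t) are the first two coordinates of z. *)
Definition double_root (z : hvec R) : hvec R := row4 (z 0 i1)
  (- 4 * z 0 i0 ^+ 3 - 2 * z 0 i1 * z 0 i0) (3 * z 0 i0 ^+ 4 + z 0 i1 * z 0 i0 ^+ 2) 1.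

Definition d_double_root (z v : hvec R) : hvec R := row4 (v 0 i1)
  (- 2 * (z 0 i1 + 6 * z 0 i0 ^+ 2) * v 0 i0 - 2 * z 0 i0 * v 0 i1)
  (2 * z 0 i0 * (z 0 i1 + 6 * z 0 i0 ^+ 2) * v 0 i0 + z 0 i0 ^+ 2 * v 0 i1) 0.

Lemma sdiff_double_root z : sdiff double_root z (d_double_root z).
Proof.
have ss := sdiff_blin z (blin_coord i0 : blin (fun v : hvec R => v 0 i0)).
have st := sdiff_blin z (blin_coord i1 : blin (fun v : hvec R => v 0 i1)).
have cs k : sdiff (fun=> k : C) z (fun=> 0) := sdiff_cst k z.
have s2 := sdiffM ss ss; have s3 := sdiffM ss s2; have s4 := sdiffM ss s3.
have E (f g : hvec R -> C) A B : sdiff f z A -> f =1 g -> A =1 B -> sdiff g z B.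
  by move=> h fg AB; apply: sdiff_eq AB _; have -> : g = f by apply/funext => x; rewrite fg.
apply: sdiff_row4 => //.
  apply: (E _ _ _ _ (sdiffD (sdiffM (cs (-4)) s3) (sdiffM (cs (-2)) (sdiffM st ss)))) => x /=;
    move: (x 0 i0) (x 0 i1) (z 0 i0) (z 0 i1) => *; ring.
apply: (E _ _ _ _ (sdiffD (sdiffM (cs 3) s4) (sdiffM st s2))) => x /=;
  move: (x 0 i0) (x 0 i1) (z 0 i0) (z 0 i1) => *; ring.
Qed.

Lemma d_double_root_linear z : linear (d_double_root z).
Proof. by move=> k u v; rewrite row4_linear /d_double_root; congr row4; rewrite ?mxE; ring. Qed.

Definition Xi (z : hvec R) := psi (double_root z).

Definition Ya (z : hvec R) := grad a (Xi z).
Definition Yb (z : hvec R) := grad b (Xi z).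
Definition Yc (z : hvec R) := grad c (Xi z).
(** By [disc_gradient], the differential at [Xi z] of the discriminant of the quartic is
    [disc_factor] times [Y z]. [Y z] is the point of S that biduality predicts, and unlike the
    differential it stays nonzero where [disc_factor] vanishes. *)
Definition Y (z : hvec R) : hvec R := z 0 i0 ^+ 2 *: Ya z + z 0 i0 *: Yb z + Yc z.

(** The independence of the three gradients will show that [Y] is nonzero and an immersion. In a
    direction killed by the derivative of [Xi], only the explicit factors [s^2] and [s] of [Y] vary,
    whence the formula for its derivative. *)
Lemma param_diff : exists2 dl : R, 0 < dl & forall z, nr z < dl ->
  [/\ coords a b c l (Xi z) = double_root z,
      forall x y w, x *: Ya z + y *: Yb z + w *: Yc z = 0 -> [/\ x = 0, y = 0 & w = 0] &
      exists dXi dY : hvec R -> hvec R,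
    [/\ (linear dXi /\ linear dY) /\ sdiff Xi z dXi, sdiff Y z dY,
        forall v, dcoords a b c l (Xi z) (dXi v) = d_double_root z v,
        (forall v, dXi v = 0 -> dY v = v 0 i0 *: ((2 * z 0 i0) *: Ya z + Yb z)) &
        forall v, d_double_root z v = 0 -> dXi v = 0]].
Proof.
have [dl dl0 hdl] := sdiff_near (sdiff_double_root 0) r0.
have dr0 : double_root 0 = row4 0 0 0 1 by rewrite /double_root !mxE !expr0n !mulr0 subrr addr0.
exists dl => // z zdl; have := hdl z; rewrite subr0 dr0 => /(_ zdl)/chart[[ga gb gc] cE [J [sJ dJ inj]]].
split=> //.
  move=> x y w h.
  (* The chart provides vectors dual to the three differentials, on which the relation is tested. *)
  have [m mE] : exists m : hvec R, dcoords a b c l (Xi z) m = row4 1 0 0 0.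
    by exists (row4 1 0 0 0 *m J); exact: dJ.
  have [m' mE'] : exists m : hvec R, dcoords a b c l (Xi z) m = row4 0 1 0 0.
    by exists (row4 0 1 0 0 *m J); exact: dJ.
  have [m'' mE''] : exists m : hvec R, dcoords a b c l (Xi z) m = row4 0 0 1 0.
    by exists (row4 0 0 1 0 *m J); exact: dJ.
  have E v : x * 'd a (Xi z) v + y * 'd b (Xi z) v + w * 'd c (Xi z) v = 0.
    have e := etrans (dot_comb3 v (Ya z) (Yb z) (Yc z) x y w) (congr2 +%R (congr2 +%R (congr1 ( *%R x) (gradE a (Xi z) v))
      (congr1 ( *%R y) (gradE b (Xi z) v))) (congr1 ( *%R w) (gradE c (Xi z) v))).
    by apply: etrans (esym e) _; rewrite h trmx0 mulmx0; exact: mxE.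
  have E' v k1 k2 k3 : 'd a (Xi z) v = k1 -> 'd b (Xi z) v = k2 -> 'd c (Xi z) v = k3 ->
      x * k1 + y * k2 + w * k3 = 0.
    by move=> <- <- <-; exact: E.
  have [ma mb mc _] := row4_inj mE; have [ma' mb' mc' _] := row4_inj mE'; have [ma'' mb'' mc'' _] := row4_inj mE''.
  split.
  - by have := E' _ _ _ _ ma mb mc; rewrite !mulr0 !addr0 mulr1.
  - by have := E' _ _ _ _ ma' mb' mc'; rewrite !mulr0 add0r addr0 mulr1.
  - by have := E' _ _ _ _ ma'' mb'' mc''; rewrite !mulr0 !add0r mulr1.
pose dXi v := d_double_root z v *m J.
have dXl : linear dXi by move=> k u v; rewrite /dXi d_double_root_linear mulmxDl scalemxAl.
have sX : sdiff Xi z dXi := sdiff_comp (sdiff_double_root z) sJ.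
pose s := z 0 i0.
pose dY (v : hvec R) : hvec R := s ^+ 2 *: dgrad a (Xi z) (dXi v) + s *: dgrad b (Xi z) (dXi v) + dgrad c (Xi z) (dXi v)
  + v 0 i0 *: ((2 * s) *: Ya z + Yb z).
exists dXi, dY; split.
- split; last exact: sX.
  split; [exact: dXl|]; exact: (combination_linear _ _ _ (dgrad_linear a _) (dgrad_linear b _) (dgrad_linear c _) dXl).
- have ss := sdiff_blin z (blin_coord i0 : blin (fun v : hvec R => v 0 i0)).
  have co j (g : hvec R -> C) : sdiff (grad g) (Xi z) (dgrad g (Xi z)) ->
      sdiff (fun y => grad g (Xi y) 0 j) z (fun v => dgrad g (Xi z) (dXi v) 0 j).
    move=> sg; exact: (sdiff_comp (sdiff_comp sX sg) (sdiff_blin _ (blin_coord j : blin (fun v : hvec R => v 0 j)))).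
  have -> : Y = fun y => \row_j (y 0 i0 * y 0 i0 * grad a (Xi y) 0 j + y 0 i0 * grad b (Xi y) 0 j + grad c (Xi y) 0 j).
    by apply/funext => y; apply/rowP => j; rewrite [RHS]mxE [LHS]mxE [X in X + _]mxE [X in X + _ + _]mxE [X in _ + X + _]mxE expr2.
  have -> : dY = fun v => \row_j (dY v 0 j) by apply/funext => v; apply/rowP => j; rewrite mxE.
  apply: sdiff_row => j.
  apply: sdiff_eq (sdiffD (sdiffD (sdiffM (sdiffM ss ss) (co j a ga)) (sdiffM ss (co j b gb))) (co j c gc)) => v.
  rewrite /dY /Ya /Yb /s; move: (dgrad a _ _) (dgrad b _ _) (dgrad c _ _) (grad a _) (grad b _) => A1 B1 C1 A2 B2.
  by rewrite /= !mxE; ring.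
- by move=> v; rewrite dJ.
- by move=> v h; rewrite /dY h !dgrad0 !scaler0 !addr0 add0r.
- by move=> v h; rewrite /dXi h mul0mx.
Qed.
End Parametrization.

Section DiscriminantDerivative.
Context {R : realType}.
Local Notation C := (Cplx R).

Lemma sdiff_disc (V : normedModType C) (f g h : V -> C) (x : V) (A B D : V -> C) :
  sdiff f x A -> sdiff g x B -> sdiff h x D ->
  sdiff (fun y => disc_poly (f y) (g y) (h y)) x (fun v => disc_da (f x) (g x) (h x) * A v
    + disc_db (f x) (g x) (h x) * B v + disc_dc (f x) (g x) (h x) * D v).
Proof.
move=> sf sg sh.
have cs k : sdiff (fun=> k : C) x (fun=> 0) := sdiff_cst k x.
have f2 := sdiffM sf sf; have f3 := sdiffM sf f2; have f4 := sdiffM sf f3.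
have g2 := sdiffM sg sg; have g4 := sdiffM g2 g2; have h2 := sdiffM sh sh; have h3 := sdiffM sh h2.
have S := sdiffD (sdiffD (sdiffD (sdiffD (sdiffD (sdiffM (cs 16) (sdiffM f4 sh)) (sdiffM (cs (-4)) (sdiffM f3 g2)))
  (sdiffM (cs (-128)) (sdiffM f2 h2))) (sdiffM (cs 144) (sdiffM sf (sdiffM g2 sh)))) (sdiffM (cs (-27)) g4))
  (sdiffM (cs 256) h3).
have -> : (fun y => disc_poly (f y) (g y) (h y)) = fun y => 16 * (f y * (f y * (f y * f y)) * h y) + -4 * (f y * (f y * f y) * (g y * g y))
   + -128 * (f y * f y * (h y * h y)) + 144 * (f y * (g y * g y * h y)) + -27 * (g y * g y * (g y * g y)) + 256 * (h y * (h y * h y)).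
  by apply/funext => y; rewrite /disc_poly; move: (f y) (g y) (h y) => *; ring.
apply: sdiff_eq S => v; rewrite /disc_da /disc_db /disc_dc.
by move: (f x) (g x) (h x) (A v) (B v) (D v) => *; ring.
Qed.

Lemma holo_disc (f g h : hvec R -> C) q : holomorphic_at q f -> holomorphic_at q g -> holomorphic_at q h ->
  holomorphic_at q (fun y => disc_poly (f y) (g y) (h y)).
Proof.
move=> hf hg hh.
have -> : (fun y => disc_poly (f y) (g y) (h y)) = fun y => 16 * (f y * (f y * (f y * f y)) * h y) + -4 * (f y * (f y * f y) * (g y * g y))
   + -128 * (f y * f y * (h y * h y)) + 144 * (f y * (g y * g y * h y)) + -27 * (g y * g y * (g y * g y)) + 256 * (h y * (h y * h y)).
  by apply/funext => y; rewrite /disc_poly; move: (f y) (g y) (h y) => *; ring.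
have hc k : holomorphic_at q (fun=> k : C) := holo_cst k q.
by do 5 (apply: holo_D; last by do ?[exact: hf | exact: hg | exact: hh | exact: hc | apply: holo_M]);
  do ?[exact: hf | exact: hg | exact: hh | exact: hc | apply: holo_M].
Qed.

Lemma sdiff_limit_zero (V W : normedModType C) (f : V -> W) (x : V) (A : V -> W) : sdiff f x A ->
  (forall eps : R, 0 < eps -> exists2 y, nr (y - x) < eps & nr (f y) <= eps) -> f x = 0.
Proof.
move=> sf h; apply/nr_eq0/le_anti; rewrite nr_ge0 andbT; apply/ler_addgt0Pl => eps eps0; rewrite addr0.
have e2 : 0 < eps / 2 by rewrite divr_gt0.
have [e e0 he] := sdiff_near sf e2.
have [|y yx fy] := h (Num.min e (eps / 2)); first by rewrite lt_min e0.
move: yx fy; rewrite lt_min le_min => /andP[/he hy _] /andP[_ fy].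
have := nrB (f y) (f y - f x); rewrite opprB addrC subrK => h1.
by apply: le_trans h1 _; have := ltW hy; lra.
Qed.

Lemma sdiff_zero (V W : normedModType C) (f : V -> W) (x : V) (A : V -> W) (e : R) : sdiff f x A -> scalable_map A ->
  0 < e -> (forall y, nr (y - x) < e -> f y = 0) -> forall v, A v = 0.
Proof.
move=> sf sA e0 h v; apply: (curve_deriv sf sA).
have v1 : 0 < nr v + 1 by rewrite ltr_wpDl ?nr_ge0.
exists 0, (e / (nr v + 1)); split; first exact: divr_gt0.
move=> t _; rewrite ltr_pdivlMr // => te.
exists (x + t *: v); first by rewrite subrr nr0 mul0r.
rewrite (h x) ?subrr ?nr0 // h ?subr0 ?nr0 ?mul0r // addrC addKr nrZ.
by apply: le_lt_trans te; rewrite ler_wpM2l ?nr_ge0 // lerDl.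
Qed.
End DiscriminantDerivative.


(** * Criteria for tangent cones *)

Section TangentCones.
Context {R : realType}.
Local Notation C := (Cplx R).
Local Notation form := (form4 R).

Lemma nr_norm (V : normedModType C) (x : V) : nr (`|x| : C) = nr x.
Proof. by rewrite nrE nr_real ger0_norm ?nr_ge0. Qed.

Lemma flat_littleo (f : hvec R -> C) m : flat m.+1 f -> f =o_ (0 : hvec R) (fun w => `|w| ^+ m).
Proof.
move=> [K [e [K0 e0 h]]]; apply/littleo_nrP => eps eps0.
exists (Num.min e (eps / K)); first by rewrite lt_min e0 divr_gt0.
move=> w; rewrite lt_min ltr_pdivlMr // => /andP[/h hw wK]; apply: le_trans hw _.
rewrite nrX nr_norm exprS mulrA ler_wpM2r ?exprn_ge0 ?nr_ge0 //.
by rewrite mulrC ltW.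
Qed.

Lemma holo_flat_ball (g : hvec R -> C) q : holomorphic_at q g ->
  flat 2 (fun w : hvec R => g (q + w) - (g q + 'd g q w)).
Proof.
move=> hg; have [dl dl0 h] := holo_lip2_at hg.
have [|K [e [K0 e0 hK]]] := h q; first by rewrite subrr nr0.
exists K, e; split=> // w we; have e1 : q + w - q = w by rewrite addrC addKr.
have := hK (q + w) q; rewrite subrr nr0 addr0 e1 => /(_ we e0).
by rewrite opprD addrA expr2 mulrA.
Qed.

Lemma flat_diff (g : hvec R -> C) q : holomorphic_at q g -> flat 1 (fun w : hvec R => 'd g q w).
Proof.
move=> hg; have [dl dl0 h] := holo_sdiff hg.
have [|[_ [K K0 hK]] _] := h q; first by rewrite subrr nr0.
by exists K, 1; split=> // w _; rewrite expr1.
Qed.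

Lemma holo_flat_zero (g : hvec R -> C) q : holomorphic_at q g -> g q = 0 ->
  flat 1 (fun w : hvec R => g (q + w)).
Proof.
move=> hg g0; have [D DE] : exists D : hvec R -> C, forall w, D w = 'd g q w by exists ('d g q).
have f2 : flat 2 (fun w : hvec R => g (q + w) - D w).
  by apply: (flat_ext ltr01) (holo_flat_ball hg) => w _; rewrite g0 add0r; congr (_ - _).
have f1 : flat 1 D by apply: (flat_ext ltr01) (flat_diff hg) => w _.
by apply: (flat_ext ltr01) (flatD (flatW (isT : (1 <= 2)%N) f2) f1) => w _; rewrite subrK.
Qed.

Definition linear_poly (u : hvec R) : form := \sum_j u 0 j *: mpolyX C (mnm1 j).

Lemma linear_poly_homog u : linear_poly u \is ishomog1 1 mdeg.
Proof.
by rewrite rpred_sum // => j _; apply: dhomogZ; rewrite dhomogX; apply/eqP; exact: mdeg1.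
Qed.

Lemma meval_linear_poly u (w : hvec R) : meval (w 0) (linear_poly u) = (w *m u^T) 0 0.
Proof.
rewrite raddf_sum [RHS]mxE; apply: eq_bigr => j _; rewrite [u^T _ _]mxE.
by apply: etrans (mevalZ _ _ _) _; rewrite mevalXU mulrC.
Qed.

Lemma cone_linear (I : set (hvec R -> C)) q v g : reduced_tangent_cone I q v -> I g ->
  holomorphic_at q g -> g q = 0 -> 'd g q v = 0.
Proof.
move=> hv Ig hg g0; apply: etrans (esym (gradE g q v)) _; rewrite -meval_linear_poly.
apply: hv Ig (linear_poly_homog _) _; apply: flat_littleo.
apply: (flat_ext ltr01) (holo_flat_ball hg) => w _.
by rewrite g0 add0r meval_linear_poly; congr (_ - _); exact: gradE.
Qed.

(** Since [a] and [b] vanish at [q], the quadratic part of [k b^2 + k' a^3] is [k] times the square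
    of the differential of [b]. *)
Lemma cone_square (I : set (hvec R -> C)) q v a b (k k' : C) : reduced_tangent_cone I q v -> k != 0 ->
  holomorphic_at q a -> holomorphic_at q b -> a q = 0 -> b q = 0 ->
  I (fun xi => k * b xi ^+ 2 + k' * a xi ^+ 3) -> 'd b q v = 0.
Proof.
move=> hv k0 ha hb a0 b0 Ig.
pose G : form := k *: (linear_poly (grad b q) * linear_poly (grad b q)).
have [D DE] : exists D : hvec R -> C, forall w, D w = 'd b q w by exists ('d b q).
have GE (w : hvec R) : meval (w 0) G = k * D w ^+ 2.
  apply: etrans (mevalZ _ _ _) _; rewrite mevalM meval_linear_poly -expr2.
  by congr (k * _ ^+ 2); apply: etrans (gradE b q w) (esym (DE w)).
have fa := holo_flat_zero ha a0.
have fb : flat 2 (fun w : hvec R => b (q + w) - D w).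
  by apply: (flat_ext ltr01) (holo_flat_ball hb) => w _; rewrite b0 add0r; congr (_ - _).
have db : flat 1 D by apply: (flat_ext ltr01) (flat_diff hb) => w _.
apply: etrans (esym (DE v)) _.
have : meval (v 0) G = 0.
  apply: hv Ig (_ : G \is ishomog1 2 mdeg) _.
    by apply: dhomogZ; apply: (dhomogM (linear_poly_homog _) (linear_poly_homog _)).
  apply: flat_littleo.
  have f1 := flatM (flat_cst _ k) (flatM fb (flatD (flatW (isT : (1 <= 2)%N) fb) (flatD db db))).
  have f2 := flatM (flat_cst _ k') (flatX 3 fa).
  apply: (flat_ext ltr01) (flatD f1 f2) => w _.
  rewrite GE; move: (b _) (a _) (D w) => b' a' db'; ring.
by rewrite GE => /eqP; rewrite mulf_eq0 (negbTE k0) expf_eq0 => /eqP.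
Qed.

(** A secant criterion: if the locus has points [q + w] with [w / t] tending to [v], then an initial
    form [G] of degree [m] of an element of the ideal satisfies [G(w / t) = o(1)] by homogeneity,
    hence vanishes at [v]. *)
Lemma cone_contains (F : form) (p : hvec R) Z (v : hvec R) :
  (forall U, nbhs p U -> forall eps : R, 0 < eps -> exists (t : C) (w : hvec R),
     [/\ t != 0, nr t < eps, nr (w - t *: v) <= eps * nr t & Z F U (gauss F p + w)]) ->
  reduced_tangent_cone (germ_ideal F Z p) (gauss F p) v.
Proof.
move=> h g m G [_ [U [W [pU /nbhsP[e1 e10 hW] hZ]]]] hG /littleo_nrP ho.
apply: (sdiff_limit_zero (sdiff_meval G v)) => eps eps0.
have v1 : 0 < (nr v + 1) ^+ m by rewrite exprn_gt0 // ltr_wpDl ?nr_ge0.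
have [e2 e20 he2] := ho (eps / (nr v + 1) ^+ m) (divr_gt0 eps0 v1).
have v2 : 0 < nr v + 1 by rewrite ltr_wpDl ?nr_ge0.
pose e := Num.min (Num.min (eps / 2) 1) (Num.min e1 e2 / (nr v + 1)).
have m1 : 0 < Num.min e1 e2 by rewrite lt_min e10.
have e0 : 0 < e by rewrite lt_min (divr_gt0 m1 v2) andbT lt_min ltr01 andbT divr_gt0.
have [t [w [t0 te wt Zw]]] := h U pU e e0.
have tn : 0 < nr t by exact: nr_gt0.
pose u := t^-1 *: w; have wE : w = t *: u by rewrite /u scalerA divff // scale1r.
have ue : nr (u - v) <= e.
  move: wt; rewrite wE -scalerBr nrZ mulrC ler_pM2r //.
have ue1 : nr (u - v) <= 1 by apply: le_trans ue _; rewrite !ge_min lexx orbT.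
have uv : nr u <= nr v + 1.
  by have := nrD v (u - v); rewrite addrC subrK => h'; apply: le_trans h' _; rewrite lerD2l.
have we : nr w < Num.min e1 e2.
  rewrite wE nrZ; apply: le_lt_trans (ler_wpM2l (nr_ge0 _) uv) _.
  by rewrite -ltr_pdivlMr //; apply: lt_le_trans te _; rewrite ge_min lexx orbT.
move: we; rewrite lt_min => /andP[we1 we2].
exists u.
  apply: le_lt_trans ue _; apply: le_lt_trans (_ : e <= eps / 2) _; last by lra.
  by rewrite /e !ge_min lexx.
have gw : g (gauss F p + w) = 0 by apply: hZ => //; apply: hW; rewrite addrC addKr.
have := he2 w we2; rewrite gw sub0r nrN nrX nr_norm {1}wE (euler_scale t u (euler_homog hG)).
rewrite nrM nrX wE nrZ exprMn mulrCA ler_pM2l ?exprn_gt0 // => h'; apply: le_trans h' _.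
rewrite -[leRHS](divfK (lt0r_neq0 v1)) (ler_wpM2l (ltW (divr_gt0 eps0 v1))) // lerXn2r ?nnegrE ?nr_ge0 //.
exact: ltW.
Qed.
End TangentCones.

(** * The surface near a swallowtail point and assertion (d) *)

Section SwallowtailSurface.
Context {R : realType}.
Local Notation C := (Cplx R).
Local Notation form := (form4 R).
Variables (F : form) (d : nat).
Hypotheses (d_gt1 : (1 < d)%N) (homF : F \is ishomog1 d mdeg) (smoothF : smooth F).
Variable (p : hvec R).
Hypothesis (Sp : on_surface F p).
Local Notation q := (gauss F p).
Variables (a b c : hvec R -> C) (l : 'cV[C]_4) (psi : hvec R -> hvec R) (r : R) (U0 : set (hvec R)).
Hypotheses (hpa : proj_holomorphic_at q a) (hpb : proj_holomorphic_at q b) (hpc : proj_holomorphic_at q c)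
  (lq : (q *m l) 0 0 = 1) (pU0 : nbhs p U0)
  (sw : forall U, nbhs p U -> U `<=` U0 ->
        \forall xi \near q, dual_surface F U xi <-> swallowtail_disc (a xi) (b xi) (c xi) = 0)
  (r0 : 0 < r) (psi0 : psi (row4 0 0 0 1) = q)
  (chart : forall y, nr (y - row4 0 0 0 1) < r ->
    [/\ [/\ sdiff (grad a) (psi y) (dgrad a (psi y)), sdiff (grad b) (psi y) (dgrad b (psi y)) &
            sdiff (grad c) (psi y) (dgrad c (psi y))],
        coords a b c l (psi y) = y & exists J,
      [/\ sdiff psi y (fun v => v *m J), forall v, dcoords a b c l (psi y) (v *m J) = v &
          forall w, dcoords a b c l (psi y) w = 0 -> w = 0]]).
Local Notation Xi := (Xi psi).
Local Notation Y := (Y a b c psi).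

Lemma Xi0 : Xi 0 = q.
Proof.
by rewrite /Xi -psi0 /double_root; congr (psi (row4 _ _ _ _)); rewrite !mxE ?expr0n ?mulr0 ?subrr ?addr0.
Qed.

Lemma Xi_near (e : R) : 0 < e -> exists2 dl : R, 0 < dl & forall z : hvec R, nr z < dl -> nr (Xi z - q) < e.
Proof.
move=> e0; have [dl dl0 h] := param_diff r0 chart.
have z0 : nr (0 : hvec R) < dl by rewrite nr0.
have [_ _ [dX [dY [[_ sX] _ _ _ _]]]] := h 0 z0.
have [e1 e10 he] := sdiff_near sX e0; exists e1 => // z ze.
by have := he z; rewrite subr0 Xi0; apply.
Qed.

(** Where [disc_factor] is nonzero, the differential of the discriminant at [Xi z] is a nonzero
    multiple of [Y z], while [dual_tangent] makes it a multiple of the point [x] of S with tangent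
    plane [Xi z]. *)
Lemma param_generic (eps : R) : 0 < eps -> exists2 dl : R, 0 < dl & forall z : hvec R, nr z < dl ->
  disc_factor (z 0 i0) (z 0 i1) != 0 ->
  exists x m, [/\ on_surface F x, nr (x - p) < eps, gauss F x = Xi z, m != 0 & Y z = m *: x].
Proof.
move=> eps0; have [d1 d10 h1] := param_diff r0 chart.
have [e e0 tang] := dual_tangent d_gt1 homF smoothF Sp (holo_disc hpa.2 hpb.2 hpc.2) pU0 (sw pU0 (@subset_refl _ U0))
  (fun xi (hx : dual_surface F U0 xi) (hW : dual_surface F U0 xi <-> _) => ltac:(
     have [s [-> ->]] := (swallowtail_disc_root _ _ _).1 (hW.1 hx); exact: disc_poly_root)).
have [ra ra0 sa] := holo_sdiff hpa.2; have [rb rb0 sb] := holo_sdiff hpb.2; have [r3 r30 sc] := holo_sdiff hpc.2.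
have e'0 : 0 < Num.min e eps by rewrite lt_min e0.
have [e2 e20 pre] := normalized_preimage d_gt1 homF e'0 lq.
(* The swallowtail equivalence is applied to a smaller neighbourhood of [p], so that the point [x]
   it produces can be taken as close to [p] as desired. *)
pose U := U0 `&` [set x | nr (x - p) < e2].
have pU : nbhs p U by apply: filterI => //; apply/nbhsP; exists e2.
have [e3 e30 swU] := (nbhsP _ _).1 (sw pU (@subIsetl _ U0 _)).
have m0 : 0 < Num.min (Num.min ra rb) (Num.min r3 e3) by rewrite !lt_min ra0 rb0 r30.
have [d2 d20 Xn] := Xi_near m0.
exists (Num.min d1 d2); first by rewrite lt_min d10.
move=> z; rewrite lt_min => /andP[z1 /Xn]; rewrite !lt_min => /andP[/andP[xa xb] /andP[xc xe]] kz.
have [cE indep _] := h1 z z1; have [aE bE cE' lE] := row4_inj cE.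
have : dual_surface F U (Xi z).
  by apply/(swU _ xe)/swallowtail_disc_root; exists (z 0 i0); rewrite aE bE cE'.
move=> [x0 [[_ x0e] Sx0 /(eqmx_scale (smoothF Sx0))[k k0 XE]]].
have [m m'0 [mx Nmx]] := pre x0 x0e.
have NX : gauss F (m *: x0) = Xi z.
  by rewrite Nmx -(normalizeZ l (gauss F x0) k0) -XE /normalize lE invr1 scale1r.
have Sx : on_surface F (m *: x0) by apply: (on_surface_scale homF x0 m'0).2.
move: mx; rewrite lt_min => /andP[mxe mxeps].
have [_ dg] := tang _ Sx mxe; rewrite NX in dg.
have YE v : 'd (fun y => disc_poly (a y) (b y) (c y)) (Xi z) v = disc_factor (z 0 i0) (z 0 i1) * (v *m (Y z)^T) 0 0.
  have S := sdiff_disc (sa _ xa) (sb _ xb) (sc _ xc); rewrite aE bE cE' in S.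
  have [E1 E2 E3] := disc_gradient (z 0 i1) (z 0 i0).
  have Sl : linear (fun v : hvec R => disc_factor (z 0 i0) (z 0 i1) * (v *m (Y z)^T) 0 0 : C).
    by move=> k' u w; rewrite mulmxDl -scalemxAl; move: (u *m _) (w *m _) => u' w'; rewrite !mxE -[RHS]/(k' * _ + _); ring.
  apply: (sdiff_diffE Sl (sdiff_eq _ S)).2 => w.
  rewrite E1 E2 E3 /Y -[Yc c psi z]scale1r.
  have e4 := etrans (dot_comb3 w (Ya a psi z) (Yb b psi z) (Yc c psi z) (z 0 i0 ^+ 2) (z 0 i0) 1)
     (congr2 +%R (congr2 +%R (congr1 ( *%R _) (gradE a (Xi z) w)) (congr1 ( *%R _) (gradE b (Xi z) w))) (congr1 ( *%R 1) (gradE c (Xi z) w))).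
  have alg (k1 s A B D : C) : k1 * s ^+ 2 * A + k1 * s * B + k1 * D = k1 * (s ^+ 2 * A + s * B + 1 * D) by ring.
  exact: etrans (alg _ _ _ _ _) (esym (congr1 ( *%R _) e4)).
have [k' YE'] : exists k', Y z = k' *: (m *: x0).
  apply: (perp_span Sx.1) => v vx; have := dg v vx; rewrite YE => /eqP.
  by rewrite mulf_eq0 (negbTE kz) => /eqP.
exists (m *: x0), k'; split=> //; apply/eqP => k'0.
have Yz : z 0 i0 ^+ 2 *: Ya a psi z + z 0 i0 *: Yb b psi z + 1 *: Yc c psi z = 0.
  by rewrite scale1r; move: YE'; rewrite k'0 scale0r.
by have [_ _ /eqP] := indep _ _ _ Yz; rewrite oner_eq0.
Qed.

Lemma param_dense (z : hvec R) (eps : R) : 0 < eps -> exists2 z' : hvec R, nr (z' - z) < eps &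
  disc_factor (z' 0 i0) (z' 0 i1) != 0.
Proof.
move=> eps0; pose s := z 0 i0; pose t := z 0 i1.
have D1 : 0 < nr (delta_mx 0 i1 : hvec R) + 1 by rewrite ltr_wpDl ?nr_ge0.
have [k [ke k1 k2]] := avoid_two (- t - 2 * s ^+ 2) (- t - 6 * s ^+ 2) (divr_gt0 eps0 D1).
exists (z + k *: delta_mx 0 i1).
  rewrite addrC addKr nrZ; move: ke; rewrite ltr_pdivlMr // => ke; apply: le_lt_trans ke.
  by rewrite ler_wpM2l ?nr_ge0 // lerDl.
have -> : (z + k *: delta_mx 0 i1) 0 i0 = s by rewrite !mxE /= mulr0 addr0.
have -> : (z + k *: delta_mx 0 i1) 0 i1 = t + k by rewrite !mxE /= mulr1.
rewrite /disc_factor; apply: mulf_neq0; last apply: expf_neq0; first (apply: mulf_neq0; first by rewrite pnatr_eq0).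
  by apply: contra k1 => /eqP h; apply/eqP; rewrite -[k]subr0 -h; ring.
by apply: contra k2 => /eqP h; apply/eqP; rewrite -[k]subr0 -h; ring.
Qed.

Lemma nr_sub_le (V : normedModType C) (x y : V) : nr x <= nr y + nr (x - y).
Proof. by have := nrD y (x - y); rewrite addrC subrK. Qed.

Definition minor (u v : hvec R) i j := u 0 i * v 0 j - u 0 j * v 0 i.

Lemma parallel_minor u v : (forall i j, minor u v i j = 0) -> parallel u v.
Proof. by move=> h i j; apply/eqP; rewrite -subr_eq0; apply/eqP; exact: h. Qed.

Lemma sdiff_minor (V : normedModType C) (f g : V -> hvec R) x A B i j : sdiff f x A -> sdiff g x B ->
  sdiff (fun y => minor (f y) (g y) i j) x
    (fun v => (f x 0 i * B v 0 j + A v 0 i * g x 0 j) - (f x 0 j * B v 0 i + A v 0 j * g x 0 i)).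
Proof.
move=> sf sg.
have co k (h : V -> hvec R) D : sdiff h x D -> sdiff (fun y => h y 0 k) x (fun v => D v 0 k).
  by move=> sh; exact: (sdiff_comp sh (sdiff_blin _ (blin_coord k : blin (fun v : hvec R => v 0 k)))).
have cs k : sdiff (fun=> k : C) x (fun=> 0) := sdiff_cst k x.
have S := sdiffD (sdiffM (co i f A sf) (co j g B sg)) (sdiffM (cs (-1))
  (sdiffM (co j f A sf) (co i g B sg))).
have -> : (fun y => minor (f y) (g y) i j) = fun y => f y 0 i * g y 0 j + -1 * (f y 0 j * g y 0 i).
  by apply/funext => y; rewrite /minor mulN1r.
by apply: sdiff_eq S => v; rewrite mul0r addr0 mulN1r.
Qed.

(** Both assertions are closed conditions: an equation, and the vanishing of 2 by 2 minors. They
    hold on the dense set where [disc_factor] is nonzero. *)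
Lemma param_surface : exists2 dl : R, 0 < dl & forall z : hvec R, nr z < dl ->
  on_surface F (Y z) /\ exists2 rho, rho != 0 & gauss F (Y z) = rho *: Xi z.
Proof.
have [d1 d10 h1] := param_diff r0 chart.
have [d2 d20 h2] := param_generic ltr01.
exists (Num.min d1 d2); first by rewrite lt_min d10.
move=> z zd; have z1 : nr z < d1 by apply: lt_le_trans zd _; rewrite ge_min lexx.
have [cE indep [dX [dY [[_ sX] sY _ _ _]]]] := h1 z z1; have [_ _ _ lE] := row4_inj cE.
have Y0 : Y z != 0.
  apply/eqP => Yz; have Yz' : z 0 i0 ^+ 2 *: Ya a psi z + z 0 i0 *: Yb b psi z + 1 *: Yc c psi z = 0.
    by rewrite scale1r.
  by have [_ _ /eqP] := indep _ _ _ Yz'; rewrite oner_eq0.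
have X0 : Xi z != 0 by apply: contraTneq (oner_neq0 C) => X0; rewrite -lE X0 mul0mx mxE eqxx.
have close (P : hvec R -> Prop) : (forall z' x m, [/\ on_surface F x, gauss F x = Xi z' & Y z' = m *: x] -> P z') ->
    forall eps : R, 0 < eps -> exists2 z', nr (z' - z) < eps & P z'.
  move=> hP eps eps0; have e1 : 0 < Num.min eps (Num.min d1 d2 - nr z) by rewrite lt_min eps0 subr_gt0.
  have [z' z'e kz'] := param_dense z e1; move: z'e; rewrite lt_min => /andP[z'e z'd].
  exists z' => //; have z'2 : nr z' < d2.
    have := nrD z (z' - z); rewrite addrC subrK => h; apply: le_lt_trans h _.
    apply: lt_le_trans (_ : Num.min d1 d2 <= d2); last by rewrite ge_min lexx orbT.
    by rewrite -ltrBrDl.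
  by have [x [m [Sx _ NX _ YE]]] := h2 z' z'2 kz'; apply: (hP z' x m).
have FY : meval (Y z 0) F = 0.
  apply: (sdiff_limit_zero (sdiff_comp sY (sdiff_meval F (Y z)))) => eps eps0.
  have [z' z'e Fz'] := close (fun z' => meval (Y z' 0) F = 0) (fun z' x m h => ltac:(
    case: h => Sx _ ->; rewrite (meval_scale homF) Sx.2; exact: mulr0)) eps eps0.
  by exists z' => //=; rewrite Fz' nr0 ltW.
have par i j : minor (gauss F (Y z)) (Xi z) i j = 0.
  have sN := sdiff_comp sY (sdiff_gauss F (Y z)).
  apply: (sdiff_limit_zero (sdiff_minor i j sN sX)) => eps eps0.
  have [z' z'e Fz'] := close (fun z' => minor (gauss F (Y z')) (Xi z') i j = 0) (fun z' x m h => ltac:(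
    case: h => _ NX ->; rewrite (gauss_scale d_gt1 homF) NX /minor !mxE; ring)) eps eps0.
  by exists z' => //=; rewrite Fz' nr0 ltW.
have SY : on_surface F (Y z) by split.
split=> //; have [rho NE] := parallelP X0 (parallel_minor par).
by exists rho => //; apply: contraNneq (smoothF SY) => rho0; rewrite NE rho0 scale0r.
Qed.

(** [Y 0] is a limit of values [Y z] proportional to points of S that tend to [p]. *)
Lemma param_center : exists2 m, m != 0 & Y 0 = m *: p.
Proof.
have [d1 d10 h1] := param_diff r0 chart; have z0 : nr (0 : hvec R) < d1 by rewrite nr0.
have [_ indep [_ [dY [_ sY _ _ _]]]] := h1 0 z0.
have par i j : minor (Y 0) p i j = 0.
  have S := sdiff_minor i j sY (sdiff_cst p 0 : sdiff (fun _ : hvec R => p) 0 (fun=> 0)).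
  apply: (sdiff_limit_zero S) => eps eps0.
  have [e1 e10 he] := sdiff_near sY ltr01.
  pose K := nr (Y 0) + 1; have K0 : 0 < K by rewrite ltr_wpDl ?nr_ge0.
  have eK : 0 < eps / (2 * K) by rewrite divr_gt0 // mulr_gt0.
  have [d2 d20 h2] := param_generic eK.
  have m0 : 0 < Num.min (Num.min e1 d2) eps by rewrite !lt_min e10 d20.
  have [z ze kz] := param_dense 0 m0; exists z.
    by apply: lt_le_trans ze _; rewrite ge_min lexx orbT.
  move: ze; rewrite !lt_min => /andP[/andP[/he Yz z2] _]; rewrite subr0 in z2.
  have [x [m [Sx xp _ _ YE]]] := h2 z z2 kz.
  have -> : minor (Y z) p i j = Y z 0 i * (p - x) 0 j - Y z 0 j * (p - x) 0 i.
    by rewrite YE /minor !mxE; ring.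
  have YK : nr (Y z) <= K by apply: le_trans (nr_sub_le (Y z) (Y 0)) _; rewrite /K lerD2l; exact: ltW Yz.
  have bd k k' : nr (Y z 0 k * (p - x) 0 k') <= eps / 2.
    rewrite nrM; have -> : eps / 2 = K * (eps / (2 * K)).
      by clearbody K; have Kn := lt0r_neq0 K0; field.
    rewrite ler_pM ?nr_ge0 //; first exact: le_trans (nr_coord _ _ _) YK.
    by apply: le_trans (nr_coord _ _ _) _; rewrite nrC ltW.
  apply: le_trans (nrB _ _) _; have := bd i j; have := bd j i; lra.
have [m YE] := parallelP Sp.1 (parallel_minor par); exists m => //; apply/eqP => m0.
have Y00 : Y 0 = 0 by rewrite YE m0 scale0r.
have Yz : (0 : hvec R) 0 i0 ^+ 2 *: Ya a psi 0 + (0 : hvec R) 0 i0 *: Yb b psi 0 + 1 *: Yc c psi 0 = 0.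
  by rewrite scale1r.
by have [_ _ /eqP] := indep _ _ _ Yz; rewrite oner_eq0.
Qed.

(* The Hessian maps the derivative of Y to that of Xi, up to scaling and modulo Xi, since the
   Gauss map sends Y to Xi. *)
Lemma param_full : exists2 dl : R, 0 < dl & forall z : hvec R, nr z < dl ->
  [/\ coords a b c l (Xi z) = double_root z,
      forall x y w, x *: Ya a psi z + y *: Yb b psi z + w *: Yc c psi z = 0 -> [/\ x = 0, y = 0 & w = 0],
      on_surface F (Y z) & exists dXi dY rho,
    [/\ (linear dY /\ sdiff Y z dY) /\ (rho != 0 /\ gauss F (Y z) = rho *: Xi z),
        forall v, dcoords a b c l (Xi z) (dXi v) = d_double_root z v,
        (forall v, dXi v = 0 -> dY v = v 0 i0 *: ((2 * z 0 i0) *: Ya a psi z + Yb b psi z)),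
        forall v, d_double_root z v = 0 -> dXi v = 0 &
        forall v : hvec R, dmeval F (Y z) (dY v) = 0 /\
          exists k, dY v *m hess F (Y z) = rho *: dXi v + k *: Xi z]].
Proof.
have [d1 d10 h1] := param_diff r0 chart; have [d2 d20 h2] := param_surface.
exists (Num.min d1 d2); first by rewrite lt_min d10.
move=> z zd; have := zd; rewrite lt_min => /andP[z1 z2].
have [cE indep [dX [dY [[[lX lY] sX] sY dc dY0 dX0]]]] := h1 z z1; have [SY [rho rho0 NE]] := h2 z z2.
have [_ _ _ lE] := row4_inj cE.
have X0 : Xi z != 0 by apply: contraTneq (oner_neq0 C) => X0; rewrite -lE X0 mul0mx mxE eqxx.
split=> //; exists dX, dY, rho; split=> // v.
have zb : 0 < Num.min d1 d2 - nr z by rewrite subr_gt0.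
have near y : nr (y - z) < Num.min d1 d2 - nr z -> nr y < d2.
  move=> yz; have := nrD z (y - z); rewrite addrC subrK => h; apply: le_lt_trans h _.
  apply: lt_le_trans (_ : Num.min d1 d2 <= d2); last by rewrite ge_min lexx orbT.
  by rewrite -ltrBrDl.
have sXs := linear_scalable lX; have sYs := linear_scalable lY.
split.
  apply: (sdiff_zero (sdiff_comp sY (sdiff_meval F (Y z))) _ zb) => [k u /=|y /near/h2[[_ Fy] _] //].
  by rewrite sYs; have := dmeval_lin F (Y z) k 0 (dY u) 0; rewrite scaler0 addr0 mul0r addr0.
pose w := dY v *m hess F (Y z) - rho *: dX v.
have : parallel w (Xi z).
  apply: parallel_minor => i j.
  have sN := sdiff_comp sY (sdiff_gauss F (Y z)).
  have S := sdiff_zero (sdiff_minor i j sN sX) _ zb _ v.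
  have : minor w (Xi z) i j = gauss F (Y z) 0 i * dX v 0 j + (dY v *m hess F (Y z)) 0 i * Xi z 0 j -
      (gauss F (Y z) 0 j * dX v 0 i + (dY v *m hess F (Y z)) 0 j * Xi z 0 i).
    rewrite NE /w /minor; move: (dY v *m _) => w'; rewrite !mxE; ring.
  move=> ->; apply: S => [k u /=|y /near/h2[_ [k _ yE]] /=].
    rewrite sXs sYs -scalemxAl; move: (dY u *m _) => w'; rewrite !mxE -[RHS]/(k * _); ring.
  by rewrite yE /minor !mxE; ring.
by move=> /(parallelP X0)[k wE]; exists k; rewrite -wE addrC subrK.
Qed.


(** The Hessian maps the derivative of [Y] to that of [Xi], so it degenerates exactly where [Xi]
    fails to be an immersion, that is at roots of multiplicity at least 3. [Y] itself is an
    immersion transversal to scaling and to the direction [l^T]. *)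
Lemma param_hessian : exists2 dl : R, 0 < dl & forall z : hvec R, nr z < dl ->
  [/\ coords a b c l (Xi z) = double_root z, on_surface F (Y z),
      exists2 rho, rho != 0 & gauss F (Y z) = rho *: Xi z,
      parabolic F (Y z) <-> z 0 i1 + 6 * z 0 i0 ^+ 2 = 0 &
      exists2 dY, linear dY /\ sdiff Y z dY & forall k al mu (v : hvec R), k != 0 ->
        al *: Y z + k *: dY v + mu *: l^T = 0 -> [/\ al = 0, mu = 0, v 0 i0 = 0 & v 0 i1 = 0]].
Proof.
have [dl dl0 h] := param_full; exists dl => // z zd.
have [cE indep SY [dX [dY [rho [[[lY sY] [rho0 NE]] dc dY0 dX0 der]]]]] := h z zd.
have [_ _ _ lE] := row4_inj cE.
have X0 : Xi z != 0 by apply: contraTneq (oner_neq0 C) => X0; rewrite -lE X0 mul0mx mxE eqxx.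
have dn0 : (d.-1%:R : C) != 0 by exact: pred_d_neq0.
have YH : Y z *m hess F (Y z) = (d.-1%:R * rho) *: Xi z by rewrite (hess_euler d_gt1 homF) NE scalerA.
(* The image by the Hessian is a combination of [dX v] and [Xi z]. The form [l] is 0 on the former
   and 1 on the latter, so both contributions vanish. *)
have kill k al v : k != 0 -> (al *: Y z + k *: dY v) *m hess F (Y z) = 0 ->
    [/\ dX v = 0, v 0 i1 = 0 & (z 0 i1 + 6 * z 0 i0 ^+ 2) * v 0 i0 = 0].
  move=> k0; rewrite mulmxDl -!scalemxAl YH; have [_ [k' ->]] := der v => E.
  have dXE : dX v = (- (al * (d.-1%:R * rho) + k * k') / (k * rho)) *: Xi z.
    have kr : k * rho != 0 by rewrite mulf_neq0.
    apply: (scalerI kr); rewrite scalerA mulrCA divff // mulr1; apply/eqP; rewrite -subr_eq0 -E.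
    by apply/eqP; move: (dX v) (Xi z) => w x; apply/rowP => i; rewrite !mxE; ring.
  have [ta tb _ tl] := row4_inj (dc v).
  have m0 : - (al * (d.-1%:R * rho) + k * k') / (k * rho) = 0.
    by move: tl; rewrite dXE -scalemxAl [LHS]mxE lE mulr1.
  have dX0v : dX v = 0 by rewrite dXE m0 scale0r.
  have dr0 : d_double_root z v = 0 by rewrite -(dc v) dX0v dcoords0.
  have [va vb _ _] := row4_inj (etrans dr0 (esym row4_0)); split=> //.
  move: vb; rewrite va mulr0 subr0 -mulrA => /eqP; rewrite mulf_eq0 oppr_eq0 pnatr_eq0 /=.
  by move/eqP.
have Nl al k mu v : (al *: Y z + k *: dY v + mu *: l^T) *m (gauss F (Y z))^T = 0 -> mu = 0.
  move=> E; have : dmeval F (Y z) (al *: Y z + k *: dY v + mu *: l^T) = 0 by rewrite dmeval_gauss E mxE.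
  rewrite -[_ + mu *: _]/(_ + mu *: _) -[al *: _ + _]scale1r dmeval_lin dmeval_lin (dmeval_self homF SY) (der v).1.
  rewrite !mulr0 add0r mulr0 add0r dmeval_gauss NE linearZ /= -scalemxAr -trmx_mul mxE [X in mu * (_ * X)]mxE lE mulr1.
  by move/eqP; rewrite mulf_eq0 (negbTE rho0) orbF => /eqP.
have inj k al mu (v : hvec R) : k != 0 ->
        al *: Y z + k *: dY v + mu *: l^T = 0 -> [/\ al = 0, mu = 0, v 0 i0 = 0 & v 0 i1 = 0].
  move=> k0 E; have mu0 : mu = 0 by apply: (Nl al k mu v); rewrite E mul0mx.
  move: E; rewrite mu0 scale0r addr0 => E.
  have [dXv v1 _] := kill k al v k0 (etrans (congr1 (mulmx^~ _) E) (mul0mx _ _)).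
  move: E; rewrite (dY0 v dXv) => E.
  have E' : (al * z 0 i0 ^+ 2 + k * v 0 i0 * (2 * z 0 i0)) *: Ya a psi z + (al * z 0 i0 + k * v 0 i0) *: Yb b psi z + al *: Yc c psi z = 0.
    rewrite -E /Y; move: (Ya _ _ _) (Yb _ _ _) (Yc _ _ _) => A B D.
    by apply/rowP => i; rewrite !mxE; ring.
  have [_ h2 al0] := indep _ _ _ E'; split=> //.
  by move/eqP: h2; rewrite al0 mul0r add0r mulf_eq0 (negbTE k0) => /eqP.
split=> //; [by exists rho| |by exists dY].
split.
  move=> /parabolicE dH; apply/eqP; apply: contraT => ts.
  have [x x0 xH] : exists2 x : hvec R, x != 0 & x *m hess F (Y z) = 0.
    by have /det0P[x x0 xH] : \det (hess F (Y z)) == 0 by [exact/eqP]; exists x.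
  (* [Y z], the two derivatives of [Y] and [l^T] form a basis, in which a kernel vector of the
     Hessian is decomposed; being tangent, it has no component on [l^T]. *)
  pose M (w : hvec R) := w 0 i2 *: Y z + 1 *: dY w + w 0 i3 *: l^T.
  have lM : linear M.
    by move=> k u w; rewrite /M lY; move: (dY u) (dY w) (Y z) (l^T) => u' w' y l'; apply/rowP => i; rewrite !mxE; ring.
  have [MM ME] := linear_mx lM.
  have uM : MM \in unitmx.
    apply: injective_unitmx => w; rewrite -ME => /(inj _ _ _ _ (oner_neq0 _))[w2 w3 w0 w1].
    by apply/rowP; apply: ord4P; rewrite mxE.
  have xE : x = M (x *m invmx MM) by rewrite ME mulmxKV.
  move: xE; move: (x *m invmx MM) => w xE.
  have w3 : w 0 i3 = 0.
    apply: (Nl (w 0 i2) 1 (w 0 i3) w); apply/rowP => i; rewrite ord1 -[X in (X *m _) 0 0]xE.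
    by rewrite (dot_gauss d_gt1 homF) xH mul0mx !mxE mulr0.
  have xE2 : x = w 0 i2 *: Y z + 1 *: dY w by rewrite xE /M w3 scale0r addr0.
  have [dXw w1 w0] := kill 1 (w 0 i2) w (oner_neq0 _) (etrans (congr1 (mulmx^~ _) (esym xE2)) xH).
  have dYw : dY w = 0.
    by move/eqP: w0; rewrite mulf_eq0 (negbTE ts) => /eqP w0; rewrite (dY0 w dXw) w0 scale0r.
  have : (w 0 i2 * (d.-1%:R * rho)) *: Xi z = 0.
    by rewrite -scalerA -YH scalemxAl -xH xE2 dYw scaler0 addr0.
  move/eqP; rewrite scaler_eq0 (negbTE X0) orbF !mulf_eq0 (negbTE dn0) (negbTE rho0) !orbF => /eqP w2.
  by move: x0; rewrite xE2 dYw w2 scale0r scaler0 addr0 eqxx.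
move=> ts; apply/parabolicE; apply/eqP; apply: contraT => dH.
have uH : hess F (Y z) \in unitmx by rewrite unitmxE unitfE.
pose v : hvec R := delta_mx 0 i0.
have v0 : v 0 i0 = 1 by rewrite mxE.
have v1 : v 0 i1 = 0 by rewrite mxE.
have dXv : dX v = 0.
  by apply: dX0; rewrite /d_double_root v1 ts !(mulr0, mul0r) subrr addr0 row4_0.
have [_ [k kE]] := der v.
have dr0 : d.-1%:R * rho != 0 by rewrite mulf_neq0.
have : (1 *: dY v + (- (k / (d.-1%:R * rho))) *: Y z) *m hess F (Y z) = 0.
  rewrite mulmxDl -!scalemxAl kE dXv scaler0 add0r YH scale1r scalerA -scalerDl mulNr divfK // subrr.
  exact: scale0r.
move=> /(congr1 (mulmx^~ (invmx (hess F (Y z))))); rewrite mulmxK // mul0mx => E.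
have E' : - (k / (d.-1%:R * rho)) *: Y z + 1 *: dY v + 0 *: l^T = 0 by rewrite scale0r addr0 addrC.
by have [_ _ /eqP] := inj _ _ _ v (oner_neq0 _) E'; rewrite v0 oner_eq0.
Qed.

(* (lam, s, t, mu) |-> lam Y(s, t) + mu l^T is a local diffeomorphism and S is the locus mu = 0. *)
Lemma param_onto (dl : R) : 0 < dl -> exists2 e : R, 0 < e & forall x, on_surface F x -> nr (x - p) < e ->
  exists z lam, [/\ nr z < dl, lam != 0 & x = lam *: Y z].
Proof.
move=> dl0; have [d1 d10 h1] := param_hessian; have [m m0 Y0E] := param_center.
have z0 : nr (0 : hvec R) < d1 by rewrite nr0.
have [_ _ _ _ [dY [lY sY] inj]] := h1 0 z0.
pose L (z : hvec R) : hvec R := (m^-1 + z 0 i2) *: Y z + z 0 i3 *: l^T.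
pose dL (v : hvec R) : hvec R := v 0 i2 *: Y 0 + m^-1 *: dY v + v 0 i3 *: l^T.
have L0 : L 0 = p by rewrite /L mxE addr0 mxE scale0r addr0 Y0E scalerA mulVf // scale1r.
have ldL : linear dL.
  by move=> k u w; rewrite /dL lY; move: (dY u) (dY w) (Y 0) (l^T) => u' w' y l'; apply/rowP => i; rewrite !mxE; ring.
have sL : sdiff L 0 dL.
  have co j (h : hvec R -> hvec R) D : sdiff h 0 D -> sdiff (fun y => h y 0 j) 0 (fun v => D v 0 j).
    by move=> sh; exact: (sdiff_comp sh (sdiff_blin _ (blin_coord j : blin (fun v : hvec R => v 0 j)))).
  have c2 := sdiff_blin (0 : hvec R) (blin_coord i2 : blin (fun v : hvec R => v 0 i2)).
  have c3 := sdiff_blin (0 : hvec R) (blin_coord i3 : blin (fun v : hvec R => v 0 i3)).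
  have cs k : sdiff (fun=> k : C) (0 : hvec R) (fun=> 0) := sdiff_cst k (0 : hvec R).
  have -> : L = fun z => \row_j ((m^-1 + z 0 i2) * Y z 0 j + z 0 i3 * l^T 0 j).
    by apply/funext => z; rewrite /L; move: (Y z) (l^T) => y l'; apply/rowP => j; rewrite !mxE.
  have -> : dL = fun v => \row_j dL v 0 j by apply/funext => v; apply/rowP => j; rewrite mxE.
  apply: sdiff_row => j.
  apply: sdiff_eq (sdiffD (sdiffM (sdiffD (cs m^-1) c2) (co j _ _ sY)) (sdiffM c3 (cs (l^T 0 j)))) => v.
  by rewrite /dL; move: (dY v) (Y 0) (l^T) => v' y l'; rewrite !mxE; ring.
have [MM ME] := linear_mx ldL.
have uM : MM \in unitmx.
  apply: injective_unitmx => w; rewrite -ME => /(inj _ _ _ _ (invr_neq0 m0))[w2 w3 w0 w1].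
  by apply/rowP; apply: ord4P; rewrite mxE.
have [K [e [K0 e0 hs]]] := local_surjectivity (sdiff_eq ME sL) (blin_mulmx (invmx MM))
  (fun v => mulmxK uM v) (fun v => mulmxKV uM v).
rewrite L0 in hs.
have l1 : 0 < nr l^T + 1 by rewrite ltr_wpDl ?nr_ge0.
(* [x] and [y = lam *: Y z] both lie on [F = 0] and differ by [mu *: l^T] with [mu = z 0 i3]. As the
   differential of [F] at [p] is 1 on [l^T], this choice gives [nr mu <= nr mu / 2], so [mu = 0]. *)
have eps0 : 0 < (2 * (nr l^T + 1))^-1 by rewrite invr_gt0 mulr_gt0.
have [e1 e10 hF] := (sdiff_meval F p).2 _ eps0.
have l2 : 0 < nr (l^T) * K + 1 by rewrite ltr_wpDl // mulr_ge0 ?nr_ge0 ?ltW.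
pose e2 := Num.min (Num.min dl d1 / K) (e1 / (1 + nr (l^T) * K)).
have e20 : 0 < Num.min e e2.
  by rewrite !lt_min e0 /= !divr_gt0 // ?lt_min ?dl0 // addrC.
exists (Num.min e e2) => // x Sx; rewrite !lt_min => /andP[xe /andP[xK x1]].
have [z hz Lz] := hs x xe; rewrite subr0 in hz.
have : nr z < Num.min dl d1 by apply: le_lt_trans hz _; rewrite mulrC -ltr_pdivlMr.
rewrite lt_min => /andP[zdl zd1]; have [_ SY _ _ _] := h1 z zd1.
exists z, (m^-1 + z 0 i2).
suff mu0 : z 0 i3 = 0.
  have xE : x = (m^-1 + z 0 i2) *: Y z by rewrite -Lz /L mu0 scale0r addr0.
  by split=> //; apply: contraNneq Sx.1 => lam0; rewrite xE lam0 scale0r.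
pose y := (m^-1 + z 0 i2) *: Y z.
have xyE : x - y = z 0 i3 *: l^T by rewrite -Lz /L /y addrC addKr.
have Fy : meval (y 0) F = 0 by rewrite /y (meval_scale homF) SY.2 mulr0.
have x1' : nr (x - p) * (1 + nr l^T * K) < e1 by rewrite -ltr_pdivlMr // addrC.
have lK0 : 0 <= nr l^T * K by rewrite mulr_ge0 ?nr_ge0 ?ltW.
have xpe : nr (x - p) < e1 by apply: le_lt_trans x1'; rewrite ler_peMr ?nr_ge0 // lerDl.
have zl : nr (x - y) <= nr (x - p) * (nr l^T * K).
  rewrite xyE nrZ mulrCA [leLHS]mulrC (ler_wpM2l (nr_ge0 _)) //; apply: le_trans (nr_coord _ _ _) _.
  by rewrite mulrC.
have ype : nr (y - p) < e1.
  have gen (u v w : hvec R) : v - w = (u - w) - (u - v) by rewrite opprB [RHS]addrC addrA subrK.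
  apply: le_lt_trans x1'; rewrite (gen x y p).
  by apply: le_trans (nrB _ _) _; rewrite mulrDr mulr1 lerD2l.
have := hF x y xpe ype; rewrite Sx.2 Fy subrr sub0r nrN xyE.
have -> : dmeval F p (z 0 i3 *: l^T) = z 0 i3.
  by rewrite dmeval_gauss -scalemxAl -trmx_mul mxE [X in _ * X]mxE lq mulr1.
rewrite nrZ mulrCA => h; apply/nr_eq0; apply/le_anti; rewrite nr_ge0 andbT.
have h2 : (2 * (nr l^T + 1))^-1 * nr l^T <= 2^-1.
  by rewrite invfM -mulrA ler_piMr // mulrC ler_pdivrMr // mul1r lerDl.
have := le_trans h (ler_wpM2l (nr_ge0 _) h2); have := nr_ge0 (z 0 i3); lra.
Qed.


(** The gradient of [c] at [q] is [Y 0], a multiple of [p]. The gradient of [b] is tangent to S and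
    sent by the Hessian to a multiple of [q], so it lies on the asymptotic tangent; independent of
    [p], it spans this line with it. *)
Lemma orth_swallowtail (k : hvec R) : ~~ (k <= p)%MS -> dmeval F p k = 0 ->
  (forall x, dmeval F p x = 0 -> (x *m hess F p <= q)%MS -> (x <= span2 p k)%MS) ->
  forall v, (v <= orth (span2 p k))%MS <-> 'd b q v = 0 /\ 'd c q v = 0.
Proof.
move=> kp kT asy; have [dl dl0 h] := param_full; have z0 : nr (0 : hvec R) < dl by rewrite nr0.
have [cE indep SY [dX [dY [rho [[_ [rho0 NE]] dc dY0 dX0 der]]]]] := h 0 z0.
have [m m0 YE] := param_center.
have z00 : (0 : hvec R) 0 i0 = 0 by rewrite mxE.
have Y0c : Y 0 = grad c q.
  rewrite /Y; move: (Ya _ _ _) (Yb _ _ _) => A B; rewrite z00 expr0n /= !scale0r !add0r.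
  exact: (congr1 (grad c) Xi0 : Yc c psi 0 = grad c q).
pose v0 : hvec R := delta_mx 0 i0.
have v00 : v0 0 i0 = 1 by rewrite mxE.
have v01 : v0 0 i1 = 0 by rewrite mxE.
have dXv : dX v0 = 0.
  by apply: dX0; rewrite /d_double_root v01 z00 [(0 : hvec R) 0 i1]mxE expr0n !(mulr0, mul0r, addr0, subr0) row4_0.
(* At the origin [Xi] is stationary in the direction of [s], which leaves only the term in the
   gradient of [b] in the derivative of [Y]. *)
have dYv : dY v0 = grad b q.
  apply: etrans (dY0 v0 dXv) _; rewrite v00 z00; move: (Ya a psi 0) => A.
  by rewrite scale1r mulr0 scale0r add0r; exact: (congr1 (grad b) Xi0 : Yb b psi 0 = grad b q).
have [_ [k' kE]] := der v0.
have bH : (grad b q *m hess F p <= q)%MS.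
  move: kE; rewrite dYv dXv scaler0 add0r Xi0 YE (hess_scale d_gt1 homF) -scalemxAr => kE.
  apply/sub_rVP; exists ((m ^+ d.-2)^-1 * k'); rewrite -scalerA -kE scalerA mulVf ?scale1r //.
  exact: expf_neq0.
have bT : dmeval F p (grad b q) = 0.
  by rewrite dmeval_gauss dot_sym gradE (proj_diff_self hpb).
have bL := asy _ bT bH.
have bp : ~~ (grad b q <= p)%MS.
  apply/negP => /sub_rVP[w wE].
  have E : 0 *: Ya a psi 0 + 1 *: Yb b psi 0 + (- (w / m)) *: Yc c psi 0 = 0.
    rewrite scale0r add0r scale1r /Yb /Yc Xi0 wE -Y0c YE scalerA mulNr divfK // -scalerDl subrr.
    exact: scale0r.
  by have [_ /eqP] := indep _ _ _ E; rewrite oner_eq0.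
have hL : (span2 p k == span2 p (grad b q))%MS.
  by apply: line_span2 => //; [exact: (span2_line Sp.1 kp)|exact: span2_l|exact: Sp.1].
have /eqmxP hO := eqmx_orth hL.
have dcE v : 'd c q v = m * (v *m p^T) 0 0.
  apply: etrans (esym (gradE c q v)) _; rewrite -Y0c YE linearZ /= -scalemxAr; move: (v *m _) => w; exact: mxE.
move=> v; rewrite hO; split.
  move=> /orthP hv; split; first exact: etrans (esym (gradE b q v)) (hv _ (span2_r _ _)).
  by rewrite dcE (hv p (span2_l _ _)) mulr0.
move=> [vb vc]; apply/orthP => x /span2P[al [be ->]].
have vp : (v *m p^T) 0 0 = 0.
  by move/eqP: vc; rewrite dcE mulf_eq0 (negbTE m0) => /eqP.
have vb' : (v *m (grad b q)^T) 0 0 = 0 by exact: etrans (gradE b q v) vb.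
have e := dot_comb3 v p (grad b q) 0 al be 0.
rewrite scale0r addr0 in e; apply: etrans e _.
by rewrite vp vb' !mulr0 mul0r !addr0.
Qed.


Lemma coords_scale k (xi zeta : hvec R) : k != 0 -> xi = k *: zeta -> [/\ a xi = a zeta, b xi = b zeta & c xi = c zeta].
Proof. by move=> k0 ->; rewrite hpa.1 // hpb.1 // hpc.1. Qed.

Lemma coordsP z : coords a b c l (Xi z) = double_root z ->
  [/\ a (Xi z) = z 0 i1, b (Xi z) = - 4 * z 0 i0 ^+ 3 - 2 * z 0 i1 * z 0 i0 &
      c (Xi z) = 3 * z 0 i0 ^+ 4 + z 0 i1 * z 0 i0 ^+ 2].
Proof. by move=> /row4_inj[]. Qed.

Lemma gauss_param x xi z lam rho : on_surface F x -> (xi == gauss F x)%MS -> lam != 0 -> x = lam *: Y z -> rho != 0 ->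
  gauss F (Y z) = rho *: Xi z -> exists2 k, k != 0 & xi = k *: Xi z.
Proof.
move=> Sx /(eqmx_scale (smoothF Sx))[k k0 ->] lam0 -> rho0; rewrite (gauss_scale d_gt1 homF) => ->.
by exists (k * (lam ^+ d.-1 * rho)); rewrite ?mulf_neq0 ?expf_neq0 // !scalerA mulrA.
Qed.

(** Substitution of [t = - 6 s^2] gives [(a, b, c) = (- 6 s^2, 8 s^3, - 3 s^4)]. *)
Lemma cuspidal_equations : exists2 e : R, 0 < e & forall xi, cuspidal_curve F [set x | nr (x - p) < e] xi ->
  c xi + a xi ^+ 2 / 12 = 0 /\ 27 * b xi ^+ 2 + 8 * a xi ^+ 3 = 0.
Proof.
have [dl dl0 h] := param_hessian; have [e e0 onto] := param_onto dl0.
exists e => // xi [x [/= xe Sx px xiE]]; have [z [lam [zd lam0 xY]]] := onto x Sx xe.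
have [cE SY [rho rho0 NE] par _] := h z zd.
have [k k0 XE] := gauss_param Sx xiE lam0 xY rho0 NE.
have pY : parabolic F (Y z) by rewrite xY in px; apply: (parabolic_scale d_gt1 homF (Y z) lam0).1.
have [-> -> ->] := coords_scale k0 XE; have [-> -> ->] := coordsP cE.
have -> : z 0 i1 = - (6 * z 0 i0 ^+ 2) by apply/eqP; rewrite -addr_eq0; apply/eqP; exact: par.1.
by split; field.
Qed.

(** Two distinct points of S with the same tangent plane have distinct [s] and equal [t], so the
    quartic has two double roots and [(a, b, c) = (- 2 s^2, 0, s^4)]. *)
Lemma double_points_equations : exists2 e : R, 0 < e & forall xi x y,
  nr (x - p) < e -> nr (y - p) < e -> on_surface F x -> on_surface F y -> ~~ (x == y)%MS ->
  (xi == gauss F x)%MS -> (xi == gauss F y)%MS -> b xi = 0 /\ c xi - a xi ^+ 2 / 4 = 0.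
Proof.
have [dl dl0 h] := param_hessian; have [e e0 onto] := param_onto dl0.
exists e => // xi x y xe ye Sx Sy xy xiE xiE'.
have [z [lam [zd lam0 xY]]] := onto x Sx xe; have [z' [lam' [zd' lam0' yY]]] := onto y Sy ye.
have [cE SY [rho rho0 NE] _ _] := h z zd; have [cE' SY' [rho' rho0' NE'] _ _] := h z' zd'.
have [k k0 XE] := gauss_param Sx xiE lam0 xY rho0 NE; have [k' k0' XE'] := gauss_param Sy xiE' lam0' yY rho0' NE'.
have [a1 b1 c1] := coords_scale k0 XE; have [a1' b1' c1'] := coords_scale k0' XE'.
have [a2 b2 c2] := coordsP cE; have [a2' b2' c2'] := coordsP cE'.
have tt : z' 0 i1 = z 0 i1 by rewrite -a2 -a2' -a1 a1'.
have ss : z 0 i0 != z' 0 i0.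
  apply: contra xy => /eqP ss; have YY : Y z = Y z'.
    by rewrite /Y /Ya /Yb /Yc /Xi /double_root ss tt.
  rewrite xY yY YY; move: (Y z') => w; apply/andP; split; apply: scalemx_sub; apply/sub_rVP.
    by exists lam'^-1; rewrite scalerA (mulVf lam0') scale1r.
  by exists lam^-1; rewrite scalerA (mulVf lam0) scale1r.
have E : z 0 i1 = - 2 * z 0 i0 ^+ 2.
  apply: (two_double_roots ss).
    by rewrite -b2 -tt -b2' -b1 b1'.
  by rewrite -c2 -tt -c2' -c1 c1'.
by rewrite a1 b1 c1 a2 b2 c2 E; split; field.
Qed.

Lemma ordinary_equations : exists2 e : R, 0 < e & forall xi, ordinary_curve F [set x | nr (x - p) < e] xi ->
  nr (xi - q) < e -> b xi = 0 /\ c xi - a xi ^+ 2 / 4 = 0.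
Proof.
have [e e0 h] := double_points_equations.
have [ra ra0 sa] := holo_sdiff hpa.2; have [rb rb0 sb] := holo_sdiff hpb.2; have [r3 r30 sc] := holo_sdiff hpc.2.
exists (Num.min e (Num.min (Num.min ra rb) r3)); first by rewrite !lt_min e0 ra0 rb0.
move=> xi [_ cl]; rewrite !lt_min => /andP[_ /andP[/andP[xa xb] xc]].
have near (f : hvec R -> C) A : sdiff f xi A ->
    (forall y, b y = 0 /\ c y - a y ^+ 2 / 4 = 0 -> f y = 0) -> f xi = 0.
  move=> sf hf; apply: (sdiff_limit_zero sf) => eps eps0.
  have [y [[x [x' [[xe xe'] [Sx Sx'] xx hx hx']]] ye]] := cl [set y | nr (y - xi) < eps] ((nbhsP _ _).2 (ex_intro2 _ _ eps eps0 (fun _ => id))).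
  exists y => //; rewrite hf ?nr0 ?ltW //; apply: (h y x x') => //.
    by move: xe; rewrite /= lt_min => /andP[].
  by move: xe'; rewrite /= lt_min => /andP[].
split; first by apply: (near b _ (sb _ xb)) => y [].
have sc' := sc _ xc; have sa' := sa _ xa.
have cs k : sdiff (fun _ : hvec R => k : C) xi (fun=> 0) := sdiff_cst k xi.
have S := sdiffD sc' (sdiffM (cs (- 4^-1)) (sdiffM sa' sa')).
have E y : c y - a y ^+ 2 / 4 = c y + (- 4^-1) * (a y * a y) by rewrite -expr2 mulNr mulrC.
by rewrite E; apply: (near _ _ S) => y [_]; rewrite E.
Qed.

Section Arcs.
Variables (be al : C) (v : hvec R) (n : nat).
Hypotheses (vE : dcoords a b c l q v = row4 be 0 0 al) (n2 : (2 <= n <= 6)%N).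

(* Points with t = - n s^2: for n = 2 they lie on the ordinary double curve, for n = 6 on the
   cuspidal one. *)
Lemma arc_direction (eps : R) : 0 < eps -> exists t s : C, exists z : hvec R,
  [/\ [/\ t != 0, nr t < eps, nr z < eps & nr al * nr t < 1], [/\ z 0 i0 = s, z 0 i1 = - n%:R * s ^+ 2 & s != 0] &
      nr ((1 + al * t) *: Xi z - q - t *: v) <= eps * nr t].
Proof.
move=> eps0.
have cancel3 (x y w : R) : y != 0 -> x / (3 * y) * (y * w) = x / 3 * w by move=> y0; field.
have divM3 (x y : R) : x / 3 / y = x / (3 * y) by rewrite invfM mulrA.
have y00 : nr (row4 0 0 0 1 - row4 0 0 0 1 : hvec R) < r by rewrite subrr nr0.
have [_ _ [J [sJ dJ inj]]] := chart y00; rewrite psi0 in dJ inj.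
have dl := dcoords_linear a b c l q.
have inj2 u w : dcoords a b c l q u = dcoords a b c l q w -> u = w.
  move=> h; apply/eqP; rewrite -subr_eq0; apply/eqP; apply: inj.
  by have := dl (-1) w u; rewrite h !scaleN1r addNr addrC.
have vJ : v = row4 be 0 0 al *m J by apply: inj2; rewrite dJ.
have qJ : q = row4 0 0 0 1 *m J.
  apply: inj2; rewrite dJ /dcoords lq; congr row4; exact: proj_diff_self.
pose B := nr be + 1; have B1 : 1 <= B by rewrite lerDr nr_ge0.
have B0 : 0 < B by exact: lt_le_trans B1.
pose J1 := 4 * nr J + 1; have J10 : 0 < J1 by rewrite ltr_wpDl // mulr_ge0 ?nr_ge0.
have A0 : 0 < nr al + 1 by rewrite ltr_wpDl ?nr_ge0.
have e1 : 0 < eps / (3 * (8 * B)) by rewrite !divr_gt0 // !mulr_gt0.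
have [r1 r10 hJ] := sJ.2 _ e1.
have e3 : 0 < eps / (3 * (nr al + 1)) by rewrite divr_gt0 // mulr_gt0.
have [r2 r20 hX] := Xi_near e3.
pose del := Num.min (Num.min 1 (eps / (3 * (8 * B * J1)))) (Num.min (r1 / (8 * B)) (Num.min r2 eps / B)).
have m0 : 0 < Num.min r2 eps by rewrite lt_min r20.
have del0 : 0 < del.
  rewrite lt_min; apply/andP; split; rewrite lt_min; apply/andP; split=> //; apply: divr_gt0 => //; by rewrite !mulr_gt0.
have [t [te t0 tb]] := @avoid_two R 0 (- be) (Num.min (Num.min (eps) (del ^+ 2 / B)) ((nr al + 1)^-1))
  ltac:(by rewrite !lt_min eps0 invr_gt0 A0 divr_gt0 // exprn_gt0).
move: te; rewrite !lt_min => /andP[/andP[te td] ta].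
have tn : 0 < nr t by exact: nr_gt0.
(* The [a]-coordinate of the arc, with velocity [be]. The term [t ^+ 2] keeps it nonzero even when
   [be = 0], as [t] avoids 0 and [- be]. *)
pose rr := be * t + t ^+ 2.
have rr0 : rr != 0 by rewrite /rr expr2 -mulrDl mulf_neq0 // addrC addr_eq0.
have del1 : del <= 1 by rewrite /del !ge_min lexx.
have t1 : nr t < 1.
  apply: lt_le_trans td _; rewrite ler_pdivrMr // mul1r; apply: le_trans B1.
  by rewrite exprn_ile1 // ltW.
have rB : nr rr <= B * nr t.
  apply: le_trans (nrD _ _) _; rewrite nrM expr2 nrM -mulrDl ler_wpM2r ?nr_ge0 //.
  by rewrite /B lerD2l ltW.
pose k : C := n%:R.
have kn : nr k = n%:R by rewrite /k -(rmorph_nat (real_complex R)) nr_real ger0_norm ?ler0n.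
have k2 : 2 <= nr k by rewrite kn ler_nat; case/andP: n2.
have k6 : nr k <= 6 by rewrite kn ler_nat; case/andP: n2.
have k0 : k != 0 by apply: contraTneq k2 => ->; rewrite nr0 -ltNge ltr0n.
(* So [s] is of order at most the square root of [t], and the coordinates [b] and [c], multiples of
   [s ^+ 3] and [s ^+ 4], are negligible with respect to [t]. *)
pose s := sqrtC (- rr / k).
have s2 : s ^+ 2 = - rr / k by exact: sqrtCK.
have ks2 : - k * s ^+ 2 = rr by rewrite s2; field.
have s0 : s != 0 by apply: contraNneq rr0 => s0; rewrite -ks2 s0 expr0n mulr0.
have sr : nr s ^+ 2 <= nr rr.
  rewrite -nrX s2 nrM nrN nrV ler_piMr ?nr_ge0 // invf_le1; last by lra.
  lra.
have sd : nr s < del.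
  have : nr s ^+ 2 < del ^+ 2.
    by apply: le_lt_trans sr _; apply: le_lt_trans rB _; rewrite mulrC -ltr_pdivlMr.
  by rewrite ltr_pXn2r ?nnegrE ?nr_ge0 // ltW.
pose z := row4 s rr 0 0.
have z0 : z 0 i0 = s by rewrite mxE.
have z1 : z 0 i1 = rr by rewrite mxE.
have dB : del * B <= Num.min r2 eps.
  by rewrite -ler_pdivlMr // /del !ge_min lexx !orbT.
have rd : nr rr < del * B.
  apply: le_lt_trans rB _; rewrite mulrC ltr_pM2r //; apply: lt_le_trans td _.
  rewrite ler_pdivrMr // expr2 ler_wpM2l ?(ltW del0) //; exact: le_trans del1 B1.
have zd : nr z < Num.min r2 eps.
  apply: lt_le_trans dB; apply: nr_coord_lt; first by rewrite mulr_gt0.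
  move=> i; rewrite ord1; apply: ord4P; rewrite mxE /= ?nr0 ?mulr_gt0 //.
  by apply: lt_le_trans sd _; rewrite ler_peMr // ltW.
move: zd; rewrite lt_min => /andP[/hX zX zeps].
exists t, s, z; split; first by split=> //; apply: le_lt_trans (_ : (nr al + 1) * nr t < 1);
  [rewrite ler_wpM2r ?nr_ge0 // lerDl | rewrite mulrC -ltr_pdivlMr // mul1r].
  by split=> //; rewrite z1.
have bE : - 4 * s ^+ 3 - 2 * rr * s = (2 * k - 4) * s ^+ 3 by rewrite -ks2; ring.
have cE : 3 * s ^+ 4 + rr * s ^+ 2 = (3 - k) * s ^+ 4 by rewrite -ks2; ring.
have drE : double_root z - row4 0 0 0 1 = row4 rr ((2 * k - 4) * s ^+ 3) ((3 - k) * s ^+ 4) 0.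
  by rewrite /double_root z0 z1 bE cE; apply/rowP; apply: ord4P; rewrite !mxE /= ?subr0 ?subrr.
have s2B : nr s ^+ 2 <= B * nr t by exact: le_trans sr rB.
have nb : nr ((2 * k - 4) * s ^+ 3) <= 8 * B * del * nr t.
  have -> : 8 * B * del * nr t = 8 * (del * (B * nr t)) by ring.
  rewrite nrM nrX exprS ler_pM ?mulr_ge0 ?exprn_ge0 ?nr_ge0 //.
    have -> : 2 * k - 4 = real_complex R (2 * n%:R - 4) by rewrite rmorphB rmorphM /= !rmorph_nat.
    by rewrite nr_real ler_norml; rewrite kn in k2 k6; lra.
  by rewrite ler_pM ?exprn_ge0 ?nr_ge0 // ltW.
have nc : nr ((3 - k) * s ^+ 4) <= 8 * B * del * nr t.
  have -> : 8 * B * del * nr t = 8 * (del * (B * nr t)) by ring.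
  rewrite nrM nrX -[4%N]/(2 + 2)%N exprD ler_pM ?mulr_ge0 ?exprn_ge0 ?nr_ge0 //.
    have -> : 3 - k = real_complex R (3 - n%:R) by rewrite rmorphB /= !rmorph_nat.
    by rewrite nr_real ler_norml; rewrite kn in k2 k6; lra.
  rewrite ler_pM ?exprn_ge0 ?nr_ge0 //; rewrite expr2.
  have := nr_ge0 s; have := ltW sd; nra.
have tB : nr (t ^+ 2) <= 8 * B * del * nr t.
  rewrite nrX expr2 ler_wpM2r ?nr_ge0 //; apply: le_trans (ltW td) _.
  rewrite ler_pdivrMr //; have : del ^+ 2 <= del by rewrite expr2 ler_piMr // ltW.
  have : 1 <= B * B by rewrite -[1]mulr1 ler_pM.
  have := del0; nra.
have rB8 : nr rr <= 8 * B * nr t by apply: le_trans rB _; rewrite -mulrA; have : 0 <= B * nr t := mulr_ge0 (ltW B0) (nr_ge0 _); lra.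
have dB8 : 8 * B * del * nr t <= 8 * B * nr t.
  by rewrite ler_wpM2r ?nr_ge0 // ler_piMr // mulr_ge0 // ltW.
have nd : nr (double_root z - row4 0 0 0 1) <= 8 * B * nr t.
  rewrite drE; apply: nr_coord_le; first by rewrite !mulr_ge0 ?nr_ge0 // ltW.
  move=> i; rewrite ord1; apply: ord4P; rewrite mxE //=.
  - exact: le_trans nb dB8.
  - exact: le_trans nc dB8.
  - by rewrite nr0 !mulr_ge0 ?nr_ge0 // ltW.
have tdel : nr t <= del.
  apply: le_trans (ltW td) _; rewrite ler_pdivrMr // expr2 ler_wpM2l ?(ltW del0) //; exact: le_trans del1 B1.
have ndr : nr (double_root z - row4 0 0 0 1) < r1.
  apply: le_lt_trans nd _; rewrite mulrC -ltr_pdivlMr ?mulr_gt0 //.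
  apply: lt_le_trans (_ : del <= _); last by rewrite /del !ge_min lexx !orbT.
  apply: lt_le_trans td _; rewrite ler_pdivrMr // expr2 ler_wpM2l ?(ltW del0) //; exact: le_trans del1 B1.
have E1 := hJ _ _ ndr (_ : nr (row4 0 0 0 1 - row4 0 0 0 1 : hvec R) < r1).
have {E1} E1 : nr (Xi z - q - (double_root z - row4 0 0 0 1) *m J) <= eps / 3 * nr t.
  have := E1 ltac:(by rewrite subrr nr0); rewrite psi0 => h; apply: le_trans h _.
  apply: le_trans (ler_wpM2l (ltW e1) nd) _.
  by rewrite cancel3 ?lexx // lt0r_neq0 // mulr_gt0.
have E2 : nr (row4 (t ^+ 2) ((2 * k - 4) * s ^+ 3) ((3 - k) * s ^+ 4) 0 *m J) <= eps / 3 * nr t.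
  apply: le_trans (nr_mulmx _ _) _.
  have h : nr (row4 (t ^+ 2) ((2 * k - 4) * s ^+ 3) ((3 - k) * s ^+ 4) 0) <= 8 * B * del * nr t.
    apply: nr_coord_le; first by rewrite !mulr_ge0 ?nr_ge0 // ltW.
    move=> i; rewrite ord1; apply: ord4P; rewrite mxE //=.
    by rewrite nr0 !mulr_ge0 ?nr_ge0 // ltW.
  have h1 : 4 * nr J <= J1 by rewrite /J1 lerDl.
  apply: le_trans (ler_pM _ _ h1 h) _; rewrite ?mulr_ge0 ?nr_ge0 //.
  have -> : J1 * (8 * B * del * nr t) = del * (8 * B * J1) * nr t by ring.
  rewrite ler_wpM2r ?nr_ge0 // -ler_pdivlMr ?mulr_gt0 //.
  rewrite divM3.
  by rewrite /del !ge_min lexx !orbT.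
have E3 : nr ((al * t) *: (Xi z - q)) <= eps / 3 * nr t.
  rewrite nrZ nrM mulrAC ler_wpM2r ?nr_ge0 //.
  apply: le_trans (ler_pM (nr_ge0 _) (nr_ge0 _) (_ : nr al <= nr al + 1) (ltW zX)) _; first by rewrite lerDl.
  by have := cancel3 eps (nr al + 1) 1 (lt0r_neq0 A0); rewrite !mulr1 mulrC => ->; exact: lexx.
(* Three errors of at most a third each: the nonlinearity of the chart, the terms of higher order in
   the coordinates, and the rescaling by [1 + al * t], which matches the [l]-component of [v]. *)
have -> : (1 + al * t) *: Xi z - q - t *: v = (Xi z - q - (double_root z - row4 0 0 0 1) *m J) +
    (row4 (t ^+ 2) ((2 * k - 4) * s ^+ 3) ((3 - k) * s ^+ 4) 0 *m J) + (al * t) *: (Xi z - q).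
  have -> : t *: v = (double_root z - row4 0 0 0 1) *m J - row4 (t ^+ 2) ((2 * k - 4) * s ^+ 3) ((3 - k) * s ^+ 4) 0 *m J + (al * t) *: q.
    rewrite vJ {1}qJ !scalemxAl -mulmxBl -mulmxDl drE; congr (_ *m J).
    by apply/rowP; apply: ord4P; rewrite !mxE /= /rr; ring.
  move: (Xi z) (_ *m J) (_ *m J) => X M1 M2.
  by apply/rowP => i; rewrite !mxE; ring.
apply: le_trans (nrD _ _) _; have := nrD (Xi z - q - (double_root z - row4 0 0 0 1) *m J) (row4 (t ^+ 2) ((2 * k - 4) * s ^+ 3) ((3 - k) * s ^+ 4) 0 *m J).
move: E1 E2 E3; set x1 := nr _; set x2 := nr _; set x3 := nr _; set x4 := nr _; set x5 := nr t; lra.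
Qed.
End Arcs.


Lemma scaled_point_near (m : C) : m != 0 -> Y 0 = m *: p -> forall U, nbhs p U ->
  exists2 dl : R, 0 < dl & forall z : hvec R, nr z < dl -> U (m^-1 *: Y z).
Proof.
move=> m0 Y0E U /nbhsP[e e0 hU]; have [dl dl0 h] := param_diff r0 chart.
have z0 : nr (0 : hvec R) < dl by rewrite nr0.
have [_ _ [dX [dY [_ sY _ _ _]]]] := h 0 z0.
have em : 0 < e * nr m by rewrite mulr_gt0 // nr_gt0.
have [e1 e10 he] := sdiff_near sY em; exists e1 => // z ze; apply: hU.
have := he z; rewrite subr0 Y0E => /(_ ze) hz.
have E (y : hvec R) : m^-1 *: y - p = m^-1 *: (y - m *: p) by rewrite scalerBr scalerA (mulVf m0) scale1r.
by rewrite E nrZ nrV mulrC ltr_pdivrMr // nr_gt0.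
Qed.

Lemma same_point (x : hvec R) (k k' : C) : k != 0 -> k' != 0 -> (k *: x == k' *: x)%MS.
Proof.
move=> k0 k'0; apply/andP; split; apply: scalemx_sub; apply/sub_rVP.
  by exists k'^-1; rewrite scalerA (mulVf k'0) scale1r.
by exists k^-1; rewrite scalerA (mulVf k0) scale1r.
Qed.

Lemma gauss_scaled_param (m rho k : C) z : m != 0 -> rho != 0 -> k != 0 -> gauss F (Y z) = rho *: Xi z ->
  (k *: Xi z == gauss F (m^-1 *: Y z))%MS.
Proof.
move=> m0 rho0 k0 NE; rewrite (gauss_scale d_gt1 homF) NE scalerA; apply: same_point => //.
by rewrite mulf_neq0 // expf_neq0 // invr_neq0.
Qed.

Section Cones.
Variable (v : hvec R).
Hypotheses (vb : 'd b q v = 0) (vc : 'd c q v = 0).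

Let vE : dcoords a b c l q v = row4 ('d a q v) 0 0 ((v *m l) 0 0).
Proof. exact: (congr2 (fun x y => row4 ('d a q v) x y ((v *m l) 0 0)) vb vc). Qed.

Let unit_scale (al t : C) : nr al * nr t < 1 -> 1 + al * t != 0.
Proof.
apply: contraTneq => /eqP; rewrite addrC addr_eq0 => /eqP E; rewrite -nrM E nrN.
by rewrite -[1]/(real_complex R 1 : C) nr_real normr1 ltxx.
Qed.

Lemma cuspidal_cone_contains : reduced_tangent_cone (germ_ideal F cuspidal_curve p) q v.
Proof.
apply: cone_contains => U pU eps eps0.
have [d1 d10 h] := param_hessian; have [m m0 Y0E] := param_center.
have [d2 d20 hU] := scaled_point_near m0 Y0E pU.
have e0 : 0 < Num.min eps (Num.min d1 d2) by rewrite !lt_min eps0 d10.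
have [t [s [z [[t0 te ze alt] [z0 z1 s0] hz]]]] := arc_direction vE (isT : 2 <= 6 <= 6)%N e0.
move: te ze; rewrite !lt_min => /andP[te _] /andP[_ /andP[zd1 zd2]].
have [cE SY [rho rho0 NE] par _] := h z zd1.
exists t, ((1 + (v *m l) 0 0 * t) *: Xi z - q); split; [exact: t0|exact: te| |].
  by apply: le_trans hz _; rewrite ler_wpM2r ?nr_ge0 // ge_min lexx.
rewrite addrC subrK; have minv : m^-1 != 0 by rewrite invr_neq0.
exists (m^-1 *: Y z); split; [exact: hU|exact: (on_surface_scale homF (Y z) minv).2| |].
  apply: (parabolic_scale d_gt1 homF (Y z) minv).2; apply: par.2.
  by rewrite z0 z1; ring.
by apply: (gauss_scaled_param m0 rho0 _ NE); exact: unit_scale.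
Qed.

Lemma ordinary_cone_contains : reduced_tangent_cone (germ_ideal F ordinary_curve p) q v.
Proof.
apply: cone_contains => U pU eps eps0.
have [d1 d10 h] := param_hessian; have [m m0 Y0E] := param_center.
have [d2 d20 hU] := scaled_point_near m0 Y0E pU; have [d3 d30 h3] := param_diff r0 chart.
have e0 : 0 < Num.min eps (Num.min d1 (Num.min d2 d3)) by rewrite !lt_min eps0 d10 d20.
have [t [s [z [[t0 te ze alt] [z0 z1 s0] hz]]]] := arc_direction vE (isT : 2 <= 2 <= 6)%N e0.
(* With [t = - 2 s^2] the quartic has the second double root [- s], so [z'] gives the same plane and
   another point of contact. *)
pose z' := row4 (- s) (z 0 i1) 0 0.
have z0' : z' 0 i0 = - s by rewrite mxE.
have z1' : z' 0 i1 = z 0 i1 by rewrite mxE.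
have ze' : nr z' < Num.min eps (Num.min d1 (Num.min d2 d3)).
  apply: le_lt_trans ze; apply: nr_coord_le; first exact: nr_ge0.
  move=> i; rewrite ord1; apply: ord4P; rewrite mxE /= ?nr0 ?nr_ge0 //; last exact: nr_coord.
  by rewrite nrN -z0; exact: nr_coord.
move: te ze ze'; rewrite !lt_min => /andP[te _] /andP[_ /and3P[zd1 zd2 zd3]] /andP[_ /and3P[zd1' zd2' zd3']].
have [cE SY [rho rho0 NE] par _] := h z zd1; have [cE' SY' [rho' rho0' NE'] _ _] := h z' zd1'.
have [_ indep _] := h3 z zd3; have [_ _ _ lE] := row4_inj cE.
have X0 : Xi z != 0 by apply: contraTneq (oner_neq0 C) => X0; rewrite -lE X0 mul0mx mxE eqxx.
have XX : Xi z' = Xi z.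
  have dr : double_root z' = double_root z.
    by rewrite /double_root z0' z1' z0 z1; congr row4; ring.
  exact: (congr1 psi dr : Xi z' = Xi z).
exists t, ((1 + (v *m l) 0 0 * t) *: Xi z - q); split; [exact: t0|exact: te| |].
  by apply: le_trans hz _; rewrite ler_wpM2r ?nr_ge0 // ge_min lexx.
have minv : m^-1 != 0 by rewrite invr_neq0.
have k0 := unit_scale alt.
rewrite addrC subrK; split; first by rewrite /= scaler_eq0 negb_or k0.
apply: subset_closure; exists (m^-1 *: Y z), (m^-1 *: Y z'); split.
- by split; exact: hU.
- by split; apply: (on_surface_scale homF _ minv).2.
(* If the points [Y z] and [Y z'] were proportional, the coefficients of the gradient of [c] would
   give ratio 1, and those of the gradient of [b] would give [s = - s]. *)
- apply/negP => /andP[/sub_rVP[k]]; rewrite scalerA mulrC -scalerA => /(scalerI minv) E _.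
  have E' : (s ^+ 2 - k * s ^+ 2) *: Ya a psi z + (s + k * s) *: Yb b psi z + (1 - k) *: Yc c psi z = 0.
    move: E; rewrite /Y z0 z0' /Ya /Yb /Yc XX; move: (grad a _) (grad b _) (grad c _) => A B D E.
    by apply/rowP => i; have := congr1 (fun w : hvec R => w 0 i) E; rewrite !mxE => E'; rewrite -(subrr (k * (s ^+ 2 * A 0 i - s * B 0 i + D 0 i))); rewrite sqrrN mulNr in E'; rewrite -{1}E'; ring.
  have [_ h1 h2] := indep _ _ _ E'.
  have k1 : k = 1 by apply/eqP; rewrite eq_sym -subr_eq0 h2.
  by move: h1; rewrite k1 mul1r -mulr2n => /eqP; rewrite mulrn_eq0 (negbTE s0).
- exact: gauss_scaled_param m0 rho0 k0 NE.
- by rewrite -XX; exact: gauss_scaled_param m0 rho0' k0 NE'.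
Qed.
End Cones.

Lemma diff_add_square (g h : hvec R -> C) (x w : hvec R) (k : C) : holomorphic_at x g -> holomorphic_at x h -> h x = 0 ->
  'd (fun xi => g xi + k * (h xi * h xi)) x w = 'd g x w.
Proof.
move=> hg hh h0.
have [rg rg0 sg] := holo_sdiff hg; have [rh rh0 sh] := holo_sdiff hh.
have xx e : 0 < e -> nr (x - x) < e by rewrite subrr nr0.
have lD : linear ('d g x : hvec R -> C) by move=> k' u u'; exact: linearP.
have [D [sD lD' DE]] : exists D : hvec R -> C, [/\ sdiff g x D, linear D & forall w, 'd g x w = D w].
  by exists ('d g x); split=> //; exact: sg (xx _ rg0).
have [A sA] : exists A : hvec R -> C, sdiff h x A by exists ('d h x); exact: sh (xx _ rh0).
have cs : sdiff (fun _ : hvec R => k : C) x (fun=> 0) := sdiff_cst k x.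
have S := sdiffD sD (sdiffM cs (sdiffM sA sA)).
apply: etrans _ (esym (DE w)); apply: (sdiff_diffE lD' (sdiff_eq _ S)).2 => u.
by rewrite h0 !(mul0r, mulr0, addr0).
Qed.

(** [b] and [c - a^2 / 4] belong to the ideal and have the linear parts [db] and [dc]. *)
Lemma ordinary_cone_sub (v : hvec R) : a q = 0 -> b q = 0 -> c q = 0 ->
  reduced_tangent_cone (germ_ideal F ordinary_curve p) q v -> 'd b q v = 0 /\ 'd c q v = 0.
Proof.
move=> a0 b0 c0 hv; have [e e0 h] := ordinary_equations.
have pU : nbhs p [set x | nr (x - p) < e] by apply/nbhsP; exists e.
have qW : nbhs q [set x | nr (x - q) < e] by apply/nbhsP; exists e.
split.
  apply: (cone_linear hv _ hpb.2 b0); split; first exact: hpb.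
  by exists [set x | nr (x - p) < e], [set x | nr (x - q) < e]; split=> // xi /h hx /hx[].
pose g xi := c xi + (- 4^-1) * (a xi * a xi).
have hg : holomorphic_at q g.
  by apply: holo_D hpc.2 _; apply: holo_M (holo_cst _ _) _; exact: holo_M hpa.2 hpa.2.
have g0 : g q = 0 by rewrite /g a0 c0 !mulr0 addr0.
apply: etrans (esym (diff_add_square v (- 4^-1) hpc.2 hpa.2 a0)) _.
apply: (cone_linear hv _ hg g0); split.
  by split=> // k w k0; rewrite /g hpc.1 // hpa.1.
exists [set x | nr (x - p) < e], [set x | nr (x - q) < e]; split=> // xi /h hx /hx[_ E].
by rewrite -[RHS]E /g; ring.
Qed.

(** The ideal contains [c + a^2 / 12], with linear part [dc], and [27 b^2 + 8 a^3], whose quadratic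
    part is [27 db^2]: a cuspidal equation, which is why the cone is taken reduced. *)
Lemma cuspidal_cone_sub (v : hvec R) : a q = 0 -> b q = 0 -> c q = 0 ->
  reduced_tangent_cone (germ_ideal F cuspidal_curve p) q v -> 'd b q v = 0 /\ 'd c q v = 0.
Proof.
move=> a0 b0 c0 hv; have [e e0 h] := cuspidal_equations.
have pU : nbhs p [set x | nr (x - p) < e] by apply/nbhsP; exists e.
split.
  apply: (cone_square (k := 27) (k' := 8) hv _ hpa.2 hpb.2 a0 b0); first by rewrite pnatr_eq0.
  split.
    split; first by move=> k w k0; rewrite hpb.1 // hpa.1.
    have hc k : holomorphic_at q (fun=> k : C) := holo_cst k q.
    have -> : (fun xi => 27 * b xi ^+ 2 + 8 * a xi ^+ 3) = fun xi => 27 * (b xi * b xi) + 8 * (a xi * (a xi * a xi)).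
      by apply/funext => xi; rewrite -!expr2 -exprS.
    apply: holo_D; first exact: holo_M (hc _) (holo_M hpb.2 hpb.2).
    exact: holo_M (hc _) (holo_M hpa.2 (holo_M hpa.2 hpa.2)).
  by exists [set x | nr (x - p) < e], setT; split=> [//||xi /h[_ E] _ //]; exact: filterT.
pose g xi := c xi + 12^-1 * (a xi * a xi).
have hg : holomorphic_at q g.
  by apply: holo_D hpc.2 _; apply: holo_M (holo_cst _ _) _; exact: holo_M hpa.2 hpa.2.
have g0 : g q = 0 by rewrite /g a0 c0 !mulr0 addr0.
apply: etrans (esym (diff_add_square v 12^-1 hpc.2 hpa.2 a0)) _.
apply: (cone_linear hv _ hg g0); split.
  by split=> // k w k0; rewrite /g hpc.1 // hpa.1.
exists [set x | nr (x - p) < e], setT; split=> [//||xi /h[E _] _]; first exact: filterT.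
by rewrite -[RHS]E /g; ring.
Qed.
End SwallowtailSurface.

Section TacnodalPoint.
Context {R : realType}.
Local Notation C := (Cplx R).
Local Notation form := (form4 R).
Variables (F : form) (d : nat).
Hypotheses (d_gt1 : (1 < d)%N) (homF : F \is ishomog1 d mdeg) (smoothF : smooth F).
Variable (p : hvec R).
Hypothesis (Sp : on_surface F p).

Theorem swallowtail_tangent_cones (k : hvec R) : locally_swallowtail F p ->
  ~~ (k <= p)%MS -> dmeval F p k = 0 ->
  (forall x, dmeval F p x = 0 -> (x *m hess F p <= gauss F p)%MS -> (x <= span2 p k)%MS) ->
  forall v : hvec R,
    (reduced_tangent_cone (germ_ideal F ordinary_curve p) (gauss F p) v <-> (v <= orth (span2 p k))%MS) /\
    (reduced_tangent_cone (germ_ideal F cuspidal_curve p) (gauss F p) v <-> (v <= orth (span2 p k))%MS).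
Proof.
move=> [a [b [c [[hpa hpb hpc] [a0 b0 c0] ker [U0 pU0 sw]]]]] kp kT asy.
have [l lq] := dual_coordinate smoothF Sp.
have [e1 e10 h1] := grad_near hpa.2; have [e2 e20 h2] := grad_near hpb.2; have [e3 e30 h3] := grad_near hpc.2.
have e0 : 0 < Num.min e1 (Num.min e2 e3) by rewrite !lt_min e10 e20.
have [psi [r [r0 psi0 chart0]]] := dual_chart hpa.2 hpb.2 hpc.2 a0 b0 c0 lq ker e0.
have chart y : nr (y - row4 0 0 0 1) < r ->
    [/\ [/\ sdiff (grad a) (psi y) (dgrad a (psi y)), sdiff (grad b) (psi y) (dgrad b (psi y)) &
            sdiff (grad c) (psi y) (dgrad c (psi y))],
        coords a b c l (psi y) = y & exists J,
      [/\ sdiff psi y (fun v => v *m J), forall v, dcoords a b c l (psi y) (v *m J) = v &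
          forall w, dcoords a b c l (psi y) w = 0 -> w = 0]].
  move=> /chart0[pe cE hJ]; move: pe; rewrite !lt_min => /and3P[pe1 pe2 pe3].
  split; [split; [exact: (h1 _ pe1).2|exact: (h2 _ pe2).2|exact: (h3 _ pe3).2]|exact: cE|exact: hJ].
move=> v; have O := orth_swallowtail d_gt1 homF smoothF Sp hpa hpb hpc lq pU0 sw r0 psi0 chart kp kT asy v.
split; split.
- move=> /(ordinary_cone_sub d_gt1 homF smoothF Sp hpa hpb hpc lq pU0 sw r0 psi0 chart a0 b0 c0); exact: O.2.
- by move=> /O[vb vc]; exact: (ordinary_cone_contains d_gt1 homF smoothF Sp hpa hpb hpc lq pU0 sw r0 psi0 chart vb vc).
- move=> /(cuspidal_cone_sub d_gt1 homF smoothF Sp hpa hpb hpc lq pU0 sw r0 psi0 chart a0 b0 c0); exact: O.2.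
- by move=> /O[vb vc]; exact: (cuspidal_cone_contains d_gt1 homF smoothF Sp hpa hpb hpc lq pU0 sw r0 psi0 chart vb vc).
Qed.
End TacnodalPoint.

Theorem theoremC2 (R : realType) (d : nat) (F : form4 R) (p : hvec R)
    (d_gt1 : (1 < d)%N) (homF : F \is ishomog1 d mdeg) (smoothF : smooth F)
    (generalF : forall r, on_surface F r -> parabolic_beta F r ->
       locally_swallowtail F r)
    (pS : on_surface F p) :
  let q := gauss F p in
  [/\ (* (a) *)
      forall L : lsub R, tangent_line (equation F) p L ->
        tangent_line (germ_ideal F dual_surface p) q (orth L),
      (* (b) *)
      ~ parabolic F p ->
      exists L1 L2 : lsub R,
        [/\ ~~ (L1 == L2)%MS,
            forall M : lsub R, asymptotic_tangent (equation F) p M <->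
              (M == L1)%MS \/ (M == L2)%MS &
            forall N : lsub R,
              asymptotic_tangent (germ_ideal F dual_surface p) q N <->
              (N == orth L1)%MS \/ (N == orth L2)%MS],
      (* (c) *)
      general_parabolic F p ->
      exists2 L : lsub R,
        forall M : lsub R, asymptotic_tangent (equation F) p M <->
          (M == L)%MS &
        curve_tangent_line (germ_ideal F cuspidal_curve p) q (orth L) &
      (* (d) *)
      parabolic_beta F p ->
      exists2 L : lsub R,
        forall M : lsub R, asymptotic_tangent (equation F) p M <->
          (M == L)%MS &
        forall v : hvec R,
          (reduced_tangent_cone (germ_ideal F ordinary_curve p) q v <->
             (v <= orth L)%MS) /\
          (reduced_tangent_cone (germ_ideal F cuspidal_curve p) q v <->
             (v <= orth L)%MS)].
Proof.
move=> q; split.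
- by move=> L; exact: (orth_tangent_line d_gt1 homF smoothF pS).
- exact: (asymptotic_tangents_dual d_gt1 homF smoothF pS).
- move=> [par sec].
  have [k [kT kp kH asy [hM cub]]] := tangent_section_line d_gt1 homF smoothF pS (isT : 1 < 2)%N sec.
  exists (span2 p k); first exact: hM.
  exact: (cuspidal_curve_tangent d_gt1 homF smoothF pS par kT kp kH asy (cub erefl)).
- move=> beta; have [par sec] := beta.
  have [k [kT kp kH asy [hM _]]] := tangent_section_line d_gt1 homF smoothF pS (isT : 1 < 3)%N sec.
  exists (span2 p k); first exact: hM.
  exact (swallowtail_tangent_cones d_gt1 homF smoothF pS (generalF p pS beta) kp kT asy).
Qed.
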